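(* Let $d\ge2$. There are constants $c,c_2\in(0,\infty)$ depending only on $d$, and for each $\varepsilon\in(0,1)$ a constant $c(\varepsilon)\in(0,\infty)$ depending only on $d,\varepsilon$, such that the following holds. Let $k\ge1$, $\varepsilon\in(0,1)$, $N\ge c(\varepsilon)$, $z\in[-N,N]$ an integer, $1\ge\delta\ge c_2\frac{r_N}{h_N}$, $u$ satisfying $uK_N\ge(\log N)^6$, let $x_1,\dots,x_k\in\mathbb{T}_N\times[-\frac N2,\frac N2]$, and let $S_1,\dots,S_k\subset B(0,N^{1-\varepsilon})$ be non-empty sets such that $S_i+x_i$, $i=1,\dots,k$, are disjoint. Then one can construct on a probability space $(\Omega_1,\mathcal{A}_1,Q_1)$ an $E_N$-valued random walk $X_\cdot$ with law $P_{q_z}$, and an independent collection $\big((\mathcal{I}_i^{u(1-\delta)}\cap S_i,\ \mathcal{I}_i^{u(1+\delta)}\cap S_i)\big)_{i=1}^k$ of pairs of random sets such that the $i$-th pair has the (joint) law of $(\mathcal{I}^{u(1-\delta)}\cap S_i,\mathcal{I}^{u(1+\delta)}\cap S_i)$ under $Q_0$, and such that, with $F$ the event $$F=\big\{\mathcal{I}_i^{u(1-\delta)}\cap S_i\subset (X(0,D_{[uK_N]})-x_i)\cap S_i\subset \mathcal{I}_i^{u(1+\delta)}\cap S_i\ \text{ for all } i=1,\dots,k\big\},$$ one has $$Q_1(F^c)\le\begin{cases}c\,u\,N^{-3d-1}&\text{if }k=1,\\ c\,u\sum_{i\ne j}\mathcal{E}(S_i+x_i,S_j+x_j)&\text{if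 }k>1.\end{cases}$$
   Context: Cylinder and walk. Fix an integer $d\ge2$. $\mathbb{T}_N=(\mathbb{Z}/N\mathbb{Z})^d$, $E_N=\mathbb{T}_N\times\mathbb{Z}$ (nearest-neighbour graph; intervals in the second coordinate mean integer intervals). $[x]$ is the integer part. $P_x$ is the law of simple random walk $(X_n)_{n\ge0}$ on $E_N$ started at $x$; for a measure $e$, $P_e=\sum_xe(x)P_x$. $q_z=N^{-d}\sum_{x\in\mathbb{T}_N\times\{z\}}\delta_x$. For $a\le b$, $X(a,b)=\{X_n:n\in[a,b]\}$. $B(x,R)$ is the closed $l_\infty$-ball of radius $R$ around $x$ in $\mathbb{Z}^{d+1}$ or $E_N$; small balls around $0$ in $E_N$ and in $\mathbb{Z}^{d+1}$ are identified, so that subsets of $B(0,N^{1-\varepsilon})$ are viewed as subsets of both (for $N$ large), and $S_i+x_i\subset E_N$. Excursions. $H_U,\tilde H_U,T_U$ denote respectively the first time $n\ge0$ with $X_n\in U$, the first time $n\ge1$ with $X_n\in U$, and the first time $n\ge0$ with $X_n\notin U$; $\theta_n$ is the time shift. $r_N=N$, $h_N=[N(2+(\log N)^2)]$, $B=\mathbb{T}_N\times[-r_N,r_N]$, $\tilde B=\mathbb{T}_N\times(-h_N,h_N)$, $K_N=\frac{N^d}{(d+1)(h_N-r_N)}$. The successive returns to $B$ and departures from $\tilde B$ are $R_1=H_B$, $D_1=T_{\tilde B}\circ\theta_{R_1}+R_1$, and for $k\ge1$, $R_{k+1}=R_1\circ\theta_{D_k}+D_k$, $D_{k+1}=D_1\circ\theta_{D_k}+D_k$.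 Mutual energy. For $K\subset\tilde B$, $e_{K,\tilde B}(x)=P_x(\tilde H_K>T_{\tilde B})1_K(x)$, and $g_{\tilde B}(x,y)=\sum_{n\ge0}P_x(X_n=y,n<T_{\tilde B})$. For disjoint $S,S'\subset\tilde B$, $\mathcal{E}(S,S')=\sum_{x\in S,y\in S'}e_{S,\tilde B}(x)g_{\tilde B}(x,y)e_{S',\tilde B}(y)$. Random interlacements. On $(\Omega_0,\mathcal{A}_0,Q_0)$, $(\mathcal{I}^u)_{u\ge0}$ is the family of random interlacements on $\mathbb{Z}^{d+1}$: random subsets of $\mathbb{Z}^{d+1}$, increasing in $u$. For finite $K\subset\mathbb{Z}^{d+1}$, with $P_x^{\mathbb{Z}^{d+1}}$ the law of simple random walk on $\mathbb{Z}^{d+1}$ and $e_K(x)=P_x^{\mathbb{Z}^{d+1}}(\tilde H_K=\infty)1_K(x)$, $\mathcal{I}^u\cap K$ has the law of the intersection with $K$ of the union of the ranges of the trajectories of a Poisson point process on the space of trajectories in $\mathbb{Z}^{d+1}$ with intensity $u\sum_xe_K(x)P_x^{\mathbb{Z}^{d+1}}$. For $u\le v$, the joint law of $(\mathcal{I}^u,\mathcal{I}^v)$ is that of $(\mathcal{I}_1^u,\mathcal{I}_1^u\cup\mathcal{I}_2^{v-u})$ where $\mathcal{I}_1,\mathcal{I}_2$ are independent copies of the family. *)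

(* Defs.v *)
From HB Require Import structures.
From mathcomp Require Import all_boot all_order all_algebra finmap.
From mathcomp Require Import all_classical all_reals all_analysis measurable_realfun.

Set Implicit Arguments.
Unset Strict Implicit.
Unset Printing Implicit Defensive.
Import Order.TTheory GRing.Theory Num.Theory.
Import numFieldNormedType.Exports.

Local Open Scope classical_set_scope.
Local Open Scope ring_scope.

Definition same_law {R : realType} {d1 d2 d' : measure_display}
    {T1 : measurableType d1} {T2 : measurableType d2} {T' : measurableType d'}
    (P1 : {measure set T1 -> \bar R}) (X1 : T1 -> T')
    (P2 : {measure set T2 -> \bar R}) (X2 : T2 -> T') : Prop :=
  forall G : set T', measurable G -> P1 (X1 @^-1` G) = P2 (X2 @^-1` G).

Definition independent_family {R : realType} {d1 d' : measure_display}
    {T : measurableType d1} {T' : measurableType d'} {I : finType}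
    (P : probability T R) (X : I -> T -> T') : Prop :=
  forall (J : {set I}) (G : I -> set T'), (forall i, measurable (G i)) ->
    (P (\bigcap_(i in [set` J]) (X i @^-1` G i)) =
     \prod_(i in J) P (X i @^-1` G i))%E.

Definition nb_points {T W : Type} (M : T -> nat) (Y : nat -> T -> W)
    (A : set W) (w : T) : nat :=
  (\sum_(i < M w) (Y i w \in A))%N.

(* Only finite intensities [mu] are needed, so the points of a Poisson        *)
(* process can be enumerated as [Y 0, ..., Y (M - 1)] with [M] random.        *)
(* The second argument of [poisson_prob] is a dummy; [poisson_prob 0 _] is    *)
(* the Dirac mass at 0.                                                       *)
Definition is_poisson_process {R : realType} {d1 d' : measure_display}
    {T : measurableType d1} {W : measurableType d'} (P : probability T R)
    (M : {mfun T >-> nat}) (Y : nat -> {mfun T >-> W}) (mu : set W -> \bar R)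
    : Prop :=
  forall (n : nat) (A : 'I_n -> set W),
    (forall j, measurable (A j)) -> trivIset setT A ->
    independent_family P (fun j => nb_points M Y (A j)) /\
    forall (j : 'I_n) (U : set nat),
      P [set w | U (nb_points M Y (A j) w)] =
      poisson_prob (fine (mu (A j))) 0%N U.

Definition cylinder_events (E : Type) : set (set (nat -> E)) :=
  [set A | exists n x, A = [set w | w n = x]].


(* For countable [E] this is the product sigma-algebra on [E^nat]. *)
Definition trajectory (E : zmodType) : Type :=
  g_sigma_algebraType (@cylinder_events E).
HB.instance Definition _ (E : zmodType) := Measurable.on (trajectory E).

(* Times take values in [option nat], with [None] standing for infinity. *)
Definition first_time (A : set nat) : option nat :=
  match pselect (exists n, `[< A n >]) with
  | left h => Some (ex_minn h)
  | right _ => None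
  end.

Definition time_lt (s t : option nat) : bool :=
  match s, t with
  | Some m, Some n => (m < n)%N
  | Some _, None => true
  | None, _ => false
  end.

Section times.
Variable E : Type.
Implicit Types (U : set E) (w : nat -> E).

Definition shift n w : nat -> E := fun m => w (n + m)%N.

Definition hit U w := first_time [set n | U (w n)].
Definition hit_pos U w := first_time [set n | (1 <= n)%N /\ U (w n)].
Definition exit U w := first_time [set n | ~ U (w n)].

(* [after t T w] is T o theta_t + t. *)
Definition after (t : option nat) (T : (nat -> E) -> option nat) w :=
  obind (fun n => omap (addn n) (T (shift n w))) t.

Definition return1 B w := hit B w.
Definition departure1 B B' w := after (return1 B w) (exit B') w.

(* [departure B B' k] is D_k, with the convention D_0 = 0. *)
Fixpoint departure (B B' : set E) (k : nat) w : option nat :=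
  if k is k'.+1 then after (departure B B' k' w) (departure1 B B') w
  else Some 0%N.

Definition visited (t : option nat) w : set E :=
  [set w n | n in [set n | ~~ time_lt t (Some n)]].

End times.

(* The base-m digits of a uniform point of [0,1] are i.i.d. uniform in        *)
(* {0, ..., m - 1}; they are used to realize i.i.d. uniform steps.            *)
Section digits.
Variables (R : realType) (D : finType) (s0 : D).

Definition digit (n : nat) (t : R) : D :=
  nth s0 (enum D) (Num.truncn (#|D|%:R ^+ n.+1 * t) %% #|D|).

Local Notation m := #|D|.
Local Notation U := (uniform_prob (@ltr01 R)).

Let m0 : (0 < m)%N. Proof. by apply/card_gt0P; exists s0. Qed.

Let mR0 n : 0 < m%:R ^+ n :> R.
Proof. by rewrite exprn_gt0// ltr0n. Qed.

Lemma uniform_probE (A : set R) : measurable A ->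
  U A = lebesgue_measure (A `&` `[0, 1[).
Proof.
move=> mA; rewrite /uniform_prob integral_uniform_pdf.
have AE : (A `&` `[0, 1]) `\ 1 = A `&` `[0, 1[.
  apply/seteqP; split => [t /= [[At]]|t /= [At]].
    by rewrite !in_itv/= => /andP[-> t1] /eqP tn1; split; rewrite // lt_neqAle tn1.
  rewrite !in_itv/= => /andP[-> t1]; rewrite (ltW t1); split => //.
  by apply/eqP; rewrite lt_eqF.
have mA1 : measurable (A `&` `[0, 1[ : set R) by exact: measurableI.
rewrite -(@integral_setD1 _ _ 1) ?AE//; last first.
  apply: (measurable_funS measurableT) => //; apply: measurableT_comp => //.
  exact: measurable_uniform_pdf.
rewrite (eq_integral (fun=> 1%E)); first by rewrite integral_cst// mul1e.
move=> t /set_mem[_ /=]; rewrite in_itv/= => /andP[t0 t1].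
by rewrite /uniform_pdf t0 (ltW t1)/= subr0 invr1.
Qed.

Let truncn_exp n (t : R) : 0 <= t ->
  (Num.truncn (m%:R ^+ n.+1 * t) %/ m)%N = Num.truncn (m%:R ^+ n * t).
Proof.
move=> t0; set K := Num.truncn (m%:R ^+ n.+1 * t).
have /truncn_itv/andP[K1 K2] : 0 <= m%:R ^+ n.+1 * t by rewrite mulr_ge0// ltW.
apply/esym/truncn_def; rewrite -/K in K1 K2; apply/andP; split.
  rewrite -(ler_pM2r (mR0 1)) expr1 -natrM mulrAC -exprSr.
  by apply: le_trans K1; rewrite ler_nat leq_divM.
rewrite -(ltr_pM2r (mR0 1)) expr1 -natrM mulrAC -exprSr.
by apply: lt_le_trans K2 _; rewrite ler_nat ltn_ceil.
Qed.

Let code (a : nat -> D) n := iteri n (fun i c => (c * m + index (a i) (enum D))%N) 0%N.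

Let index_lt a : (index a (enum D) < m)%N.
Proof. by rewrite cardE index_mem mem_enum. Qed.

Let code_lt a n : (code a n < m ^ n)%N.
Proof.
elim: n => //= n IH; rewrite /code/= -/(code a n).
rewrite expnSr; apply: (@leq_trans ((code a n).+1 * m)).
  by rewrite mulSn addnC -addSn leq_add2r index_lt.
by rewrite leq_mul2r IH orbT.
Qed.

Let digits_code (a : nat -> D) n (t : R) : 0 <= t -> t < 1 ->
  (forall i, (i < n)%N -> digit i t = a i) <->
  Num.truncn (m%:R ^+ n * t) = code a n.
Proof.
move=> t0 t1; elim: n => [|n IH].
  split=> // _; rewrite expr0 mul1r /=; apply: truncn_def.
  by rewrite t0.
set K := Num.truncn (m%:R ^+ n.+1 * t).
have KE : K = (code a n.+1) <->
    (K %/ m = code a n /\ K %% m = index (a n) (enum D))%N.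
  rewrite {1}(divn_eq K m) /code/= -/(code a n); split => [|[-> ->]//].
  move=> H; split.
    have := congr1 (divn^~ m) H.
    by rewrite !divnMDl// (divn_small (ltn_pmod _ m0)) (divn_small (index_lt _))
      !addn0.
  have := congr1 (modn^~ m) H.
  by rewrite !modnMDl modn_mod (modn_small (index_lt _)).
have dE : digit n t = a n <-> (K %% m)%N = index (a n) (enum D).
  rewrite /digit -/K; split => [<-|->]; last by rewrite nth_index// mem_enum.
  by rewrite index_uniq ?enum_uniq// -cardE ltn_pmod.
rewrite KE {1}/K truncn_exp// -dE -IH; split => [H|[H1 H2] i].
  by split => [i ilt|]; apply: H => //; exact: ltnW.
by rewrite ltnS leq_eqVlt => /predU1P[->//|]; exact: H1.
Qed.

Lemma measurable_digit n s : measurable [set t : R | digit n t = s].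
Proof.
have -> : [set t : R | digit n t = s] =
    \bigcup_(j in [set j | nth s0 (enum D) (j %% m) = s])
      [set t : R | Num.truncn (m%:R ^+ n.+1 * t) = j].
  by apply/seteqP; split => [t /= <-|t [j /= <- <-]//];
    exists (Num.truncn (m%:R ^+ n.+1 * t)).
apply: bigcup_measurable => j _; case: j => [|j].
  rewrite [X in measurable X](_ : _ = `]-oo, (m%:R ^+ n.+1)^-1[)%classic//.
  apply/seteqP; split => t /=; rewrite in_itv/= -[_^-1]mulr1 ltr_pdivlMl//.
    by move/eqP; rewrite -leqn0 real_truncn_le_nat// num_real.
  by move=> H; apply/eqP; rewrite -leqn0 real_truncn_le_nat// num_real.
rewrite [X in measurable X](_ : _ =
  `[(m%:R ^+ n.+1)^-1 * j.+1%:R, (m%:R ^+ n.+1)^-1 * j.+2%:R[)%classic//.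
apply/seteqP; split => t /=; rewrite in_itv/= ler_pdivrMl// ltr_pdivlMl//.
  move=> H; have := truncn_gt_nat (m%:R ^+ n.+1 * t) j; rewrite H ltnSn => /esym H1.
  by rewrite H1/= -real_truncn_le_nat ?num_real// H.
by move=> H; apply: truncn_def.
Qed.

Lemma measurable_digits n (a : nat -> D) :
  measurable [set t : R | forall i, (i < n)%N -> digit i t = a i].
Proof.
rewrite [X in measurable X](_ : _ =
  \bigcap_(i in `I_n) [set t : R | digit i t = a i])//.
by apply: bigcap_measurableType => i _; exact: measurable_digit.
Qed.

Lemma digits_iid n (a : nat -> D) :
  U [set t : R | forall i, (i < n)%N -> digit i t = a i] =
  ((m%:R ^+ n)^-1)%:E.
Proof.
rewrite uniform_probE; last exact: measurable_digits.
set c := (code a n)%:R : R.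
have -> : [set t : R | forall i, (i < n)%N -> digit i t = a i] `&` `[0, 1[ =
    `[(m%:R ^+ n)^-1 * c, (m%:R ^+ n)^-1 * (c + 1)[%classic.
  apply/seteqP; split => t /=.
    rewrite !in_itv/= => -[H /andP[t0 t1]]; move/(digits_code _ _ t0 t1) : H.
    move=> H; have /truncn_itv : 0 <= m%:R ^+ n * t by rewrite mulr_ge0// ltW.
    by rewrite H ler_pdivrMl// ltr_pdivlMl// natr1.
  rewrite !in_itv/= ler_pdivrMl// ltr_pdivlMl// natr1 => H.
  have /andP[H1 H2] := H.
  have t0 : 0 <= t.
    by rewrite -(pmulr_rge0 _ (mR0 n)); apply: le_trans H1.
  have t1 : t < 1.
    rewrite -(ltr_pM2l (mR0 n)) mulr1; apply: lt_le_trans H2 _.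
    by rewrite -natrX ler_nat code_lt.
  split; last by rewrite t0.
  by apply/digits_code => //; apply: truncn_def.
rewrite lebesgue_measure_itv/= lte_fin ltr_pM2l ?invr_gt0// ltrDl ltr01.
by rewrite -EFinB -mulrBr addrAC subrr add0r mulr1.
Qed.

End digits.

Section walk.
Variables (R : realType) (D : finType) (s0 : D) (E : zmodType) (st : D -> E).

Definition walk (x : E) (t : R) : trajectory E :=
  fun n => x + \sum_(i < n) st (digit s0 i t).

Let walk_event (x : E) n (Q : ('I_n -> D) -> Prop) :
  measurable [set t : R | Q (fun i => digit s0 i t)].
Proof.
rewrite [X in measurable X](_ : _ = \bigcup_(f in [set f : {ffun 'I_n -> D} | Q f])
    \bigcap_(i in [set: 'I_n]) [set t : R | digit s0 i t = f i]).
  apply: fin_bigcup_measurable => // f _.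
  by apply: fin_bigcap_measurable => // i _; exact: measurable_digit.
apply/seteqP; split => t /=.
  move=> H; exists [ffun i : 'I_n => digit s0 i t] => /=.
    rewrite (_ : (fun_of_fin _ : 'I_n -> D) = fun i : 'I_n => digit s0 i t)//.
    by apply/funext => i; rewrite ffunE.
  by move=> i _ /=; rewrite ffunE.
move=> [f /= Qf H]; rewrite (_ : (fun i : 'I_n => _) = f)//.
by apply/funext => i; exact: H.
Qed.

Lemma measurable_walk x : @measurable_fun _ _ (measurableTypeR R) (trajectory E) setT (walk x).
Proof.
apply: (@measurability _ _ _ (trajectory E) setT (walk x) (@cylinder_events E) erefl).
move=> _ [_ [n [y ->]] <-]; rewrite setTI.
exact: (@walk_event x n (fun f => x + \sum_(i < n) st (f i) = y)).
Qed.

Definition walk_mfun (x : E) : {mfun measurableTypeR R >-> trajectory E} :=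
  @mfun_Sub _ _ (measurableTypeR R) (trajectory E) (walk x) (mem_set (measurable_walk x)).

(* The law P_x of the walk with i.i.d. uniform steps in [st D]; it is         *)
(* characterized by [walk_lawE].                                              *)
Definition walk_law (x : E) : probability (trajectory E) R :=
  distribution (uniform_prob (@ltr01 R)) (walk_mfun x).

Lemma walk_lawE x n (y : nat -> E) :
  walk_law x [set w | forall i, (i <= n)%N -> w i = y i] =
  ((y 0%N == x)%:R *
   \prod_(i < n) (#|[pred s | y i + st s == y i.+1]|%:R / #|D|%:R))%:E.
Proof.
rewrite /walk_law /distribution /pushforward /=.
have [<-|yx] := eqVneq (y 0%N) x; last first.
  rewrite mul0r (_ : _ @^-1` _ = set0) ?measure0//.
  apply/seteqP; split => // t /= /(_ 0%N isT); rewrite /walk big_ord0 addr0.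
  by move/eqP; rewrite eq_sym (negbTE yx).
rewrite mul1r.
pose F (i : 'I_n) : pred D := [pred s | y i + st s == y i.+1].
pose ev (f : {ffun 'I_n -> D}) : set R :=
  [set t : R | forall i : 'I_n, digit s0 i t = f i].
have mev f : measurable (ev f).
  exact: (@walk_event 0 n (fun g => forall i, g i = f i)).
rewrite (_ : _ @^-1` _ = \bigcup_(f in [set` family F]) ev f); last first.
  apply/seteqP; split => t /=.
    move=> H; exists [ffun i : 'I_n => digit s0 i t] => /=; last first.
      by move=> i; rewrite ffunE.
    apply/familyP => i; rewrite ffunE inE -(H i (ltnW (ltn_ord i))).
    by rewrite -(H i.+1 (ltn_ord i)) /walk big_ord_recr/= addrA.
  move=> [f /= /familyP Ff H] i; elim: i => [_|i IH ilt].
    by rewrite /walk big_ord0 addr0.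
  have := Ff (Ordinal ilt); rewrite inE => /eqP <- /=; rewrite -IH ?(ltnW ilt)//.
  by rewrite /walk big_ord_recr/= addrA (H (Ordinal ilt)).
rewrite measure_fin_bigcup//; first last.
- by move=> f _; exact: mev.
- move=> f g _ _ [t [/= H1 H2]]; apply/ffunP => i.
  by rewrite -H1 -H2.
have evE f : uniform_prob (@ltr01 R) (ev f) = ((#|D|%:R ^+ n)^-1)%:E.
  rewrite -(digits_iid R s0 n (fun i => if insub i is Some j then f j else s0)).
  congr (uniform_prob _ _); apply/seteqP; split => t /= H i.
    by move=> ilt; rewrite insubT; exact: (H (Ordinal ilt)).
  by rewrite (H i (ltn_ord i)) valK.
rewrite fsbig_finite//= (eq_bigr (fun=> ((#|D|%:R ^+ n)^-1)%:E)) => [|f _//].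
rewrite big_const_seq iter_addr addr0 count_predT.
have -> : size (fset_set [set` family F]) = #|family F|.
  rewrite cardE; apply/perm_size/uniq_perm; rewrite ?fset_uniq ?enum_uniq//.
  by move=> f; rewrite in_fset_set// mem_enum; apply/idP/idP; rewrite inE.
rewrite -[LHS](_ : (((#|D|%:R ^+ n)^-1 *+ #|family F|)%:E = _)); last first.
  by elim: #|family F| => // k IH; rewrite !mulrS EFinD IH.
rewrite card_family prodf_div/= prodr_const card_ord.
congr (_%:E); rewrite -[LHS]mulr_natl; congr (_ * _).
rewrite -natr_prod; congr (_%:R).
by rewrite foldrE big_map big_enum.
Qed.

End walk.

(* [lattice int d] is Z^(d+1), seen as Z^d x Z; [lattice 'Z_N d] is E_N. For  *)
(* N <= 2 parallel edges occur in E_N, and ['Z_0], ['Z_1] denote Z/2Z; only   *)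
(* large N matter below.                                                      *)
Notation lattice A d := ('rV[A]_d * int)%type.

Definition direction (d : nat) : finType := (option 'I_d * bool)%type.

Definition unit_vector (A : pzRingType) (d : nat) (i : option 'I_d)
    : lattice A d :=
  if i is Some j then (delta_mx 0 j, 0) else (0, 1).

Definition step (A : pzRingType) (d : nat) (s : direction d) : lattice A d :=
  if s.2 then - unit_vector A s.1 else unit_vector A s.1.

Lemma card_direction d : #|direction d| = (2 * d.+1)%N.
Proof. by rewrite card_prod card_option card_ord card_bool mulnC. Qed.

Section simple_random_walk.
Variables (R : realType) (A : pzRingType) (d : nat).
Implicit Types (x y : lattice A d) (K : {fset lattice A d}).
Implicit Types (U : set (lattice A d)).
Local Open Scope ereal_scope.

Definition srw x : probability (trajectory (lattice A d)) R :=
  walk_law R ((None, false) : direction d) (@step A d) x.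

Definition equilibrium K x : \bar R :=
  if x \in K then srw x [set w | hit_pos [set` K] w = None] else 0.

Definition killed_equilibrium U K x : \bar R :=
  if x \in K
  then srw x [set w | time_lt (exit U w) (hit_pos [set` K] w)] else 0.

Definition killed_green U x y : \bar R :=
  \sum_(0 <= n <oo) srw x [set w | w n = y /\ time_lt (Some n) (exit U w)].

Definition mutual_energy U (S S' : {fset lattice A d}) : \bar R :=
  \sum_(x <- S) \sum_(y <- S')
    killed_equilibrium U S x * killed_green U x y * killed_equilibrium U S' y.

End simple_random_walk.

Definition point_events (E : Type) : set (set (set E)) :=
  [set C | exists x, C = [set A | A x]].

(* Subsets of [E], with the sigma-algebra generated by the events "x in A".   *)
Definition configuration (E : Type) : Type :=
  g_sigma_algebraType (@point_events E).
HB.instance Definition _ (E : Type) := Measurable.on (configuration E).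

Definition trace {E : choiceType} (A : configuration E) (K : {fset E})
    : configuration E :=
  [set x | A x /\ x \in K].

Section interlacements.
Variables (R : realType) (d : nat).
Local Notation Zd1 := (lattice int d).

Definition interlacement_intensity (u : R) (K : {fset Zd1})
    (G : set (trajectory Zd1)) : \bar R :=
  (u%:E * \sum_(x <- K) equilibrium R K x * srw R x G)%E.

Definition ranges {T : Type} (M : T -> nat) (Y : nat -> T -> trajectory Zd1)
    (w : T) : configuration Zd1 :=
  [set x | exists i n, (i < M w)%N /\ Y i w n = x].

(* In [interlacement_joint], the two coordinates of [Q0 \x Q0] carry          *)
(* independent copies of the family.                                          *)
Record is_interlacement {d0 : measure_display} {Omega0 : measurableType d0}
    (Q0 : probability Omega0 R) (I : R -> Omega0 -> configuration Zd1) : Prop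
    := IsInterlacement {
  interlacement_measurable : forall u, 0 <= u -> measurable_fun setT (I u) ;
  interlacement_increasing : forall u v w,
    0 <= u -> u <= v -> (I u w : set Zd1) `<=` I v w ;
  interlacement_local : forall (u : R) (K : {fset Zd1}), 0 <= u ->
    exists (d' : measure_display) (T : measurableType d')
      (P : probability T R) (M : {mfun T >-> nat})
      (Y : nat -> {mfun T >-> trajectory Zd1}),
      is_poisson_process P M Y (interlacement_intensity u K) /\
      same_law Q0 (fun w => trace (I u w) K)
               P (fun w => trace (ranges M Y w) K) ;
  interlacement_joint : forall u v, 0 <= u -> u <= v ->
    same_law Q0 (fun w => (I u w, I v w))
             (Q0 \x Q0)%E
             (fun w => (I u w.1, (I u w.1 : set Zd1) `|` I (v - u) w.2))
}.

End interlacements.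

Section cylinder.
Variables (R : realType) (d N : nat).
Local Notation EN := (lattice 'Z_N d).
Local Notation Zd1 := (lattice int d).

Definition hN : nat := Num.truncn (N%:R * (2 + ln N%:R ^+ 2) : R).

Definition inner_box : set EN := [set x | (`|x.2| <= N)%N].

Definition outer_box : set EN := [set x | (`|x.2| < hN)%N].

Definition KN : R := N%:R ^+ d / (d.+1%:R * (hN%:R - N%:R)).

Definition qz_walk (z : int) (G : set (trajectory EN)) : \bar R :=
  (\sum_(t : 'rV['Z_N]_d) ((N%:R ^+ d)^-1)%:E * srw R ((t, z) : EN) G)%E.

Definition visited_departure (m : nat) (w : trajectory EN) : set EN :=
  visited (departure inner_box outer_box m w) w.

Definition project (y : Zd1) : EN := (map_mx intr y.1, y.2).

(* S + x as a subset of E_N, for S in Z^(d+1). Balls of radius N^(1-eps)      *)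
(* around 0 in Z^(d+1) and E_N are identified through [project].              *)
Definition translate (S : {fset Zd1}) (x : EN) : {fset EN} :=
  [fset (project y + x)%R | y in S]%fset.

Definition linf_ball (rho : R) : set Zd1 :=
  [set y : Zd1 | (forall j, `|y.1 0 j|%:~R <= rho) /\ `|y.2|%:~R <= rho].

End cylinder.

(* Submission.v *)
(* Cut the walk into excursions from the slab B to the exit of the larger slab. Reversing time between
   the set and the two sides, and mixing of the projection to the torus, the law of the trace that an
   excursion leaves on the sets S_i + x_i is, up to factors 1 + O(N/h), one over K_N times the law of
   the trace of the Z^(d+1) walk started from the equilibrium measure of S_i; both laws are compared by
   a Harnack inequality on a shell well inside the torus, obtained from explicit radial super- and
   subharmonic functions. What is left over is the event of meeting two different sets, whose
   probability is bounded by the mutual energies over K_N, and an error of order N^(-3d-1)/K_N.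

   Conditionally on its past, each excursion is therefore coupled with an upper slot that contains its
   trace and a lower slot contained in it, both independent of the past and given by thinning one law.
   Poissonizing the number of slots, with a Chernoff bound for the number of excursions, turns the
   slots into two ordered random sets whose down-set probabilities are exponentials; the void
   probabilities of interlacements are the same, and these determine the law of the pair. All couplings
   are couplings of laws on finite sets; the walk is glued to them at the end, so that it is never
   enlarged path by path. If the energies times u / K_N are not small, the bound to prove exceeds 1. *)

Require Import Defs.
From HB Require Import structures.
From mathcomp Require Import all_boot all_order all_algebra finmap.
From mathcomp Require Import all_classical all_reals all_analysis measurable_realfun.
From mathcomp Require Import ring lra zify.
Set Implicit Arguments.
Unset Strict Implicit.
Unset Printing Implicit Defensive.
Import Order.TTheory GRing.Theory Num.Theory.
Import numFieldNormedType.Exports.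
Local Open Scope classical_set_scope.
Local Open Scope ring_scope.

(** * Markov property and hitting probabilities *)

Section prb.
Context {R : realType} {d : measure_display} {T : measurableType d}.
Variable P : probability T R.
Implicit Types A B : set T.

Definition prb A : R := fine (P A).

Lemma prbE A : measurable A -> P A = (prb A)%:E.
Proof. by move=> mA; rewrite /prb fineK// fin_num_measure. Qed.

Lemma prb_ge0 A : 0 <= prb A.
Proof. exact: fine_ge0. Qed.

Lemma prb0 : prb set0 = 0. Proof. by rewrite /prb measure0. Qed.

Lemma prbT : prb setT = 1. Proof. by rewrite /prb probability_setT. Qed.

Lemma le_prb A B : measurable A -> measurable B -> A `<=` B -> prb A <= prb B.
Proof.
by move=> mA mB AB; rewrite -lee_fin -!prbE//; apply: le_measure; rewrite ?inE.
Qed.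

Lemma prb_le1 A : measurable A -> prb A <= 1.
Proof. by move=> mA; rewrite -prbT le_prb. Qed.

Lemma prbU A B : measurable A -> measurable B -> A `&` B = set0 ->
  prb (A `|` B) = prb A + prb B.
Proof.
move=> mA mB AB; apply/EFin_inj; rewrite EFinD -!prbE//; last exact: measurableU.
by rewrite measureU//; apply/disj_setPS; rewrite AB.
Qed.

Lemma prb_split A B : measurable A -> measurable B ->
  prb A = prb (A `&` B) + prb (A `\` B).
Proof.
move=> mA mB; rewrite -prbU; [by rewrite setUIDK|exact: measurableI|exact: measurableD|].
by rewrite setDE setIACA setICr setI0.
Qed.

Lemma prbC A : measurable A -> prb (~` A) = 1 - prb A.
Proof.
move=> mA; have := prb_split measurableT mA; rewrite prbT setTI setTD => ->.
by rewrite addrAC subrr add0r.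
Qed.

Lemma prbU_le A B : measurable A -> measurable B -> prb (A `|` B) <= prb A + prb B.
Proof.
move=> mA mB; rewrite -lee_fin EFinD -!prbE//; last exact: measurableU.
exact: measureU2.
Qed.

Lemma prb_seq (I : eqType) (f : T -> I) A (s : seq I) : measurable A ->
  (forall i, i \in s -> measurable [set w | f w = i]) -> uniq s ->
  prb (A `&` [set w | f w \in s]) = \sum_(i <- s) prb (A `&` [set w | f w = i]) /\
  measurable [set w | f w \in s].
Proof.
move=> mA; elim: s => [_ _|i s IH mf /= /andP[nis us]].
  by rewrite big_nil (_ : [set w | _] = set0) ?setI0 ?prb0//; apply/seteqP; split.
have [j js||IH1 IH2] := IH => //; first by apply: mf; rewrite inE js orbT.
have mi : measurable [set w | f w = i] by apply: mf; rewrite inE eqxx.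
have -> : [set w | f w \in i :: s] = [set w | f w = i] `|` [set w | f w \in s].
  apply/seteqP; split => w /=; rewrite inE; first by case/predU1P; [left|right].
  by case=> [->|->]; rewrite ?eqxx ?orbT.
split; last exact: measurableU.
rewrite setIUr big_cons prbU ?IH1//; try exact: measurableI.
by apply/seteqP; split => // w [[_ /= fi] [_ /=]]; rewrite fi (negbTE nis).
Qed.

Lemma prb_fin (I : finType) (f : T -> I) A : measurable A ->
  (forall i, measurable [set w | f w = i]) ->
  prb A = \sum_i prb (A `&` [set w | f w = i]).
Proof.
move=> mA mf; have [|<- _] := @prb_seq _ f A (index_enum I) mA _ (index_enum_uniq _).
  by move=> i _; exact: mf.
by congr (prb _); apply/seteqP; split => [w Aw|w []//]; split; rewrite //= mem_index_enum.
Qed.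

Lemma prb_series (F : nat -> set T) : (forall n, measurable (F n)) ->
  trivIset setT F -> P (\bigcup_n F n) = (\sum_(0 <= n <oo) (prb (F n))%:E)%E.
Proof.
move=> mF tF; rewrite measure_semi_bigcup//; last exact: bigcupT_measurable.
by apply: eq_eseriesr => n _; exact: prbE.
Qed.

Lemma prb_bigcup_le (F : nat -> set T) c : (forall n, measurable (F n)) ->
  {homo F : n m / (n <= m)%N >-> n `<=` m} -> (forall n, prb (F n) <= c) ->
  prb (\bigcup_n F n) <= c.
Proof.
move=> mF ndF Fc; have mU : measurable (\bigcup_n F n) by exact: bigcupT_measurable.
rewrite -lee_fin -prbE//.
have := @nondecreasing_cvg_mu _ _ _ P _ mF mU; move=> /(_ _)/cvg_lim <-//.
  apply: lime_le.
    apply: ereal_nondecreasing_is_cvgn => n m nm; apply: le_measure; rewrite ?inE//.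
    exact: ndF.
  by near=> n; rewrite /= prbE// lee_fin.
by move=> n m nm; apply/subsetPset; exact: ndF.
Unshelve. all: by end_near. Qed.

End prb.

Section markov.
Variables (R : realType) (E : zmodType) (D : finType) (s0 : D) (st : D -> E).
Hypothesis countE : countable [set: E].
Local Notation traj := (trajectory E).
Local Notation P := (walk_law R s0 st).

Definition fdep (n : nat) (A : set (nat -> E)) :=
  forall w w', (forall i, (i <= n)%N -> w i = w' i) -> A w -> A w'.

Let cyl n (y : nat -> E) : set traj := [set w | forall i, (i <= n)%N -> w i = y i].

Let cylinders : set (set traj) := [set C | C = set0 \/ exists n y, C = cyl n y].

Let fdep_gen (GG : set (set traj)) n (A : set traj) :
  (forall k y, <<s GG >> (cyl k y)) -> fdep n A -> <<s GG >> A.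
Proof.
move=> Gcyl fA; have /countable_injP[f finj] := countE.
pose F (c : seq nat) := [set w : traj | A w /\ [seq f (w i) | i <- iota 0 n.+1] = c].
have -> : A = \bigcup_c F c.
  apply/seteqP; split=> [w Aw|w [c _ []//]].
  by exists [seq f (w i) | i <- iota 0 n.+1].
apply: (@countable_bigcupT_measurable _ (g_sigma_algebraType GG)) => [|c].
  exact: countableP.
have [[w0 [Aw0 wc]]|nF] := pselect (exists w, F c w); last first.
  rewrite (_ : F c = set0); first exact: (@measurable0 _ (g_sigma_algebraType GG)).
  by apply/seteqP; split => // w Fw; apply: nF; exists w.
rewrite (_ : F c = cyl n w0); first exact: Gcyl.
apply/seteqP; split => [w [Aw]|w ww].
  rewrite -wc => /eq_in_map H i ilt; apply: finj; rewrite ?in_setT//.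
  by apply: H; rewrite mem_iota add0n ltnS.
split; first by apply: fA Aw0 => i ilt; rewrite ww.
rewrite -wc; apply/eq_in_map => i; rewrite mem_iota add0n ltnS => /andP[_ ilt].
by rewrite ww.
Qed.

Lemma measurable_at n x : measurable ([set w | w n = x] : set traj).
Proof. by apply: sub_sigma_algebra; exists n, x. Qed.

Let measurable_cyl n y : measurable (cyl n y).
Proof.
have -> : cyl n y = \bigcap_(i in `I_n.+1) [set w | w i = y i].
  by apply/seteqP; split => w H i ilt; apply: H.
by apply: bigcap_measurableType => i _; exact: measurable_at.
Qed.

Lemma fdep_measurable n (A : set traj) : fdep n A -> measurable A.
Proof. by move=> fA; apply: (fdep_gen _ fA) => k y; exact: measurable_cyl. Qed.

Let gen_cylinders : @measurable _ traj = <<s cylinders >>.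
Proof.
apply/seteqP; split; apply: smallest_sub; try exact: smallest_sigma_algebra.
  move=> _ [n [x ->]]; apply: (@fdep_gen _ n).
    by move=> k y; apply: sub_sigma_algebra; right; exists k, y.
  by move=> w w' ww' /= <-; rewrite ww'.
by move=> _ [->//|[n [y ->]]]; exact: measurable_cyl.
Qed.

Let cylindersI : setI_closed cylinders.
Proof.
move=> A B [->|[n [y ->]]] [->|[k [z ->]]]; rewrite ?set0I ?setI0; do 1? by left.
wlog nk : n k y z / (n <= k)%N.
  by move=> H; have [/H//|/ltnW/H] := leqP n k; rewrite setIC; exact.
have [yz|yz] := pselect (forall i, (i <= n)%N -> y i = z i).
  right; exists k, z; apply/seteqP; split => [w []//|w wz]; split => // i ilt.
  by rewrite yz// wz// (leq_trans ilt).
left; apply/seteqP; split=> // w [wy wz]; apply: yz => i ilt.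
by rewrite -wy// wz// (leq_trans ilt).
Qed.

Lemma walk_measure_unique (m1 m2 : {measure set traj -> \bar R}) :
  (m1 setT < +oo)%E ->
  (forall n y, m1 [set w | forall i, (i <= n)%N -> w i = y i] =
               m2 [set w | forall i, (i <= n)%N -> w i = y i]) ->
  forall G, measurable G -> m1 G = m2 G.
Proof.
move=> m1oo m12 G mG.
have C0 : forall B, cylinders B -> m1 B = m2 B.
  by move=> B [->|[n [y ->]]]; [rewrite !measure0|exact: m12].
have /countable_injP[f finj] := countE.
pose g (k : nat) : set traj :=
  match pselect (exists x, f x = k) with left h => cyl 0 (fun=> sval (cid h)) | right _ => set0 end.
apply: (measure_unique cylinders g) => //.
- move=> k; rewrite /g; case: pselect => h; last by left.
  by right; exists 0%N, (fun=> sval (cid h)).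
- apply/seteqP; split=> // w _; exists (f (w 0%N)) => //; rewrite /g.
  case: pselect => [h|[]]; last by exists (w 0%N).
  case=> // _; apply/esym; apply: finj; rewrite ?in_setT//; exact: (svalP (cid h)).
- move=> k; apply: le_lt_trans m1oo; apply: le_measure; rewrite ?inE//.
  by rewrite /g; case: pselect.
Qed.

Lemma walk_law0 x : P x [set w | w 0%N = x] = 1%E.
Proof.
have := walk_lawE R s0 st x 0 (fun=> x); rewrite eqxx big_ord0 mulr1 => <-.
by congr (P x _); apply/seteqP; split => [w /= + i|w /= ->//]; case: i.
Qed.

Definition consw (x : E) (w : traj) : traj := fun n => if n is k.+1 then w k else x.

Lemma measurable_consw x : measurable_fun setT (consw x).
Proof.
apply: (@measurability _ _ traj traj setT (consw x) (@cylinder_events E)) => //.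
move=> _ [_ [n [y ->]] <-]; rewrite setTI; case: n => [|n] /=.
  have [->|xy] := eqVneq x y; first by rewrite (_ : _ @^-1` _ = setT)//; apply/seteqP.
  rewrite (_ : _ @^-1` _ = set0)//; apply/seteqP; split => // w /= /eqP.
  by rewrite (negbTE xy).
exact: measurable_at.
Qed.

HB.instance Definition _ x := isMeasurableFun.Build _ _ traj traj (consw x) (measurable_consw x).

Lemma walk_cons x G : measurable G ->
  P x G = (\sum_(s : D) (#|D|%:R^-1)%:E * P (x + st s) (consw x @^-1` G))%E.
Proof.
move=> mG.
have c0 : 0 <= #|D|%:R^-1 :> R by rewrite invr_ge0.
pose c : {nonneg R} := NngNum c0.
pose m2 := msum (fun k => mscale c
  (distribution (P (x + st (nth s0 (enum D) k))) (consw x))) #|D|.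
have m2E A : m2 A = (\sum_(s : D) (#|D|%:R^-1)%:E * P (x + st s) (consw x @^-1` A))%E.
  rewrite -big_enum/= (big_nth s0) -cardE big_mkord /m2 /msum /=.
  by apply: eq_bigr => k _; rewrite /mscale.
rewrite -m2E; apply: (@walk_measure_unique (P x) m2) => // [|n y].
  by apply: le_lt_trans (ltry 1); exact: probability_le1.
apply: (etrans (walk_lawE R s0 st x n y)); apply: (etrans _ (esym (m2E _))).
case: n => [|n].
  rewrite big_ord0 mulr1; have [<-|yx] := eqVneq (y 0%N) x.
    rewrite (eq_bigr (fun=> (#|D|%:R^-1)%:E)) => [|s _]; last first.
      rewrite (_ : _ @^-1` _ = setT) ?probability_setT ?mule1//.
      by apply/seteqP; split => // w _ i; rewrite leqn0 => /eqP->.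
    rewrite sumEFin sumr_const -(mulr_natr _^-1) mulVf// pnatr_eq0 -lt0n.
    by apply/card_gt0P; exists s0.
  rewrite big1// => s _; rewrite (_ : _ @^-1` _ = set0) ?measure0 ?mule0//.
  by apply/seteqP; split => // w /= /(_ 0%N isT)/= /eqP; rewrite eq_sym (negbTE yx).
have [yx|yx] := eqVneq (y 0%N) x; last first.
  rewrite mul0r big1// => s _; rewrite (_ : _ @^-1` _ = set0) ?measure0 ?mule0//.
  by apply/seteqP; split => // w /= /(_ 0%N isT)/= /eqP; rewrite eq_sym (negbTE yx).
rewrite mul1r (eq_bigr (fun s => (#|D|%:R^-1 * ((y 1%N == x + st s)%:R *
   \prod_(i < n) (#|[pred s | y i.+1 + st s == y i.+2]|%:R / #|D|%:R)))%:E)) => [|s _].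
  rewrite sumEFin -mulr_sumr -mulr_suml big_ord_recl/= mulrC; congr (_%:E).
  rewrite [RHS]mulrA mulrC; congr (_ * _); rewrite mulrC; congr (_ * _).
  rewrite -natr_sum; congr (_%:R); rewrite -sum1_card [LHS]big_mkcond; apply: eq_bigr => s _.
  by rewrite inE yx eq_sym; case: eqP.
rewrite [RHS]EFinM; congr (_ * _)%E.
apply: (etrans _ (walk_lawE R s0 st (x + st s) n (fun i => y i.+1))).
congr (P (x + st s) _); apply/seteqP; split => w /= H i.
  by move=> ilt; exact: (H i.+1).
by case: i => [|i]//= ilt; exact: H.
Qed.

Definition pr x (G : set traj) : R := prb (P x) G.

Lemma pr_cons x G : measurable G ->
  pr x G = #|D|%:R^-1 * \sum_(s : D) pr (x + st s) (consw x @^-1` G).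
Proof.
move=> mG; apply/EFin_inj; rewrite -prbE// walk_cons// mulr_sumr -sumEFin.
apply: eq_bigr => s _; rewrite EFinM -prbE//.
by rewrite -[X in measurable X]setTI; exact: measurable_consw.
Qed.

Lemma pr_as x (G G' : set traj) : measurable G -> measurable G' ->
  (forall w, w 0%N = x -> G w <-> G' w) -> pr x G = pr x G'.
Proof.
move=> mG mG' GG'; have m0 := measurable_at 0 x.
have H0 A : measurable A -> pr x A = pr x (A `&` [set w | w 0%N = x]).
  move=> mA; rewrite /pr (prb_split _ mA m0) -[RHS]addr0; congr (_ + _).
  apply/eqP; rewrite eq_le prb_ge0 andbT.
  have -> : 0 = prb (P x) (~` [set w : traj | w 0%N = x]).
    by rewrite prbC// /prb walk_law0 subrr.
  apply: le_prb; [exact: measurableD|exact: measurableC|by move=> w []].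
rewrite H0// [RHS]H0//; congr (pr x _).
by apply/seteqP; split => w [wG w0]; split => //; apply/(GG' w w0).
Qed.

Lemma measurable_shift n : measurable_fun setT (Defs.shift n : traj -> traj).
Proof.
apply: (@measurability _ _ traj traj setT (Defs.shift n) (@cylinder_events E)) => //.
by move=> _ [_ [k [y ->]] <-]; rewrite setTI; exact: measurable_at.
Qed.

Lemma measurable_shiftI n (A G : set traj) : measurable A -> measurable G ->
  measurable [set w | A w /\ G (Defs.shift n w)].
Proof.
move=> mA mG; apply: measurableI => //.
by rewrite -[X in measurable X]setTI; exact: measurable_shift.
Qed.

Lemma walk_markov n (A G : set traj) (Y : set E) c x : fdep n A ->
  (forall w, A w -> Y (w n)) -> measurable G -> (forall y, Y y -> pr y G = c) ->
  pr x [set w | A w /\ G (Defs.shift n w)] = pr x A * c.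
Proof.
move=> + + mG Yc; elim: n A x => [|n IH] A x fA AY.
  have mA := fdep_measurable fA.
  have [Ax|nAx] := pselect (A (fun=> x)).
    rewrite (@pr_as x _ G)//; [|exact: measurable_shiftI|].
      rewrite (@pr_as x A setT)//; first by rewrite [X in X * _]prbT mul1r; exact/Yc/(AY _ Ax).
      by move=> w w0; split => // _; apply: fA Ax => i; rewrite leqn0 => /eqP->.
    by move=> w w0; split => [[]//|Gw]; split => //; apply: fA Ax => i; rewrite leqn0 => /eqP->.
  have H0 w : w 0%N = x -> ~ A w.
    by move=> w0 Aw; apply: nAx; apply: fA Aw => i; rewrite leqn0 => /eqP->.
  rewrite (@pr_as x _ set0)//; last 2 first.
    exact: measurable_shiftI.
    by move=> w /H0; split => // -[].
  by rewrite (@pr_as x A set0)// ?/pr ?prb0 ?mul0r// => w /H0.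
have mA := fdep_measurable fA.
rewrite !pr_cons//; last exact: measurable_shiftI.
rewrite -mulrA mulr_suml; congr (_ * _); apply: eq_bigr => s _.
apply: (IH (consw x @^-1` A)).
  by move=> w w' ww' /=; apply: fA => -[|i]//= ilt; exact: ww'.
by move=> w /AY.
Qed.

Definition stopping (tau : nat -> set (nat -> E)) :=
  (forall n, fdep n (tau n)) /\
  (forall n m w, tau n w -> tau m w -> n = m).

Lemma fdep_at n (Y : set E) : fdep n [set w | Y (w n)].
Proof. by move=> w w' /= ->. Qed.

Lemma fdepI n A B : fdep n A -> fdep n B -> fdep n (A `&` B).
Proof. by move=> fA fB w w' ww' [/(fA _ _ ww') ? /(fB _ _ ww')]. Qed.

Lemma stopping_measurable tau (Y : set E) : stopping tau ->
  measurable ([set w | exists n, tau n w /\ Y (w n)] : set traj).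
Proof.
move=> [ft _].
rewrite (_ : [set w | _] = \bigcup_n [set w | tau n w /\ Y (w n)]); last first.
  by apply/seteqP; split => [w [n H]|w [n _ H]]; exists n.
apply: bigcupT_measurable => n; apply: (@fdep_measurable n).
by apply: fdepI => //; exact: fdep_at.
Qed.

Lemma strong_markov tau (Y : set E) (G : set traj) c x : stopping tau ->
  measurable G -> (forall y, Y y -> pr y G = c) ->
  measurable ([set w | exists n, [/\ tau n w, Y (w n) & G (Defs.shift n w)]] : set traj) /\
  pr x [set w | exists n, [/\ tau n w, Y (w n) & G (Defs.shift n w)]] =
  pr x [set w | exists n, tau n w /\ Y (w n)] * c.
Proof.
move=> [ft tu] mG Gc.
pose A n := [set w : traj | tau n w /\ Y (w n)].
have fA n : fdep n (A n) by apply: fdepI => //; exact: fdep_at.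
pose B n := [set w | A n w /\ G (Defs.shift n w)].
have mB n : measurable (B n).
  by apply: measurable_shiftI => //; exact: fdep_measurable (fA n).
have -> : [set w | exists n, [/\ tau n w, Y (w n) & G (Defs.shift n w)]] = \bigcup_n B n.
  by apply/seteqP; split => [w [n [? ? ?]]|w [n _ [[? ?] ?]]]; exists n.
have -> : [set w | exists n, tau n w /\ Y (w n)] = \bigcup_n A n.
  by apply/seteqP; split => [w [n H]|w [n _ H]]; exists n.
split; first exact: bigcupT_measurable.
apply/EFin_inj; rewrite -prbE; last exact: bigcupT_measurable.
rewrite prb_series//; last first.
  by move=> n m _ _ [w [[[tn _] _] [[tm _] _]]]; exact: tu tn tm.
rewrite EFinM -prbE; last first.
  by apply: bigcupT_measurable => n; exact: fdep_measurable (fA n).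
rewrite prb_series; first last.
- by move=> n m _ _ [w [[tn _] [tm _]]]; exact: tu tn tm.
- by move=> n; exact: fdep_measurable (fA n).
have [[y Yy]|nY] := pselect (exists y, Y y).
  rewrite muleC -nneseriesZl => [|n _]; last by rewrite lee_fin prb_ge0.
  apply: eq_eseriesr => n _; rewrite -EFinM mulrC; congr (_%:E).
  by apply: (walk_markov (Y := Y)) => // w [].
rewrite !eseries0 ?mul0e// => n _ _.
  by rewrite (_ : A n = set0) ?prb0//; apply/seteqP; split => // w [_ Yw]; apply: nY; exists (w n).
by rewrite (_ : B n = set0) ?prb0//; apply/seteqP; split => // w [[_ Yw] _]; apply: nY; exists (w n).
Qed.

Definition avg (u : E -> R) (x : E) : R := #|D|%:R^-1 * \sum_s u (x + st s).

Let D0 : 0 < #|D|%:R :> R.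
Proof. by rewrite ltr0n; apply/card_gt0P; exists s0. Qed.

Lemma avg_cst c x : avg (fun=> c) x = c.
Proof. by rewrite /avg sumr_const -(mulr_natl c) mulrA mulVf ?gt_eqF// mul1r. Qed.

Lemma le_avg u v x : (forall s, u (x + st s) <= v (x + st s)) -> avg u x <= avg v x.
Proof. by move=> uv; rewrite ler_pM2l ?invr_gt0//; apply: ler_sum. Qed.

Lemma eq_avg u v x : (forall s, u (x + st s) = v (x + st s)) -> avg u x = avg v x.
Proof. by move=> uv; congr (_ * _); apply: eq_bigr. Qed.

Lemma avgD u v x : avg (fun y => u y + v y) x = avg u x + avg v x.
Proof. by rewrite /avg big_split mulrDr. Qed.

Lemma avgZ c u x : avg (fun y => c * u y) x = c * avg u x.
Proof. by rewrite /avg -mulr_sumr mulrCA. Qed.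

Lemma avgN u x : avg (fun y => - u y) x = - avg u x.
Proof. by rewrite /avg sumrN mulrN. Qed.

Lemma avgB u v x : avg (fun y => u y - v y) x = avg u x - avg v x.
Proof. by rewrite avgD avgN. Qed.

Lemma avg_sum (I : Type) (r : seq I) (F : I -> E -> R) x :
  avg (fun y => \sum_(i <- r) F i y) x = \sum_(i <- r) avg (F i) x.
Proof. by rewrite /avg exchange_big mulr_sumr. Qed.

Lemma avg_ge0 u x : (forall s, 0 <= u (x + st s)) -> 0 <= avg u x.
Proof. by move=> u0; rewrite mulr_ge0 ?invr_ge0// sumr_ge0. Qed.

Lemma lt_avg u v x s : (forall s, u (x + st s) <= v (x + st s)) ->
  u (x + st s) < v (x + st s) -> avg u x < avg v x.
Proof.
move=> uv uvs; rewrite ltr_pM2l ?invr_gt0// (bigD1 s)//= [ltRHS](bigD1 s)//=.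
by rewrite ltr_leD// ler_sum.
Qed.

Lemma avg_ge u x s : (forall s, 0 <= u (x + st s)) ->
  #|D|%:R^-1 * u (x + st s) <= avg u x.
Proof.
move=> u0; rewrite ler_pM2l ?invr_gt0// (bigD1 s isT)/= lerDl; apply: sumr_ge0 => i _.
exact: u0.
Qed.

Definition hitat (Z : set E) (n : nat) : set (nat -> E) :=
  [set w | Z (w n) /\ forall i, (i < n)%N -> ~ Z (w i)].

Lemma hitat_stopping Z : stopping (hitat Z).
Proof.
split=> [n w w' ww' [Zn nZ]|n m w [Zn nZn] [Zm nZm]].
  by split; [rewrite -ww'|move=> i ilt; rewrite -ww'; [exact: nZ|exact: ltnW]].
by have [/nZm/(_ Zn)//|/nZn/(_ Zm)//|] := ltngtP n m.
Qed.

Definition hev (Z S : set E) : set traj := [set w | exists n, hitat Z n w /\ S (w n)].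

Definition hp Z S x := pr x (hev Z S).

Lemma measurable_hev Z S : measurable (hev Z S).
Proof. exact: stopping_measurable (hitat_stopping Z). Qed.

Lemma hp_ge0 Z S x : 0 <= hp Z S x. Proof. exact: prb_ge0. Qed.

Lemma hp_le1 Z S x : hp Z S x <= 1.
Proof. by apply: prb_le1; exact: measurable_hev. Qed.

Lemma pr_setT x : pr x setT = 1. Proof. exact: prbT. Qed.

Lemma hp_in Z S x : Z x -> hp Z S x = `[<S x>]%:R.
Proof.
move=> Zx; case: asboolP => [Sx|nSx].
  rewrite -(pr_setT x); apply: pr_as => //; first exact: measurable_hev.
  by move=> w w0; split => // _; exists 0%N; rewrite w0; split => //; split; rewrite ?w0.
rewrite -[RHS](prb0 (P x)); apply: pr_as => //; first exact: measurable_hev.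
move=> w w0; split => // -[n [[Zn nZ] Sn]]; apply: nSx; rewrite -w0.
by case: n => [//|n] in Zn nZ Sn *; have := nZ 0%N isT; rewrite w0.
Qed.

Let hev_cons Z S x w : ~ Z x -> hev Z S (consw x w) <-> hev Z S w.
Proof.
move=> nZx; split => [[[|n] [[//= Zn nZ] Sn]]|[n [[Zn nZ] Sn]]].
  by exists n; split => //; split => // i ilt; exact: (nZ i.+1).
by exists n.+1; split => //; split => // -[|i]//= ilt; exact: nZ.
Qed.

Lemma hp_step Z S x : ~ Z x -> hp Z S x = avg (hp Z S) x.
Proof.
move=> nZx; rewrite /hp pr_cons; last exact: measurable_hev.
congr (_ * _); apply: eq_bigr => s _; congr (pr _ _).
by apply/seteqP; split => w Hw; exact/(hev_cons S w nZx).
Qed.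

Lemma eq_hp Z S Z' S' x : (forall y, Z y <-> Z' y) ->
  (forall y, Z y -> S y <-> S' y) -> hp Z S x = hp Z' S' x.
Proof.
move=> ZZ' SS'; congr (pr _ _); apply/seteqP; split => w [n [[Zn nZ] Sn]]; exists n.
  split; first by split; [exact/ZZ'|move=> i /nZ nZi /ZZ'].
  exact/SS'.
split; first by split; [exact/ZZ'|move=> i /nZ nZi /ZZ'].
by apply/SS' => //; exact/ZZ'.
Qed.

Lemma le_hp Z S S' x : (forall y, Z y -> S y -> S' y) -> hp Z S x <= hp Z S' x.
Proof.
move=> SS'; apply: le_prb; [exact: measurable_hev|exact: measurable_hev|].
by move=> w [n [[Zn nZ] Sn]]; exists n; split => //; exact: SS'.
Qed.

Lemma hpU Z S S' x : (forall y, S y -> S' y -> False) ->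
  hp Z (S `|` S') x = hp Z S x + hp Z S' x.
Proof.
move=> SS'; rewrite /hp /pr -prbU; [|exact: measurable_hev|exact: measurable_hev|].
  congr (prb _ _); apply/seteqP; split.
    by move=> w [n [Zn [Sn|Sn]]]; [left|right]; exists n.
  by move=> w [[n [Zn Sn]]|[n [Zn Sn]]]; exists n; split => //; [left|right].
apply/seteqP; split => // w [[n [Zn Sn]] [m [Zm Sm]]]; apply: SS' Sn _.
by have [_ /(_ _ _ _ Zn Zm) ->] := hitat_stopping Z.
Qed.

Lemma hp_seq Z (s : seq E) x : uniq s ->
  hp Z [set` s] x = \sum_(y <- s) hp Z [set y] x.
Proof.
elim: s => [_|y s IH /= /andP[nys us]].
  by rewrite big_nil -(prb0 (P x)); congr (prb _ _); apply/seteqP; split => // w [n []].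
rewrite big_cons -IH// -hpU//; last by move=> z ->; apply/negP.
congr (pr _ _); apply/seteqP; split => w [n [Zn]] /=.
  by rewrite inE => /predU1P[?|?]; exists n; split => //; [left|right].
by case=> /= [Sn|Sn]; exists n; split => //=; rewrite inE Sn ?eqxx ?orbT.
Qed.

(* Both sides are compared at finite horizons, so the domain need not be exited almost surely. *)
Lemma hp_le_super Z S (Dm : set E) (F : E -> R) :
  (forall x, Dm x -> ~ Z x) -> (forall x, Dm x -> 0 <= F x) ->
  (forall x, Dm x -> avg (fun y => if `[<Dm y>] then F y else hp Z S y) x <= F x) ->
  forall x, Dm x -> hp Z S x <= F x.
Proof.
move=> DZ F0 FF.
pose h n : set traj := [set w | exists j, (j <= n)%N /\ (hitat Z j w /\ S (w j))].
have mh n : measurable (h n).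
  apply: (@fdep_measurable n) => w w' ww' [j [jn [[Zj nZ] Sj]]]; exists j.
  split => //; rewrite -ww'//; split => //; split; first by rewrite -ww'.
  by move=> i ij; rewrite -ww' ?(leq_trans (ltnW ij))//; exact: nZ.
have hle n x : pr x (h n) <= hp Z S x.
  apply: le_prb => //; first exact: measurable_hev.
  by move=> w [j [_ H]]; exists j.
have hF n x : Dm x -> pr x (h n) <= F x.
  elim: n x => [|n IH] x Dx.
    rewrite (@pr_as x _ set0)// ?/pr ?prb0 ?F0// => w w0; split => // -[j []].
    by rewrite leqn0 => /eqP-> [[]]; rewrite w0 => /(DZ _ Dx).
  apply: le_trans (FF x Dx); rewrite pr_cons// ler_pM2l ?invr_gt0//; apply: ler_sum => s _.
  have -> : consw x @^-1` h n.+1 = h n.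
    apply/seteqP; split => w [j [jn [[Zj nZ] Sj]]].
      case: j => [|j] in jn Zj nZ Sj *; first by case: (DZ _ Dx Zj).
      exists j; split => //; split => //; split => // i ij; exact: (nZ i.+1).
    exists j.+1; split => //; split => //; split => // -[_|i ij]; first exact: DZ.
    exact: nZ.
  by case: asboolP => [Dy|_]; [exact: IH|exact: hle].
move=> x Dx; rewrite /hp (_ : hev Z S = \bigcup_n h n).
  apply: prb_bigcup_le => // [n m nm w [j [jn H]]|n]; last exact: hF.
  by exists j; split => //; exact: leq_trans nm.
apply/seteqP; split => [w [n H]|w [n _ [j [_ H]]]]; last by exists j.
by exists n => //; exists n.
Qed.

End markov.

Arguments avg {R E D} st u x.
Arguments hp_step {R E D s0 st} countE {Z} S {x} _.
Arguments hp_in {R E D s0 st} countE {Z} S {x} _.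
Arguments hp_seq {R E D s0 st} countE Z {s} x _.
Arguments le_hp {R E D s0 st} countE {Z S S'} x _.
Arguments hpU {R E D s0 st} countE Z {S S'} x _.
Arguments hp_le1 {R E D s0 st} countE Z S x.
Arguments hp_ge0 {R E D s0 st} Z S x.
Arguments eq_hp {R E D s0 st Z S Z' S'} x _ _.
Arguments pr_as {R E D s0 st x G G'} _ _ _.
Arguments pr_cons {R E D s0 st} countE x {G} _.
Arguments le_avg {R E D} s0 {st u v x} _.
Arguments avg_cst {R E D} s0 {st} c x.
Arguments avg_ge {R E D} s0 {st u x} s _.
Arguments avgZ {R E D st} c u x.

Lemma first_timeP (A : set nat) :
  match first_time A with
  | Some n => A n /\ forall i, (i < n)%N -> ~ A i
  | None => forall n, ~ A n
  end.
Proof.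
rewrite /first_time; case: pselect => [h|h].
  case: ex_minnP => n /asboolP An min; split => // i ilt Ai.
  by have := min i (introT (asboolP _) Ai); rewrite leqNgt ilt.
by move=> n An; apply: h; exists n; exact/asboolP.
Qed.

Lemma hit_hitat (E : zmodType) (Z : set E) w n : hit Z w = Some n <-> hitat Z n w.
Proof.
have := first_timeP [set n | Z (w n)]; rewrite /hit; case: first_time => [m|] H.
  split => [[<-]//|H']; congr Some.
  by have [_ /(_ _ _ _ H H')] := hitat_stopping Z.
by split => // -[/H].
Qed.

Lemma seq_argmax (R : realType) (T : eqType) (f : T -> R) (s : seq T) x : x \in s ->
  exists2 y, y \in s & forall z, z \in s -> f z <= f y.
Proof.
elim: s x => // y s IH x _; case: s IH => [_|z s IH].
  by exists y; rewrite ?inE// => t; rewrite inE => /eqP->.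
have [t ts tmax] := IH z (mem_head _ _).
have [ty|yt] := leP (f t) (f y).
  exists y; rewrite ?mem_head// => v; rewrite inE => /predU1P[->//|/tmax vt].
  exact: le_trans ty.
exists t; first by rewrite inE ts orbT.
by move=> v; rewrite inE => /predU1P[->|/tmax//]; exact: ltW.
Qed.

Section max_principle.
Variables (R : realType) (A : pzRingType) (d : nat).
Local Notation E := (lattice A d).
Local Notation avg := (avg (@step A d)).

Lemma max_principle (Dm : seq E) (u : E -> R) :
  (forall x, x \in Dm -> u x <= avg u x) ->
  (forall x s, x \in Dm -> x + step A s \notin Dm -> u (x + step A s) <= 0) ->
  forall x, x \in Dm -> u x <= 0.
Proof.
move=> sub bd x xD; rewrite leNgt; apply/negP => ux.
have [y yD ymax] := seq_argmax u xD.
have uy : 0 < u y by exact: lt_le_trans (ymax _ xD).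
have [|z] := @seq_argmax R _ (fun z : E => (z.2)%:~R) [seq z <- Dm | u z == u y] y.
  by rewrite mem_filter eqxx.
rewrite mem_filter => /andP[/eqP uz zD] zmax.
have nb s : u (z + step A s) <= u y.
  have [/ymax//|/(bd _ _ zD)] := boolP (z + step A s \in Dm).
  by move=> /le_trans; apply; exact: ltW.
pose up : direction d := (None, false).
have [upy|upy] := eqVneq (u (z + step A up)) (u y).
  have upD : z + step A up \in Dm.
    by apply: contraT => /(bd _ _ zD); rewrite upy leNgt uy.
  have := zmax (z + step A up); rewrite mem_filter upy eqxx upD => /(_ isT).
  by rewrite ler_int/= leNgt ltrDl ltr01.
have := sub z zD; rewrite leNgt => /negP; apply; rewrite uz.
rewrite -[ltRHS](avg_cst ((None, false) : direction d) (st := @step A d) (u y) z).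
apply: (@lt_avg _ _ _ ((None, false) : direction d) _ _ _ _ up) => //.
by rewrite lt_neqAle upy nb.
Qed.

End max_principle.

Lemma big_seq_sub (V : nmodType) (T : eqType) (L1 L2 : seq T) (F : T -> V) :
  uniq L1 -> uniq L2 -> {subset L1 <= L2} -> (forall x, x \notin L1 -> F x = 0) ->
  \sum_(x <- L2) F x = \sum_(x <- L1) F x.
Proof.
move=> u1 u2 s12 F0; rewrite (bigID (mem L1))/= [X in _ + X]big1 ?addr0; last first.
  by move=> x; exact: F0.
rewrite -big_filter; apply: perm_big; apply: uniq_perm => //; first exact: filter_uniq.
by move=> x; rewrite mem_filter andb_idr//; exact: s12.
Qed.

Section lift.
Variables (R : realType) (E E' : zmodType) (D : finType) (s0 : D).
Variables (st : D -> E) (st' : D -> E') (f : E -> E').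
Hypothesis fst : forall x s, f (x + st s) = f x + st' s.

Lemma pr_lift x (G : set (trajectory E')) :
  pr R s0 st' (f x) G = pr R s0 st x [set w : nat -> E | G (f \o w)].
Proof.
congr (fine (uniform_prob _ _)); apply/seteqP; split => t /=;
  congr G; apply/funext => n /=; elim: n => [|n IH]; rewrite /walk ?big_ord0 ?addr0//=;
  rewrite !big_ord_recr/= !addrA fst; congr (_ + _); rewrite /walk in IH; exact: IH.
Qed.

Lemma hp_lift Z S x : hp R s0 st' Z S (f x) = hp R s0 st (f @^-1` Z) (f @^-1` S) x.
Proof. by rewrite /hp pr_lift. Qed.

End lift.

Section lattice_walk.
Variables (R : realType) (A : pzRingType) (d : nat).
Local Notation E := (lattice A d).
Hypothesis countE : countable [set: E].
Local Notation s0 := ((None, false) : direction d).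
Local Notation st := (@step A d).
Local Notation avg := (@avg R _ _ st).
Local Notation hp := (hp R s0 st).

Definition opp_dir (s : direction d) : direction d := (s.1, ~~ s.2).

Lemma opp_dirK : involutive opp_dir.
Proof. by case=> i b; rewrite /opp_dir/= negbK. Qed.

Lemma step_opp s : st (opp_dir s) = - st s.
Proof. by case: s => i []; rewrite /step/= ?opprK. Qed.

Lemma avg_adj (a b : E -> R) (L L' : seq E) : uniq L -> uniq L' ->
  {subset L <= L'} -> (forall x s, x \in L -> x + st s \in L') ->
  (forall x, x \notin L -> a x = 0) ->
  \sum_(y <- L') a y * avg b y = \sum_(y <- L') b y * avg a y.
Proof.
move=> uL uL' LL' stL a0; rewrite /avg.
under eq_bigr do rewrite mulrCA mulr_sumr.
under [RHS]eq_bigr do rewrite mulrCA mulr_sumr.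
rewrite -!mulr_sumr; congr (_ * _); rewrite exchange_big [RHS]exchange_big/=.
rewrite (reindex_inj (inv_inj opp_dirK)); apply: eq_bigr => s _.
rewrite (big_seq_sub uL uL' LL') => [|x xL]; last by rewrite a0 ?mul0r.
have inj : injective (fun x : E => x + st (opp_dir s)) by move=> x y /addIr.
rewrite -[RHS]/(\sum_(i <- L') (fun y => b y * a (y + st s)) i) (big_seq_sub (L1 := [seq x + st (opp_dir s) | x <- L]) (F := fun y => b y * a (y + st s)))//.
- by rewrite big_map; apply: eq_bigr => x _; rewrite step_opp subrK mulrC.
- by rewrite map_inj_uniq.
- by move=> _ /mapP[x xL ->]; exact: stL.
- move=> x xL; rewrite a0 ?mulr0//; apply: contra xL => xL.
  by apply/mapP; exists (x + st s); rewrite // step_opp addrK.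
Qed.

Definition bdry (Dm : seq E) : seq E :=
  undup [seq z <- [seq x + st s | x <- Dm, s <- enum {: direction d}] | z \notin Dm].

Lemma bdryP Dm x s : x \in Dm -> x + st s \notin Dm -> x + st s \in bdry Dm.
Proof.
move=> xD xs; rewrite mem_undup mem_filter xs/=; apply/allpairsP.
by exists (x, s); rewrite mem_enum.
Qed.

Lemma bdry_notin Dm y : y \in bdry Dm -> y \notin Dm.
Proof. by rewrite mem_undup mem_filter => /andP[]. Qed.

Lemma bdry_exists Dm y : y \in bdry Dm -> exists x s, x \in Dm /\ y = x + st s.
Proof.
rewrite mem_undup mem_filter => /andP[_ /allpairsP[[x s] /= [xD _ ->]]].
by exists x, s.
Qed.

Lemma max_principle_le (Dm : seq E) (u v : E -> R) :
  (forall x, x \in Dm -> u x - avg u x <= v x - avg v x) ->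
  (forall y, y \in bdry Dm -> u y <= v y) ->
  forall x, x \in Dm -> u x <= v x.
Proof.
move=> uv buv x xD; rewrite -subr_le0.
apply: (max_principle (u := fun x => u x - v x)) xD => [y yD|y s yD ys].
  by rewrite avgB -subr_ge0; have := uv y yD; lra.
by rewrite subr_le0 buv// bdryP.
Qed.

Lemma hp_total (Dm : seq E) (Z S : set E) :
  (forall x, Z x <-> x \notin Dm) -> (forall y, y \in bdry Dm -> S y) ->
  forall x, x \in Dm -> hp Z S x = 1.
Proof.
move=> ZD BS x xD; apply/eqP; rewrite eq_le (hp_le1 countE)//=.
apply: (max_principle_le (u := fun=> 1) (v := hp Z S)) xD => y yD.
  have nZ : ~ Z y by move/ZD; rewrite yD.
  by rewrite (avg_cst s0) -(hp_step countE)// !subrr.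
by rewrite (hp_in countE) ?asboolT//; [exact: BS|exact/ZD/bdry_notin].
Qed.

End lattice_walk.

(** * Radial superharmonic and subharmonic functions *)

Section taylor.
Variable R : realType.

Let pw (a t : R) := (1 + t) `^ a.

Let is_derive_pw (a t : R) : - 1 < t -> is_derive t 1 (pw a) (a * pw (a - 1) t).
Proof.
move=> t1; have p1 : 0 < 1 + t by rewrite -ltrBlDl sub0r.
have D1 : is_derive t 1 (cst (1 : R) + id) (0 + 1) by apply: is_deriveD.
rewrite add0r in D1.
have H : is_derive t 1 ((fun x => x `^ a) \o (cst (1 : R) + id)) (a * (1 + t) `^ (a - 1) * 1).
  by apply: is_derive1_comp; exact: is_derive1_powR.
by rewrite mulr1 in H.
Qed.

Let is_derive_lin (k t : R) : is_derive t 1 (fun x => k * x) (k * 1).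
Proof. exact: (@is_deriveZ _ _ _ id). Qed.

Let is_derive_sqr (k t : R) : is_derive t 1 (fun x => k * x ^+ 2) (k * (2 * t ^+ 1 * 1)).
Proof. exact: (@is_deriveZ _ _ _ (id ^+ 2 : R -> R)). Qed.

Let taylor_step (h dh : R -> R) (C : R) k : 0 <= C ->
  (forall t : R, `|t| <= 2^-1 -> is_derive t 1 h (dh t)) ->
  (forall t : R, `|t| <= 2^-1 -> `|dh t| <= C * `|t| ^+ k) ->
  forall t : R, `|t| <= 2^-1 -> `|h t - h 0| <= C * `|t| ^+ k.+1.
Proof.
move=> C0 hd bd t th.
have cont a b : (forall x, x \in `[a, b] -> `|x| <= 2^-1) ->
    {within `[a, b], continuous h}.
  move=> ab; apply: derivable_within_continuous => x /ab xh.
  by have [] := hd x xh.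
have [t0|t0] := leP 0 t.
  have bnd x : x \in `[0, t] -> `|x| <= 2^-1.
    rewrite in_itv/= => /andP[x0 xt]; rewrite ger0_norm//.
    by move: th; rewrite ger0_norm//; exact: le_trans.
  have [|c ct ->] := MVT_segment t0 (df := dh) _ (cont _ _ bnd).
    by move=> x xt; apply/hd/bnd/subset_itv_oo_cc.
  rewrite subr0 normrM exprSr mulrA ler_wpM2r//.
  apply: le_trans (bd _ (bnd _ ct)) _; rewrite ler_wpM2l// lerXn2r ?nnegrE//.
  by move: ct; rewrite in_itv/= => /andP[c0 ct]; rewrite !ger0_norm.
have bnd x : x \in `[t, 0] -> `|x| <= 2^-1.
  rewrite in_itv/= => /andP[tx x0]; rewrite ler0_norm//.
  by move: th; rewrite ltr0_norm//; apply: le_trans; rewrite lerN2.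
have [|c ct H] := MVT_segment (ltW t0) (df := dh) _ (cont _ _ bnd).
  by move=> x xt; apply/hd/bnd/subset_itv_oo_cc.
rewrite distrC H sub0r normrM normrN exprSr mulrA ler_wpM2r//.
apply: le_trans (bd _ (bnd _ ct)) _; rewrite ler_wpM2l// lerXn2r ?nnegrE//.
by move: ct; rewrite in_itv/= => /andP[c0 ct]; rewrite !ler0_norm ?(ltW t0)// lerN2.
Qed.

Lemma taylor_powRN (s : R) : 0 <= s -> exists2 C, 0 <= C &
  forall t : R, `|t| <= 2^-1 ->
  `|(1 + t) `^ (- s) - (1 - s * t + s * (s + 1) / 2 * t ^+ 2)| <= C * `|t| ^+ 3.
Proof.
move=> s0.
have t1 (t : R) : `|t| <= 2^-1 -> - 1 < t.
  by move=> th; have := ler_norm (- t); rewrite normrN; lra.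
have pw0 a : pw a 0 = 1 by rewrite /pw addr0 powR1.
pose C0 := (s + 2) * 2 `^ (s + 3).
have C00 : 0 <= C0 by rewrite mulr_ge0 ?powR_ge0// addr_ge0.
have b3 (t : R) : `|t| <= 2^-1 -> `|(- s - 2) * pw (- s - 2 - 1) t| <= C0 * `|t| ^+ 0.
  move=> th; rewrite expr0 mulr1 normrM; apply: ler_pM => //.
    by rewrite ler0_norm; lra.
  have h1 : 2^-1 <= 1 + t by have := ler_norm (- t); rewrite normrN; lra.
  rewrite ger0_norm ?powR_ge0// /pw (_ : - s - 2 - 1 = - (s + 3)); last by ring.
  rewrite powRN -[leRHS]invrK lef_pV2 ?posrE ?invr_gt0 ?powR_gt0//; last by lra.
  have -> : (2 `^ (s + 3))^-1 = 2^-1 `^ (s + 3) :> R.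
    have p2 : 2 `^ (s + 3) != 0 :> R by rewrite gt_eqF// powR_gt0.
    by apply: (mulIf p2); rewrite mulVf// -powRM// mulVf// powR1.
  by apply: ge0_ler_powR; rewrite ?nnegrE; lra.
have s2 (t : R) : `|t| <= 2^-1 -> `|pw (- s - 2) t - 1| <= C0 * `|t| ^+ 1.
  move=> th; rewrite -[X in _ - X](pw0 (- s - 2)).
  by apply: (taylor_step (dh := fun t => (- s - 2) * pw (- s - 2 - 1) t)) => // x /t1/is_derive_pw.
have s1 (t : R) : `|t| <= 2^-1 ->
    `|pw (- s - 1) t + (s + 1) * t - (pw (- s - 1) 0 + (s + 1) * 0)| <= (s + 1) * C0 * `|t| ^+ 2.
  move=> th.
  apply: (taylor_step (h := fun t => pw (- s - 1) t + (s + 1) * t)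
    (dh := fun t => (- s - 1) * pw (- s - 1 - 1) t + (s + 1) * 1)) => //.
  - by rewrite mulr_ge0// addr_ge0.
  - by move=> x /t1 x1; apply: is_deriveD; exact: is_derive_pw.
  - move=> x xh; have -> : (- s - 1) * pw (- s - 1 - 1) x + (s + 1) * 1 =
        - ((s + 1) * (pw (- s - 2) x - 1)).
      by rewrite (_ : - s - 1 - 1 = - s - 2); ring.
    rewrite normrN normrM ger0_norm; last by lra.
    by rewrite -mulrA ler_wpM2l ?s2//; lra.
exists (s * ((s + 1) * C0)); first by rewrite !mulr_ge0// addr_ge0.
move=> t th.
have -> : (1 + t) `^ (- s) - (1 - s * t + s * (s + 1) / 2 * t ^+ 2) =
  (pw (- s) t + (s * t - s * (s + 1) / 2 * t ^+ 2)) -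
  (pw (- s) 0 + (s * 0 - s * (s + 1) / 2 * 0 ^+ 2)).
  by rewrite pw0 /pw; field.
apply: (taylor_step (h := fun t => pw (- s) t + (s * t - s * (s + 1) / 2 * t ^+ 2))
  (dh := fun t => - s * pw (- s - 1) t + (s * 1 - s * (s + 1) / 2 * (2 * t ^+ 1 * 1)))) => //.
- by rewrite !mulr_ge0// addr_ge0.
- move=> x /t1 x1; apply: is_deriveD; first exact: is_derive_pw.
  by apply: is_deriveB; do [exact: is_derive_lin|exact: is_derive_sqr].
- move=> x xh; have := s1 x xh; rewrite pw0 mulr0 addr0 => H.
  have -> : - s * pw (- s - 1) x + (s * 1 - s * (s + 1) / 2 * (2 * x ^+ 1 * 1)) =
      - (s * (pw (- s - 1) x + (s + 1) * x - 1)) by field.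
  by rewrite normrN normrM (ger0_norm s0) -mulrA ler_wpM2l.
Qed.

End taylor.

Section radial.
Variables (R : realType) (d : nat).
Local Notation E := (lattice int d).
Local Notation st := (@step int d).
Local Notation avg := (@avg R _ _ st).
Local Notation D := (d.+1%:R : R).

Definition coord (x : E) (i : option 'I_d) : int :=
  if i is Some j then x.1 0 j else x.2.

Definition nsq (x : E) : R := \sum_i (coord x i)%:~R ^+ 2.

Lemma nsq_ge0 x : 0 <= nsq x.
Proof. by apply: sumr_ge0 => i _; exact: sqr_ge0. Qed.

Lemma coord_step x i b j :
  coord (x + st (i, b)) j = coord x j + (if i == j then (-1) ^+ b else 0).
Proof.
have cD (y z : E) : coord (y + z) j = coord y j + coord z j.
  by case: j => [j|] //=; rewrite mxE.
rewrite cD; congr (_ + _); rewrite /step/=.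
have cN (y : E) k : coord (- y) k = - coord y k by case: k => [k|] //=; rewrite mxE.
have -> : coord (if b then - unit_vector int i else unit_vector int i) j =
    (-1) ^+ b * coord (unit_vector int i) j.
  by case: b; rewrite ?cN ?mulN1r ?mul1r.
have -> : coord (unit_vector int i) j = (i == j)%:R.
  case: i j {cD cN} => [i|] [j|] //=; rewrite ?mxE ?eqxx//= eq_sym.
  by rewrite (inj_eq (@Some_inj _)).
by case: eqP; rewrite ?mulr1 ?mulr0.
Qed.

Lemma nsq_step x i b :
  nsq (x + st (i, b)) = nsq x + (1 + 2 * (-1) ^+ b * (coord x i)%:~R).
Proof.
rewrite /nsq (bigD1 i)//= [in RHS](bigD1 i)//= coord_step eqxx intrD.
rewrite (eq_bigr (fun j => (coord x j)%:~R ^+ 2)) => [|j ji]; last first.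
  by rewrite coord_step eq_sym (negbTE ji) addr0.
by case: b; rewrite ?expr1 ?expr0/=; ring.
Qed.

Lemma avg_dirE (u : E -> R) x : avg u x =
  (2 * D)^-1 * \sum_i (u (x + st (i, false)) + u (x + st (i, true))).
Proof.
rewrite /Submission.avg card_direction natrM; congr (_ * _).
rewrite (eq_bigr (fun i => \sum_b u (x + st (i, b)))) => [|i _]; last first.
  by rewrite big_bool addrC.
by rewrite pair_big; apply: eq_bigr => -[].
Qed.

Definition radial (A s : R) (x : E) : R := (nsq x + A) `^ (- s).

Let sum_opt (c : R) : \sum_(i : option 'I_d) c = D * c.
Proof. by rewrite sumr_const card_option card_ord mulr_natl. Qed.

Lemma avg_radial (s : R) : 0 <= s -> exists2 C, 0 <= C &
  forall (A : R) x, let rho := nsq x + A in 0 <= A -> 36 <= rho ->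
  `|avg (radial A s) x - rho `^ (- s) *
     (1 + s / rho * (- 1 + (s + 1) * (D + 4 * nsq x) / (2 * D * rho)))| <=
  rho `^ (- s) * (C / (rho * Num.sqrt rho)).
Proof.
move=> s0; have [C C0 HC] := taylor_powRN s0; exists (27 * C); first by rewrite mulr_ge0.
move=> A x rho A0 rho36; set r := Num.sqrt rho.
have rho0 : 0 < rho by lra.
have r0 : 0 < r by rewrite sqrtr_gt0.
have rr : r ^+ 2 = rho by rewrite sqr_sqrtr// ltW.
have r6 : 6 <= r by rewrite -[6]ger0_norm// -sqrtr_sqr ler_sqrt; lra.
pose c i : R := (coord x i)%:~R.
pose t i b : R := (1 + 2 * (-1) ^+ b * c i) / rho.
have cr i : `|c i| <= r.
  rewrite -sqrtr_sqr ler_sqrt ?(ltW rho0)// /rho /nsq /c (bigD1 i)//=.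
  rewrite -addrA lerDl addr_ge0//.
  by apply: sumr_ge0 => j _; exact: sqr_ge0.
have tr i b : `|t i b| <= 3 / r.
  rewrite normrM (ger0_norm (_ : 0 <= rho^-1)) ?invr_ge0 ?(ltW rho0)// ler_pdivrMr// -rr.
  rewrite (_ : 3 / r * r ^+ 2 = 3 * r); last by field; rewrite gt_eqF.
  apply: le_trans (ler_normD _ _) _; rewrite !normrM normrX normrN1 expr1n mulr1 normr1.
  by rewrite ger0_norm//; have := cr i; lra.
have t2 i b : `|t i b| <= 2^-1.
  apply: le_trans (tr i b) _; rewrite ler_pdivrMr//; lra.
have uE i b : radial A s (x + st (i, b)) = rho `^ (- s) * (1 + t i b) `^ (- s).
  have t0 : 0 <= 1 + t i b.
    by have := t2 i b; have := ler_norm (- t i b); rewrite normrN; lra.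
  rewrite -powRM ?(ltW rho0)//; congr (_ `^ _).
  by rewrite nsq_step /t mulrDr mulr1 mulrCA divff ?gt_eqF// mulr1 /rho -/(c i); ring.
pose T (z : R) := 1 - s * z + s * (s + 1) / 2 * z ^+ 2.
rewrite avg_dirE.
under eq_bigr do rewrite !uE -mulrDr.
rewrite -mulr_sumr mulrCA -mulrBr normrM (ger0_norm (powR_ge0 _ _)).
rewrite ler_wpM2l ?powR_ge0//.
have D0 : 0 < D by rewrite ltr0n.
have -> : 1 + s / rho * (- 1 + (s + 1) * (D + 4 * nsq x) / (2 * D * rho)) =
    (2 * D)^-1 * \sum_i (T (t i false) + T (t i true)).
  have -> : \sum_i (T (t i false) + T (t i true)) =
      \sum_(i : option 'I_d) ((2 - 2 * s / rho + s * (s + 1) / rho ^+ 2) +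
        (s * (s + 1) * 4 / rho ^+ 2) * c i ^+ 2).
    apply: eq_bigr => i _; rewrite /T /t expr0 expr1; field; rewrite gt_eqF//.
  rewrite big_split/= -mulr_sumr -/(nsq x) sum_opt.
  by field; rewrite !gt_eqF.
rewrite -mulrBr -sumrB normrM (ger0_norm (_ : 0 <= (2 * D)^-1)) ?invr_ge0 ?mulr_ge0 ?(ltW D0)//.
rewrite ler_pdivrMl ?mulr_gt0//; apply: le_trans (ler_norm_sum _ _ _) _.
have cub i b : `|(1 + t i b) `^ (- s) - T (t i b)| <= 27 * C / (rho * r).
  apply: le_trans (HC _ (t2 i b)) _.
  rewrite (_ : 27 * C / (rho * r) = C * (3 / r) ^+ 3); last first.
    by rewrite -rr; field; rewrite gt_eqF.
  by rewrite ler_wpM2l// lerXn2r ?nnegrE ?tr// divr_ge0 ?ltW.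
apply: (@le_trans _ _ (\sum_(i : option 'I_d) (2 * (27 * C / (rho * r))))).
  apply: ler_sum => i _; rewrite opprD addrACA; apply: le_trans (ler_normD _ _) _.
  by have := cub i false; have := cub i true; lra.
by rewrite sum_opt mulrCA mulrA.
Qed.

Lemma radial_super (s : R) : 0 < s -> 2 * (s + 1) < D ->
  exists2 A, 1 <= A & forall x, avg (radial A s) x <= radial A s x.
Proof.
move=> s0 sD; have [C C0 HC] := avg_radial (ltW s0).
have D0 : 0 < D by rewrite ltr0n.
pose th := 1 - 2 * (s + 1) / D.
have th0 : 0 < th by rewrite subr_gt0 ltr_pdivrMr// mul1r.
pose a := 6 + ((s + 1) / 2 + C / s) / th.
have a6 : 6 <= a by rewrite lerDl divr_ge0 ?(ltW th0)// addr_ge0// divr_ge0 ?(ltW D0) ?(ltW s0)//; lra.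
exists (a ^+ 2) => [|x]; first by nra.
have A36 : 36 <= a ^+ 2 by nra.
have rho36 : 36 <= nsq x + a ^+ 2 by have := nsq_ge0 x; lra.
have A0 : 0 <= a ^+ 2 by lra.
have := HC (a ^+ 2) x A0 rho36; set rho := nsq x + _ in rho36 *.
set r := Num.sqrt rho => H.
have rho0 : 0 < rho by lra.
have ra : a <= r by rewrite -[a]ger0_norm; [rewrite -sqrtr_sqr ler_sqrt ?(ltW rho0)// lerDr nsq_ge0|lra].
have r0 : 0 < r by lra.
have rr : r ^+ 2 = rho by rewrite sqr_sqrtr// ltW.
have rho_r : r <= rho by rewrite -rr; nra.
have := le_trans (ler_norm _) H; rewrite lerBlDl => /le_trans; apply.
rewrite -mulrDr /radial -/rho -[leRHS]mulr1 ler_wpM2l ?powR_ge0// -addrA gerDl.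
have -> : s / rho * (-1 + (s + 1) * (D + 4 * nsq x) / (2 * D * rho)) + C / (rho * r)
   = s / rho * (-1 + (s + 1) / 2 / rho + 2 * (s + 1) / D * (nsq x / rho) + C / s / r).
  by field; rewrite !gt_eqF.
rewrite pmulr_rle0 ?divr_gt0//.
have q1 : nsq x / rho <= 1 by rewrite ler_pdivrMr// mul1r /rho lerDl.
have e1 : 2 * (s + 1) / D * (nsq x / rho) <= 2 * (s + 1) / D.
  by rewrite ler_piMr// divr_ge0 ?mulr_ge0 ?(ltW D0)//; lra.
have e2 : (s + 1) / 2 / rho <= (s + 1) / 2 / r.
  by rewrite ler_wpM2l ?divr_ge0 ?lef_pV2 ?posrE//; lra.
have e3 : ((s + 1) / 2 + C / s) / r <= th.
  rewrite ler_pdivrMr// -ler_pdivrMl// [leLHS]mulrC; apply: le_trans ra.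
  by rewrite /a lerDr.
rewrite mulrDl in e3; move: e1 e2 e3; rewrite /th; set u := 2 * (s + 1) / D; set v := u * _.
by set p := (s + 1) / 2 / rho; set q := (s + 1) / 2 / r; set w := C / s / r; lra.
Qed.

Lemma radial_sub (s : R) : 0 < s -> D < 2 * (s + 1) ->
  exists2 R0, 36 <= R0 & forall x, R0 <= nsq x -> radial 1 s x <= avg (radial 1 s) x.
Proof.
move=> s0 sD; have [C C0 HC] := avg_radial (ltW s0).
have D0 : 0 < D by rewrite ltr0n.
pose th := 2 * (s + 1) / D - 1.
have th0 : 0 < th by rewrite subr_gt0 ltr_pdivlMr// mul1r.
pose a := 6 + (2 * (s + 1) / D + C / s) / th.
have a6 : 6 <= a by rewrite lerDl divr_ge0 ?(ltW th0)// addr_ge0// divr_ge0 ?(ltW D0) ?(ltW s0)//; lra.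
exists (a ^+ 2) => [|x xa]; first by nra.
have A36 : 36 <= a ^+ 2 by nra.
have rho36 : 36 <= nsq x + 1 by lra.
have := HC 1 x ler01 rho36; set rho := nsq x + 1 in rho36 *.
set r := Num.sqrt rho => H.
have rho0 : 0 < rho by lra.
have rhoa : a ^+ 2 <= rho by rewrite /rho; lra.
have ra : a <= r by rewrite -[a]ger0_norm; [rewrite -sqrtr_sqr ler_sqrt ?(ltW rho0)|lra].
have r0 : 0 < r by lra.
have rr : r ^+ 2 = rho by rewrite sqr_sqrtr// ltW.
have rho_r : r <= rho by rewrite -rr; nra.
have := H; rewrite distrC => /(le_trans (ler_norm _)); rewrite lerBlDl -lerBlDr; apply: le_trans.
rewrite -mulrBr /radial -/rho -[leLHS]mulr1 ler_wpM2l ?powR_ge0// -addrA lerDl.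
have -> : s / rho * (-1 + (s + 1) * (D + 4 * nsq x) / (2 * D * rho)) - C / (rho * r)
   = s / rho * (-1 + (s + 1) / 2 / rho + 2 * (s + 1) / D * (nsq x / rho) - C / s / r).
  by field; rewrite !gt_eqF.
rewrite pmulr_rge0 ?divr_gt0//.
have -> : nsq x / rho = 1 - rho^-1 by rewrite /rho; field; rewrite gt_eqF.
have e0 : 0 <= (s + 1) / 2 / rho by rewrite !divr_ge0//; lra.
have e2 : 2 * (s + 1) / D * rho^-1 <= 2 * (s + 1) / D / r.
  by rewrite ler_wpM2l ?divr_ge0 ?lef_pV2 ?posrE//; lra.
have e3 : (2 * (s + 1) / D + C / s) / r <= th.
  rewrite ler_pdivrMr// -ler_pdivrMl// [leLHS]mulrC; apply: le_trans ra.
  by rewrite /a lerDr.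
rewrite mulrDl in e3; move: e0 e2 e3; rewrite mulrBr mulr1 /th; set u := 2 * (s + 1) / D; set v := u * rho^-1.
by set p := (s + 1) / 2 / rho; set q := u / r; set w := C / s / r; lra.
Qed.

End radial.

(** * Harnack inequality on a shell *)

Section boxes.
Variables (R : realType) (d : nat).
Local Notation E := (lattice int d).
Local Notation st := (@step int d).
Local Notation D := (d.+1%:R : R).
Local Notation nsq := (@nsq R d).

Lemma countable_latticeZ : countable [set: lattice int d].
Proof. exact: countableP. Qed.

Lemma coordD (x y : E) i : coord (x + y) i = coord x i + coord y i.
Proof. by case: i => [j|] //=; rewrite mxE. Qed.

Lemma coordN (x : E) i : coord (- x) i = - coord x i.
Proof. by case: i => [j|] //=; rewrite mxE. Qed.

Lemma coordB (x y : E) i : coord (x - y) i = coord x i - coord y i.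
Proof. by rewrite coordD coordN. Qed.

Lemma coord0 i : coord (0 : E) i = 0.
Proof. by case: i => [j|] //=; rewrite mxE. Qed.

Lemma coord_inj (x y : E) : (forall i, coord x i = coord y i) -> x = y.
Proof.
case: x y => [x1 x2] [y1 y2] H; congr (_, _); last exact: (H None).
by apply/rowP => j; exact: (H (Some j)).
Qed.

Definition nrm (x : E) : nat := \max_i `|coord x i|%N.

Lemma nrmP x b : reflect (forall i, (`|coord x i|%N <= b)%N) (nrm x <= b)%N.
Proof. by apply: (iffP (bigmax_leqP _ _ _)) => H i; [exact: H|move=> _]. Qed.

Lemma nrm_coord x i : (`|coord x i|%N <= nrm x)%N.
Proof. exact/nrmP. Qed.

Lemma nrmN x : nrm (- x) = nrm x.
Proof. by apply: eq_bigr => i _; rewrite coordN abszN. Qed.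

Lemma nrmD x y : (nrm (x + y)%R <= nrm x + nrm y)%N.
Proof.
apply/nrmP => i; rewrite coordD; apply: (@leq_trans (`|coord x i| + `|coord y i|)%N).
  lia.
by rewrite leq_add ?nrm_coord.
Qed.

Lemma nrmB x y : (nrm (x - y)%R <= nrm x + nrm y)%N.
Proof. by rewrite -[X in (_ <= _ + X)%N]nrmN nrmD. Qed.

Lemma nrmC x y : nrm (x - y)%R = nrm (y - x)%R.
Proof. by rewrite -nrmN opprB. Qed.

Lemma nrmBr x y : (nrm x - nrm y <= nrm (x - y)%R)%N.
Proof. by have := nrmD (x - y) y; rewrite subrK; lia. Qed.

Lemma nrm_step s : (nrm (st s) <= 1)%N.
Proof.
apply/nrmP => j; case: s => i b; have := coord_step 0 i b j.
by rewrite add0r coord0 add0r => ->; case: eqP => //; case: b.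
Qed.

Lemma nrm_addstep x s : (nrm (x + st s)%R <= (nrm x).+1)%N.
Proof. by apply: leq_trans (nrmD _ _) _; rewrite -addn1 leq_add2l nrm_step. Qed.

Lemma nrm_addstep_ge x s : ((nrm x).-1 <= nrm (x + st s)%R)%N.
Proof. by have := nrm_addstep (x + st s) (opp_dir s); rewrite step_opp addrK; lia. Qed.

Let sqabs (z : int) : (z%:~R : R) ^+ 2 = (`|z|%N)%:R ^+ 2.
Proof. by rewrite -[LHS]real_normK ?num_real// -intr_norm natr_absz. Qed.

Lemma nsq_le x : nsq x <= D * (nrm x)%:R ^+ 2.
Proof.
rewrite mulr_natl -[X in _ *+ X.+1]card_ord -card_option -sumr_const.
by apply: ler_sum => i _; rewrite sqabs lerXn2r ?nnegrE// ler_nat nrm_coord.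
Qed.

Lemma nsq_ge x : (nrm x)%:R ^+ 2 <= nsq x.
Proof.
have c0 : (0 < #|{: option 'I_d}|)%N by rewrite card_option.
rewrite /nrm; have [i ->] := bigop.eq_bigmax (fun i => `|coord x i|%N) c0.
by rewrite -sqabs /nsq (bigD1 i)//= lerDl sumr_ge0// => j _; exact: sqr_ge0.
Qed.

Definition boxpt b (f : {ffun option 'I_d -> 'I_(2 * b).+1}) : E :=
  (\row_j ((f (Some j) : nat)%:Z - b%:Z), (f None : nat)%:Z - b%:Z).

Definition box (b : nat) : seq E := undup [seq boxpt f | f <- enum {ffun option 'I_d -> 'I_(2 * b).+1}].

Lemma mem_box x b : (x \in box b) = (nrm x <= b)%N.
Proof.
rewrite mem_undup; apply/mapP/nrmP => [[f _ ->] [j|]|xb] /=.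
- by rewrite mxE; move: (nat_of_ord _) (ltn_ord (f (Some j))) => k kb; lia.
- by move: (nat_of_ord _) (ltn_ord (f None)) => k kb; lia.
exists [ffun i => inord `|(coord x i + b%:Z)%R|%N]; first by rewrite mem_enum.
have H i : ((inord `|(coord x i + b%:Z)%R|%N : 'I_(2 * b).+1) : nat)%:Z = coord x i + b%:Z.
  have := xb i; move: (coord x i) => z zb; rewrite inordK; lia.
apply: coord_inj => -[j|] /=; rewrite ?mxE ffunE H /=.
  by move: (x.1 0 j) => z; lia.
by move: x.2 => z; lia.
Qed.

Lemma box_uniq b : uniq (box b).
Proof. exact: undup_uniq. Qed.

End boxes.

Section harnack.
Variables (R : realType) (d : nat).
Hypothesis d_ge2 : (2 <= d)%N.
Local Notation E := (lattice int d).
Local Notation st := (@step int d).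
Local Notation s0 := ((None, false) : direction d).
Local Notation avg := (@avg R _ _ st).
Local Notation hp := (@hp R _ _ s0 st).
Local Notation D := (d.+1%:R : R).
Local Notation nsq := (@nsq R d).
Local Notation box := (@box d).
Local Notation countE := (countable_latticeZ d).

Lemma avg_shift (f : E -> R) w x : avg (fun y => f (y - w)) x = avg f (x - w).
Proof. by congr (_ * _); apply: eq_bigr => s _; rewrite addrAC. Qed.

Lemma hp_le_point (F : E -> R) (Z : set E) w : Z w -> (forall x, 0 <= F x) ->
  (forall x, avg F x <= F x) -> 0 < F 0 ->
  forall x, hp Z [set w] x <= F (x - w) / F 0.
Proof.
move=> Zw F0 sF F00 x; have [Zx|nZx] := pselect (Z x).
  rewrite (hp_in countE)//; case: asboolP => [->|_].
    by rewrite subrr divff// gt_eqF.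
  by rewrite divr_ge0// ltW.
apply: (hp_le_super countE (Dm := ~` Z) (F := fun x => F (x - w) / F 0)) nZx => // y.
  by rewrite divr_ge0// ltW.
move=> nZy; apply: (@le_trans _ _ (avg (fun x => F (x - w) / F 0) y)).
  apply: (le_avg s0) => s; case: asboolP => [//|/contrapT Zys].
  rewrite (hp_in countE)//; case: asboolP => [->|_].
    by rewrite subrr divff// gt_eqF.
  by rewrite divr_ge0// ltW.
have -> : (fun x => F (x - w) / F 0) = (fun x => (F 0)^-1 * F (x - w)).
  by apply/funext => z; rewrite mulrC.
rewrite avgZ avg_shift mulrC ler_wpM2r ?invr_ge0 ?(ltW F00)//.
Qed.

(* Step toward [w] one coordinate at a time; each step has probability 1/(2D).*)
Lemma hp_point_lb (Z : set E) v w n x : (nrm w <= v)%N ->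
  (forall y, (nrm y <= v)%N -> Z y -> y = w) -> Z w ->
  (nrm x <= v)%N -> (\sum_i `|coord (x - w)%R i| <= n)%N ->
  (2 * D)^-1 ^+ n <= hp Z [set w] x.
Proof.
move=> wv ZV Zw; have D1 : 1 <= D by rewrite ler1n.
have q0 : 0 <= (2 * D)^-1 by rewrite invr_ge0 mulr_ge0// ltW.
have q1 : (2 * D)^-1 <= 1 by rewrite invf_le1; lra.
elim: n x => [|n IH] x xv.
  rewrite leqn0 sum_nat_eq0 => /forallP H; rewrite expr0.
  have -> : x = w; last by rewrite (hp_in countE)// asboolT.
  apply: coord_inj => i; have := H i; rewrite coordB; lia.
have [->|xw] := eqVneq x w; first by rewrite (hp_in countE)// asboolT// exprn_ile1.
move=> xn; have [i xi] : exists i, coord x i != coord w i.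
  apply/existsP; rewrite -negb_forall; apply: contra xw => /forallP H.
  by apply/eqP/coord_inj => i; exact/eqP.
have nZx : ~ Z x by move=> /(ZV _ xv)/eqP; rewrite (negbTE xw).
rewrite (hp_step countE)//.
apply: le_trans (avg_ge s0 (i, (coord w i < coord x i)%R) _) => [|s]; last exact: hp_ge0.
rewrite card_direction natrM exprS ler_wpM2l//; apply: IH.
  apply/nrmP => j; rewrite coord_step; have := nrm_coord x j; have := nrm_coord w j.
  case: eqP => [<-|_]; last by rewrite addr0; lia.
  by move: xi; case: ltrgtP; rewrite ?expr1 ?expr0 //; lia.
move: xn; rewrite (bigD1 i)//= [in X in _ -> X](bigD1 i)//= !coordB coord_step eqxx.
rewrite [X in _ -> (_ + X <= _)%N](eq_bigr (fun j => `|coord (x - w)%R j|%N)) => [|j ji].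
  by move: xi; case: ltrgtP; rewrite ?expr1 ?expr0 //; lia.
by rewrite !coordB coord_step eq_sym (negbTE ji) addr0.
Qed.

Section estimates.
Variables (s1 s2 A R0 : R).
Hypotheses (s1_gt0 : 0 < s1) (A_ge1 : 1 <= A) (s2_gt0 : 0 < s2).
Hypothesis super : forall x, avg (radial A s1) x <= radial A s1 x.
Hypothesis sub : forall x, R0 <= nsq x -> radial 1 s2 x <= avg (radial 1 s2) x.
Hypothesis R0_ge : 36 <= R0.

Local Notation f1 := (@radial R d A s1).
Local Notation f2 := (@radial R d 1 s2).

Lemma f1_gt0 x : 0 < f1 x.
Proof. by apply: powR_gt0; have := nsq_ge0 R x; move: A_ge1; lra. Qed.

Lemma le_radial (B s r r' : R) : 0 < s -> 0 < B -> 0 <= r -> r <= r' ->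
  (r' + B) `^ (- s) <= (r + B) `^ (- s).
Proof.
move=> s0 B0 r0 rr'; rewrite !powRN lef_pV2 ?posrE ?powR_gt0//; try lra.
by apply: ge0_ler_powR; rewrite ?nnegrE; lra.
Qed.

Lemma f1_le_nrm x (n : nat) : (n <= nrm x)%N -> f1 x <= (n%:R ^+ 2 + A) `^ (- s1).
Proof.
move=> nx; apply: le_radial => //; [by move: A_ge1; lra|].
apply: le_trans (nsq_ge R x); rewrite lerXn2r ?nnegrE// ler_nat//.
Qed.

Lemma f1_ge_nrm x (n : nat) : (nrm x <= n)%N -> (D * n%:R ^+ 2 + A) `^ (- s1) <= f1 x.
Proof.
move=> xn; apply: le_radial => //; [by move: A_ge1; lra|exact: nsq_ge0|].
apply: le_trans (nsq_le R x) _; rewrite ler_wpM2l ?ler0n// lerXn2r ?nnegrE// ler_nat//.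
Qed.

Lemma f2_le_nrm x (n : nat) : (n <= nrm x)%N -> f2 x <= (n%:R ^+ 2 + 1) `^ (- s2).
Proof.
move=> nx; apply: le_radial => //.
apply: le_trans (nsq_ge R x); rewrite lerXn2r ?nnegrE// ler_nat//.
Qed.

Lemma f2_ge_nrm x (n : nat) : (nrm x <= n)%N -> (D * n%:R ^+ 2 + 1) `^ (- s2) <= f2 x.
Proof.
move=> xn; apply: le_radial => //; first exact: nsq_ge0.
apply: le_trans (nsq_le R x) _; rewrite ler_wpM2l ?ler0n// lerXn2r ?nnegrE// ler_nat//.
Qed.

Lemma f2_le1 x : f2 x <= 1.
Proof.
rewrite /radial powRN invf_le1 ?powR_gt0; try by have := nsq_ge0 R x; lra.
rewrite -{1}(powRr0 (nsq x + 1)); apply: ler_powR; [have := nsq_ge0 R x; lra|exact: ltW].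
Qed.

Let c0 : R := (2 * D)^-1 ^+ (Num.truncn R0).+1.

Lemma hp_point_ge (v : nat) w (Z : set E) : (nrm w <= v)%N ->
  (forall y, Z y <-> (y = w \/ (v < nrm y)%N)) ->
  forall x, (nrm x <= v)%N ->
  c0 * (f2 (x - w) - ((v.+1 - nrm w)%N%:R ^+ 2 + 1) `^ (- s2)) <= hp Z [set w] x.
Proof.
move=> wv ZE; set m := _ `^ (- s2).
have m0 : 0 <= m by exact: powR_ge0.
have c00 : 0 <= c0 by rewrite exprn_ge0// invr_ge0.
have ball x : (nrm x <= v)%N -> nsq (x - w) < R0 ->
    c0 * (f2 (x - w) - m) <= hp Z [set w] x.
  move=> xv xR; apply: (@le_trans _ _ c0).
    by rewrite ler_piMr//; have := f2_le1 (x - w); lra.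
  apply: (hp_point_lb (v := v)) => //.
  - by move=> y yv /ZE[//|]; rewrite ltnNge yv.
  - by apply/ZE; left.
  rewrite -ltnS; have : ((\sum_i `|coord (x - w)%R i|)%N%:R : R) < (Num.truncn R0).+1%:R.
    apply: le_lt_trans (truncnS_gt _); apply/ltW; apply: le_lt_trans xR.
    rewrite natr_sum; apply: ler_sum => i _; rewrite natr_absz.
    by rewrite -rmorphXn/= ler_int; move: (coord _ i) => z; nia.
  by rewrite ltr_nat => /leqW.
move=> x xv; have [xR|xR] := ltP (nsq (x - w)) R0; first exact: ball.
pose Dm := [seq y <- box v | R0 <= nsq (y - w)].
have mD y : (y \in Dm) = (nrm y <= v)%N && (R0 <= nsq (y - w)).
  by rewrite mem_filter mem_box andbC.
have nZ y : y \in Dm -> ~ Z y.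
  rewrite mD => /andP[yv yR] /ZE[yw|]; last by rewrite ltnNge yv.
  move: yR; rewrite yw subrr /Submission.nsq big1 => [|i _]; last by rewrite coord0 expr0n.
  by move: R0_ge; lra.
apply: (max_principle_le (Dm := Dm) (u := fun y => c0 * (f2 (y - w) - m))).
- move=> y yD; rewrite -(hp_step countE _ (nZ _ yD)) subrr.
  rewrite avgZ avgB avg_shift (avg_cst s0) -mulrBr pmulr_rle0 ?exprn_gt0 ?invr_gt0//.
  by move: yD; rewrite mD => /andP[_ /sub]; lra.
- move=> y /[dup] /bdry_notin; rewrite mD; have [yv /=|yv _ _] := leqP (nrm y) v.
    by rewrite -ltNge => yR _; exact: ball.
  rewrite (hp_in countE) ?asboolF//; last 2 first.
    by move=> /= yw; move: yv; rewrite yw ltnNge wv.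
  by apply/ZE; right.
  rewrite pmulr_rle0 ?exprn_gt0 ?invr_gt0// subr_le0; apply: f2_le_nrm.
  by apply: leq_trans (nrmBr _ _); lia.
- by rewrite mD xv xR.
Qed.

Variables (n0 u1 u v : nat) (S : seq E).
Hypotheses (S_box : forall y, y \in S -> (nrm y <= n0)%N).
Hypotheses (n0u1 : (n0 < u1)%N) (u1u : (u1.+1 < u)%N) (uv : (u.+1 < v)%N).

Local Notation ZS := [set y : E | y \in S \/ (v < nrm y)%N].

Definition point_ub : R := ((u - u1.+1)%N%:R ^+ 2 + A) `^ (- s1) / f1 0.
Definition point_lb : R := c0 * ((D * (u + u1 + 2)%N%:R ^+ 2 + 1) `^ (- s2) -
   ((v - u)%N%:R ^+ 2 + 1) `^ (- s2)).
Definition box_ub (a b : nat) : R := (b%:R ^+ 2 + A) `^ (- s1) / (D * a%:R ^+ 2 + A) `^ (- s1).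
Definition escape_lb : R := 1 - (1 + A) `^ (- s1) / A `^ (- s1).

Let powA (r : R) : 0 <= r -> 0 < (r + A) `^ (- s1).
Proof. by move=> r0; apply: powR_gt0; move: A_ge1; lra. Qed.

Lemma escape_lb_gt0 : 0 < escape_lb.
Proof.
have A0 : 0 < A by move: A_ge1; lra.
rewrite subr_gt0 ltr_pdivrMr ?powR_gt0// mul1r !powRN ltf_pV2 ?posrE ?powR_gt0//; try lra.
by apply: gt0_ltr_powR; rewrite ?nnegrE//; lra.
Qed.

Lemma box_superE a x : (nrm x <= a)%N -> 1 <= f1 x / (D * a%:R ^+ 2 + A) `^ (- s1).
Proof.
move=> xa; rewrite ler_pdivlMr ?mul1r ?f1_ge_nrm//.
by apply: powA; rewrite mulr_ge0// sqr_ge0.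
Qed.

Section pole.
Variables (w : E) (w_lo : (u <= nrm w)%N) (w_hi : (nrm w <= u.+1)%N).
Local Notation Zw := [set y : E | y \in S \/ (v < nrm y)%N \/ y = w].
Local Notation b := (hp Zw [set w]).

Let wv : (nrm w <= v)%N. Proof. lia. Qed.
Let wS : w \notin S. Proof. by apply/negP => /S_box; lia. Qed.

Lemma pole_ub x : (nrm x <= u1.+1)%N -> b x <= point_ub.
Proof.
move=> xu; apply: le_trans (hp_le_point _ _ super _ x) _; try exact: f1_gt0.
- by right; right.
- by move=> y; exact/ltW/f1_gt0.
rewrite ler_wpM2r ?invr_ge0 ?(ltW (f1_gt0 _))//; apply: f1_le_nrm.
by rewrite nrmC; apply: leq_trans (nrmBr _ _); lia.
Qed.

Lemma pole_lb x : nrm x = u1.+1 -> point_lb - point_ub * box_ub n0 u1.+1 <= b x.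
Proof.
move=> xu.
pose W := [set y : E | y = w \/ (v < nrm y)%N].
pose b0 := hp W [set w].
have b0_ge : point_lb <= b0 x.
  apply: le_trans (hp_point_ge wv (Z := W) _ _); last 2 first.
  - by [].
  - by lia.
  rewrite ler_wpM2l ?exprn_ge0 ?invr_ge0 ?mulr_ge0//; apply: lerB.
    by apply: f2_ge_nrm; apply: leq_trans (nrmB _ _) _; lia.
  apply: le_radial => //; rewrite ?sqr_ge0// lerXn2r ?nnegrE// ler_nat; lia.
have b0_le y : (nrm y <= n0)%N -> b0 y <= point_ub.
  move=> yn; apply: le_trans (hp_le_point _ _ super _ y) _; try exact: f1_gt0.
  - by left.
  - by move=> z; exact/ltW/f1_gt0.
  rewrite ler_wpM2r ?invr_ge0 ?(ltW (f1_gt0 _))//; apply: f1_le_nrm.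
  by rewrite nrmC; apply: leq_trans (nrmBr _ _); have := n0u1; lia.
set g := (D * n0%:R ^+ 2 + A) `^ (- s1).
have g0 : 0 < g by apply: powA; rewrite mulr_ge0 ?sqr_ge0.
have pu0 : 0 <= point_ub by rewrite divr_ge0 ?powR_ge0 ?(ltW (f1_gt0 _)).
have pg0 : 0 <= point_ub / g by rewrite (mulr_ge0 pu0)// invr_ge0 ltW.
pose F y := b0 y - point_ub / g * f1 y.
apply: (@le_trans _ _ (F x)).
  rewrite /F lerB// /box_ub -/g mulrAC -mulrA ler_wpM2l// ler_wpM2r ?invr_ge0 ?(ltW g0)//.
  by apply: f1_le_nrm; rewrite xu.
pose Dm := [seq y <- box v | (y \notin S) && (y != w)].
have mD y : (y \in Dm) = [&& y \notin S, y != w & (nrm y <= v)%N].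
  by rewrite mem_filter mem_box andbA.
apply: (max_principle_le (Dm := Dm) (u := F) (v := b)) => [y|y|].
- rewrite mD => /and3P[yS yw yv].
  rewrite -[X in _ <= _ - X](hp_step countE); last first.
    by move=> [|[|]] /=; [apply/negP|rewrite ltnNge yv|apply/eqP].
  rewrite subrr /F avgB avgZ -(hp_step countE); last first.
    by move=> [|] /=; [apply/eqP|rewrite ltnNge yv].
  rewrite subr_le0 lerB//; apply: ler_wpM2l; last exact: super.
  by rewrite (mulr_ge0 pu0)// invr_ge0 ltW.
- move=> /bdry_notin; rewrite mD => yb.
  have Zy : Zw y.
    have [yS|yS] := boolP (y \in S); first by left.
    have [yw|yw] := eqVneq y w; first by right; right.
    by right; left; move: yb; rewrite yS yw/= -ltnNge.
  have Fle : F y <= 1.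
    rewrite /F lerBlDr; apply: le_trans (hp_le1 countE _ _ _) _; rewrite lerDl.
    by rewrite (mulr_ge0 pg0)// (ltW (f1_gt0 _)).
  rewrite (hp_in countE)//; case: asboolP => [//|/= yw].
  have [yS|yS] := boolP (y \in S).
    rewrite /F subr_le0; apply: le_trans (b0_le y (S_box yS)) _.
    by rewrite -mulrA ler_peMr// mulrC box_superE// S_box.
  rewrite /F /b0 (hp_in countE) ?asboolF//.
    by rewrite sub0r oppr_le0 (mulr_ge0 pg0)// (ltW (f1_gt0 _)).
  by case: Zy => [|[|//]]; [rewrite (negbTE yS)|right].
rewrite mD xu; apply/and3P; split.
- by apply/negP => /S_box; rewrite xu; move: n0u1; clear; lia.
- by apply/eqP => xw; move: xu w_lo u1u; rewrite xw; move: (nrm w); clear; lia.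
- by move: u1u uv; clear; lia.
Qed.

(* Summation by parts against the hitting probability of the pole [w]. *)
Lemma pole_adj y : y \in S -> hp ZS [set y] w * (1 - avg b w) = avg b y.
Proof.
move=> yS; pose a := hp ZS [set y].
have av x : x \notin box v -> a x = 0.
  rewrite mem_box -ltnNge => xv; rewrite /a (hp_in countE) ?asboolF//; last by right.
  by move=> /= xy; move: (S_box yS); rewrite -xy; lia.
have := @avg_adj R int d a b (box v) (box v.+1) (box_uniq d v) (box_uniq d v.+1) _ _ av.
move=> /(_ _ _)/eqP H; have {}H : \sum_(x <- box v.+1) a x * (b x - avg b x) =
   \sum_(x <- box v.+1) b x * (a x - avg a x).
  apply/eqP; under eq_bigr do rewrite mulrBr; under [X in _ == X]eq_bigr do rewrite mulrBr.
  rewrite !sumrB (eqP (H _ _)); last 2 first.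
  - by move=> x; rewrite !mem_box; lia.
  - by move=> x s; rewrite !mem_box => xv; apply: leq_trans (nrm_addstep _ _) _.
  by under eq_bigr do rewrite mulrC.
have nZ x : x \notin S -> (nrm x <= v)%N -> x <> w -> ~ Zw x.
  by move=> xS xv xw [|[|//]]; [apply/negP|rewrite ltnNge xv].
move: H; rewrite [RHS]big1_seq => [|x /andP[_ _]]; last first.
  have [Zx|nZx] := pselect (ZS x); last by rewrite /a -(hp_step countE)// subrr mulr0.
  rewrite (hp_in countE); last by case: Zx; [left|right; left].
  rewrite asboolF ?mul0r// => xw; case: Zx; rewrite xw; first exact/negP.
  by rewrite ltnNge wv.
have yw : y != w by apply: contra wS => /eqP <-.
rewrite (bigD1_seq w) ?box_uniq ?mem_box//=; last by lia.
rewrite -big_filter (bigD1_seq y)/= ?filter_uniq ?box_uniq//; last first.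
  by rewrite mem_filter yw mem_box; have := S_box yS; lia.
rewrite big1_seq ?addr0 => [|x].
  rewrite (hp_in countE) ?asboolT//; last by right; right.
  rewrite [a y](hp_in countE) ?asboolT//; last by left.
  rewrite [b y](hp_in countE) ?asboolF//; [|exact/eqP|by left].
  by rewrite mul1r sub0r => /eqP; rewrite subr_eq0 => /eqP.
rewrite mem_filter => /andP[xy /andP[xw _]].
have [Zx|nZx] := pselect (ZS x).
  by rewrite /a (hp_in countE) ?asboolF ?mul0r//; exact/eqP.
rewrite -(hp_step countE) ?subrr ?mulr0//.
by move=> [xS|[xv|/eqP]]; [apply: nZx; left|apply: nZx; right|rewrite (negbTE xw)].
Qed.

Lemma pole_escape : escape_lb <= 1 - avg b w.
Proof.
rewrite lerB//; have [F0 F1] : 0 < f1 0 /\ (forall x, 0 <= f1 x).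
  by split => [|x]; [exact: f1_gt0|exact/ltW/f1_gt0].
apply: (@le_trans _ _ (avg (fun x => (f1 0)^-1 * f1 (x - w)) w)).
  apply: (le_avg s0) => s; rewrite mulrC; apply: hp_le_point => //.
  by right; right.
rewrite avgZ avg_shift subrr mulrC.
have -> : f1 0 = A `^ (- s1).
  by rewrite /radial /Submission.nsq big1 ?add0r// => i _; rewrite coord0 expr0n.
rewrite ler_wpM2r ?invr_ge0 ?powR_ge0//.
rewrite -(avg_cst s0 (st := st) ((1 + A) `^ (- s1)) 0); apply: (le_avg s0) => -[i b].
rewrite /radial nsq_step coord0 mulr0 addr0 /Submission.nsq big1 ?add0r// => j _.
by rewrite coord0 expr0n.
Qed.

End pole.

Theorem harnack w w' y : y \in S ->
  (u <= nrm w <= u.+1)%N -> (u <= nrm w' <= u.+1)%N ->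
  escape_lb * (point_lb - point_ub * box_ub n0 u1.+1) * hp ZS [set y] w' <=
  point_ub * hp ZS [set y] w.
Proof.
move=> yS /andP[wl wh] /andP[wl' wh'].
set L := point_lb - _.
pose b w := hp [set y : E | y \in S \/ (v < nrm y)%N \/ y = w] [set w].
have pu0 : 0 <= point_ub by rewrite divr_ge0 ?powR_ge0 ?(ltW (f1_gt0 _)).
have a0 z : 0 <= hp ZS [set y] z by exact: hp_ge0.
have [L0|L0] := leP L 0.
  apply: (@le_trans _ _ 0); last by rewrite mulr_ge0.
  by rewrite mulr_le0_ge0// mulr_ge0_le0// ltW// escape_lb_gt0.
have cmp z : (nrm z <= u1)%N -> z \notin S -> L * b w' z <= point_ub * b w z.
  move=> zu zS; pose Dm := [seq y <- box u1 | y \notin S].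
  have mD t : (t \in Dm) = (t \notin S) && (nrm t <= u1)%N by rewrite mem_filter mem_box.
  apply: (max_principle_le (Dm := Dm) (u := fun z => L * b w' z)
    (v := fun z => point_ub * b w z)) => [t|t tb|]; last by rewrite mD zS.
    rewrite mD => /andP[tS tu].
    have h q : (u <= nrm q)%N -> b q t = avg (b q) t.
      move=> ql; rewrite /b -(hp_step countE)// => -[|[|]] /=; [exact/negP|by move: tu u1u uv; clear; lia|].
      by move=> tq; move: ql tu u1u; rewrite -tq; move: (nrm q); clear; lia.
    by rewrite !avgZ -!h// !subrr.
  have [tS|tS] := boolP (t \in S).
    rewrite /b !(hp_in countE) ?asboolF ?mulr0//; try by left.
      by move=> /= tw; move: (S_box tS) wl n0u1 u1u; rewrite tw; move: (nrm w); clear; lia.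
    by move=> /= tw; move: (S_box tS) wl' n0u1 u1u; rewrite tw; move: (nrm w'); clear; lia.
  have tu : nrm t = u1.+1.
    have := bdry_notin tb; rewrite mD tS/= -ltnNge => ut.
    have [q [s [qD tE]]] := bdry_exists tb.
    by move: qD; rewrite mD => /andP[_]; have := nrm_addstep q s; rewrite -tE; move: ut; clear; lia.
  rewrite mulrC; apply: ler_pM; rewrite ?hp_ge0 ?(ltW L0)//.
    by apply: pole_ub => //; rewrite tu.
  exact: pole_lb.
have cmpS z : (nrm z <= u1)%N -> L * b w' z <= point_ub * b w z.
  move=> zu; have [zS|zS] := boolP (z \in S); last exact: cmp.
  rewrite /b (hp_in countE) ?asboolF; [|by move=> /= zw; move: (S_box zS) wl' n0u1 u1u; rewrite zw; move: (nrm w'); clear; lia|by left].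
  by rewrite mulr0 mulr_ge0// hp_ge0.
have yn := S_box yS.
have avc : L * avg (b w') y <= point_ub * avg (b w) y.
  rewrite -!avgZ; apply: (le_avg s0) => s; apply: cmpS.
  by apply: leq_trans (nrm_addstep _ _) _; lia.
rewrite -mulrA mulrCA; apply: (@le_trans _ _ (L * avg (b w') y)).
  rewrite ler_wpM2l ?(ltW L0)// -pole_adj// mulrC ler_wpM2l// pole_escape//.
apply: le_trans avc _; rewrite ler_wpM2l// -pole_adj// ler_piMr//.
by rewrite gerBl avg_ge0// => s; exact: hp_ge0.
Qed.

End estimates.
End harnack.

(** * Comparison of the cylinder with the lattice *)

Lemma nrm_vert d (a : nat) : nrm ((0, a%:Z) : lattice int d) = a.
Proof.
apply/eqP; rewrite eqn_leq; apply/andP; split.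
  by apply/nrmP => -[j|] //=; rewrite mxE.
exact: (nrm_coord ((0, a%:Z) : lattice int d) None).
Qed.

Section return_ratio.
Variables (R : realType) (d : nat).
Hypothesis d_ge2 : (2 <= d)%N.
Local Notation E := (lattice int d).
Local Notation st := (@step int d).
Local Notation s0 := ((None, false) : direction d).
Local Notation avg := (@avg R _ _ st).
Local Notation hp := (@hp R _ _ s0 st).
Local Notation D := (d.+1%:R : R).
Local Notation nsq := (@nsq R d).
Local Notation box := (@box d).
Local Notation countE := (countable_latticeZ d).

Variables (n0 u v : nat) (S : seq E).
Hypotheses (S_box : forall y, y \in S -> (nrm y <= n0)%N).
Hypotheses (n0u : (n0 < u)%N) (uv : (u.+1 < v)%N).

Local Notation ZS := [set y : E | y \in S \/ (v < nrm y)%N].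

(* A killed walk that coincides with the plain one in the box [v]: it stops at *)
(* [Z], and [T y] is the part of [Z] identified with [y \in S].  [F] controls  *)
(* the probability of coming back to (the images of) the box [u].             *)
Record box_model (Z : set E) (T : E -> set E) (U : set E) (F : E -> R) (q : R) := BoxModel {
  model_Z : forall x, (nrm x <= v)%N -> (Z x <-> x \in S) ;
  model_T : forall x y, y \in S -> (nrm x <= v)%N -> (T y x <-> x = y) ;
  model_TU : forall x y, y \in S -> T y x -> U x ;
  model_F0 : forall x, ~ U x -> ~ Z x -> 0 <= F x ;
  model_F0s : forall x s, ~ U x -> ~ Z x -> 0 <= F (x + st s) ;
  model_F1 : forall x s, ~ U x -> ~ Z x -> U (x + st s) -> 1 <= F (x + st s) ;
  model_super : forall x, ~ U x -> ~ Z x -> avg F x <= F x ;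
  model_per : forall x s, ~ U x -> ~ Z x -> U (x + st s) ->
    exists2 w, nrm w = u & forall y, y \in S -> hp Z (T y) (x + st s) = hp Z (T y) w ;
  model_bd : forall x, nrm x = v.+1 -> ~ U x /\ F x <= q
}.

Variables (Z : set E) (T : E -> set E) (U : set E) (F : E -> R) (q : R).
Hypothesis model : box_model Z T U F q.
Hypotheses (q_ge0 : 0 <= q) (q_half : q <= 2^-1).

Local Notation P y := (hp Z (T y)).
Local Notation pV y := (hp ZS [set y]).

Lemma model_hit_le x : ~ U x -> ~ Z x ->
  hp Z [set z | exists2 y, y \in S & T y z] x <= F x.
Proof.
move=> nUx nZx; apply: (hp_le_super countE (Dm := [set x | ~ U x /\ ~ Z x])) => //.
- by move=> y [].
- by move=> y [nU nZ]; exact: model_F0 model _ nU nZ.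
move=> y [nU nZ]; apply: le_trans (model_super model nU nZ); apply: (le_avg s0) => s.
case: asboolP => // ys; have [Uys|nUys] := pselect (U (y + st s)).
  by apply: le_trans (hp_le1 countE _ _ _) (model_F1 model nU nZ Uys).
have Zys : Z (y + st s) by apply: contrapT => nZys; exact: ys.
rewrite (hp_in countE)// asboolF ?(model_F0s model)// => -[t tS Tt].
exact/nUys/(model_TU model tS Tt).
Qed.

Lemma model_return_le y M x : y \in S ->
  (forall w, nrm w = u -> P y w <= M) -> ~ U x -> ~ Z x -> P y x <= M * F x.
Proof.
move=> yS PM nUx nZx.
have M0 : 0 <= M.
  exact: le_trans (hp_ge0 _ _ _) (PM _ (nrm_vert d u)).
apply: (hp_le_super countE (Dm := [set x | ~ U x /\ ~ Z x])
  (F := fun x => M * F x)) => // [z []//|z [nU nZ]|z [nU nZ]].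
  by rewrite mulr_ge0// (model_F0 model).
rewrite -[leRHS]/(M * F z); apply: (@le_trans _ _ (M * avg F z)); last first.
  by rewrite ler_wpM2l// (model_super model).
rewrite -avgZ; apply: (le_avg s0) => s.
case: asboolP => // zs; have [Uzs|nUzs] := pselect (U (z + st s)).
  have [w wu ->] := model_per model nU nZ Uzs; last by [].
  apply: le_trans (PM _ wu) _; rewrite ler_peMr// (model_F1 model)//.
have Zzs : Z (z + st s) by apply: contrapT => nZzs; exact: zs.
rewrite (hp_in countE)// asboolF ?mulr_ge0 ?(model_F0s model)// => Tt.
exact/nUzs/(model_TU model yS Tt).
Qed.

Let Dm := [seq x <- box v | x \notin S].
Let mD x : (x \in Dm) = (x \notin S) && (nrm x <= v)%N.
Proof. by rewrite mem_filter mem_box. Qed.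

Let bdryD x : x \in bdry Dm -> x \in S \/ nrm x = v.+1.
Proof.
move=> xb; have := bdry_notin xb; rewrite mD negb_and negbK => /orP[|]; first by left.
rewrite -ltnNge => vx; right; have [t [s [tD tE]]] := bdry_exists xb.
by move: tD; rewrite mD => /andP[_ tv]; have := nrm_addstep t s; rewrite -tE; lia.
Qed.

Let harm y x : x \in Dm -> P y x = avg (P y) x.
Proof.
by rewrite mD => /andP[xS xv]; rewrite -(hp_step countE)// => /(model_Z model xv); exact/negP.
Qed.

Let harmV y x : x \in Dm -> pV y x = avg (pV y) x.
Proof.
rewrite mD => /andP[xS xv]; rewrite -(hp_step countE)// => -[|]; first exact/negP.
by rewrite ltnNge xv.
Qed.

Let PS y x : y \in S -> x \in S -> P y x = pV y x.
Proof.
move=> yS xS; have xv : (nrm x <= v)%N by have := S_box xS; lia.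
rewrite !(hp_in countE); [|by left|exact/(model_Z model xv)].
by congr ((nat_of_bool _)%:R); apply: asbool_equiv_eq; exact: model_T model _ _ yS xv.
Qed.

Let pV0 y x : y \in S -> nrm x = v.+1 -> pV y x = 0.
Proof.
move=> yS xv; rewrite (hp_in countE) ?asboolF//; last by right; rewrite /= xv.
by move=> /= xy; have := S_box yS; rewrite -xy xv; lia.
Qed.

Lemma model_lb y x : y \in S -> (nrm x <= v)%N -> pV y x <= P y x.
Proof.
move=> yS xv; have [xS|xS] := boolP (x \in S); first by rewrite PS.
apply: (max_principle_le (Dm := Dm)) => [z zD|z /bdryD[zS|zv]|]; last by rewrite mD xS.
- by rewrite -harm// -harmV// !subrr.
- by rewrite PS.
- by rewrite pV0 ?hp_ge0.
Qed.

Lemma model_ub (kappa : R) y w : y \in S ->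
  (forall w w', (u <= nrm w <= u.+1)%N -> (u <= nrm w' <= u.+1)%N ->
     pV y w' <= kappa * pV y w) ->
  (u <= nrm w <= u.+1)%N -> P y w <= (1 + 2 * q * kappa) * pV y w.
Proof.
move=> yS hk wu.
have x0 : ((0, u%:Z) : E) \in [seq x <- box u | nrm x == u].
  by rewrite mem_filter mem_box nrm_vert eqxx leqnn.
have [m + mmax] := seq_argmax (P y) x0.
rewrite mem_filter => /andP[/eqP mu _].
have PM x : nrm x = u -> P y x <= P y m.
  by move=> xu; apply: mmax; rewrite mem_filter mem_box xu eqxx leqnn.
have step1 x : (nrm x <= v)%N -> P y x <= pV y x + q * P y m.
  move=> xv; have qm0 : 0 <= q * P y m by rewrite mulr_ge0// hp_ge0.
  have [xS|xS] := boolP (x \in S); first by rewrite PS// lerDl.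
  apply: (max_principle_le (Dm := Dm) (v := fun x => pV y x + q * P y m))
    => [z zD|z /bdryD[zS|zv]|]; last by rewrite mD xS.
  - by rewrite avgD (avg_cst s0) -harm// -harmV// subrr opprD addrACA !subrr addr0.
  - by rewrite PS// lerDl.
  - have [nU Fq] := model_bd model zv; rewrite pV0// add0r.
    have [Zz|nZz] := pselect (Z z).
      by rewrite (hp_in countE)// asboolF// => /(model_TU model yS).
    apply: le_trans (model_return_le yS PM nU nZz) _.
    by rewrite mulrC ler_wpM2r// hp_ge0.
have mv : (nrm m <= v)%N by rewrite mu; lia.
have wv : (nrm w <= v)%N by lia.
have Pm : P y m <= 2 * pV y m.
  have := step1 m mv; have : 0 <= P y m by exact: hp_ge0.
  by move: (P y m) (pV y m) q_half q_ge0 => a b; nra.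
have mk : pV y m <= kappa * pV y w by apply: hk => //; rewrite mu leqnn/=.
apply: le_trans (step1 w wv) _; rewrite mulrDl mul1r lerD2l.
apply: (@le_trans _ _ (q * (2 * (kappa * pV y w)))).
  by rewrite ler_wpM2l//; apply: le_trans Pm _; rewrite ler_wpM2l.
by rewrite le_eqVlt; apply/orP; left; apply/eqP; ring.
Qed.

End return_ratio.

Section models.
Variables (R : realType) (d : nat).
Hypothesis d_ge2 : (2 <= d)%N.
Local Notation E := (lattice int d).
Local Notation st := (@step int d).
Local Notation s0 := ((None, false) : direction d).
Local Notation avg := (@avg R _ _ st).
Local Notation hp := (@hp R _ _ s0 st).
Local Notation D := (d.+1%:R : R).
Local Notation nsq := (@nsq R d).
Local Notation box := (@box d).
Local Notation countE := (countable_latticeZ d).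
Variables (s1 A : R).
Hypotheses (s1_gt0 : 0 < s1) (A_ge1 : 1 <= A).
Hypothesis super : forall x, avg (radial A s1) x <= radial A s1 x.
Local Notation f1 := (@radial R d A s1).
Variables (n0 u v : nat) (S : seq E).
Hypotheses (S_box : forall y, y \in S -> (nrm y <= n0)%N).
Hypotheses (n0u : (n0 < u)%N) (uv : (u.+1 < v)%N).

Let g := (D * u%:R ^+ 2 + A) `^ (- s1).

Let g0 : 0 < g.
Proof.
have H : 0 <= D * u%:R ^+ 2 by rewrite mulr_ge0// sqr_ge0.
by apply: powR_gt0; move: A_ge1; lra.
Qed.

Lemma full_model : box_model u v S [set x | x \in S] (fun y => [set y])
  [set x | (nrm x <= u)%N] (fun x => f1 x / g) (box_ub d s1 A u v.+1).
Proof.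
have f0 x : 0 < f1 x / g by rewrite divr_gt0// f1_gt0.
split => //.
- by move=> x y yS -> /=; have := S_box yS; lia.
- by move=> x _ _; exact: ltW.
- by move=> x s _ _; exact: ltW.
- by move=> x s _ _ xu; exact: box_superE.
- move=> x _ _; rewrite (_ : (fun x => f1 x / g) = (fun x => g^-1 * f1 x)).
    by rewrite avgZ mulrC ler_wpM2r ?invr_ge0 ?(ltW g0)//.
  by apply/funext => z; rewrite mulrC.
- move=> x s /negP; rewrite -ltnNge => ux _ xsu; exists (x + st s) => //.
  by have := nrm_addstep_ge x s; move: xsu => /=; lia.
- move=> x xv; split; first by move=> /=; lia.
  by rewrite /box_ub -/g ler_wpM2r ?invr_ge0 ?(ltW g0)// f1_le_nrm ?xv.
Qed.

Variables (N M h : nat) (zh : int).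
Hypotheses (M_gt0 : (0 < M)%N) (uN : (u <= N)%N) (vN : (v.+1 + v.+1 <= N)%N).
Hypothesis vh : (`|zh| + v < h)%N.

Definition period (k : E) : E := (N%:Z *: k.1, 0).

Definition equiv (x y : E) : Prop := exists k, x = y + period k.

Definition per_box (x : E) : Prop := exists k, (nrm (x - period k)%R <= u)%N.

Definition lift_Z : set E :=
  [set x | (exists2 y, y \in S & equiv x y) \/ (h <= `|(x.2 + zh)%R|)%N].

Definition psi (x : E) : R :=
  \sum_(j < d) ((x.1 0 j)%:~R ^+ 2 - (x.2 + zh)%:~R ^+ 2 + h%:R ^+ 2).

Definition lift_F (x : E) : R :=
  \sum_(k <- box M) f1 (x - period k) / g + psi x / (N * M)%:R ^+ 2.

Definition lift_q : R := (M.*2.+1 ^ d.+1)%:R * box_ub d s1 A u v.+1 +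
  d%:R * (N%:R ^+ 2 + h%:R ^+ 2) / (N * M)%:R ^+ 2.

Lemma size_box b : (size (box b) <= b.*2.+1 ^ d.+1)%N.
Proof.
apply: leq_trans (size_undup _) _.
by rewrite size_map -cardE card_ffun card_ord card_option card_ord mul2n.
Qed.

Lemma avg_psi x : avg psi x = psi x.
Proof.
have D0 : 0 < D by rewrite ltr0n.
rewrite /psi -[RHS]addr0 avg_sum.
suff H j : avg (fun y : E => (y.1 0 j)%:~R ^+ 2 - (y.2 + zh)%:~R ^+ 2 + h%:R ^+ 2) x =
    (x.1 0 j)%:~R ^+ 2 - (x.2 + zh)%:~R ^+ 2 + h%:R ^+ 2.
  by rewrite addr0; apply: eq_bigr => j _; exact: H.
rewrite avgD (avg_cst s0) avgB; congr (_ + _).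
have sq (i : option 'I_d) (c : R) : avg (fun y : E => ((coord y i)%:~R + c) ^+ 2) x =
    ((coord x i)%:~R + c) ^+ 2 + D^-1.
  rewrite avg_dirE (bigD1 i)//= (eq_bigr (fun=> 2 * ((coord x i)%:~R + c) ^+ 2)); last first.
    by move=> k ki; rewrite !coord_step (negbTE ki) !addr0; ring.
  rewrite big_const_seq iter_addr addr0 -sum1_count -/(index_enum _) sum1_card.
  rewrite (cardC1 i) card_option card_ord !coord_step eqxx expr0 expr1.
  rewrite -mulr_natl; field.
  by rewrite addrC natr1 gt_eqF.
have := sq (Some j) 0; have := sq None zh%:~R => /= H1 H2.
rewrite (_ : (fun y : E => (y.1 0 j)%:~R ^+ 2) = (fun y : E => ((y.1 0 j)%:~R + 0) ^+ 2 : R)).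
  rewrite H2 (_ : (fun y : E => (y.2 + zh)%:~R ^+ 2) = (fun y : E => (y.2%:~R + zh%:~R) ^+ 2 : R)).
    by rewrite H1 addr0 intrD; ring.
  by apply/funext => y; rewrite intrD.
by apply/funext => y; rewrite addr0.
Qed.

Lemma hp_period Z S' k x : (forall y, Z (y + period k) <-> Z y) ->
  (forall y, S' (y + period k) <-> S' y) -> hp Z S' (x + period k) = hp Z S' x.
Proof.
move=> Zk Sk; have fst y s : y + st s + period k = y + period k + st s by rewrite addrAC.
rewrite (hp_lift R s0 fst); apply: eq_hp => y; first exact: Zk.
by move=> _; exact: Sk.
Qed.

Lemma periodD k k' : period (k + k') = period k + period k'.
Proof. by rewrite /period scalerDr; congr (_, _); rewrite addr0. Qed.

Lemma periodN k : period (- k) = - period k.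
Proof. by rewrite /period scalerN; congr (_, _); rewrite oppr0. Qed.

Lemma equivD k x y : equiv (x + period k) y <-> equiv x y.
Proof.
split=> -[k' xy]; last by exists (k' + k); rewrite xy periodD addrA.
by exists (k' - k); rewrite periodD periodN addrA -xy addrK.
Qed.

Lemma lift_Z_period k x : lift_Z (x + period k) <-> lift_Z x.
Proof.
rewrite /lift_Z/= addr0; split=> -[[y yS xy]|]; try by right.
  by left; exists y => //; exact/(equivD k).
by left; exists y => //; exact/(equivD k).
Qed.

Lemma equiv_in_box x y : (nrm x <= v)%N -> (nrm y <= v)%N -> equiv x y -> x = y.
Proof.
move=> xv yv [k xE]; apply: coord_inj => -[j|]; last by rewrite xE coordD addr0.
have xj := leq_trans (nrm_coord x (Some j)) xv; have yj := leq_trans (nrm_coord y (Some j)) yv.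
have E1 : coord x (Some j) = coord y (Some j) + N%:Z * k.1 0 j by rewrite {1}xE coordD /= mxE.
rewrite E1 in xj *; move: xj yj; move: (coord y _) (k.1 0 j) => a b aN bN.
suff -> : b = 0 by rewrite mulr0 addr0.
by move: aN bN; clear -vN; move: vN; nia.
Qed.

Lemma psi_ge0 x : (`|(x.2 + zh)%R| <= h)%N -> 0 <= psi x.
Proof.
move=> xh; apply: sumr_ge0 => j _.
have : ((x.2 + zh)%:~R : R) ^+ 2 <= h%:R ^+ 2.
  rewrite -[leLHS]real_normK ?num_real// -intr_norm lerXn2r ?nnegrE//.
    by rewrite -[_%:R]/(h%:Z%:~R) ler_int; lia.
by have := sqr_ge0 ((x.1 0 j)%:~R : R); lra.
Qed.

Let NM0 : 0 < (N * M)%:R :> R.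
Proof. by rewrite ltr0n muln_gt0 M_gt0 andbT; lia. Qed.

Let f10 x : 0 <= f1 x / g.
Proof. by rewrite divr_ge0 ?(ltW g0) ?ltW ?f1_gt0. Qed.

Let term_ge0 x : (`|(x.2 + zh)%R| <= h)%N -> 0 <= lift_F x.
Proof.
by move=> xh; rewrite addr_ge0 ?sumr_ge0// divr_ge0 ?psi_ge0// sqr_ge0.
Qed.

Let step2 x s : (`|(x.2 + zh)%R| < h)%N -> (`|((x + st s).2 + zh)%R| <= h)%N.
Proof.
have := nrm_step s; move=> /nrmP/(_ None) /=; move: (st s) => t /= tb xh.
by move: x.2 t.2 tb xh => a b; lia.
Qed.

Let in_slab x : ~ lift_Z x -> (`|(x.2 + zh)%R| < h)%N.
Proof. by move=> nZ; rewrite ltnNge; apply/negP => hx; apply: nZ; right. Qed.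

Lemma lift_F_ge1 x : (`|(x.2 + zh)%R| <= h)%N -> per_box x -> 1 <= lift_F x.
Proof.
move=> xh [k ku]; have p0 := psi_ge0 xh.
have [kM|kM] := leqP (nrm ((k.1, 0) : E)) M.
  rewrite /lift_F (bigD1_seq ((k.1, 0) : E)) ?mem_box ?box_uniq//=.
  have -> : period (k.1, 0) = period k by [].
  rewrite -addrA; apply: (@le_trans _ _ (f1 (x - period k) / g)); last first.
    by rewrite lerDl addr_ge0 ?sumr_ge0// divr_ge0 ?sqr_ge0.
  exact: box_superE.
have [j jM] : exists j, (M < `|k.1 0%R j|)%N.
  apply: contrapT => H; move: kM; rewrite ltnNge => /negP; apply; apply/nrmP => -[j|]//=.
  by rewrite leqNgt; apply/negP => jM; apply: H; exists j.
have xj : (N * M <= `|x.1 0%R j|)%N.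
  have := nrmP _ _ ku (Some j); rewrite coordB /= mxE.
  move: (x.1 0 j) (k.1 0 j) jM => a b jM ab; move: uN => ?; nia.
have : 1 <= psi x / (N * M)%:R ^+ 2.
  rewrite ler_pdivlMr ?exprn_gt0// mul1r; apply: (@le_trans _ _ ((x.1 0 j)%:~R ^+ 2)).
    rewrite -[leRHS]real_normK ?num_real// -intr_norm lerXn2r ?nnegrE//.
    by rewrite -[_%:R]/((N * M)%N%:Z%:~R) ler_int; lia.
  rewrite /psi (bigD1 j)//=.
  have sq : ((x.2 + zh)%:~R : R) ^+ 2 <= h%:R ^+ 2.
    rewrite -[leLHS]real_normK ?num_real// -intr_norm lerXn2r ?nnegrE//.
    by rewrite -[_%:R]/(h%:Z%:~R) ler_int; lia.
  have : 0 <= \sum_(i < d | i != j) ((x.1 0 i)%:~R ^+ 2 - (x.2 + zh)%:~R ^+ 2 + h%:R ^+ 2 : R).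
    by apply: sumr_ge0 => i _; have := sqr_ge0 ((x.1 0 i)%:~R : R); lra.
  by lra.
by move=> /le_trans; apply; rewrite lerDr sumr_ge0.
Qed.

Lemma lift_F_le x : (forall k, (v < nrm (x - period k)%R)%N) ->
  (forall j, (`|x.1 0%R j| <= N)%N) -> lift_F x <= lift_q.
Proof.
move=> xk xN; apply: lerD.
  apply: (@le_trans _ _ (\sum_(k <- box M) box_ub d s1 A u v.+1)).
    apply: ler_sum => k _; rewrite /box_ub -/g ler_wpM2r ?invr_ge0 ?(ltW g0)//.
    exact: f1_le_nrm.
  have b0 : 0 <= box_ub d s1 A u v.+1 by rewrite divr_ge0 ?powR_ge0.
  rewrite big_const_seq iter_addr addr0 count_predT -[leLHS]mulr_natl ler_wpM2r//.
  by rewrite ler_nat size_box.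
rewrite ler_wpM2r ?invr_ge0 ?sqr_ge0//; rewrite mulr_natl -[X in _ *+ X]card_ord -sumr_const.
apply: ler_sum => j _.
have : ((x.1 0 j)%:~R : R) ^+ 2 <= N%:R ^+ 2.
  rewrite -[leLHS]real_normK ?num_real// -intr_norm lerXn2r ?nnegrE//.
  by rewrite -[_%:R]/(N%:Z%:~R) ler_int; have := xN j; lia.
by have := sqr_ge0 ((x.2 + zh)%:~R : R); lra.
Qed.

Lemma lift_model : box_model u v S lift_Z (fun y x => equiv x y) per_box lift_F lift_q.
Proof.
have Sv y : y \in S -> (nrm y <= v)%N by move=> /S_box; lia.
split.
- move=> x xv; split => [[[y yS /equiv_in_box xy]|]|xS].
  + by rewrite (xy xv (Sv y yS)).
  + by have := nrm_coord x None; move=> /=; move: x.2 vh xv => a; lia.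
  + by left; exists x => //; exists 0; rewrite /period scaler0 addr0.
- move=> x y yS xv; split => [/equiv_in_box xy|->]; first exact: xy xv (Sv y yS).
  by exists 0; rewrite /period scaler0 addr0.
- by move=> x y yS [k ->]; exists k; rewrite addrK; have := S_box yS; lia.
- by move=> x _ /in_slab xh; apply: term_ge0; exact: ltnW.
- by move=> x s _ /in_slab xh; apply/term_ge0/step2.
- by move=> x s _ /in_slab xh Us; apply: lift_F_ge1 => //; exact: step2.
- move=> x _ _; rewrite /lift_F avgD.
  rewrite (_ : (fun y => psi y / (N * M)%:R ^+ 2) = (fun y => ((N * M)%:R ^+ 2)^-1 * psi y)).
    rewrite avgZ avg_psi [X in _ + X <= _]mulrC lerD2r avg_sum; apply: ler_sum => k _.
    rewrite (_ : (fun y => f1 (y - period k) / g) = (fun y => g^-1 * f1 (y - period k))).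
      by rewrite avgZ avg_shift mulrC ler_wpM2r ?invr_ge0 ?(ltW g0).
    by apply/funext => y; rewrite mulrC.
  by apply/funext => y; rewrite mulrC.
- move=> x s nU nZ [k ku]; exists (x + st s - period k).
    apply/eqP; rewrite eqn_leq ku/= leqNgt; apply/negP => H; apply: nU.
    exists k; have := nrm_addstep_ge (x - period k) s; rewrite addrAC => /leq_ltn_trans/(_ H).
    by case: (nrm (x - period k)).
  move=> y yS; rewrite -[in LHS](subrK (period k) (x + st s)); apply: hp_period => z.
    exact: lift_Z_period.
  exact: equivD.
- move=> x xv.
  have xk k : (v < nrm (x - period k)%R)%N.
    have [k0|k0] := eqVneq k.1 0; first by rewrite /period k0 scaler0 subr0 xv.
    have [j kj] : exists j, k.1 0 j != 0.
      apply/existsP; rewrite -negb_forall; apply: contra k0 => /forallP H.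
      by apply/eqP/rowP => j; rewrite mxE; exact/eqP/H.
    apply: leq_trans (nrm_coord _ (Some j)); rewrite coordB /= mxE.
    have := nrm_coord x (Some j) => /=; rewrite xv.
    by move: (x.1 0 j) (k.1 0 j) kj vN => a b; nia.
  split; first by move=> [k ku]; have := xk k; lia.
  apply: lift_F_le => // j; have := nrm_coord x (Some j) => /=; rewrite xv => H.
  by move: vN; lia.
Qed.

End models.

(** * Laws of traces *)

Section trace_algebra.
Variables (R : realType) (Y T W : finType) (cup : T -> T -> T).
Variables (kap : Y -> T -> W -> R) (p1 p2 : Y -> W -> R) (f1 f2 : Y -> T -> T -> R).
Hypotheses (kap_ge0 : forall y t w, 0 <= kap y t w)
  (kap_le1 : forall y, \sum_t \sum_w kap y t w <= 1).
Hypotheses (p1_ge0 : forall y w, 0 <= p1 y w) (p2_ge0 : forall y w, 0 <= p2 y w).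
Variables (eta rho : R).
Hypotheses (eta_ge0 : 0 <= eta) (p12 : forall y w, p1 y w <= (1 + eta) * p2 y w)
  (r12 : forall w, 1 - \sum_y p1 y w <= (1 + eta) * (1 - \sum_y p2 y w))
  (p1_rho : forall w, \sum_y p1 y w <= rho).
Let rec (p : Y -> W -> R) (f : Y -> T -> T -> R) y B A : R :=
  \sum_t \sum_w kap y t w * ((cup B t == A)%:R * (1 - \sum_y' p y' w) +
    \sum_y' p y' w * f y' (cup B t) A).
Hypotheses (f1_rec : forall y B A, f1 y B A = rec p1 f1 y B A)
  (f2_rec : forall y B A, f2 y B A = rec p2 f2 y B A).
Hypotheses (f1_ge0 : forall y B A, 0 <= f1 y B A) (f2_ge0 : forall y B A, 0 <= f2 y B A)
  (f1_le1 : forall y B, \sum_A f1 y B A <= 1).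
Hypotheses (rho_ge0 : 0 <= rho) (p2_le1 : forall w, \sum_y p2 y w <= 1).

(* j-fold returns to the set are compared exactly; more returns are rare.     *)
Lemma trace_compare (j : nat) : exists2 g : Y -> T -> T -> R,
  (forall y B A, f1 y B A <= (1 + eta) ^+ j * f2 y B A + g y B A) &
  (forall y B A, 0 <= g y B A) /\ (forall y B, \sum_A g y B A <= rho ^+ j).
Proof.
elim: j => [|j [g fg [g0 gs]]].
  exists f1; last by split => // y B; rewrite expr0.
  by move=> y B A; rewrite expr0 mul1r lerDr.
pose g' y B A := \sum_t \sum_w kap y t w * \sum_y' p1 y' w * g y' (cup B t) A.
have e1 : 1 <= (1 + eta) ^+ j by rewrite exprn_ege1// lerDl.
exists g'; last split.
- move=> y B A; rewrite f1_rec f2_rec /rec /g' mulr_sumr -big_split/=.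
  apply: ler_sum => t _; rewrite mulr_sumr -big_split/=; apply: ler_sum => w _.
  rewrite mulrCA -mulrDr ler_wpM2l// [_ ^+ j.+1 * (_ + _)]mulrDr; set a := (_ == A)%:R.
  have ha : a * (1 - \sum_y' p1 y' w) <= (1 + eta) ^+ j.+1 * (a * (1 - \sum_y' p2 y' w)).
    rewrite [leRHS]mulrCA ler_wpM2l ?ler0n//; apply: le_trans (r12 w) _.
    by rewrite exprS mulrAC ler_peMr// mulr_ge0 ?subr_ge0// addr_ge0.
  rewrite -addrA; apply: (lerD ha).
  rewrite mulr_sumr -big_split/=; apply: ler_sum => y' _.
  apply: (@le_trans _ _ (p1 y' w * ((1 + eta) ^+ j * f2 y' (cup B t) A + g y' (cup B t) A))).
    by rewrite ler_wpM2l.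
  rewrite mulrDr lerD2r mulrCA exprSr -!mulrA ler_wpM2l ?exprn_ge0 ?addr_ge0//.
  by rewrite mulrA ler_wpM2r.
- move=> y B A; apply: sumr_ge0 => t _; apply: sumr_ge0 => w _; rewrite mulr_ge0//.
  by apply: sumr_ge0 => y' _; rewrite mulr_ge0.
move=> y B; rewrite /g' exchange_big/=.
apply: (@le_trans _ _ (\sum_t \sum_w kap y t w * rho ^+ j.+1)).
  apply: ler_sum => t _; rewrite exchange_big/=; apply: ler_sum => w _.
  rewrite -mulr_sumr ler_wpM2l// exchange_big/=.
  apply: (@le_trans _ _ (\sum_y' p1 y' w * rho ^+ j)).
    by apply: ler_sum => y' _; rewrite -mulr_sumr ler_wpM2l.
  by rewrite -mulr_suml exprS ler_wpM2r// exprn_ge0.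
under eq_bigr do rewrite -mulr_suml.
by rewrite -mulr_suml ler_piMl// exprn_ge0.
Qed.

End trace_algebra.

Section prb_partition.
Context {R : realType} {d : measure_display} {T : measurableType d}.
Variable P : probability T R.

Lemma prb_partition (I : finType) (H : I -> set T) (G : set T) : measurable G ->
  (forall i, measurable (H i)) -> (forall i j w, H i w -> H j w -> i = j) ->
  prb P G = \sum_i prb P (G `&` H i) + prb P (G `\` \bigcup_i H i).
Proof.
move=> mG mH dH.
pose f w := if pselect (exists i, H i w) is left e then Some (sval (cid e)) else None.
have fS i : [set w | f w = Some i] = H i.
  apply/seteqP; split => w; rewrite /= /f; case: pselect => // e.
    by move=> [<-]; exact: (svalP (cid e)).
  by move=> Hi; congr Some; apply: dH (svalP (cid e)) Hi.
  by move=> Hi; case: e; exists i.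
have mU : measurable (\bigcup_i H i) by apply: fin_bigcup_measurable => // i _.
rewrite (prb_split _ mG mU); congr (_ + _).
have [||E1 _] := @prb_seq _ _ _ P _ f G [seq Some i | i <- enum I] mG.
- by move=> _ /mapP[i _ ->]; rewrite fS.
- by rewrite map_inj_uniq ?enum_uniq// => i j [].
rewrite big_map big_enum/= in E1; rewrite -[RHS](eq_bigr _ (fun i _ => congr1 (fun A => prb P (G `&` A)) (fS i))).
rewrite -E1; congr (prb P (G `&` _)); apply/seteqP; split => w.
  move=> [i _ Hi]; apply/mapP; exists i; rewrite ?mem_enum//.
  by have : [set w | f w = Some i] w by rewrite fS.
move=> /mapP[i _ fi]; exists i => //; have : [set w | f w = Some i] w by [].
by rewrite fS.
Qed.

End prb_partition.

Section trace_walk.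
Variables (R : realType) (d : nat).
Local Notation E := (lattice int d).
Local Notation traj := (trajectory E).
Local Notation st := (@step int d).
Local Notation s0 := ((None, false) : direction d).
Local Notation hp := (@hp R _ _ s0 st).
Local Notation pr := (@pr R _ _ s0 st).
Local Notation box := (@box d).
Local Notation countE := (countable_latticeZ d).
Variables (u : nat) (S : {fset E}).
Hypothesis S_box : forall y : S, (nrm (val y) <= u)%N.

Let O : set E := [set x | (u < nrm x)%N].
Let bd := bdry (box u).

Definition ptrace (n : nat) (w : traj) : {set S} :=
  [set y | `[< exists j, (j <= n)%N /\ w j = val y >]].

Definition kappa (y : S) (A : {set S}) (x : seq_sub bd) : R :=
  pr (val y) [set w | exists n, (hitat O n w /\ ptrace n w = A) /\ w n = val x].

Let O_notin x : O x <-> x \notin box u.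
Proof. by rewrite mem_box -ltnNge. Qed.

Let tau A n := [set w : nat -> E | hitat O n w /\ ptrace n w = A].

Let tau_stopping A : stopping (tau A).
Proof.
have [fO uO] := hitat_stopping O; split=> [n w w' ww' [On An]|n m w [On _] [Om _]].
  split; first exact: fO On.
  rewrite -An; apply/setP => y; rewrite !inE; apply: asbool_equiv_eq.
  by split=> -[j [jn wj]]; exists j; split => //; rewrite -wj ww'.
exact: uO On Om.
Qed.

Lemma kappa_ge0 y A x : 0 <= kappa y A x. Proof. exact: prb_ge0. Qed.

Let H (i : {set S} * seq_sub bd) : set traj :=
  [set w | exists n, tau i.1 n w /\ w n = val i.2].

Let mH i : measurable (H i).
Proof. exact: (stopping_measurable countE [set val i.2] (tau_stopping i.1)). Qed.

Let dH i j w : H i w -> H j w -> i = j.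
Proof.
move: i j => [A1 x1] [A2 x2] [n [[/= On Ai] /= wi]] [m [[/= Om Aj] /= wj]].
have [_ uO] := hitat_stopping O; have nm := uO _ _ _ On Om; subst m.
congr (_, _); first by rewrite -Ai -Aj.
by apply: val_inj; rewrite /= -wi -wj.
Qed.

Let exit_as (y : S) : \sum_i prb (walk_law R s0 st (val y)) (H i) = 1 /\
  forall G, measurable G -> pr (val y) (G `\` \bigcup_i H i) = 0.
Proof.
have mU : measurable (\bigcup_i H i).
  by apply: fin_bigcup_measurable => [|i _]; [exact: finite_finset|exact: mH].
have U1 : pr (val y) (\bigcup_i H i) = 1.
  apply/eqP; rewrite eq_le prb_le1//=.
  have <- : hp O [set` bd] (val y) = 1.
    have yb : val y \in box u by rewrite mem_box.
    exact: (@hp_total R _ d countE (box u) O [set` bd] O_notin (fun z zb => zb) _ yb).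
  apply: le_prb; [exact: (measurable_hev countE)|exact: mU|].
  move=> w [n [On wb]]; exists (ptrace n w, SeqSub wb) => //.
  by exists n.
split; last first.
  move=> G mG; apply/eqP; rewrite eq_le prb_ge0 andbT.
  apply: (@le_trans _ _ (pr (val y) (~` \bigcup_i H i))).
    by apply: le_prb; [exact: measurableD|exact: measurableC|move=> w []].
  by rewrite /pr prbC// -/(pr _ _) U1 subrr.
have := prb_partition (walk_law R s0 st (val y)) mU mH dH.
rewrite setDv prb0 addr0 -/(pr _ _) U1 => ->; apply: eq_bigr => i _.
by congr (prb _ _); apply/seteqP; split => [w Hi|w []//]; split => //; exists i.
Qed.

Lemma kappa_le1 y : \sum_t \sum_x kappa y t x <= 1.
Proof. by have [<- _] := exit_as y; rewrite pair_big. Qed.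

Variables (dead : set E) (T : S -> set E).
Hypothesis T_box : forall (y : S) x, (nrm x <= u.+1)%N -> (T y x <-> x = val y).
Hypothesis T_disj : forall (y y' : S) x, T y x -> T y' x -> y = y'.
Hypothesis alive_box : forall x, (nrm x <= u.+1)%N -> ~ dead x.

Definition visits (y : S) (w : traj) : Prop :=
  exists n, T y (w n) /\ forall j, (j <= n)%N -> ~ dead (w j).

Definition trset (w : traj) : {set S} := [set y | `[< visits y w >]].

Definition ev (B A : {set S}) : set traj := [set w | B :|: trset w = A].

Definition trZ : set E := [set x | (exists y, T y x) \/ dead x].

Hypothesis T_inv : forall (y : S) x B A, T y x -> pr x (ev B A) = pr (val y) (ev B A).

Lemma measurable_trset (Q : {set S} -> Prop) : measurable ([set w : traj | Q (trset w)]).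
Proof.
have mv y : measurable ([set w : traj | visits y w]).
  rewrite (_ : [set w | _] = \bigcup_n [set w : traj | T y (w n) /\ forall j, (j <= n)%N -> ~ dead (w j)]).
    apply: bigcupT_measurable => n; apply: (@fdep_measurable _ countE n).
    by move=> w w' ww' [Tn nd]; split=> [|j jn]; rewrite -ww'//; exact: nd.
  by apply/seteqP; split => [w [n H1]|w [n _ H1]]; exists n.
have mA (A : {set S}) : measurable ([set w : traj | trset w = A]).
  rewrite (_ : [set w | _] = \bigcap_(y in [set: S])
      (if y \in A then [set w | visits y w] else ~` [set w | visits y w])).
    apply: fin_bigcap_measurable => // y _; case: ifP => _ //; exact: measurableC.
  apply/seteqP; split => w.
    by move=> /= <- y _; rewrite inE; case: asboolP.
  move=> Hw; apply/setP => y; have := Hw y I; rewrite inE.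
  by case: ifP => _; case: asboolP.
rewrite (_ : [set w | _] = \bigcup_(A in [set A | Q A]) [set w | trset w = A]).
  by apply: fin_bigcup_measurable => // A _.
by apply/seteqP; split => [w Qw|w [A /= QA ->]//]; exists (trset w).
Qed.

Let m_ev B A : measurable (ev B A).
Proof. exact: (measurable_trset (fun t => B :|: t = A)). Qed.

Let shift_visits n (y : S) w : (forall j, (j < n)%N -> ~ dead (w j)) ->
  visits y (Defs.shift n w) -> visits y w.
Proof.
move=> nd [m [Tm ndm]]; exists (n + m)%N; split => // j jnm.
have [jn|nj] := ltnP j n; first exact: nd.
by have := ndm (j - n)%N; rewrite /Defs.shift subnKC//; apply; lia.
Qed.

Let visits_shift n m (y : S) w : (n <= m)%N -> T y (w m) ->
  (forall j, (j <= m)%N -> ~ dead (w j)) -> visits y (Defs.shift n w).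
Proof.
move=> nm Tm nd; exists (m - n)%N; rewrite /Defs.shift subnKC//; split => // j jm.
by apply: nd; lia.
Qed.

Let trset_hit n w : hitat trZ n w -> trset w = trset (Defs.shift n w).
Proof.
move=> [Zn nZ]; apply/setP => y; rewrite !inE; apply: asbool_equiv_eq; split.
  move=> [m [Tm nd]]; apply: (visits_shift _ Tm nd); rewrite leqNgt; apply/negP => mn.
  by apply: (nZ _ mn); left; exists y.
by apply: shift_visits => j jn dj; apply: (nZ _ jn); right.
Qed.

Lemma ev_return x B A : ~ trZ x -> pr x (ev B A) =
  (B == A)%:R * (1 - \sum_y hp trZ (T y) x) +
  \sum_y hp trZ (T y) x * pr (val y) (ev B A).
Proof.
move=> nZx; pose Hi (y : S) := hev trZ (T y).
have mHi y : measurable (Hi y) by exact: (measurable_hev countE).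
have dHi y y' w : Hi y w -> Hi y' w -> y = y'.
  move=> [n [Zn Tn]] [m [Zm Tm]]; have [_ uZ] := hitat_stopping trZ.
  by have nm := uZ _ _ _ Zn Zm; subst m; exact: T_disj Tn Tm.
have mU : measurable (\bigcup_y Hi y) by apply: fin_bigcup_measurable => // i _.
have sumE : pr x (\bigcup_y Hi y) = \sum_y hp trZ (T y) x.
  rewrite /Submission.pr (prb_partition _ mU mHi dHi) setDv prb0 addr0.
  by apply: eq_bigr => y _; congr (prb _ _); apply/seteqP; split => [w []//|w Hw]; split => //; exists y.
rewrite {1}/Submission.pr (prb_partition _ (m_ev B A) mHi dHi) addrC; congr (_ + _).
  have -> : ev B A `\` \bigcup_y Hi y = if B == A then ~` \bigcup_y Hi y else set0.
    have t0 w : ~ (\bigcup_y Hi y) w -> trset w = finset.set0.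
      move=> nH; apply/setP => y; rewrite !inE; apply/asboolP => -[n [Tn nd]].
      apply: nH; have [k [Zk kmin]] : exists k, hitat trZ k w /\ (k <= n)%N.
        have Zn : exists n, `[< trZ (w n) >] by exists n; apply/asboolP; left; exists y.
        case: (ex_minnP Zn) => k /asboolP Zk kmin; exists k; split.
          split=> // i ik /asboolT Zi; by have := kmin i Zi; rewrite leqNgt ik.
        by apply: kmin; apply/asboolP; left; exists y.
      case: (Zk) => -[[y' Ty']|/nd]; last by [].
      by move=> _; exists y' => //; exists k.
    apply/seteqP; split => w; case: eqP => [BA|BA].
    - by case.
    - by move=> [ew /t0 tw]; apply: BA; move: ew; rewrite /ev/= tw finset.setU0.
    - by move=> nH; split => //; rewrite /ev/= (t0 _ nH) finset.setU0.
    - by [].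
  case: eqP => _; last by rewrite prb0 mul0r.
  by rewrite mul1r prbC// -/(Submission.pr _ _ _ _ _) sumE.
apply: eq_bigr => y _.
have := strong_markov countE x (hitat_stopping trZ) (m_ev B A)
  (fun z Tz => @T_inv y z B A Tz) (Y := T y).
move=> [_ <-]; congr (prb _ _); apply/seteqP; split => w.
  by move=> [ew [n [Zn Tn]]]; exists n; split => //; rewrite /ev/= -(trset_hit Zn).
by move=> [n [Zn Tn ew]]; split; [rewrite /ev/= (trset_hit Zn)|exists n].
Qed.

Let bd_box x : x \in bd -> nrm x = u.+1.
Proof.
move=> xb; have := bdry_notin xb; rewrite mem_box -ltnNge => ux.
have [t [s [tu xE]]] := bdry_exists xb; rewrite mem_box in tu.
by apply/eqP; rewrite eqn_leq ux andbT xE; apply: leq_trans (nrm_addstep _ _) _.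
Qed.

Lemma bd_notin (x : seq_sub bd) : ~ trZ (val x).
Proof.
have xu := bd_box (valP x); have xu1 : (nrm (val x) <= u.+1)%N by rewrite xu.
move=> [[y /(T_box y xu1) xy]|]; last exact: alive_box.
by have := S_box y; rewrite -xy xu ltnn.
Qed.

Let trset_exit A n w (x : seq_sub bd) : hitat O n w -> ptrace n w = A -> w n = val x ->
  trset w = A :|: trset (Defs.shift n w).
Proof.
move=> [On nO] <- wx.
have inb j : (j <= n)%N -> (nrm (w j) <= u.+1)%N.
  rewrite leq_eqVlt => /predU1P[->|jn]; first by rewrite wx (bd_box (valP x)).
  by have := nO _ jn; rewrite /O/= => /negP; rewrite -leqNgt => /leqW.
apply/setP => y; rewrite !inE; apply/asboolP/orP => [[m [Tm nd]]|[/asboolP[j [jn wj]]|/asboolP]].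
- have [nm|mn] := leqP n m; first by right; apply/asboolP; exact: (visits_shift nm Tm nd).
  left; apply/asboolP; exists m; split; first exact: ltnW.
  by apply/T_box => //; exact: inb (ltnW mn).
- exists j; split; first by apply/T_box => //; exact: inb.
  by move=> i ij; apply/alive_box/inb/(leq_trans ij).
- by apply: shift_visits => j jn; apply/alive_box/inb/ltnW.
Qed.

Lemma ev_exit y B A : pr (val y) (ev B A) =
  \sum_t \sum_x kappa y t x * pr (val x) (ev (B :|: t) A).
Proof.
have e0 : prb (walk_law R s0 st (val y)) (ev B A `\` \bigcup_i H i) = 0.
  exact: (exit_as y).2.
rewrite {1}/Submission.pr (prb_partition _ (m_ev B A) mH dH) e0 addr0 pair_big; apply: eq_bigr => -[t x] _ /=.
have [_ <-] := @strong_markov R _ _ s0 st countE _ [set val x] _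
  (pr (val x) (ev (B :|: t) A)) (val y) (tau_stopping t) (m_ev (B :|: t) A)
  (fun z (zx : z = val x) => congr1 (fun z => pr z _) zx).
congr (prb _ _); apply/seteqP; split => w.
  move=> [ew [n [[On tn] wn]]]; exists n; split => //.
  by rewrite /ev/= -finset.setUA -(trset_exit On tn wn).
move=> [n [[On tn] wn ew]]; split; last by exists n.
by rewrite /ev/= (trset_exit On tn wn) finset.setUA.
Qed.

Lemma trace_rec y B A : pr (val y) (ev B A) =
  \sum_t \sum_x kappa y t x * ((B :|: t == A)%:R * (1 - \sum_y' hp trZ (T y') (val x)) +
    \sum_y' hp trZ (T y') (val x) * pr (val y') (ev (B :|: t) A)).
Proof.
rewrite ev_exit; apply: eq_bigr => t _; apply: eq_bigr => x _; congr (_ * _).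
by rewrite ev_return//; exact: bd_notin.
Qed.

Lemma sum_ev x B : \sum_A pr x (ev B A) = 1.
Proof.
have mB A : measurable [set w : traj | B :|: trset w = A] by exact: m_ev.
rewrite -(prbT (walk_law R s0 st x)) (prb_fin _ measurableT mB).
by apply: eq_bigr => A _; rewrite setTI.
Qed.

Lemma sum_hp_class x : \sum_y hp trZ (T y) x =
  hp trZ [set z | exists y, T y z] x.
Proof.
have mH' y : measurable (hev trZ (T y)) by exact: (measurable_hev countE).
rewrite /Submission.hp {2}/Submission.pr (prb_partition _ (measurable_hev countE _ _) mH').
  rewrite (_ : _ `\` _ = set0) ?prb0 ?addr0.
    apply: eq_bigr => y _; congr (prb _ _); apply/seteqP; split => w.
      by move=> [n [Zn Tn]]; split; exists n => //; split => //; exists y.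
    by case.
  by apply/seteqP; split => // w [[n [Zn [y Ty]]]]; apply; exists y => //; exists n.
move=> y y' w [n [Zn Tn]] [m [Zm Tm]]; have [_ uZ] := hitat_stopping trZ.
by have nm := uZ _ _ _ Zn Zm; subst m; exact: T_disj Tn Tm.
Qed.

End trace_walk.

Lemma eq_leR (R : realType) (a b : R) : a = b -> a <= b. Proof. by move->. Qed.

Section two_models.
Variables (R : realType) (d : nat).
Local Notation E := (lattice int d).
Local Notation st := (@step int d).
Local Notation s0 := ((None, false) : direction d).
Local Notation hp := (@hp R _ _ s0 st).
Local Notation pr := (@pr R _ _ s0 st).
Local Notation avg := (@avg R _ _ st).
Local Notation box := (@box d).
Local Notation countE := (countable_latticeZ d).
Variables (u : nat) (S : {fset E}).
Hypothesis S_box : forall y : S, (nrm (val y) <= u)%N.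

Definition capture (dead : set E) (T : S -> set E) (x : E) : R :=
  hp (trZ dead T) [set z | exists y, T y z] x.

Definition escape dead T (y : S) : R := avg (fun x => 1 - capture dead T x) (val y).

Definition trace_weight dead T (A : {set S}) : R :=
  \sum_y escape dead T y * pr (val y) (ev dead T finset.set0 A).

Lemma escape_ge0 dead T y : 0 <= escape dead T y.
Proof. by apply: avg_ge0 => s; rewrite subr_ge0 (hp_le1 countE). Qed.

Lemma escape_le1 dead T y : escape dead T y <= 1.
Proof.
rewrite -[leRHS](avg_cst s0 (st := st) 1 (val y)); apply: (le_avg s0) => s.
by rewrite gerBl hp_ge0.
Qed.

Record trace_model (dead : set E) (T : S -> set E) : Prop := TraceModel {
  tm_box : forall (y : S) x, (nrm x <= u.+1)%N -> (T y x <-> x = val y) ;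
  tm_disj : forall (y y' : S) x, T y x -> T y' x -> y = y' ;
  tm_alive : forall x, (nrm x <= u.+1)%N -> ~ dead x ;
  tm_inv : forall (y : S) x B A, T y x -> pr x (ev dead T B A) = pr (val y) (ev dead T B A)
}.

Variables (dead1 dead2 : set E) (T1 T2 : S -> set E) (eta rho : R).
Hypotheses (m1 : trace_model dead1 T1) (m2 : trace_model dead2 T2).
Hypotheses (eta_ge0 : 0 <= eta) (rho_ge0 : 0 <= rho) (eta_rho : 1 <= (1 + eta) * (1 - rho)).
Hypothesis p12 : forall y w, nrm w = u.+1 ->
  hp (trZ dead1 T1) (T1 y) w <= (1 + eta) * hp (trZ dead2 T2) (T2 y) w.
Hypotheses (c1_rho : forall w, nrm w = u.+1 -> capture dead1 T1 w <= rho).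
Hypotheses (c2_rho : forall w, nrm w = u.+1 -> capture dead2 T2 w <= rho).

Lemma nrm_bdry_box x : x \in bdry (box u) -> nrm x = u.+1.
Proof.
move=> xb; have := bdry_notin xb; rewrite mem_box -ltnNge => ux.
have [t [s [tu xE]]] := bdry_exists xb; rewrite mem_box in tu.
by apply/eqP; rewrite eqn_leq ux andbT xE; apply: leq_trans (nrm_addstep _ _) _.
Qed.

Lemma trZ_box dead T x : trace_model dead T -> (nrm x <= u.+1)%N -> trZ dead T x <-> x \in S.
Proof.
move=> m xu; split => [[[y /(tm_box m y xu) ->]|/(tm_alive m xu)]//|xS].
  exact: valP.
by left; exists [` xS]%fset; apply/(tm_box m).
Qed.

Lemma escape_compare y : escape dead1 T1 y <= (1 + eta) * escape dead2 T2 y.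
Proof.
rewrite /escape -avgZ; apply: (le_avg s0) => s.
have ySu : (nrm (val y + st s)%R <= u.+1)%N.
  by apply: leq_trans (nrm_addstep _ _) _; rewrite ltnS.
pose Dm := [seq x <- box u | x \notin S].
have mD x : (x \in Dm) = (x \notin S) && (nrm x <= u)%N by rewrite mem_filter mem_box.
have cS dead T x : trace_model dead T -> x \in S -> (nrm x <= u.+1)%N -> capture dead T x = 1.
  move=> m xS xu; rewrite /capture (hp_in countE); last exact/(trZ_box m xu).
  by rewrite asboolT//; exists [` xS]%fset; apply/(tm_box m).
have bS x : x \in bdry Dm -> (x \in S /\ (nrm x <= u.+1)%N) \/ nrm x = u.+1.
  move=> xb; have [t [s' [tD xE]]] := bdry_exists xb; move: tD; rewrite mD => /andP[_ tu].
  have xu : (nrm x <= u.+1)%N by rewrite xE; apply: leq_trans (nrm_addstep _ _) _.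
  have := bdry_notin xb; rewrite mD negb_and negbK => /orP[xS|]; first by left.
  by rewrite -ltnNge => ux; right; apply/eqP; rewrite eqn_leq xu.
have bdc x : (x \in S /\ (nrm x <= u.+1)%N) \/ nrm x = u.+1 ->
    1 - capture dead1 T1 x <= (1 + eta) * (1 - capture dead2 T2 x).
  move=> [[xS xu]|xu]; first by rewrite !cS// !subrr mulr0.
  apply: (@le_trans _ _ 1); first by rewrite gerBl hp_ge0.
  apply: le_trans eta_rho _; rewrite ler_wpM2l ?addr_ge0// lerD2l lerN2.
  exact: c2_rho.
have [xD|] := boolP (val y + st s \in Dm).
  apply: (@max_principle_le R int d Dm (fun x => 1 - capture dead1 T1 x)
    (fun x => (1 + eta) * (1 - capture dead2 T2 x)) _ _ _ xD) => [x|x /bS/bdc//].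
  rewrite mD => /andP[xS xu]; have xu1 := leqW xu.
  rewrite avgZ !avgB !(avg_cst s0) -!(hp_step countE) ?subrr ?mulrBr ?subrr//.
    by move/(trZ_box m2 xu1); exact/negP.
  by move/(trZ_box m1 xu1); exact/negP.
rewrite mD negb_and negbK => /orP[xS|]; first by apply: bdc; left.
by rewrite -ltnNge => ux; apply: bdc; right; apply/eqP; rewrite eqn_leq ySu.
Qed.

Lemma trace_weight_compare (j : nat) : exists2 g : {set S} -> R,
  (forall A, 0 <= g A /\
    trace_weight dead1 T1 A <= (1 + eta) ^+ j.+1 * trace_weight dead2 T2 A + g A) &
  \sum_A g A <= #|{: S}|%:R * rho ^+ j.
Proof.
pose p dead T (y : S) (w : seq_sub (bdry (box u))) := hp (trZ dead T) (T y) (val w).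
pose f dead (T : S -> set E) (y : S) (B A : {set S}) := pr (val y) (ev dead T B A).
have sump dead T w : trace_model dead T -> \sum_y p dead T y w = capture dead T (val w).
  by move=> m; rewrite sum_hp_class//; exact: tm_disj m.
have wu (w : seq_sub (bdry (box u))) : nrm (val w : E) = u.+1 by case: w => w wb /=; exact: nrm_bdry_box.
have fr dead T : trace_model dead T -> forall y B A, f dead T y B A =
    \sum_t \sum_w kappa R y t w * ((finset.setU B t == A)%:R * (1 - \sum_y' p dead T y' w) +
    \sum_y' p dead T y' w * f dead T y' (finset.setU B t) A).
  move=> m y B A.
  exact: (trace_rec S_box (tm_box m) (tm_disj m) (tm_alive m) (tm_inv m)).
have [g fg [g0 gs]] := @trace_compare R _ _ _ (@finset.setU _) (@kappa R d u S) (p dead1 T1) (p dead2 T2)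
  (f dead1 T1) (f dead2 T2) (@kappa_ge0 R d u S) (kappa_le1 R S_box)
  (fun y w => hp_ge0 _ _ _) eta rho eta_ge0 (fun y w => p12 y (wu w))
  (fun w => ltac:(rewrite !sump//; apply: le_trans (le_trans _ eta_rho) _;
     [by rewrite gerBl hp_ge0|rewrite ler_wpM2l ?addr_ge0// lerD2l lerN2; exact/c2_rho/wu]))
  (fun w => ltac:(rewrite sump//; exact/c1_rho/wu)) (fr _ _ m1) (fr _ _ m2)
  (fun _ _ _ => prb_ge0 _ _) (fun _ _ _ => prb_ge0 _ _)
  (fun y B => eq_leR (sum_ev _ _ _ _ _)) rho_ge0
  (fun w => eq_ind_r (fun a => a <= 1) (hp_le1 countE _ _ _) (sump _ _ w m2)) j.
exists (fun A => \sum_y escape dead1 T1 y * g y finset.set0 A).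
  move=> A; split; first by apply: sumr_ge0 => y _; rewrite mulr_ge0 ?escape_ge0.
  rewrite /trace_weight mulr_sumr -big_split/=; apply: ler_sum => y _.
  apply: le_trans (ler_wpM2l (escape_ge0 _ _ _) (fg _ _ _)) _.
  rewrite mulrDr lerD2r exprSr -/(f dead2 T2 y finset.set0 A).
  have P0 : 0 <= (1 + eta) ^+ j by rewrite exprn_ge0// addr_ge0.
  have F0 : 0 <= f dead2 T2 y finset.set0 A by exact: prb_ge0.
  move: (escape_compare y) (_ ^+ j) P0 (f _ _ _ _ _) F0.
  move: (escape _ _ _) (escape _ _ _) (1 + eta) => a b e ab P P0 F F0.
  have := ler_wpM2r (mulr_ge0 P0 F0) ab; congr (_ <= _); ring.
rewrite exchange_big/=; apply: (@le_trans _ _ (\sum_(y : S) rho ^+ j)).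
  apply: ler_sum => y _; rewrite -mulr_sumr; apply: le_trans (gs y finset.set0).
  by rewrite ler_piMl ?escape_le1// sumr_ge0.
by rewrite sumr_const -[leLHS]mulr_natl.
Qed.

End two_models.

Section local_compare.
Variables (R : realType) (d : nat).
Hypothesis d_ge2 : (2 <= d)%N.
Local Notation E := (lattice int d).
Local Notation st := (@step int d).
Local Notation s0 := ((None, false) : direction d).
Local Notation hp := (@hp R _ _ s0 st).
Local Notation pr := (@pr R _ _ s0 st).
Local Notation avg := (@avg R _ _ st).
Local Notation D := (d.+1%:R : R).
Local Notation radial := (@radial R d).
Local Notation nsq := (@nsq R d).
Local Notation countE := (countable_latticeZ d).
Variables (s1 s2 A R0 : R).
Hypotheses (s1_gt0 : 0 < s1) (A_ge1 : 1 <= A) (s2_gt0 : 0 < s2).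
Hypothesis super : forall x, avg (radial A s1) x <= radial A s1 x.
Hypothesis sub : forall x, R0 <= nsq x -> radial 1 s2 x <= avg (radial 1 s2) x.
Hypothesis R0_ge : 36 <= R0.
Variables (n0 u1 u v : nat) (S : {fset E}).
Hypotheses (S_box : forall y, y \in S -> (nrm y <= n0)%N).
Hypotheses (n0u1 : (n0 < u1)%N) (u1u : (u1.+1 < u)%N) (uv : (u.+1 < v)%N).
Variables (N M h : nat) (zh : int).
Hypotheses (M_gt0 : (0 < M)%N) (uN : (u <= N)%N) (vN : (v.+1 + v.+1 <= N)%N).
Hypothesis vh : (`|zh| + v < h)%N.

Definition dead_cyl : set E := [set x | (h <= `|(x.2 + zh)%R|)%N].
Definition T_cyl (y : S) : set E := [set x | equiv N x (val y)].
Definition T_full (y : S) : set E := [set val y].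

Let Sv (y : E) : y \in S -> (nrm y <= v)%N.
Proof. by move=> /S_box; lia. Qed.

Lemma full_tm : trace_model R u (set0 : set E) T_full.
Proof.
split=> [y x _|y y' x -> /val_inj//|x _ []|y x B A' ->//]; split => //.
Qed.

Let visits_period k (y : S) w : visits dead_cyl T_cyl y (fun n => w n + period N k) <-> visits dead_cyl T_cyl y w.
Proof.
by split=> -[n [Tn nd]]; exists n; (split=> [|j jn]; [exact/(equivD N k)|
  have := nd j jn; rewrite /dead_cyl /= addr0]).
Qed.

Lemma cyl_tm : trace_model R u dead_cyl T_cyl.
Proof.
have uv1 : (u.+1 <= v)%N by lia.
split=> [y x xu|y y' x [k xk] [k' xk']|x xu|y x B A' [k ->]].
- split => [|->]; last by exists 0; rewrite /period scaler0 addr0.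
  by move=> xy; have := @equiv_in_box _ v N vN _ _ (leq_trans xu uv1) (Sv (valP y)) xy.
- apply: val_inj; apply: (equiv_in_box vN (Sv (valP y)) (Sv (valP y'))).
  by exists (k' - k); rewrite periodD periodN addrA -xk' xk addrK.
- by rewrite /dead_cyl/= => H; have := nrm_coord x None => /=; move: x.2 vh H => a; lia.
rewrite (@pr_lift R E E _ s0 st st (fun x => x + period N k)) => [|z s]; last by rewrite addrAC.
congr (pr _ _); apply/seteqP; split => w; rewrite /ev/= => <-; congr (_ :|: _);
  by apply/setP => z; rewrite !inE; apply: asbool_equiv_eq; rewrite visits_period.
Qed.

Definition harnack_cst : R := point_ub d s1 A u1 u /
  (escape_lb s1 A * (point_lb d s2 R0 u1 u v - point_ub d s1 A u1 u * box_ub d s1 A n0 u1.+1)).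

Variables (q eta : R).
Hypothesis lb_gt0 :
  0 < point_lb d s2 R0 u1 u v - point_ub d s1 A u1 u * box_ub d s1 A n0 u1.+1.
Hypotheses (q_half : q <= 2^-1) (q_full : box_ub d s1 A u v.+1 <= q)
  (q_cyl : lift_q d s1 A u v N M h <= q).
Hypotheses (eta_ge : 2 * q * harnack_cst <= eta) (eta_le1 : eta <= 1).
Local Notation rho := (2 * box_ub d s1 A n0 u.+1).
Hypothesis eta_rho : 1 <= (1 + eta) * (1 - rho).

Let n0u : (n0 < u)%N. Proof. exact: ltn_trans n0u1 (ltn_trans (ltnSn _) u1u). Qed.
Let q0 : 0 <= q.
Proof. by apply: le_trans q_full; rewrite divr_ge0 ?powR_ge0. Qed.
Let S_box' y : y \in (S : seq E) -> (nrm y <= n0)%N. Proof. exact: S_box. Qed.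

Let kap0 : 0 <= harnack_cst.
Proof.
have f0 : 0 < radial A s1 0 by exact: f1_gt0.
rewrite /harnack_cst; apply: divr_ge0; first by rewrite divr_ge0 ?powR_ge0// ltW.
by rewrite mulr_ge0 ?(ltW lb_gt0)// ltW// escape_lb_gt0.
Qed.
Let eta0 : 0 <= eta.
Proof. by apply: le_trans eta_ge; rewrite mulr_ge0// mulr_ge0. Qed.

Local Notation pV y := (hp [set z : E | z \in (S : seq E) \/ (v < nrm z)%N] [set y]).

Let hk y w w' : y \in (S : seq E) -> (u <= nrm w <= u.+1)%N -> (u <= nrm w' <= u.+1)%N ->
  pV y w' <= harnack_cst * pV y w.
Proof.
move=> yS wu w'u; have H := harnack d_ge2 s1_gt0 A_ge1 s2_gt0 super sub R0_ge S_box' n0u1 u1u uv yS wu w'u.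
have e0 := escape_lb_gt0 s1_gt0 A_ge1.
by rewrite /harnack_cst mulrAC ler_pdivlMr ?mulr_gt0// mulrC.
Qed.

Let pV_hit w : nrm w = u.+1 -> \sum_(y : S) pV (val y) w <= box_ub d s1 A n0 u.+1.
Proof.
move=> wu; have -> : \sum_(y : S) pV (val y) w =
    hp [set z : E | z \in (S : seq E) \/ (v < nrm z)%N] [set` (S : seq E)] w.
  rewrite (hp_seq countE)//; [|exact: fset_uniq].
  by rewrite [RHS](big_seq_fsetE _ _ predT).
pose g := (D * n0%:R ^+ 2 + A) `^ (- s1).
have g0 : 0 < g by apply: powR_gt0; have := sqr_ge0 (n0%:R : R); have : 0 <= D by []; move: A_ge1; nra.
apply: (@le_trans _ _ (radial A s1 w / g)); last first.
  by rewrite ler_pM2r ?invr_gt0// f1_le_nrm// wu.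
have f0 x : 0 <= radial A s1 x / g by rewrite divr_ge0 ?(ltW g0)// ltW// f1_gt0.
apply: (hp_le_super countE (Dm := [set x | ~ (x \in (S : seq E) \/ (v < nrm x)%N)])
  (F := fun x => radial A s1 x / g)) => //.
- move=> x nx; apply: (@le_trans _ _ (avg (fun x => g^-1 * radial A s1 x) x)).
    apply: (le_avg s0) => s; rewrite mulrC; case: asboolP => // nD.
    have [xS|xS] := boolP (x + st s \in (S : seq E)).
      apply: le_trans (hp_le1 countE _ _ _) _; rewrite mulrC; apply: box_superE => //.
      exact: S_box.
    rewrite (hp_in countE) ?asboolF//; [by rewrite mulrC f0|exact/negP|].
    exact: contrapT.
  by rewrite avgZ mulrC ler_wpM2r ?invr_ge0 ?(ltW g0).
by move=> [/S_box|]; rewrite wu; [rewrite leqNgt (ltn_trans n0u)|rewrite ltnNge (ltnW uv)].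
Qed.

Let model_sandwich Z T U F q' dead (TS : S -> set E) y w :
  box_model u v (S : seq E) Z T U F q' -> q' <= q -> 0 <= q' ->
  (forall y : S, TS y = T (val y)) -> (forall x, trZ dead TS x <-> Z x) ->
  nrm w = u.+1 ->
  pV (val y) w <= hp (trZ dead TS) (TS y) w <= (1 + eta) * pV (val y) w.
Proof.
move=> m q'q q'0 TST ZE wu.
have -> : hp (trZ dead TS) (TS y) w = hp Z (T (val y)) w by apply: eq_hp => // z _; rewrite TST.
apply/andP; split; first by apply: (model_lb d_ge2 S_box' n0u uv m q'0 (le_trans q'q q_half) (valP y)); rewrite wu ltnW.
apply: le_trans (model_ub d_ge2 S_box' n0u uv m q'0 (le_trans q'q q_half) (valP y) (fun w w' => @hk _ w w' (valP y)) _) _.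
  by rewrite wu leqnSn leqnn.
rewrite ler_wpM2r ?hp_ge0// lerD2l; apply: le_trans eta_ge.
by rewrite ler_wpM2r// ler_wpM2l.
Qed.

Let full_sandwich y w : nrm w = u.+1 ->
  pV (val y) w <= hp (trZ set0 T_full) (T_full y) w <= (1 + eta) * pV (val y) w.
Proof.
move=> wu; have m := full_model d_ge2 s1_gt0 A_ge1 super S_box' n0u uv.
apply: (@model_sandwich _ _ _ _ _ _ T_full y w m) => //.
  by rewrite divr_ge0 ?powR_ge0.
move=> x; split => [[[z ->]|[]]|xS]; first exact: (valP z).
by left; exists [` xS]%fset.
Qed.

Let cyl_sandwich y w : nrm w = u.+1 ->
  pV (val y) w <= hp (trZ dead_cyl T_cyl) (T_cyl y) w <= (1 + eta) * pV (val y) w.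
Proof.
move=> wu; have m := lift_model d_ge2 s1_gt0 A_ge1 super S_box' n0u uv M_gt0 uN vN vh.
apply: (@model_sandwich _ _ _ _ _ _ T_cyl y w m) => //.
  apply: addr_ge0; first by rewrite mulr_ge0// divr_ge0 ?powR_ge0.
  by rewrite divr_ge0 ?sqr_ge0// mulr_ge0// addr_ge0// sqr_ge0.
move=> x; split => [[[z zx]|xd]|[[z zS zx]|xd]].
- by left; exists (val z) => //; exact: valP.
- by right.
- by left; exists [` zS]%fset.
- by right.
Qed.

Let capture_rho dead (TS : S -> set E) : (forall y y' x, TS y x -> TS y' x -> y = y') ->
  (forall y w, nrm w = u.+1 ->
  pV (val y) w <= hp (trZ dead TS) (TS y) w <= (1 + eta) * pV (val y) w) ->
  forall w, nrm w = u.+1 -> capture R dead TS w <= rho.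
Proof.
move=> dT sw w wu; rewrite /capture -sum_hp_class//.
apply: (@le_trans _ _ (\sum_y 2 * pV (val y) w)).
  apply: ler_sum => y _; have /andP[_ /le_trans] := sw y w wu; apply.
  by rewrite ler_wpM2r ?hp_ge0//; move: eta_le1; lra.
by rewrite -mulr_sumr ler_wpM2l// pV_hit.
Qed.

Let compare_gen dead dead' (TS TS' : S -> set E) :
  (forall y w, nrm w = u.+1 ->
    pV (val y) w <= hp (trZ dead TS) (TS y) w <= (1 + eta) * pV (val y) w) ->
  (forall y w, nrm w = u.+1 ->
    pV (val y) w <= hp (trZ dead' TS') (TS' y) w <= (1 + eta) * pV (val y) w) ->
  trace_model R u dead TS -> trace_model R u dead' TS' ->
  (forall y, escape R dead TS y <= (1 + eta) * escape R dead' TS' y) /\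
  forall j, exists2 g : {set S} -> R,
  (forall A, 0 <= g A /\
    trace_weight R dead TS A <= (1 + eta) ^+ j.+1 * trace_weight R dead' TS' A + g A) &
  \sum_A g A <= #|{: S}|%:R * rho ^+ j.
Proof.
move=> sw sw' m m'.
have c := capture_rho (tm_disj m) sw; have c' := capture_rho (tm_disj m') sw'.
have Su (y : S) : (nrm (val y) <= u)%N by exact: leq_trans (S_box (valP y)) (ltnW n0u).
have rho0 : 0 <= rho by rewrite mulr_ge0// divr_ge0 ?powR_ge0.
have p12 y w : nrm w = u.+1 ->
    hp (trZ dead TS) (TS y) w <= (1 + eta) * hp (trZ dead' TS') (TS' y) w.
  move=> wu; have /andP[_ /le_trans] := sw y w wu; apply.
  by rewrite ler_wpM2l ?addr_ge0//; have /andP[] := sw' y w wu.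
split; first by move=> y; apply: (@escape_compare R d u S Su dead dead' TS TS' eta rho).
by move=> j; apply: (@trace_weight_compare R d u S Su dead dead' TS TS' eta rho).
Qed.

Lemma capture_cyl_le (x : E) : (forall j, (`|x.1 0%R j| <= N)%N) -> (v < `|x.2|)%N ->
  ~ dead_cyl x -> capture R dead_cyl T_cyl x <= q.
Proof.
move=> xN xv xd.
have m := lift_model d_ge2 s1_gt0 A_ge1 super S_box' n0u uv M_gt0 uN vN vh.
have far k : (v < nrm (x - period N k)%R)%N.
  by apply: leq_trans (nrm_coord _ None); rewrite coordB /= subr0.
have nZ : ~ lift_Z (S : seq E) N h zh x.
  move=> [[y yS [k xE]]|//]; have := far k; rewrite xE addrK ltnNge.
  by rewrite (leq_trans (S_box yS) (ltnW (ltn_trans n0u (ltnW uv)))).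
have nU : ~ per_box u N x.
  by move=> [k]; rewrite leqNgt (ltn_trans (ltnW uv) (far k)).
have Fq : lift_F s1 A u N M h zh x <= lift_q d s1 A u v N M h by exact: (lift_F_le d_ge2 s1_gt0 A_ge1 n0u uv M_gt0 uN vN vh far xN).
apply: le_trans (le_trans Fq q_cyl).
rewrite -[leLHS]/(hp _ _ _) (_ : hp _ _ _ =
    hp (lift_Z (S : seq E) N h zh) [set z | exists2 y, y \in (S : seq E) & equiv N z y] x).
  exact: (model_hit_le m nU nZ).
apply: eq_hp => z; last first.
  by move=> _; split=> [[y zy]|[y yS zy]]; [exists (val y) => //; exact: valP|exists [` yS]%fset].
split=> [[[y zy]|zd]|[[y yS zy]|zd]]; [left|by right|left|by right].
  - by exists (val y) => //; exact: valP.
- by exists [` yS]%fset.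
Qed.

Theorem local_compare :
  ((forall y, escape R dead_cyl T_cyl y <= (1 + eta) * escape R set0 T_full y) /\
   (forall y, escape R set0 T_full y <= (1 + eta) * escape R dead_cyl T_cyl y)) /\
  forall j, exists2 g : {set S} -> R,
    (forall A, [/\ 0 <= g A,
    trace_weight R dead_cyl T_cyl A <= (1 + eta) ^+ j.+1 * trace_weight R set0 T_full A + g A &
    trace_weight R set0 T_full A <= (1 + eta) ^+ j.+1 * trace_weight R dead_cyl T_cyl A + g A]) &
    \sum_A g A <= 2 * (#|{: S}|%:R * rho ^+ j).
Proof.
have [e1 t1] := compare_gen cyl_sandwich full_sandwich cyl_tm full_tm.
have [e2 t2] := compare_gen full_sandwich cyl_sandwich full_tm cyl_tm.
split; first by [].
move=> j; have [g1 h1 sg1] := t1 j; have [g2 h2 sg2] := t2 j.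
exists (fun A => g1 A + g2 A); last by rewrite big_split/= mulr_natl mulr2n lerD.
move=> B; have [a1 b1] := h1 B; have [a2 b2] := h2 B.
by split; [rewrite addr_ge0|apply: le_trans b1 _|apply: le_trans b2 _]; rewrite ?lerD2l ?lerDl ?lerDr.
Qed.

End local_compare.

Section growth.
Variable R : realType.
Implicit Types (C t : R) (N : nat).

Lemma near_powR C t : 0 < t -> \forall N \near \oo, C <= N%:R `^ t.
Proof.
move=> t0; pose a := (Num.max C 0) `^ t^-1.
have : \forall N \near \oo, a <= N%:R by exact: nbhs_infty_ger.
apply: filterS => N aN; apply: (@le_trans _ _ (Num.max C 0)); first by rewrite le_max lexx.
have m0 : 0 <= Num.max C 0 by rewrite le_max lexx orbT.
have -> : Num.max C 0 = a `^ t by rewrite /a -powRrM mulVf ?gt_eqF// powRr1.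
by apply: ge0_ler_powR; rewrite ?nnegrE ?powR_ge0// ltW.
Qed.

Lemma hN_bounds N : (N%:R * (2 + ln N%:R ^+ 2) - 1 < (hN R N)%:R :> R) /\
  ((hN R N)%:R <= N%:R * (2 + ln N%:R ^+ 2) :> R) /\ (2 * N <= hN R N)%N.
Proof.
have n0 : 0 <= N%:R * (2 + ln N%:R ^+ 2) :> R by rewrite mulr_ge0// addr_ge0// sqr_ge0.
have /andP[a b] := truncn_itv n0; split; last split => //.
  by rewrite ltrBlDr natr1.
rewrite -ltnS -(ltr_nat R); apply: le_lt_trans b; rewrite natrM mulrC ler_wpM2l//.
by rewrite lerDl sqr_ge0.
Qed.

Lemma near_ln_sqr t : 0 < t -> \forall N \near \oo, 2 + ln N%:R ^+ 2 <= N%:R `^ t :> R.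
Proof.
move=> t0; have t4 : 0 < t / 4 by rewrite divr_gt0.
near=> N; have N1 : 1 <= N%:R :> R by near: N; exact: nbhs_infty_ger.
have N0 : 0 < N%:R :> R by exact: lt_le_trans N1.
set p := N%:R `^ (t / 4).
have p1 : 1 <= p by rewrite /p; near: N; exact: near_powR.
have lnp : t / 4 * ln N%:R <= p.
  rewrite -ln_powR; apply: le_trans (ltW (ltr_pwDl _ (lexx _))) _ => //.
  by rewrite -/p -lerBrDl; have := @le_ln1Dx R (p - 1); rewrite addrCA subrr addr0; apply; move: p1; lra.
have p2 : p ^+ 2 = N%:R `^ (t / 2).
  by rewrite -powR_mulrn ?powR_ge0// /p -powRrM; congr (_ `^ _); lra.
have C1 : 2 + 16 / t ^+ 2 <= p ^+ 2.
  by rewrite p2; near: N; apply: near_powR; rewrite divr_gt0.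
have -> : N%:R `^ t = p ^+ 2 * p ^+ 2.
  rewrite -!powR_mulrn ?powR_ge0// /p -!powRrM -powRD; last by rewrite (gt_eqF N0) implybT.
  by congr (_ `^ _); lra.
have l0 : 0 <= ln N%:R :> R by rewrite ln_ge0.
have l2 : ln N%:R <= 4 / t * p by rewrite mulrAC ler_pdivlMr//; lra.
have l3 : ln N%:R ^+ 2 <= 16 / t ^+ 2 * p ^+ 2.
  have := lerXn2r 2 l0 (le_trans l0 l2) l2; move/le_trans; apply.
  by rewrite exprMn exprMn exprVn; lra.
apply: (@le_trans _ _ ((2 + 16 / t ^+ 2) * p ^+ 2)); last by rewrite ler_wpM2r// sqr_ge0.
rewrite mulrDl; apply: lerD => //; have : 1 <= p ^+ 2 by rewrite exprn_ege1.
lra.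
Unshelve. all: by end_near. Qed.

End growth.

Section scales.
Variables (R : realType) (d : nat).
Local Notation D := (d.+1%:R : R).
Variables (s A : R).
Hypotheses (A1 : 1 <= A) (s0 : 4^-1 <= s).

Let Dgt0 : 1 <= D. Proof. by rewrite ler1n. Qed.

Let s_gt0 : 0 < s. Proof. by move: s0; lra. Qed.

Lemma powR_mono (x y r : R) : 0 <= r -> 0 <= x -> x <= y -> x `^ r <= y `^ r.
Proof. by move=> r0 x0 xy; apply: ge0_ler_powR; rewrite ?nnegrE// (le_trans x0). Qed.

Lemma powR_anti (x y r : R) : 0 <= r -> 0 < x -> x <= y -> y `^ (- r) <= x `^ (- r).
Proof.
move=> r0 x0 xy; rewrite !powRN lef_pV2 ?posrE ?powR_gt0//; first exact: powR_mono (ltW x0) xy.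
exact: lt_le_trans xy.
Qed.

Lemma box_ub_le (a b : nat) (y : R) : (0 < a)%N -> 0 <= y -> a%:R <= y * b%:R ->
  box_ub d s A a b <= ((D + A) * y ^+ 2) `^ s.
Proof.
move=> a0 y0 ayb.
have a1 : 1 <= a%:R :> R by rewrite ler1n.
have b0 : 0 < b%:R :> R.
  by rewrite lt_neqAle ler0n andbT; apply/eqP => b0; move: ayb; rewrite -b0 mulr0; lra.
have Aa : 0 < D * a%:R ^+ 2 + A by have := sqr_ge0 (a%:R : R); move: Dgt0 A1; nra.
have Bb : 0 < b%:R ^+ 2 + A by have := sqr_ge0 (b%:R : R); move: A1; lra.
rewrite /box_ub !powRN invrK -powR_inv1 ?powR_ge0// powRAC -powRM ?powR_ge0 ?(ltW Aa)//.
rewrite powR_inv1 ?(ltW Bb)//; apply: powR_mono => //; first exact: ltW.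
  by rewrite mulr_ge0 ?invr_ge0 ?(ltW Aa) ?(ltW Bb).
rewrite mulrC ler_pdivrMr//; apply: (@le_trans _ _ ((D + A) * a%:R ^+ 2)).
  by have := exprn_ege1 2 a1; move: A1; nra.
rewrite -mulrA ler_wpM2l//; first by move: Dgt0 A1; lra.
have := lerXn2r 2 (ler0n _ _) (le_trans (ler0n _ _) ayb) ayb; rewrite exprMn => /le_trans; apply.
by rewrite ler_wpM2l ?sqr_ge0// lerDl; move: A1; lra.
Qed.

Lemma box_ub_powR (a b : nat) (x c t : R) : (0 < a)%N -> 1 <= x -> 0 <= c -> 0 <= t ->
  a%:R <= c * x `^ (- t) * b%:R ->
  box_ub d s A a b <= ((D + A) * c ^+ 2) `^ s * x `^ (- (t / 2)).
Proof.
move=> a0 x1 c0 t0 /(box_ub_le a0) H; apply: le_trans (H _) _; first by rewrite mulr_ge0 ?powR_ge0.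
have DA : 0 <= D + A by move: Dgt0 A1; lra.
rewrite exprMn mulrA powRM ?mulr_ge0 ?sqr_ge0 ?exprn_ge0 ?powR_ge0// ler_wpM2l ?powR_ge0//.
rewrite -powR_mulrn ?powR_ge0// -!powRrM; apply: ler_powR => //.
by move: s0 t0; nra.
Qed.

End scales.

Section local_trace.
Variables (R : realType) (d : nat).
Hypothesis d_ge2 : (2 <= d)%N.
Local Notation E := (lattice int d).
Local Notation D := (d.+1%:R : R).
Local Notation countE := (countable_latticeZ d).

Lemma in_linf_ball (N : nat) (e : R) (y : E) : 0 < e -> e < 1 ->
  linf_ball (N%:R `^ (1 - e)) y -> (nrm y <= Num.truncn (N%:R `^ (1 - e) : R))%N.
Proof.
move=> e0 e1 [y1 y2]; apply/nrmP => i; rewrite (@truncn_ge_nat R) ?powR_ge0//.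
case: i => [j|] /=; [have := y1 j|have := y2]; apply: le_trans;
  by rewrite -[leLHS]/(Posz _)%:~R abszE intr_norm.
Qed.

Lemma card_ball (n0 : nat) (S : {fset E}) : (forall y, y \in S -> (nrm y <= n0)%N) ->
  (#|{: S}| <= n0.*2.+1 ^ d.+1)%N.
Proof.
move=> Sn; rewrite -cardfE; apply: leq_trans (size_box d n0); apply: uniq_leq_size; first exact: fset_uniq.
by move=> y yS; rewrite mem_box; exact: Sn.
Qed.

Lemma exprD1_le (e : R) n : 0 <= e -> e <= 1 -> (1 + e) ^+ n <= 1 + 2 ^+ n * e.
Proof.
move=> e0 e1; suff : (1 + e) ^+ n <= 1 + (2 ^+ n - 1) * e.
  by move/le_trans; apply; rewrite lerD2l ler_wpM2r// gerBl.
elim: n => [|n IH]; first by rewrite !expr0 subrr mul0r addr0.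
rewrite exprS; apply: le_trans (ler_wpM2l _ IH) _; first lra.
have : 1 <= 2 ^+ n :> R by rewrite exprn_ege1// ler1n.
rewrite exprS; move: (2 ^+ n) => p p1.
have : (p - 1) * e * e <= (p - 1) * e by rewrite ler_piMr// mulr_ge0// subr_ge0.
lra.
Qed.

Section harnack_scale.
Variables (s1 s2 A R0 : R) (n0 u1 u v : nat).
Hypotheses (A1 : 1 <= A) (s1_ge : 4^-1 <= s1) (s2_ge : 2^-1 <= s2).
Hypotheses (u0 : (0 < u)%N) (u1u : (4 * u1.+1 <= u)%N) (uv : (6 * d.+1 * u <= v)%N).
Local Notation U := ((u%:R : R) ^+ 2).
Definition ub_cst : R := (4 * A) `^ s1.
Definition lb_cst : R := (2 * D)^-1 ^+ (Num.truncn R0).+1 * ((5 * D) `^ (- s2) / 2).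

Let U1 : 1 <= U. Proof. by rewrite exprn_ege1// ler1n. Qed.
Let D1 : 1 <= D. Proof. by rewrite ler1n. Qed.

Lemma point_ub_scale : point_ub d s1 A u1 u <= ub_cst * U `^ (- s1).
Proof.
have s10 : 0 <= s1 by move: s1_ge; lra.
have A0 : 0 < A by move: A1; lra.
have U0 : 0 < U by move: U1; lra.
have -> : ub_cst * U `^ (- s1) = (U / 4) `^ (- s1) * A `^ s1.
  have q4 : (4^-1 : R) `^ (- s1) = 4 `^ s1 by rewrite -[4^-1]powR_inv1// -powRrM mulrNN mul1r.
  have q0 : 0 <= 4^-1 :> R by rewrite invr_ge0.
  by rewrite /ub_cst (powRM s1 (ler0n _ 4) (ltW A0)) (powRM (- s1) (ltW U0) q0) q4; ring.
rewrite /point_ub /radial (_ : nsq R 0 = 0) ?add0r; last first.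
  by rewrite /nsq big1// => i _; rewrite coord0 expr0n.
rewrite [_^-1](_ : _ = A `^ s1); last by rewrite powRN invrK.
rewrite ler_wpM2r ?powR_ge0//; apply: powR_anti => //; first by rewrite divr_gt0.
have : u%:R / 2 <= (u - u1.+1)%N%:R :> R.
  rewrite ler_pdivrMr// natrB; last by lia.
  by have := ler0n R u1.+1; move: u1u; rewrite -(ler_nat R) natrM; lra.
have : 0 <= u%:R / 2 :> R by rewrite divr_ge0.
by move: A0; nra.
Qed.

Lemma point_lb_scale : lb_cst * U `^ (- s2) <= point_lb d s2 R0 u1 u v.
Proof.
have s20 : 0 <= s2 by move: s2_ge; lra.
have U0 : 0 < U by move: U1; lra.
have D0 : 0 < D by move: D1; lra.
rewrite /lb_cst /point_lb -mulrA ler_wpM2l ?exprn_ge0 ?invr_ge0 ?mulr_ge0//.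
have a1 : (5 * D * U) `^ (- s2) <= (D * (u + u1 + 2)%N%:R ^+ 2 + 1) `^ (- s2).
  apply: powR_anti => //.
  have : (u + u1 + 2)%N%:R <= 2 * u%:R :> R by rewrite -natrM ler_nat; lia.
  have : 0 <= (u + u1 + 2)%N%:R :> R by [].
  move: ((_ + _)%N%:R : R) (u%:R : R) U1 D1 => a b U1' D1' a0 ab.
  have ab2 : a ^+ 2 <= 4 * b ^+ 2 by nra.
  have := ler_wpM2l (le_trans ler01 D1') ab2.
  have : 1 <= D * b ^+ 2 by rewrite mulr_ege1.
  by lra.
have a2 : ((v - u)%N%:R ^+ 2 + 1) `^ (- s2) <= (20 * D * U) `^ (- s2).
  apply: powR_anti => //; first by apply: mulr_gt0 => //; exact: mulr_gt0.
  have : 5 * D * u%:R <= (v - u)%N%:R :> R.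
    rewrite -!natrM ler_nat; move: uv; nia.
  have : 0 <= u%:R :> R by [].
  move: ((_ - _)%N%:R : R) (u%:R : R) => a b b0 ab.
  have h1 : (5 * D * b) ^+ 2 <= a ^+ 2.
    by rewrite lerXn2r ?nnegrE// ?(le_trans _ ab)// !mulr_ge0.
  have h2 : 20 * D * b ^+ 2 <= (5 * D * b) ^+ 2.
    by rewrite 2!exprMn ler_wpM2r ?sqr_ge0//; move: D1; nra.
  by lra.
have a3 : (20 * D * U) `^ (- s2) <= 2^-1 * (5 * D * U) `^ (- s2).
  rewrite (_ : 20 * D * U = 4 * (5 * D * U)); last by ring.
  have X0 : 0 <= 5 * D * U by apply/ltW/mulr_gt0 => //; exact: mulr_gt0.
  rewrite (powRM (- s2) (ler0n _ 4) X0).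
  rewrite ler_wpM2r ?powR_ge0//.
  apply: (@le_trans _ _ (4 `^ (- 2^-1))); first by apply: ler_powR; rewrite ?lerN2// ler1n.
  rewrite powRN lef_pV2 ?posrE ?powR_gt0// powR12_sqrt// (_ : 4 = 2 ^+ 2) ?sqrtr_sqr ?ger0_norm//.
  by ring.
rewrite [(5 * D * U) `^ _]powRM in a1 a3 *; [|by rewrite mulr_ge0|exact: sqr_ge0].
by move: a1 a2 a3; lra.
Qed.

Lemma lb_cst_gt0 : 0 < lb_cst.
Proof.
have D0 : 0 < D by move: D1; lra.
by rewrite /lb_cst mulr_gt0 ?exprn_gt0 ?invr_gt0 ?mulr_gt0 ?powR_gt0 ?mulr_gt0.
Qed.

Variable b : R.
Hypothesis s12 : s1 <= s2.
Hypothesis b_ge : box_ub d s1 A n0 u1.+1 <= b.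
Hypothesis b_small : ub_cst * U `^ (s2 - s1) * b <= lb_cst / 2.

Lemma harnack_scale :
  0 < point_lb d s2 R0 u1 u v - point_ub d s1 A u1 u * box_ub d s1 A n0 u1.+1 /\
  harnack_cst d s1 s2 A R0 n0 u1 u v <=
    ub_cst / (escape_lb s1 A * (lb_cst / 2)) * U `^ (s2 - s1).
Proof.
have A0 : 0 < A by move: A1; lra.
have s10 : 0 < s1 by move: s1_ge; lra.
have U0 : 0 < U by move: U1; lra.
have lc := lb_cst_gt0.
have e0 : 0 < escape_lb s1 A by exact: escape_lb_gt0.
have UE : U `^ (- s1) = U `^ (s2 - s1) * U `^ (- s2).
  by rewrite -powRD ?(gt_eqF U0) ?implybT//; congr (_ `^ _); ring.
have b0 : 0 <= b by apply: le_trans b_ge; rewrite divr_ge0 ?powR_ge0.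
have p0 : 0 < U `^ (- s2) by exact: powR_gt0.
have c1 : lb_cst / 2 * U `^ (- s2) <=
    point_lb d s2 R0 u1 u v - point_ub d s1 A u1 u * box_ub d s1 A n0 u1.+1.
  have H : point_ub d s1 A u1 u * box_ub d s1 A n0 u1.+1 <= ub_cst * U `^ (- s1) * b.
    apply: ler_pM => //; [|by rewrite divr_ge0 ?powR_ge0|exact: point_ub_scale].
    by rewrite divr_ge0 ?powR_ge0.
  have : ub_cst * U `^ (- s1) * b <= lb_cst / 2 * U `^ (- s2).
    by rewrite UE mulrA mulrAC ler_wpM2r// ltW.
  by have := point_lb_scale; move: H; lra.
have c2 : 0 < lb_cst / 2 * U `^ (- s2) by rewrite mulr_gt0// divr_gt0.
split; first exact: lt_le_trans c1.
rewrite /harnack_cst ler_pdivrMr; last by rewrite mulr_gt0//; exact: lt_le_trans c1.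
apply: le_trans point_ub_scale _; rewrite UE.
apply: (@le_trans _ _ (ub_cst / (escape_lb s1 A * (lb_cst / 2)) * U `^ (s2 - s1) *
    (escape_lb s1 A * (lb_cst / 2 * U `^ (- s2))))).
  rewrite le_eqVlt; apply/orP; left; apply/eqP; field.
  by rewrite !gt_eqF.
rewrite ler_wpM2l//; last by rewrite ler_wpM2l// ltW.
by rewrite mulr_ge0 ?powR_ge0// divr_ge0 ?powR_ge0// mulr_ge0 ?(ltW e0)// divr_ge0// ltW.
Qed.

End harnack_scale.

Theorem local_trace (eps : R) (P : nat) : 0 < eps -> eps < 1 ->
  \forall N \near \oo, forall (S : {fset E}) (zh : int),
  (forall y, y \in S -> linf_ball (N%:R `^ (1 - eps)) y) -> (`|zh|%N.*2 <= N)%N ->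
  let h := hN R N in let eta := N%:R / h%:R : R in
  let dead := dead_cyl h zh in let T := @T_cyl d S N in
  ((forall y, escape R dead T y <= (1 + eta) * escape R set0 (@T_full d S) y) /\
   (forall y, escape R set0 (@T_full d S) y <= (1 + eta) * escape R dead T y)) /\
  (forall x : E, (forall j, (`|x.1 0%R j| <= N)%N) -> (N < 4 * `|x.2|)%N -> ~ dead x ->
    capture R dead T x <= eta) /\
  exists2 g : {set S} -> R,
    (forall B, [/\ 0 <= g B,
      trace_weight R dead T B <= (1 + eta) * trace_weight R set0 (@T_full d S) B + g B &
      trace_weight R set0 (@T_full d S) B <= (1 + eta) * trace_weight R dead T B + g B]) &
    \sum_B g B <= (N%:R ^+ P)^-1.
Proof.
move=> e0 e1.
have D3 : 3 <= D by rewrite ler_nat.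
pose kap := eps / (16 * D); pose th := kap / 8.
have kap0 : 0 < kap by rewrite divr_gt0 ?mulr_gt0//; lra.
have kapD : kap * D = eps / 16 by rewrite /kap; field; lra.
have kap_le : kap <= eps / 48.
  by rewrite ler_pdivrMr; [move: D3 e0; nra|rewrite mulr_gt0//; lra].
pose s1 := (D - 2 - th) / 2; pose s2 := (D - 2 + th) / 2.
have s1g : 4^-1 <= s1 by rewrite /s1 /th; lra.
have s2g : 2^-1 <= s2 by rewrite /s2 /th; lra.
have s12 : s2 - s1 = th by rewrite /s2 /s1; lra.
have s1_gt0 : 0 < s1 by lra.
have s2_gt0 : 0 < s2 by lra.
have [A A1 super] := @radial_super R d s1 s1_gt0 ltac:(by rewrite /s1 /th; lra).
have [R0 R036 sub] := @radial_sub R d s2 s2_gt0 ltac:(by rewrite /s2 /th; lra).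
pose Cb (c : R) := ((D + A) * c ^+ 2) `^ s1.
have Cb0 c : 0 <= Cb c by exact: powR_ge0.
have lc := lb_cst_gt0 s2 R0; set C1 := ub_cst s1 A; set C2 := lb_cst s2 R0 in lc.
have C10 : 0 <= C1 by exact: powR_ge0.
have esc0 : 0 < escape_lb s1 A by exact: escape_lb_gt0.
pose C4 := C1 / (escape_lb s1 A * (C2 / 2)).
have C40 : 0 <= C4 by rewrite divr_ge0// mulr_ge0 ?(ltW esc0)// divr_ge0// ltW.
pose C6 := 5 ^+ d.+1 * Cb 4 + 2 * d%:R.
have C60 : 0 <= C6 by rewrite addr_ge0 ?mulr_ge0 ?exprn_ge0.
pose C7 := 2 * C6 * C4 + 1.
have C71 : 1 <= C7 by rewrite /C7 lerDr; apply: mulr_ge0 => //; exact: mulr_ge0.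
pose j := (Num.truncn ((P + 2 * d.+1 + 1)%N%:R * 4 / eps)).+1.
have jP : (P + 2 * d.+1 + 1)%N%:R <= j%:R * (eps / 4) :> R.
  rewrite mulrA ler_pdivlMr// -ler_pdivrMr//; apply: ltW.
  by rewrite /j; have /andP[] := @truncn_itv R ((P + 2 * d.+1 + 1)%N%:R * 4 / eps)
    ltac:(by rewrite divr_ge0 ?mulr_ge0 ?ltW).
near=> N; have N3 : 100 * D <= N%:R :> R by near: N; exact: nbhs_infty_ger.
set x : R := N%:R in N3 *.
have x1 : 1 <= x by move: D3 N3; lra.
have x0 : 0 < x by lra.
have xD a b : x `^ (a + b) = x `^ a * x `^ b by rewrite powRD// (gt_eqF x0) implybT.
have xge a b : a <= b -> x `^ a <= x `^ b by move=> ab; apply: ler_powR.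
have xp a : 0 < x `^ a by exact: powR_gt0.
have x_1 : x `^ 1 = x by rewrite powRr1// ltW.
have K1 : 100 * D <= x `^ (eps / 4) by rewrite /x; near: N; apply: near_powR; lra.
have K2 : C1 * (Cb 1 * 2) <= C2 * x `^ (eps / 4 - 2 * th).
  rewrite -ler_pdivrMl// /x; near: N; apply: near_powR; rewrite /th; lra.
have K3 : 2 * C6 <= x `^ kap by rewrite /x; near: N; exact: near_powR.
have K7 : C6 <= x `^ (kap / 2) by rewrite /x; near: N; apply: near_powR; rewrite divr_gt0.
have K4 : 2 ^+ j.+1 * C7 <= x `^ (kap / 4).
  by rewrite /x; near: N; apply: near_powR; rewrite divr_gt0.
have K5 : 4 * Cb 1 <= x `^ (eps / 8) by rewrite /x; near: N; apply: near_powR; lra.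
have K6 : 2 + ln x ^+ 2 <= x `^ (kap / 4).
  by rewrite /x; near: N; apply: near_ln_sqr; rewrite divr_gt0.
match goal with H : _ \is_near _ |- _ => clear H end.
move=> S zh Sball zhN; set h := hN R N; set eta := x / h%:R.
set dead := dead_cyl h zh; set T := @T_cyl d S N.
set p0 := x `^ (1 - eps); set p1 := x `^ (1 - eps / 2); set p2 := x `^ (1 - eps / 4).
have p01 : 1 <= p0 by rewrite -[leLHS](powRr0 x); apply: xge; (move: e0 e1 kap0 kap_le; clear; lra).
have K1' : 100 * D <= x `^ (eps / 2) by apply: le_trans K1 _; apply: xge; (move: e0 e1 kap0 kap_le; clear; lra).
have p0p1 : p1 = p0 * x `^ (eps / 2) by rewrite -xD; congr (_ `^ _); (move: e0 e1 kap0 kap_le; clear; lra).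
have p1p2 : p2 = p1 * x `^ (eps / 4) by rewrite -xD; congr (_ `^ _); (move: e0 e1 kap0 kap_le; clear; lra).
have p2x : x = p2 * x `^ (eps / 4) by rewrite -xD -[LHS]x_1; congr (_ `^ _); (move: e0 e1 kap0 kap_le; clear; lra).
have G1 : 100 * D * p0 <= p1 by rewrite p0p1 mulrC; apply: ler_wpM2l => //; exact/ltW/xp.
have G2 : 100 * D * p1 <= p2 by rewrite p1p2 mulrC; apply: ler_wpM2l => //; exact/ltW/xp.
have G3 : 100 * D * p2 <= x by rewrite [leRHS]p2x mulrC; apply: ler_wpM2l => //; exact/ltW/xp.
have Q1 : 300 * p0 <= p1 by move: G1 D3 p01; (clear; nra).
have Q2 : 300 * p1 <= p2 by move: G2 D3 p01 Q1; (clear; nra).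
pose n0 := Num.truncn p0; pose u1 := Num.truncn p1; pose u := Num.truncn p2.
pose v := (N %/ 4)%N; pose M := (Num.truncn (x `^ kap)).+1.
have tr (p : R) : 0 <= p -> (Num.truncn p)%:R <= p /\ p - 1 < (Num.truncn p)%:R.
  by move=> /truncn_itv/andP[-> H]; split => //; rewrite ltrBlDr natr1.
have [n0a n0b] := tr p0 (ltW (xp _)); have [u1a u1b] := tr p1 (ltW (xp _)).
have [ua ub] := tr p2 (ltW (xp _)); have [Ma Mb] := tr (x `^ kap) (ltW (xp _)).
rewrite -/n0 in n0a n0b; rewrite -/u1 in u1a u1b; rewrite -/u in ua ub.
have natS (m : nat) : m.+1%:R = m%:R + 1 :> R by rewrite -natr1.
have n0_gt0 : (0 < n0)%N by rewrite (@truncn_ge_nat R)// (le_trans ler01).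
have n0u1 : (n0 < u1)%N by rewrite -(ltr_nat R); (move: Q1 p01 u1b n0a; clear; lra).
have u14 : (4 * u1.+1 <= u)%N by rewrite -(ler_nat R) natrM natS; (move: Q1 Q2 p01 u1a ub; clear; lra).
have v4 : (4 * v <= N < 4 * v.+1)%N.
  by have := divn_eq N 4; have := ltn_pmod N (isT : (0 < 4)%N); rewrite -/v; clear; lia.
have N4 : x < 4 * (v%:R + 1) by rewrite -natS -natrM ltr_nat; case/andP: v4.
have uv6 : (6 * d.+1 * u <= v)%N.
  rewrite -(ler_nat R) !natrM; have := ler_wpM2l (ler0n R d.+1) ua.
  have : 1 <= D * p2 by move: D3 p01 Q1 Q2; clear; nra.
  by move: G3 N4; clear; lra.
have u0 : (0 < u)%N by move: u14; clear; lia.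
have u1u : (u1.+1 < u)%N by move: u14; clear; lia.
have uv : (u.+1 < v)%N by move: uv6 d_ge2 u14; clear; nia.
have uN : (u <= N)%N by move: uv6 v4; clear; nia.
have vN : (v.+1 + v.+1 <= N)%N by move: v4 uv; clear; lia.
have hN2 : (2 * N <= h)%N by have [_ []] := hN_bounds R N.
have vh : (`|zh| + v < h)%N by move: zhN hN2 v4 uv; clear; lia.
have Sb y : y \in S -> (nrm y <= n0)%N by move=> /Sball; exact: in_linf_ball.
pose U : R := u%:R ^+ 2.
have U_th : U `^ (s2 - s1) <= x `^ (2 * th).
  rewrite s12 /U -powR_mulrn// -powRrM; apply: powR_mono => //.
    by rewrite mulr_ge0// ltW// divr_gt0.
  apply: le_trans ua _; rewrite -[leRHS]x_1; apply: xge; (move: e0 e1 kap0 kap_le; clear; lra).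
have b1 : box_ub d s1 A n0 u1.+1 <= Cb 1 * x `^ (- (eps / 4)).
  have -> : eps / 4 = (eps / 2) / 2 by (move: e0 e1 kap0 kap_le; clear; lra).
  apply: box_ub_powR => //; first (move: e0 e1 kap0 kap_le; clear; lra).
  rewrite mul1r (natS u1) mulrC powRN ler_pdivlMr//; apply: (@le_trans _ _ p1); last (move: u1b; clear; lra).
  by rewrite p0p1 ler_wpM2r// ltW.
have b1_small : C1 * U `^ (s2 - s1) * (Cb 1 * x `^ (- (eps / 4))) <= C2 / 2.
  apply: (@le_trans _ _ (C1 * x `^ (2 * th) * (Cb 1 * x `^ (- (eps / 4))))).
    by rewrite ler_wpM2r ?ler_wpM2l// mulr_ge0// ltW.
  have E1 : x `^ (2 * th) * x `^ (- (eps / 4)) * x `^ (eps / 4 - 2 * th) = 1.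
    by rewrite -!xD -[RHS](powRr0 x); congr (_ `^ _); (rewrite /th; clear; lra).
  set w := x `^ (2 * th) * x `^ (- (eps / 4)) in E1.
  have w0 : 0 < w by rewrite mulr_gt0.
  have -> : C1 * x `^ (2 * th) * (Cb 1 * x `^ (- (eps / 4))) = w * (C1 * Cb 1).
    by rewrite /w; ring.
  have := ler_wpM2l (ltW w0) K2; rewrite (mulrCA w C2) E1 mulr1; (clear; lra).
have [L0 Hk] := harnack_scale A1 s1g s2g u0 u14 uv6 b1 b1_small.
rewrite -/C1 -/C2 -/C4 -/U in Hk.
pose q := C6 * x `^ (- kap).
have q_half : q <= 2^-1.
  rewrite /q powRN ler_pdivrMr//; move: K3; (clear; lra).
have b2 : box_ub d s1 A u v.+1 <= Cb 4 * x `^ (- (eps / 8)).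
  have -> : eps / 8 = (eps / 4) / 2 by (move: e0 e1 kap0 kap_le; clear; lra).
  apply: box_ub_powR => //; first (move: e0 e1 kap0 kap_le; clear; lra).
  rewrite (natS v) -mulrA mulrCA powRN mulrC ler_pdivlMr//; apply: (@le_trans _ _ x); last (move: N4; clear; lra).
  by rewrite [leRHS]p2x ler_wpM2r// ltW.
have b3 : box_ub d s1 A n0 u.+1 <= Cb 1 * x `^ (- (3 * eps / 8)).
  have -> : 3 * eps / 8 = (3 * eps / 4) / 2 by (move: e0 e1 kap0 kap_le; clear; lra).
  apply: box_ub_powR => //; first (move: e0 e1 kap0 kap_le; clear; lra).
  rewrite mul1r (natS u) mulrC powRN ler_pdivlMr//; apply: (@le_trans _ _ p2); last (move: ub; clear; lra).
  rewrite [leRHS](_ : _ = p0 * x `^ (3 * eps / 4)) ?ler_wpM2r// ?ltW//.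
  by rewrite -xD; congr (_ `^ _); (move: e0 e1 kap0 kap_le; clear; lra).
have MS : M%:R = (Num.truncn (x `^ kap))%:R + 1 :> R by exact: natS.
have M1 : x `^ kap <= M%:R by rewrite MS; (move: Mb; clear; lra).
have M2 : M.*2.+1%:R <= 5 * x `^ kap :> R.
  have : 1 <= x `^ kap by rewrite -[leLHS](powRr0 x); apply: xge; exact: ltW.
  by rewrite -[M.*2.+1]addn1 -mul2n natrD natrM MS; (move: Ma; clear; lra).
have bq : 5 ^+ d.+1 * Cb 4 * x `^ (- (eps / 16)) <= 5 ^+ d.+1 * Cb 4 * x `^ (- kap).
  by apply: ler_wpM2l; [rewrite mulr_ge0 ?exprn_ge0|apply: xge; (move: e0 e1 kap0 kap_le; clear; lra)].
have lq : (M.*2.+1 ^ d.+1)%:R * box_ub d s1 A u v.+1 <= 5 ^+ d.+1 * Cb 4 * x `^ (- (eps / 16)).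
  apply: (@le_trans _ _ (((5 * x `^ kap) ^+ d.+1) * (Cb 4 * x `^ (- (eps / 8))))).
    apply: ler_pM => //; first by rewrite divr_ge0 ?powR_ge0.
    by rewrite natrX lerXn2r ?nnegrE ?mulr_ge0// ltW.
  rewrite exprMn -[(x `^ kap) ^+ _]powR_mulrn// -?powRrM ?kapD; last exact: ltW.
  have -> : - (eps / 16) = eps / 16 + - (eps / 8) by (move: e0 e1 kap0 kap_le; clear; lra).
  by rewrite xD le_eqVlt; apply/orP; left; apply/eqP; ring.
have q_full : box_ub d s1 A u v.+1 <= q.
  apply: le_trans b2 _; rewrite /q mulrDl; apply: ler_wpDr.
    by rewrite !mulr_ge0// ltW.
  apply: ler_pM => //; [by rewrite ltW| |by apply: xge; (move: e0 e1 kap0 kap_le; clear; lra)].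
  by rewrite ler_peMl// exprn_ege1// ler1n.
have h_le : h%:R <= x * x `^ (kap / 4).
  by have [_ [+ _]] := hN_bounds R N; move/le_trans; apply; rewrite ler_wpM2l// ltW.
have q_cyl : lift_q d s1 A u v N M h <= q.
  rewrite /lift_q /q mulrDl; apply: lerD; first exact: le_trans lq bq.
  have y1 : 1 <= x `^ (kap / 4) by rewrite -[leLHS](powRr0 x); apply: xge; apply: divr_ge0 => //; exact: ltW.
  have y4 : x `^ kap = (x `^ (kap / 4)) ^+ 4.
    by rewrite -powR_mulrn ?ltW// -powRrM; congr (_ `^ _); (move: e0 e1 kap0 kap_le; clear; lra).
  set y := x `^ (kap / 4) in y1 y4 h_le.
  have M0 : 0 < M%:R :> R by exact: lt_le_trans M1.
  rewrite natrM -/x ler_pdivrMr ?exprn_gt0 ?mulr_gt0// powRN.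
  have hh : x ^+ 2 + h%:R ^+ 2 <= x ^+ 2 * (2 * y ^+ 2).
    have := lerXn2r 2 (ler0n R h) (le_trans (ler0n R h) h_le) h_le.
    have : x ^+ 2 * 1 <= x ^+ 2 * y ^+ 2 by rewrite ler_wpM2l ?sqr_ge0// exprn_ege1.
    by rewrite exprMn; (clear; lra).
  apply: (@le_trans _ _ (d%:R * (x ^+ 2 * (2 * y ^+ 2)))); first by rewrite ler_wpM2l.
  rewrite [leRHS](_ : _ = d%:R * (x ^+ 2 * (2 * (M%:R ^+ 2 / x `^ kap)))); last by ring.
  apply: ler_wpM2l => //; apply: ler_wpM2l; first exact: sqr_ge0.
  apply: ler_wpM2l => //.
  rewrite ler_pdivlMr//; apply: (@le_trans _ _ ((x `^ kap) ^+ 2)); last first.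
    by rewrite lerXn2r ?nnegrE// ltW.
  rewrite expr2 ler_wpM2r ?(ltW (xp _))// y4 -[4%N]/((2 + 2)%N) exprD ler_peMl ?sqr_ge0//.
  by rewrite exprn_ege1.
pose et := C7 * x `^ (- (kap / 2)).
have et_ge : 2 * q * harnack_cst d s1 s2 A R0 n0 u1 u v <= et.
  apply: (@le_trans _ _ (2 * q * (C4 * x `^ (2 * th)))).
    rewrite ler_wpM2l; [by []| |apply: le_trans Hk _; by rewrite ler_wpM2l].
    by rewrite !mulr_ge0// ltW.
  rewrite /et /q.
  have -> : 2 * (C6 * x `^ (- kap)) * (C4 * x `^ (2 * th)) =
      2 * C6 * C4 * x `^ (- kap + 2 * th) by rewrite xD; ring.
  apply: ler_pM; [|exact: ltW|by rewrite lerDl|].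
    by apply: mulr_ge0 => //; exact: mulr_ge0.
  by apply: xge; rewrite /th; move: kap0; (clear; lra).
have et_small : 2 ^+ j.+1 * et <= x `^ (- (kap / 4)).
  rewrite /et mulrA; have -> : - (kap / 4) = kap / 4 + - (kap / 2) by (move: e0 e1 kap0 kap_le; clear; lra).
  by rewrite xD ler_wpM2r// ltW.
have et0 : 0 <= et by rewrite mulr_ge0 ?(ltW (xp _))// (le_trans ler01).
have et1 : et <= 1.
  apply: (@le_trans _ _ (2 ^+ j.+1 * et)); first by rewrite ler_peMl// exprn_ege1// ler1n.
  by apply: le_trans et_small _; rewrite -[leRHS](powRr0 x); apply: xge; move: kap0; (clear; lra).
have rho_et : 2 * box_ub d s1 A n0 u.+1 <= et / 2.
  have : 4 * Cb 1 * x `^ (- (3 * eps / 8)) <= x `^ (- (eps / 4)).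
    have -> : - (eps / 4) = eps / 8 + - (3 * eps / 8) by (move: e0 e1 kap0 kap_le; clear; lra).
    by rewrite xD ler_wpM2r// ltW.
  have : x `^ (- (eps / 4)) <= et.
    apply: (@le_trans _ _ (x `^ (- (kap / 2)))); first by apply: xge; (move: e0 e1 kap0 kap_le; clear; lra).
    by rewrite /et ler_peMl// ltW.
  by move: b3; (clear; lra).
have eta_rho : 1 <= (1 + et) * (1 - 2 * box_ub d s1 A n0 u.+1).
  by move: rho_et et0 et1; move: (box_ub _ _ _ _ _) => b; (clear; nra).
have M_gt0 : (0 < M)%N by [].
have [[e12 e21] /(_ j)] := local_compare d_ge2 s1_gt0 A1 s2_gt0 super sub R036 Sb n0u1 u1u uv
  M_gt0 uN vN vh L0 q_half q_full q_cyl et_ge et1 eta_rho.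
rewrite -/dead -/T => -[g gB gs].
have h0 : 0 < h%:R :> R by rewrite ltr0n; exact: leq_ltn_trans vh.
have eta_small : x `^ (- (kap / 2)) <= eta.
  rewrite /eta ler_pdivlMr// powRN mulrC ler_pdivrMr//; apply: le_trans h_le _.
  by apply: ler_wpM2l; [exact: ltW|apply: xge; move: kap0; clear; lra].
have eta_ge : (1 + et) ^+ j.+1 <= 1 + eta.
  apply: le_trans (exprD1_le _ et0 et1) _; rewrite lerD2l; apply: le_trans et_small _.
  rewrite /eta ler_pdivlMr// powRN mulrC ler_pdivrMr//.
have eta_ge1 : 1 + et <= 1 + eta.
  by apply: le_trans eta_ge; rewrite exprS ler_peMr ?exprn_ege1 ?addr_ge0// lerDl.
have tw0 D' T' B : 0 <= trace_weight R D' T' B.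
  by apply: sumr_ge0 => y _; rewrite mulr_ge0 ?escape_ge0 ?prb_ge0.
split; first split.
- by move=> y; apply: le_trans (e12 y) _; rewrite ler_wpM2r// escape_ge0.
- by move=> y; apply: le_trans (e21 y) _; rewrite ler_wpM2r// escape_ge0.
split.
  move=> w wN w4 wd; have vw : (v < `|w.2|)%N by move: w4 v4; clear; lia.
  have H := capture_cyl_le d_ge2 s1_gt0 A1 super Sb n0u1 u1u uv M_gt0 uN vN vh q_cyl wN vw wd.
  apply: le_trans H _; apply: le_trans eta_small.
  rewrite /q (_ : - kap = - (kap / 2) + - (kap / 2)); last by clear; lra.
  rewrite xD mulrA -[leRHS]mul1r ler_wpM2r ?(ltW (xp _))// powRN ler_pdivrMr ?mul1r//.
exists g.
  move=> B; have [gB0 h1 h2] := gB B; split; first exact: gB0.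
    by apply: le_trans h1 _; rewrite lerD2r ler_wpM2r.
  by apply: le_trans h2 _; rewrite lerD2r ler_wpM2r.
apply: le_trans gs _; set rho := 2 * box_ub _ _ _ _ _.
have rho0 : 0 <= rho by rewrite mulr_ge0//; apply: divr_ge0; exact: powR_ge0.
have rho_le : rho <= x `^ (- (eps / 4)).
  have : 4 * Cb 1 * x `^ (- (3 * eps / 8)) <= x `^ (- (eps / 4)).
    have -> : - (eps / 4) = eps / 8 + - (3 * eps / 8) by (move: e0 e1 kap0 kap_le; clear; lra).
    by rewrite xD ler_wpM2r// ltW.
  have := mulr_ge0 (Cb0 1) (ltW (xp (- (3 * eps / 8)))).
  by rewrite /rho; move: b3; (clear; lra).
have rhoj : rho ^+ j <= x `^ (- (P + 2 * d.+1 + 1)%N%:R).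
  apply: (@le_trans _ _ ((x `^ (- (eps / 4))) ^+ j)).
    by rewrite lerXn2r ?nnegrE// ltW.
  have -> : (x `^ (- (eps / 4))) ^+ j = x `^ (- (eps / 4) * j%:R).
    by rewrite powRrM powR_mulrn// ltW.
  by apply: xge; move: jP; clear; lra.
have cS : #|{: S}|%:R <= x ^+ (2 * d.+1).
  apply: (@le_trans _ _ ((n0.*2.+1 ^ d.+1)%N%:R)); first by rewrite ler_nat card_ball.
  rewrite natrX exprM lerXn2r ?nnegrE ?sqr_ge0//.
  rewrite -[n0.*2.+1]addn1 -mul2n natrD natrM.
  have : p0 <= x by rewrite -[leRHS]x_1; apply: xge; (move: e0 e1 kap0 kap_le; clear; lra).
  by move: n0a N3 D3 x1; (clear; nra).
apply: (@le_trans _ _ (x * (x ^+ (2 * d.+1) * x `^ (- (P + 2 * d.+1 + 1)%N%:R)))).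
  apply: ler_pM => //; first by rewrite mulr_ge0// exprn_ge0.
    by move: N3 D3; (clear; lra).
  by apply: ler_pM => //; rewrite exprn_ge0.
have xn n : x ^+ n = x `^ n%:R by rewrite powR_mulrn// ltW.
rewrite !xn -[X in X * _]x_1 -!xD -powRN; apply: xge.
by rewrite !natrD; clear; lra.
Unshelve. all: by end_near. Qed.

End local_trace.

(** * Mixing of the horizontal coordinate *)

Section torus_poincare.
Variables (R : realType) (d N : nat).
Hypothesis N_gt1 : (1 < N)%N.
Local Notation T := 'rV['Z_N]_d.
Implicit Types (f : T -> R) (r : T).

Definition shift_energy f r : R := \sum_t (f (t + r) - f t) ^+ 2.
Definition dirichlet f : R := \sum_j shift_energy f (delta_mx 0 j).

Lemma sum_torus_shift (F : T -> R) r : \sum_t F (t + r) = \sum_t F t.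
Proof. by rewrite [RHS](reindex_inj (addIr r)). Qed.

Lemma shift_energy_ge0 f r : 0 <= shift_energy f r.
Proof. by apply: sumr_ge0 => t _; exact: sqr_ge0. Qed.

Lemma dirichlet_ge0 f : 0 <= dirichlet f.
Proof. by apply: sumr_ge0 => j _; exact: shift_energy_ge0. Qed.

Lemma shift_energy_sum f (s : seq 'I_d) :
  shift_energy f (\sum_(j <- s) delta_mx 0 j) <= (size s)%:R ^+ 2 * dirichlet f.
Proof.
elim: s => [|j s IH].
  by rewrite big_nil /shift_energy big1 ?mulr_ge0 ?dirichlet_ge0 ?sqr_ge0// => t _;
    rewrite addr0 subrr expr0n.
rewrite big_cons; set r := \sum_(j <- s) _ in IH *; set e : T := delta_mx 0 j.
have ej : shift_energy f e <= dirichlet f.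
  by rewrite /dirichlet (bigD1 j)//= lerDl sumr_ge0// => i _; exact: shift_energy_ge0.
have D0 := dirichlet_ge0 f.
have [s0|s0] := posnP (size s).
  have -> : r = 0 by rewrite /r (size0nil s0) big_nil.
  by rewrite addr0 /= s0 expr1n mul1r.
set n : R := (size s)%:R in IH *; have n0 : 0 < n by rewrite ltr0n.
have key : n * shift_energy f (e + r) <= (n + 1) * shift_energy f r + n * (n + 1) * shift_energy f e.
  rewrite [X in _ <= (n + 1) * X + _](_ : _ = \sum_t (f (t + e + r) - f (t + e)) ^+ 2); last first.
    exact: esym (sum_torus_shift (fun t => (f (t + r) - f t) ^+ 2) e).
  rewrite /shift_energy !mulr_sumr -big_split/=; apply: ler_sum => t _.
  rewrite addrA; move: (f (t + e + r)) (f (t + e)) (f t) => a b c.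
  have := sqr_ge0 ((a - b) - n * (b - c)); nra.
rewrite /= -natr1 -/n -(ler_pM2l n0); apply: le_trans key _.
have : (n + 1) * shift_energy f r <= (n + 1) * (n ^+ 2 * dirichlet f).
  by rewrite ler_wpM2l// addr_ge0// ltW.
have : n * (n + 1) * shift_energy f e <= n * (n + 1) * dirichlet f.
  by rewrite ler_wpM2l// mulr_ge0 ?addr_ge0// ltW.
by lra.
Qed.

Lemma torus_decomp r : exists2 s : seq 'I_d,
  (size s <= d * N)%N & r = \sum_(j <- s) delta_mx 0 j.
Proof.
exists (flatten [seq nseq (r 0 j) j | j <- enum 'I_d]).
  rewrite size_flatten sumnE /shape big_map big_map; apply: leq_trans (_ : \sum_(j <- enum 'I_d) N <= _)%N.
    apply: leq_sum => j _; rewrite size_nseq ltnW//.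
    by have := ltn_ord (r 0 j); move: (nat_of_ord _) => i; rewrite Zp_cast.
  by rewrite big_enum/= sum_nat_const card_ord.
rewrite big_flatten/= big_map big_enum/=; apply/rowP => j.
rewrite summxE (bigD1 j)//= [X in _ + X]big1 ?addr0 => [|i ij].
  rewrite big_nseq -[iter _ _ _](_ : (delta_mx 0 j : T) *+ (r 0 j) = _); last first.
    by elim: (nat_of_ord _) => // n IH; rewrite mulrS IH.
  by rewrite mulmxnE mxE !eqxx/= Zp_nat natr_Zp.
rewrite summxE big_seq big1// => k; rewrite mem_nseq => /andP[_ /eqP->].
by rewrite mxE eqxx/= eq_sym (negbTE ij).
Qed.

Lemma poincare f : \sum_t f t = 0 ->
  2 * \sum_t f t ^+ 2 <= (d * N)%:R ^+ 2 * dirichlet f.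
Proof.
move=> f0; have T0 : 0 < #|{: T}|%:R :> R by rewrite ltr0n; apply/card_gt0P; exists 0.
rewrite -(ler_pM2l T0); have -> : #|{: T}|%:R * (2 * \sum_t f t ^+ 2) = \sum_r shift_energy f r.
  transitivity (\sum_(r : T) (2 * \sum_t f t ^+ 2 - 2 * \sum_t f (t + r) * f t)).
    rewrite big_split/= sumr_const mulr_natl -[LHS]addr0; congr (_ + _).
    rewrite sumrN -mulr_sumr exchange_big/= big1 ?mulr0 ?oppr0// => t _.
    rewrite -mulr_suml (eq_bigr (fun r => f (r + t))) => [|r _]; last by rewrite addrC.
    by rewrite sum_torus_shift f0 mul0r.
  apply: eq_bigr => r _; rewrite /shift_energy.
  rewrite [RHS](eq_bigr (fun t => f (t + r) ^+ 2 + f t ^+ 2 - 2 * (f (t + r) * f t))) => [|t _]; last by ring.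
  rewrite sumrB big_split/= (sum_torus_shift (fun t => f t ^+ 2)) -mulr_sumr.
  by rewrite mulr2n mulrDl !mul1r.
rewrite mulr_natl -sumr_const; apply: ler_sum => r _.
have [s sd ->] := torus_decomp r; apply: le_trans (shift_energy_sum f s) _.
by rewrite ler_wpM2r ?dirichlet_ge0// lerXn2r ?nnegrE// ler_nat.
Qed.

End torus_poincare.

Lemma big_option (V : nmodType) (I : finType) (F : option I -> V) :
  \sum_i F i = F None + \sum_i F (Some i).
Proof.
rewrite (bigD1 None)//=; congr (_ + _); rewrite (reindex_omap Some id) => [|[]//].
by apply: eq_bigl => i; rewrite eqxx.
Qed.

Section mixing.
Variables (R : realType) (d N : nat).
Hypotheses (N_gt1 : (1 < N)%N) (d_gt0 : (0 < d)%N).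
Local Notation A := 'Z_N.
Local Notation T := 'rV[A]_d.
Local Notation E := (lattice A d).
Local Notation avg := (@avg R _ _ (@step A d)).
Local Notation D := (d.+1%:R : R).
Local Notation s0 := ((None, false) : direction d).
Local Notation NT := (N%:R ^+ d : R).
Implicit Types (u : E -> R).

Lemma card_torus : #|{: T}|%:R = NT :> R.
Proof. by rewrite card_mx card_ord Zp_cast// mul1n natrX. Qed.

Lemma NT_gt0 : 0 < NT.
Proof. by rewrite exprn_gt0// ltr0n ltnW. Qed.

Definition slice_mean u (z : int) : R := NT^-1 * \sum_(t : T) u (t, z).

Lemma avg_cylE u t z : 2 * D * avg u (t, z) =
  (\sum_j (u (t + delta_mx 0 j, z) + u (t - delta_mx 0 j, z))) + (u (t, z + 1) + u (t, z - 1)).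
Proof.
rewrite /Submission.avg card_direction natrM mulrA mulfV ?mul1r ?mulf_neq0 ?pnatr_eq0//.
rewrite (eq_bigr (fun s => u ((t, z) + @step A d (s.1, s.2)))) => [|[] //].
rewrite -(pair_bigA _ (fun i b => u ((t, z) + @step A d (i, b)))) /=.
have aE (a : T) (b : int) : (t, z) + (a, b) = (t + a, z + b) :> E by [].
have oE (a : T) (b : int) : - (a, b) = (- a, - b) :> E by [].
rewrite big_option/= addrC; congr (_ + _).
  by apply: eq_bigr => j _; rewrite big_bool [LHS]addrC /step/= oE !aE oppr0 addr0.
by rewrite big_bool [LHS]addrC /step/= oE !aE oppr0 addr0.
Qed.

Lemma slice_mean_avg u z : 2 * D * slice_mean (avg u) z =
  2 * d%:R * slice_mean u z + (slice_mean u (z + 1) + slice_mean u (z - 1)).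
Proof.
rewrite /slice_mean mulrCA mulr_sumr; under eq_bigr do rewrite avg_cylE.
rewrite big_split/= exchange_big/=.
have -> : \sum_(j < d) \sum_(t : T) (u (t + delta_mx 0 j, z) + u (t - delta_mx 0 j, z)) =
    2 * d%:R * \sum_(t : T) u (t, z).
  rewrite (eq_bigr (fun=> 2 * \sum_(t : T) u (t, z))) => [|j _]; last first.
    by rewrite big_split/= !(sum_torus_shift (fun t => u (t, z))) mulr2n mulrDl !mul1r.
  by rewrite sumr_const card_ord -[LHS]mulr_natl mulrCA mulrA.
by rewrite big_split/=; ring.
Qed.

Lemma slice_mean_harm u z : (forall t, u (t, z) = avg u (t, z)) ->
  slice_mean u (z + 1) + slice_mean u (z - 1) = 2 * slice_mean u z.
Proof.
move=> h; have := slice_mean_avg u z.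
have -> : slice_mean (avg u) z = slice_mean u z by congr (_ * _); apply: eq_bigr => t _.
by rewrite -natr1; lra.
Qed.

Lemma affine_interp (f : int -> R) (a : int) (n : nat) :
  (forall k, (0 < k)%N -> (k < n)%N -> f (a + k%:Z + 1) + f (a + k%:Z - 1) = 2 * f (a + k%:Z)) ->
  forall k, (k <= n)%N -> n%:R * f (a + k%:Z) = (n - k)%N%:R * f a + k%:R * f (a + n%:Z).
Proof.
move=> h.
have lin k : (k <= n)%N -> f (a + k%:Z) = f a + k%:R * (f (a + 1) - f a).
  elim/ltn_ind: k => -[|[|k]] IH kn; first by rewrite addr0 mul0r addr0.
    by rewrite mul1r subrKC.
  have := h k.+1 isT kn.
  have -> : a + k.+1%:Z + 1 = a + k.+2%:Z by rewrite -addrA -PoszD addn1.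
  have -> : a + k.+1%:Z - 1 = a + k%:Z by rewrite -addrA -[k.+1]addn1 PoszD addrK.
  rewrite (IH k.+1)// 1?ltnW// (IH k)//; last by rewrite ltnW// ltnW.
  by rewrite -[k.+2]addn2 -[k.+1]addn1 !natrD; lra.
move=> k kn; rewrite (lin k kn) (lin n (leqnn n)) natrB//; ring.
Qed.

Definition fluct u (z : int) : R := Num.sqrt (\sum_(t : T) (u (t, z) - slice_mean u z) ^+ 2).

Definition gam : R := 2 / (d * N)%:R ^+ 2.

Let dN0 : 0 < (d * N)%:R :> R.
Proof. by rewrite ltr0n muln_gt0 d_gt0 ltnW. Qed.

Lemma cauchy_schwarz (I : finType) (a b : I -> R) :
  \sum_i a i * b i <= Num.sqrt (\sum_i a i ^+ 2) * Num.sqrt (\sum_i b i ^+ 2).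
Proof.
set X := \sum_i a i ^+ 2; set Y := \sum_i b i ^+ 2; set Z := \sum_i _ * _.
have X0 : 0 <= X by apply: sumr_ge0 => i _; exact: sqr_ge0.
have Y0 : 0 <= Y by apply: sumr_ge0 => i _; exact: sqr_ge0.
have H s : 0 <= X - 2 * s * Z + s ^+ 2 * Y.
  have -> : X - 2 * s * Z + s ^+ 2 * Y = \sum_i (a i - s * b i) ^+ 2.
    rewrite /X /Y /Z !mulr_sumr -sumrB -big_split/=; apply: eq_bigr => i _; ring.
  by apply: sumr_ge0 => i _; exact: sqr_ge0.
rewrite -sqrtrM//; apply: le_trans (ler_norm _) _; rewrite -sqrtr_sqr ler_sqrt ?mulr_ge0//.
have [Y00|Yn0] := eqVneq Y 0.
  have b0 i : b i = 0.
    apply/eqP; rewrite -sqrf_eq0; apply/eqP.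
    have := psumr_eq0P (fun i _ => sqr_ge0 (b i)) Y00; exact.
  have -> : Z = 0 by rewrite /Z big1// => i _; rewrite b0 mulr0.
  by rewrite expr0n/= Y00 mulr0.
have Yp : 0 < Y by rewrite lt_neqAle eq_sym Yn0.
have := H (Z / Y); rewrite -(pmulr_lge0 _ Yp).
have -> : (X - 2 * (Z / Y) * Z + (Z / Y) ^+ 2 * Y) * Y = X * Y - Z ^+ 2 by field.
by rewrite subr_ge0.
Qed.

Lemma fluct_step u z : (forall t, u (t, z) = avg u (t, z)) ->
  (2 + gam) * fluct u z <= fluct u (z + 1) + fluct u (z - 1).
Proof.
move=> h; pose w z' (t : T) := u (t, z') - slice_mean u z'.
have w0 z' : \sum_t w z' t = 0.
  rewrite sumrB sumr_const -[X in _ - X]mulr_natl card_torus /slice_mean mulrA.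
  by rewrite mulfV ?gt_eqF ?NT_gt0// mul1r subrr.
have wE t : 2 * D * w z t = (\sum_j (w z (t + delta_mx 0 j) + w z (t - delta_mx 0 j))) +
    (w (z + 1) t + w (z - 1) t).
  rewrite {1}/w mulrBr {1}h avg_cylE.
  have := slice_mean_harm h; rewrite /w.
  rewrite [X in _ -> _ = X + _](eq_bigr (fun j : 'I_d =>
    (u (t + delta_mx 0 j, z) + u (t - delta_mx 0 j, z)) - 2 * slice_mean u z)) => [|j _]; last by ring.
  rewrite sumrB sumr_const card_ord -[X in _ - X + _]mulr_natl -natr1; lra.
pose G := \sum_t w z t ^+ 2.
have E1 : \sum_t w z t * w (z + 1) t + \sum_t w z t * w (z - 1) t = 2 * G + dirichlet (w z).
  have : \sum_t w z t * (2 * D * w z t) = \sum_j \sum_t w z t * (w z (t + delta_mx 0 j) + w z (t - delta_mx 0 j))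
      + (\sum_t w z t * w (z + 1) t + \sum_t w z t * w (z - 1) t).
    rewrite exchange_big -!big_split/=; apply: eq_bigr => t _.
    by rewrite wE !mulrDr mulr_sumr.
  have -> : \sum_t w z t * (2 * D * w z t) = 2 * D * G.
    by rewrite /G mulr_sumr; apply: eq_bigr => t _; ring.
  have -> : \sum_j \sum_t w z t * (w z (t + delta_mx 0 j) + w z (t - delta_mx 0 j)) =
      2 * d%:R * G - dirichlet (w z).
    have -> : 2 * d%:R * G = \sum_(j < d) 2 * G.
      by rewrite sumr_const card_ord -[RHS]mulr_natl mulrCA mulrA.
    rewrite /dirichlet -sumrB; apply: eq_bigr => j _.
    have -> : shift_energy (w z) (delta_mx 0 j) =
        2 * G - 2 * \sum_t w z t * w z (t + delta_mx 0 j).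
      rewrite /shift_energy (eq_bigr (fun t => (w z (t + delta_mx 0 j) ^+ 2 + w z t ^+ 2) -
        2 * (w z t * w z (t + delta_mx 0 j)))) => [|t _]; last by ring.
      rewrite sumrB big_split/= (sum_torus_shift (fun t => w z t ^+ 2)) -mulr_sumr -/G; ring.
    under eq_bigr do rewrite mulrDr.
    rewrite big_split/= -[X in _ + X = _](sum_torus_shift _ (delta_mx 0 j)).
    under [X in _ + X = _]eq_bigr do rewrite addrK mulrC.
    by ring.
  by rewrite -natr1; lra.
have G2 : G = fluct u z ^+ 2 by rewrite sqr_sqrtr// sumr_ge0// => t _; exact: sqr_ge0.
have f0 z' : 0 <= fluct u z' by exact: sqrtr_ge0.
have : gam * G <= dirichlet (w z).
  rewrite /gam mulrAC ler_pdivrMr ?exprn_gt0// mulrC [leRHS]mulrC mulrC.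
  exact: poincare.
have := cauchy_schwarz (w z) (w (z + 1)); have := cauchy_schwarz (w z) (w (z - 1)).
rewrite -!/(fluct u _) => H1 H2 H3.
have [->|fz] := eqVneq (fluct u z) 0; first by rewrite mulr0 addr_ge0.
have fp : 0 < fluct u z by rewrite lt_neqAle eq_sym fz f0.
rewrite -(ler_pM2l fp); move: H1 H2 H3 E1; rewrite G2; lra.
Qed.

Definition decay : R := (1 + (d * N)%:R^-1)^-1.

Lemma decay_gt0 : 0 < decay.
Proof. by rewrite invr_gt0 addr_gt0// invr_gt0. Qed.

Lemma decay_lt1 : decay < 1.
Proof. by rewrite invf_lt1 ?addr_gt0 ?invr_gt0// ltrDl invr_gt0. Qed.

Lemma decay_step n : decay ^+ n.+2 + decay ^+ n <= (2 + gam) * decay ^+ n.+1.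
Proof.
have l0 := decay_gt0; rewrite !exprS.
have -> : decay * (decay * decay ^+ n) + decay ^+ n = decay ^+ n * (decay * decay + 1) by ring.
have -> : (2 + gam) * (decay * decay ^+ n) = decay ^+ n * ((2 + gam) * decay) by ring.
rewrite ler_wpM2l ?exprn_ge0 ?(ltW l0)//.
have t0 : 0 < (d * N)%:R^-1 :> R by rewrite invr_gt0.
rewrite /gam -exprVn /decay; move: ((d * N)%:R^-1) t0 => t t0.
have t1 : 0 < 1 + t by lra.
rewrite -(ler_pM2l t1) -(ler_pM2l t1).
rewrite (_ : (1 + t) * ((1 + t) * ((1 + t)^-1 * (1 + t)^-1 + 1)) = 1 + (1 + t) ^+ 2); last by field; lra.
rewrite (_ : (1 + t) * ((1 + t) * ((2 + 2 * t ^+ 2) * (1 + t)^-1)) = (1 + t) * (2 + 2 * t ^+ 2)); last by field; lra.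
by have := sqr_ge0 t; nra.
Qed.

Variables (u : E -> R) (a : int) (n : nat) (M : R).
Hypothesis u_harm : forall t k, (0 < k < n)%N -> u (t, a + k%:Z) = avg u (t, a + k%:Z).
Hypotheses (Ma : fluct u a <= M) (Mn : fluct u (a + n%:Z) <= M).

Lemma fluct_decay k : (k <= n)%N ->
  fluct u (a + k%:Z) <= M * (decay ^+ k + decay ^+ (n - k)).
Proof.
have M0 : 0 <= M by apply: le_trans Ma; exact: sqrtr_ge0.
have g0 : 0 < gam by rewrite divr_gt0// exprn_gt0.
pose f (k : nat) := fluct u (a + k%:Z); pose v (k : nat) := M * (decay ^+ k + decay ^+ (n - k)).
have l0 := ltW decay_gt0.
pose w k := f k - v k.
have wstep j : (0 < j < n)%N -> (2 + gam) * w j <= w j.+1 + w j.-1.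
  move=> jn; have := fluct_step (fun t => u_harm t jn).
  rewrite (_ : a + j%:Z + 1 = a + j.+1%:Z); last by rewrite -addrA -PoszD addn1.
  rewrite (_ : a + j%:Z - 1 = a + j.-1%:Z); last first.
    by case: j jn => // j _ /=; rewrite -addrA -[j.+1]addn1 PoszD addrK.
  rewrite -/(f _) -/(f _) -/(f _) /w.
  have : v j.+1 + v j.-1 <= (2 + gam) * v j.
    rewrite /v -mulrDr mulrCA ler_wpM2l// addrACA mulrDr.
    apply: lerD; first by case: j jn => // j _; exact: decay_step.
    have -> : (n - j = (n - j.+1).+1)%N by case/andP: jn; lia.
    have -> : (n - j.-1 = (n - j.+1).+2)%N by case/andP: jn; lia.
    by rewrite addrC; exact: decay_step.
  lra.
move=> kn; rewrite -subr_le0 -/(f k) -/(v k) -/(w k).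
have [m + mmax] := @seq_argmax R _ w (iota 0 n.+1) k ltac:(by rewrite mem_iota add0n ltnS).
rewrite mem_iota add0n ltnS => mn.
apply: le_trans (mmax k _) _; first by rewrite mem_iota add0n ltnS.
have w_end j : (j == 0%N) || (j == n) -> w j <= 0.
  have e1 i : 0 <= decay ^+ i by exact: exprn_ge0.
  case/orP => /eqP->; rewrite subr_le0 /f /v ?addr0 ?subnn ?subn0 expr0; [apply: le_trans Ma _|apply: le_trans Mn _];
    by rewrite ler_peMr// ?lerDl ?lerDr.
have [/w_end//|] := boolP ((m == 0%N) || (m == n)); rewrite negb_or => /andP[m0 mnn].
have mb : (0 < m < n)%N by rewrite lt0n m0 ltn_neqAle mnn.
have := wstep m mb; have H j : (j <= n)%N -> w j <= w m by move=> jn; apply: mmax; rewrite mem_iota add0n ltnS.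
have := H m.+1 ltac:(by case/andP: mb); have := H m.-1 ltac:(by move: mn; lia).
by rewrite -(pmulr_rle0 _ g0); lra.
Qed.

Theorem mixing k t : (k <= n)%N ->
  `|u (t, a + k%:Z) - slice_mean u (a + k%:Z)| <= M * (decay ^+ k + decay ^+ (n - k)).
Proof.
move=> /fluct_decay; apply: le_trans; rewrite -sqrtr_sqr ler_sqrt.
  by rewrite (bigD1 t)//= lerDl sumr_ge0// => i _; exact: sqr_ge0.
by apply: sumr_ge0 => i _; exact: sqr_ge0.
Qed.

Lemma slice_mean_interp k : (k <= n)%N ->
  n%:R * slice_mean u (a + k%:Z) =
  (n - k)%N%:R * slice_mean u a + k%:R * slice_mean u (a + n%:Z).
Proof.
apply: affine_interp => j j0 jn; apply: slice_mean_harm => t; apply: u_harm.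
by rewrite j0.
Qed.

End mixing.

(** * Entrance laws in the cylinder *)

Section cylinder_slabs.
Variables (R : realType) (d N : nat).
Hypotheses (N_gt1 : (1 < N)%N) (d_gt0 : (0 < d)%N).
Local Notation A := 'Z_N.
Local Notation T := 'rV[A]_d.
Local Notation E := (lattice A d).
Local Notation st := (@step A d).
Local Notation s0 := ((None, false) : direction d).
Local Notation avg := (@avg R _ _ st).
Local Notation hp := (@hp R _ _ s0 st).
Local Notation D := (d.+1%:R : R).
Local Notation NT := (N%:R ^+ d : R).
Local Notation smean := (@slice_mean R d N).
Local Notation lam := (decay R d N).

Lemma countable_cyl : countable [set: E].
Proof. exact: countableP. Qed.
Local Notation countE := countable_cyl.

Definition slab (a : int) (n : nat) : seq E :=
  [seq (t, a + k%:Z) | t <- enum {: T}, k <- iota 1 n.-1].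

Lemma mem_slab a n (x : E) : (x \in slab a n) = (a < x.2 < a + n%:Z).
Proof.
apply/allpairsP/idP => [[[t k] /= [_ + ->]]|/andP[ax xn]].
  by rewrite mem_iota /=; clear; lia.
exists (x.1, `|x.2 - a|%N); split; rewrite /= ?mem_enum ?mem_iota//; first by move: x.2 ax xn => z; clear; lia.
by case: x ax xn => t z /= ax xn; congr (_, _); move: ax xn; clear; lia.
Qed.

Lemma slab_uniq a n : uniq (slab a n).
Proof.
apply: allpairs_uniq => [||[t k] [t' k'] _ _ [-> /addrI [->]]//]; first exact: enum_uniq.
exact: iota_uniq.
Qed.

Lemma big_slab (F : E -> R) a n :
  \sum_(x <- slab a n) F x = \sum_(k <- iota 1 n.-1) \sum_t F (t, a + k%:Z).
Proof. by rewrite big_allpairs_dep/= exchange_big/=; apply: eq_bigr => k _; rewrite big_enum. Qed.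

Lemma step_height (x : E) s : (x + st s).2 = x.2 \/ (x + st s).2 = x.2 + 1 \/ (x + st s).2 = x.2 - 1.
Proof.
have -> : (x + st s).2 = x.2 + (st s).2 by [].
by case: s => [[j|] []]; rewrite /step/= ?oppr0 ?addr0; clear; tauto.
Qed.

Lemma step_height_le (x : E) s : x.2 - 1 <= (x + st s).2 <= x.2 + 1.
Proof. by have [->|[->|->]] := step_height x s; move: x.2 => z; clear; lia. Qed.

Lemma bdry_height (Dm : seq E) (x : E) : x \in bdry Dm ->
  x \notin Dm /\ exists2 z : E, z \in Dm & z.2 - 1 <= x.2 <= z.2 + 1.
Proof.
move=> xb; split; first exact: bdry_notin xb.
by have [z [s [zD ->]]] := bdry_exists xb; exists z => //; exact: step_height_le.
Qed.

Lemma hp_mono (Z Z' S : set E) x : Z `<=` Z' -> S `<=` Z -> hp Z' S x <= hp Z S x.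
Proof.
move=> ZZ SZ; apply: le_prb; [exact: (measurable_hev countE)|exact: (measurable_hev countE)|].
move=> w [n [[Zn nZ] Sn]]; exists n; split => //; split; first exact: SZ.
by move=> i ilt /ZZ; exact: nZ.
Qed.

Definition out (a : int) (n : nat) : set E := [set x | ~ (a < x.2 < a + n%:Z)].

Lemma outP a n x : out a n x <-> x \notin slab a n.
Proof. by rewrite mem_slab; split => /negP. Qed.

Lemma fluct_le1 (u : E -> R) z : \sum_t u (t, z) ^+ 2 <= 1 -> fluct u z <= 1.
Proof.
move=> h; rewrite /fluct -[leRHS]sqrtr1 ler_sqrt//; apply: le_trans h.
rewrite (eq_bigr (fun t => u (t, z) ^+ 2 - (2 * smean u z * u (t, z) - smean u z ^+ 2))) => [|t _]; last by ring.
rewrite sumrB gerBl sumrB -mulr_sumr sumr_const -[X in _ - X]mulr_natl (card_torus R d N_gt1).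
have -> : \sum_t u (t, z) = NT * smean u z.
  by rewrite /slice_mean mulrA mulfV ?mul1r// gt_eqF// NT_gt0.
rewrite subr_ge0 (_ : 2 * _ * _ = 2 * (NT * smean u z ^+ 2)); last by ring.
by have := mulr_ge0 (ltW (NT_gt0 R d N_gt1)) (sqr_ge0 (smean u z)); lra.
Qed.

Lemma sum_indic (y : T) : \sum_t (`[<t = y>]%:R : R) = 1.
Proof.
rewrite (bigD1 y)//= asboolT// big1 ?addr0// => t /eqP ty; by rewrite asboolF.
Qed.

Lemma slab_exit a n k t t' (top : bool) : (k <= n)%N ->
  NT^-1 * ((if top then k else (n - k)%N)%:R / n%:R) - (lam ^+ k + lam ^+ (n - k)) <=
  hp (out a n) [set (t', a + (if top then n else 0%N)%:Z)] (t, a + k%:Z).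
Proof.
move=> kn; set b := if top then n else 0%N.
set y : E := (t', a + b%:Z); pose u := hp (out a n) [set y].
have harm t1 j : (0 < j < n)%N -> u (t1, a + j%:Z) = avg u (t1, a + j%:Z).
  by move=> jn; apply: (hp_step countE) => nj; apply: nj => /=; move: jn; lia.
have bdE j t1 : (j == 0%N) || (j == n) -> u (t1, a + j%:Z) = (j == b)%:R * `[<t1 = t'>]%:R.
  move=> jb; rewrite /u (hp_in countE); last by rewrite /out/=; move: jb => /orP[]/eqP->; lia.
  case: eqP => [->|jbn]; last by rewrite mul0r asboolF// => -[_ /addrI[]].
  by rewrite mul1r; congr ((nat_of_bool _)%:R); apply: asbool_equiv_eq; split => [[->]|->].
have fl j : (j == 0%N) || (j == n) -> fluct u (a + j%:Z) <= 1.
  move=> jb; apply: fluct_le1; under eq_bigr do rewrite bdE//.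
  apply: (@le_trans _ _ (\sum_t1 (`[<t1 = t'>]%:R : R))); last by rewrite sum_indic.
  by apply: ler_sum => t1 _; case: (j == b); case: asbool; rewrite ?(mul0r, mul1r, expr0n, expr1n).
have fa : fluct u a <= 1 by have := fl 0%N isT; rewrite addr0.
have fn : fluct u (a + n%:Z) <= 1 by apply: fl; rewrite eqxx orbT.
have := mixing N_gt1 d_gt0 harm fa fn t kn; rewrite mul1r -/(u _) => /ler_normlP[H _].
have mE j : (j == 0%N) || (j == n) -> smean u (a + j%:Z) = (j == b)%:R * NT^-1.
  move=> jb; rewrite /slice_mean; under eq_bigr do rewrite bdE//.
  by rewrite -mulr_sumr sum_indic mulr1 mulrC.
have m0 : smean u a = (0%N == b)%:R * NT^-1 by have := mE 0%N isT; rewrite addr0.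
have mn : smean u (a + n%:Z) = (n == b)%:R * NT^-1 by apply: mE; rewrite eqxx orbT.
have := slice_mean_interp harm kn; rewrite m0 mn => I.
have [n0|n0] := posnP n.
  have l0 : 0 <= lam by rewrite ltW// decay_gt0.
  rewrite n0 invr0 !mulr0 sub0r /u; apply: le_trans (hp_ge0 _ _ _).
  by rewrite oppr_le0 addr_ge0// exprn_ge0.
have nR : 0 < n%:R :> R by rewrite ltr0n.
have -> : NT^-1 * ((if top then k else (n - k)%N)%:R / n%:R) = smean u (a + k%:Z).
  apply: (mulfI (lt0r_neq0 nR)); rewrite I /b; case: (top) => //.
    rewrite eqxx eq_sym (negbTE (lt0n_neq0 n0)) mul0r mulr0 add0r mul1r.
    by rewrite mulrCA [n%:R * _]mulrC divfK ?gt_eqF// mulrC.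
  rewrite eqxx (negbTE (lt0n_neq0 n0)) mul0r mulr0 addr0 mul1r.
  by rewrite mulrCA [n%:R * _]mulrC divfK ?gt_eqF// mulrC.
by rewrite lerBlDl -lerBlDr; move: H; rewrite opprB.
Qed.

Lemma sum_hp_slice_le1 Z b x : \sum_t' hp Z [set (t', b)] x <= 1.
Proof.
have -> : \sum_t' hp Z [set (t', b)] x = hp Z [set` [seq ((t', b) : E) | t' <- enum {: T}]] x.
  by rewrite (hp_seq countE) ?big_map ?big_enum// map_inj_uniq ?enum_uniq// => t1 t2 [].
exact: (hp_le1 countE).
Qed.

(* An upper bound at one point follows from lower bounds at the others, the total mass being at most 1. *)
Lemma slice_hit_ub Z b x (e : R) : 0 <= e ->
  (forall t', NT^-1 * (1 - e) <= hp Z [set (t', b)] x) ->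
  forall t', hp Z [set (t', b)] x <= NT^-1 * (1 + NT * e).
Proof.
move=> e0 lb t'; have := sum_hp_slice_le1 Z b x; rewrite (bigD1 t')//= => H.
have N0 := NT_gt0 R d N_gt1.
have : \sum_(t1 | t1 != t') NT^-1 * (1 - e) <= \sum_(t1 | t1 != t') hp Z [set (t1, b)] x.
  by apply: ler_sum.
have -> : \sum_(t1 | t1 != t') NT^-1 * (1 - e) = (1 - e) - NT^-1 * (1 - e).
  have := sumr_const {: T} (NT^-1 * (1 - e)); rewrite -[X in _ = X]mulr_natl (card_torus R d N_gt1).
  rewrite mulrA mulfV ?gt_eqF// mul1r (bigD1 t')//=; lra.
have : 0 <= NT^-1 * e by rewrite mulr_ge0// invr_ge0 ltW.
have -> : NT^-1 * (1 + NT * e) = NT^-1 + e by rewrite mulrDr mulr1 mulKf ?gt_eqF.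
lra.
Qed.

Section killed.
Variables (h : nat).
Hypothesis Nh : (N < h)%N.

Definition tB : seq E := slab (- h%:Z) (2 * h).

Lemma mem_tB x : (x \in tB) = (`|x.2| < h)%N.
Proof. by rewrite mem_slab; move: x.2 => z; clear; lia. Qed.

Definition Kc (K : {fset E}) : set E := [set x | x \in K \/ ~ (`|x.2| < h)%N].

Definition sgn (s : bool) (z : nat) : int := if s then z%:Z else - z%:Z.

Definition exits (s : bool) : set E := [set x | x.2 = sgn s h].
Definition exitAll : set E := [set x | ~ (`|x.2| < h)%N].

Lemma exits_edge x : `|x.2|%N = h -> exits true x \/ exits false x.
Proof. by rewrite /exits/=; move: x.2 => z; clear; lia. Qed.

Definition fol (K : {fset E}) (s : bool) (x : E) : R := hp (Kc K) (exits s) x.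
Definition hitK (K : {fset E}) (x : E) : R := hp (Kc K) [set` K] x.

Lemma KcP K x : Kc K x <-> x \notin [seq z <- tB | z \notin K].
Proof.
rewrite mem_filter mem_tB negb_and negbK; split => [[->//|/negP->]|/orP[|/negP]]; rewrite ?orbT//.
  by left.
by right.
Qed.

Lemma bdryK (K : {fset E}) (x : E) : x \in bdry [seq z <- tB | z \notin K] -> x \in K \/ (`|x.2| = h)%N.
Proof.
move=> /bdry_height[+ [z]]; rewrite !mem_filter !mem_tB negb_and negbK.
by case/orP => [xK _ _|]; [left|move=> xh /andP[_ zh] zx; right; move: x.2 z.2 xh zh zx => a b; lia].
Qed.

Variable K : {fset E}.
Hypothesis K_in : forall x, x \in K -> (`|x.2| < N)%N.

Let K_tB x : x \in K -> (`|x.2| < h)%N.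
Proof. by move=> /K_in/ltn_trans; exact. Qed.

Lemma exit_sum x : (`|x.2| <= h)%N -> fol K true x + fol K false x + hitK K x = 1.
Proof.
have h0 : (0 < h)%N by exact: leq_ltn_trans Nh.
move=> xh; pose AA := exits true `|` exits false `|` [set` K] : set E.
have dis1 y : exits true y -> exits false y -> False by rewrite /exits/= => ->; lia.
have dis2 y : (exits true `|` exits false) y -> [set` K] y -> False.
  by move=> [|] /= + /K_tB; rewrite /exits/= => ->; lia.
have -> : fol K true x + fol K false x + hitK K x = hp (Kc K) AA x.
  by rewrite /fol /hitK -(hpU countE _ _ dis1) -(hpU countE _ _ dis2).
have [xD|xD] := boolP (x \in [seq z <- tB | z \notin K]).
  apply: (@hp_total R A d countE _ _ AA (@KcP K) _ _ xD) => y /bdryK[yK|yh]; first by right.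
  by left; exact: exits_edge.
rewrite (hp_in countE) ?asboolT//; last exact/KcP.
move: xD; rewrite mem_filter mem_tB negb_and negbK => /orP[xK|xn]; first by right.
by left; apply: exits_edge; apply/eqP; rewrite eqn_leq xh leqNgt.
Qed.

Lemma hitK_in x : x \in K -> hitK K x = 1.
Proof. by move=> xK; rewrite /hitK (hp_in countE) ?asboolT//; left. Qed.

Lemma fol_in x s : x \in K -> fol K s x = 0.
Proof.
move=> xK; rewrite /fol (hp_in countE) ?asboolF//; last by left.
by rewrite /exits/= => xs; have := K_tB xK; rewrite xs /sgn; case: (s); lia.
Qed.

Definition eqm (x : E) : R := avg (fun z => 1 - hitK K z) x.

Lemma hp_out0 (y x : E) : y \in K -> ~ (`|x.2| < h)%N -> hp (Kc K) [set y] x = 0.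
Proof.
move=> yK xh; rewrite (hp_in countE) ?asboolF//; last by right.
by move=> xy; move: xh; rewrite xy => /(_ (K_tB yK)).
Qed.

(* Time reversal: Green's identity between the hitting probability of [y]     *)
(* and the probability of leaving through the side [s].                       *)
Lemma reversal (y : E) s : y \in K ->
  avg (fol K s) y = \sum_t avg (hp (Kc K) [set y]) (t, sgn s h).
Proof.
move=> yK; have h0 : (0 < h)%N by exact: leq_ltn_trans Nh.
pose L' := slab (- h%:Z - 1) (2 * h + 2).
have L'E x : (x \in L') = (`|x.2| <= h)%N by rewrite mem_slab; move: x.2 => z; lia.
pose u := hp (Kc K) [set y]; pose b := fol K s.
have u0 x : x \notin tB -> u x = 0 by rewrite mem_tB => /negP; exact: hp_out0.
have uL' : uniq L' by exact: slab_uniq.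
have := @avg_adj R A d u b tB L' (slab_uniq _ _) uL'.
case/(_ _ _ u0)/Wrap => [x||].
- by rewrite mem_tB L'E => /ltnW.
- move=> x s'; rewrite mem_tB L'E; move: (x + st s') (step_height_le x s') => w.
  by move: x.2 w.2 => a1 a2; lia.
move=> adj; have yL : y \in L' by rewrite L'E ltnW// K_tB.
have split0 : \sum_(x <- L') (u x * avg b x - b x * avg u x) = 0 by rewrite sumrB adj subrr.
have termE x : x \in L' -> u x * avg b x - b x * avg u x =
    (x == y)%:R * avg b y - (x.2 == sgn s h)%:R * avg u x.
  rewrite L'E => xh; have [xK|xK] := boolP (x \in K).
    rewrite /b fol_in// mul0r subr0 /u (hp_in countE); last by left.
    have -> : (x.2 == sgn s h) = false by apply/negbTE/eqP => xs; have := K_tB xK; rewrite xs /sgn; case: (s); lia.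
    rewrite mul0r subr0; have [->|/eqP xy] := eqVneq x y; first by rewrite asboolT.
    by rewrite asboolF; [rewrite !mul0r|exact: xy].
  have -> : (x == y) = false by apply/negbTE; apply: contra xK => /eqP->.
  have [xB|xB] := boolP (x \in tB).
    have nK : ~ Kc K x by move/KcP; rewrite mem_filter xK xB.
    have -> : avg u x = u x by rewrite /u -(hp_step countE).
    have -> : avg b x = b x by rewrite /b /fol -(hp_step countE).
    rewrite mulrC subrr mul0r sub0r.
    rewrite (_ : _ == _ = false) ?mul0r ?oppr0//.
    by apply/negbTE/eqP => xs; move: xB; rewrite mem_tB xs /sgn; case: (s); lia.
  rewrite u0// !mul0r !sub0r; congr (- (_ * _)); rewrite /b /fol (hp_in countE).
    congr ((nat_of_bool _)%:R); rewrite /exits/=; by apply/asboolP/eqP.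
  by right => /=; apply/negP; rewrite -mem_tB.
rewrite (eq_big_seq _ termE) sumrB in split0.
have S1 : \sum_(x <- L') (x == y)%:R * avg b y = avg b y.
  by rewrite (bigD1_seq y)//= eqxx mul1r big1 ?addr0// => x /negbTE->; rewrite mul0r.
have S2 : \sum_(x <- L') (x.2 == sgn s h)%:R * avg u x = \sum_t avg u (t, sgn s h).
  rewrite big_slab exchange_big/=; apply: eq_bigr => t _.
  have kin : `|(sgn s h + h%:Z + 1)%R|%N \in iota 1 (2 * h + 2).-1.
    by rewrite mem_iota /sgn; case: (s); lia.
  rewrite (bigD1_seq _ kin) ?iota_uniq//= big1_seq ?addr0.
    have -> : - h%:Z - 1 + `|(sgn s h + h%:Z + 1)%R|%N%:Z = sgn s h by rewrite /sgn; case: (s); lia.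
    by rewrite eqxx mul1r.
  move=> k /andP[kn]; rewrite mem_iota => ki; rewrite (_ : _ == _ = false) ?mul0r//.
  by apply/negbTE; apply: contra kn => /eqP <-; apply/eqP; lia.
by move: split0; rewrite S1 S2 => /eqP; rewrite subr_eq0 => /eqP.
Qed.

Lemma avg_edge (y : E) s t : y \in K ->
  avg (hp (Kc K) [set y]) (t, sgn s h) = (2 * D)^-1 * hp (Kc K) [set y] (t, sgn s h.-1).
Proof.
move=> yK; have h0 : (1 < h)%N by exact: ltn_trans N_gt1 Nh.
set u := hp _ _; have := avg_cylE u t (sgn s h).
have u0 x : ~ (`|x.2| < h)%N -> u x = 0 by exact: hp_out0.
rewrite big1 ?add0r => [|j _]; last by rewrite !u0 ?addr0//=; rewrite /sgn; case: (s); lia.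
have D0 : 2 * D != 0 by rewrite mulf_neq0 ?pnatr_eq0.
have -> : u (t, sgn s h + 1) + u (t, sgn s h - 1) = u (t, sgn s h.-1).
  rewrite /sgn; case: (s).
    by rewrite u0 ?add0r /=; [congr (u (_, _)); lia|lia].
  by rewrite [X in _ + X]u0 ?addr0 /=; [congr (u (_, _)); lia|lia].
by move=> <-; rewrite mulKf.
Qed.

Lemma entrance_eq (y : E) s : y \in K ->
  smean (hp (Kc K) [set y]) (sgn s N) = (2 * D * (h - N)%N%:R / NT) * avg (fol K s) y.
Proof.
move=> yK; set u := hp _ _; have u0 x : ~ (`|x.2| < h)%N -> u x = 0 by exact: hp_out0.
have hN1 : (N.+1 <= h)%N by [].
rewrite reversal//; under eq_bigr do rewrite avg_edge//.
rewrite -mulr_sumr -/u; set n := (h - N)%N.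
have n0 : (0 < n)%N by rewrite subn_gt0.
have nR : n%:R != 0 :> R by rewrite pnatr_eq0 -lt0n.
have m0 : smean u (sgn s h) = 0.
  by rewrite /slice_mean big1 ?mulr0// => t _; rewrite u0//= /sgn; case: (s); lia.
have harm (a : int) t k : (a = N%:Z \/ a = - h%:Z) -> (0 < k < n)%N -> u (t, a + k%:Z) = avg u (t, a + k%:Z).
  move=> aE kn; apply: (hp_step countE) => -[/K_in|] /=; move: aE kn; rewrite /n => -[]->; lia.
have key : n%:R * smean u (sgn s h.-1) = smean u (sgn s N).
  case: s m0 => m0.
    have := slice_mean_interp (fun t k => @harm N%:Z t k (or_introl erefl)) (leq_pred n).
    rewrite (_ : N%:Z + n%:Z = sgn true h); last by rewrite /sgn /n; lia.
    rewrite m0 mulr0 addr0 (_ : N%:Z + n.-1%:Z = sgn true h.-1); last by rewrite /sgn /n; lia.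
    by rewrite (_ : n - n.-1 = 1)%N ?mul1r//; lia.
  have := slice_mean_interp (fun t k => @harm (- h%:Z) t k (or_intror erefl)) n0.
  rewrite (_ : - h%:Z + n%:Z = sgn false N); last by rewrite /sgn /n; lia.
  rewrite (_ : - h%:Z = sgn false h)// m0 mulr0 add0r mul1r.
  by rewrite (_ : sgn false h + 1%N%:Z = sgn false h.-1)//; rewrite /sgn; lia.
rewrite -key /slice_mean; have D0 : D != 0 by rewrite pnatr_eq0.
have NT0 := lt0r_neq0 (NT_gt0 R d N_gt1).
by move: (D) (NT) D0 NT0 => D' NT' D0 NT0; field; rewrite NT0 D0.
Qed.

Local Notation rho := (N%:R / h%:R : R).

Lemma vertical_exit (s : bool) (x : E) : (`|x.2| <= h)%N ->
  hp (out (- h%:Z) (2 * h)) (exits s) x = (1 + (sgn s 1 * x.2)%:~R / h%:R) / 2.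
Proof.
have h0 : (0 < h)%N by exact: leq_ltn_trans Nh.
have hR : 0 < h%:R :> R by rewrite ltr0n.
move=> xh; pose f (x : E) : R := (1 + (sgn s 1 * x.2)%:~R / h%:R) / 2.
have favg z : avg f z = f z.
  have D0 : 2 * D != 0 by rewrite mulf_neq0 ?pnatr_eq0.
  apply: (mulfI D0); case: z => t z; rewrite avg_cylE /f /= !mulrDr !intrD.
  by rewrite sumr_const card_ord mulrN intrN -[X in X + _]mulr_natl -natr1; field; rewrite gt_eqF.
have bd z : `|z.2|%N = h -> hp (out (- h%:Z) (2 * h)) (exits s) z = f z.
  move=> zh; rewrite (hp_in countE); last by rewrite /out/=; move: z.2 zh => a1; lia.
  have [zs|zs] := pselect (exits s z).
    rewrite asboolT// /f; move: zs; rewrite /exits/= => ->.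
    have -> : sgn s 1 * sgn s h = h%:Z by rewrite /sgn; case: (s); lia.
    by rewrite -[_%:~R]/(h%:R) divff ?gt_eqF//; lra.
  rewrite asboolF// /f; have -> : sgn s 1 * z.2 = - h%:Z.
    by move: zs zh; rewrite /exits /sgn/=; case: (s); rewrite ?mulN1r ?mul1r; move: z.2 => a1; lia.
  by rewrite intrN -[h%:Z%:~R]/(h%:R) mulNr divff ?gt_eqF// subrr mul0r.
have [xB|xB] := boolP (x \in tB); last by apply: bd; apply/eqP; rewrite eqn_leq xh leqNgt -mem_tB.
have eqH z : z \in tB -> hp (out (- h%:Z) (2 * h)) (exits s) z = avg (hp (out (- h%:Z) (2 * h)) (exits s)) z.
  by move=> zB; apply: (hp_step countE) => /outP; rewrite zB.
have bdB z : z \in bdry tB -> `|z.2|%N = h.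
  by move=> /bdry_height[+ [z']]; rewrite !mem_tB; move: z.2 z'.2 => a1 a2; lia.
apply/eqP; rewrite eq_le; apply/andP; split.
  by apply: (@max_principle_le R A d tB _ f) xB => z zB; rewrite ?favg -?eqH// ?subrr// bd ?bdB.
by apply: (@max_principle_le R A d tB f) xB => z zB; rewrite ?favg -?eqH// ?subrr// bd ?bdB.
Qed.

Lemma fol_le_vertical s x : (`|x.2| <= h)%N -> fol K s x <= hp (out (- h%:Z) (2 * h)) (exits s) x.
Proof.
move=> xh; apply: hp_mono => z; last by rewrite /exits /out /sgn/=; move: z.2; case: (s) => a1; lia.
by rewrite /out /Kc/= => zo; right; move: z.2 zo => a1; lia.
Qed.

Lemma vertical_le_fol s x : (`|x.2| <= h)%N ->
  hp (out (- h%:Z) (2 * h)) (exits s) x <= fol K s x + hitK K x.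
Proof.
move=> xh; have xh' := xh.
have := fol_le_vertical (~~ s) xh; have := exit_sum xh.
have := vertical_exit (~~ s) xh; have := vertical_exit s xh.
have -> : sgn (~~ s) 1 * x.2 = - (sgn s 1 * x.2) by case: (s); rewrite /sgn/= ?mulNr ?opprK ?mul1r.
rewrite intrN; case: s => /=; lra.
Qed.

Hypothesis rho_small : rho <= 2^-1.
Hypothesis capture_small : forall x, `|x.2|%N = N -> hitK K x <= rho.

Let rho0 : 0 <= rho. Proof. by rewrite divr_ge0. Qed.

Lemma fol_ratio s x : (`|x.2| <= N)%N ->
  (1 - 3 * rho) / 2 * (1 - hitK K x) <= fol K s x <= (1 + 4 * rho) / 2 * (1 - hitK K x).
Proof.
move=> xN.
pose Dm := [seq z <- slab (- N%:Z) (2 * N) | z \notin K].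
have mD z : (z \in Dm) = (z \notin K) && (`|z.2| < N)%N by rewrite mem_filter mem_slab; congr andb; move: z.2 => a1; lia.
have bdN z : (z \in K) || (`|z.2|%N == N) -> (1 - 3 * rho) / 2 * (1 - hitK K z) <= fol K s z <= (1 + 4 * rho) / 2 * (1 - hitK K z).
  case/orP => [zK|/eqP zN]; first by rewrite hitK_in// fol_in// subrr !mulr0 lexx.
  have zh : (`|z.2| <= h)%N by rewrite zN ltnW.
  have := capture_small zN; have := fol_le_vertical s zh; have := vertical_le_fol s zh.
  have := vertical_exit s zh; have : 0 <= hitK K z by exact: hp_ge0.
  have : (sgn s 1 * z.2)%:~R / h%:R = rho \/ (sgn s 1 * z.2)%:~R / h%:R = - rho.
    have : sgn s 1 * z.2 = N%:Z \/ sgn s 1 * z.2 = - N%:Z by rewrite /sgn; case: (s); lia.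
    by move=> [->|->]; [left|right]; rewrite ?intrN ?mulNr.
  have hh0 := rho0; have hh := rho_small.
  have : 0 <= fol K s z by exact: hp_ge0.
  move: (rho) (hp _ _ _) (fol _ _ _) (hitK _ _) hh0 hh => r v f k r0 r2 f0 e k0 -> v1 v2 kr.
  have p1 : 0 <= (1 + 4 * r) * (r - k) by rewrite mulr_ge0 ?subr_ge0//; lra.
  have p2 : 0 <= r * (2^-1 - r) by rewrite mulr_ge0 ?subr_ge0.
  apply/andP; split; last by move: e v2 => [->|->]; lra.
  have [r3|r3] := leP 0 (1 - 3 * r).
    have : 0 <= (1 - 3 * r) * k by rewrite mulr_ge0.
    by move: e v1 => [->|->]; lra.
  by apply: le_trans f0; rewrite mulr_le0_ge0//; lra.
have hN : (N <= h)%N by exact: ltnW.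
have bdD z : z \in bdry Dm -> (z \in K) || (`|z.2|%N == N).
  move=> /bdry_height[+ [z']]; rewrite !mD negb_and negbK => /orP[->//|zN] /andP[_ z'N] zz'.
  by apply/orP; right; move: z.2 z'.2 zN z'N zz' => a1 a2; lia.
have nKc z : z \in Dm -> ~ Kc K z.
  by rewrite mD => /andP[/negP zK zN] [//|]; apply; exact: leq_trans hN.
have harm (c : R) z : z \in Dm -> c * (1 - hitK K z) = avg (fun z => c * (1 - hitK K z)) z.
  by move=> zD; rewrite avgZ avgB (avg_cst s0) -(hp_step countE)//; exact: nKc.
have harmf z : z \in Dm -> fol K s z = avg (fol K s) z.
  by move=> zD; rewrite -(hp_step countE)//; exact: nKc.
have [xD|xD] := boolP (x \in Dm); last first.
  by apply: bdN; move: xD; rewrite mD negb_and negbK => /orP[->//|]; rewrite -leqNgt => Nx; rewrite [X in _ || X]eqn_leq xN Nx orbT.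
apply/andP; split.
  apply: (@max_principle_le R A d Dm (fun z => (1 - 3 * rho) / 2 * (1 - hitK K z)) (fol K s)) xD => z zD.
    by rewrite -harm// -harmf// !subrr.
  by have /andP[] := bdN z (bdD z zD).
apply: (@max_principle_le R A d Dm (fol K s) (fun z => (1 + 4 * rho) / 2 * (1 - hitK K z))) xD => z zD.
  by rewrite -harm// -harmf// !subrr.
by have /andP[] := bdN z (bdD z zD).
Qed.

(* [1/K_N] in the notation of the paper *)
Local Notation invKN := (D * (h - N)%N%:R / NT).

Lemma entrance_bounds (y : E) s : y \in K ->
  (1 - 3 * rho) * (eqm y * invKN) <= smean (hp (Kc K) [set y]) (sgn s N) <= (1 + 4 * rho) * (eqm y * invKN).
Proof.
move=> yK; rewrite entrance_eq//.
have c0 : 0 <= invKN by rewrite divr_ge0 ?mulr_ge0// ltW// NT_gt0.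
have nb s' : (`|(y + st s')%R.2| <= N)%N by move: (y + st s') (step_height_le y s') (K_in yK) => w; move: y.2 w.2 => a1 a2; lia.
have lo : (1 - 3 * rho) / 2 * eqm y <= avg (fol K s) y.
  by rewrite /eqm -avgZ; apply: (le_avg s0) => s'; have /andP[] := fol_ratio s (nb s').
have hi : avg (fol K s) y <= (1 + 4 * rho) / 2 * eqm y.
  by rewrite /eqm -avgZ; apply: (le_avg s0) => s'; have /andP[] := fol_ratio s (nb s').
have := ler_wpM2l c0 lo; have := ler_wpM2l c0 hi.
rewrite (_ : 2 * D * (h - N)%N%:R / NT = 2 * invKN); last by ring.
move: (invKN) (avg _ _) (eqm _) => c a e H1 H2; apply/andP; split; lra.
Qed.

End killed.

End cylinder_slabs.

(** * Mutual energy and capacity *)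

Section cylinder_energy.
Variables (R : realType) (d N h : nat).
Hypotheses (N_gt1 : (1 < N)%N) (d_gt0 : (0 < d)%N) (Nh : (N < h)%N).
Local Notation A := 'Z_N.
Local Notation T := 'rV[A]_d.
Local Notation E := (lattice A d).
Local Notation st := (@step A d).
Local Notation s0 := ((None, false) : direction d).
Local Notation avg := (@avg R _ _ st).
Local Notation hp := (@hp R _ _ s0 st).
Local Notation pr := (@pr R _ _ s0 st).
Local Notation D := (d.+1%:R : R).
Local Notation NT := (N%:R ^+ d : R).
Local Notation smean := (@slice_mean R d N).
Local Notation lam := (decay R d N).
Local Notation countE := (countable_cyl d N).
Local Notation hitK := (@hitK R d N h).
Local Notation fol := (@fol R d N h).
Local Notation eqm := (@eqm R d N h).
Local Notation Kc := (@Kc d N h).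
Local Notation invKN := (D * (h - N)%N%:R / NT).
Local Notation rho := (N%:R / h%:R : R).
Local Notation U := ([set x | (`|x.2| < h)%N] : set E).
Local Notation traj := (trajectory E).

Let h0 : (0 < h)%N. Proof. exact: leq_ltn_trans Nh. Qed.

Lemma exit_after n w : time_lt (Some n) (exit U w) <-> forall i, (i <= n)%N -> (`|(w i).2| < h)%N.
Proof.
have := first_timeP [set n | ~ U (w n)]; rewrite /exit; case: first_time => [m [wm mm]|wU] /=.
  split=> [nm i ni|H]; first by apply: contrapT => /=; exact/mm/(leq_ltn_trans ni).
  by rewrite ltnNge; apply/negP => /H.
by split => // _ i _; apply: contrapT => /wU.
Qed.

Definition pn n (x y : E) : R := pr x [set w | w n = y /\ time_lt (Some n) (exit U w)].

Definition alive n (x : E) : R := pr x [set w | forall i, (i < n)%N -> (`|(w i).2| < h)%N].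

Let measurable_alive n : measurable ([set w | forall i, (i < n)%N -> (`|(w i).2| < h)%N] : set traj).
Proof.
apply: (@fdep_measurable _ countE n) => w w' ww' H i ilt.
by rewrite -ww' ?H// ltnW.
Qed.

Let measurable_pn n y : measurable ([set w | w n = y /\ time_lt (Some n) (exit U w)] : set traj).
Proof.
apply: (@fdep_measurable _ countE n) => w w' ww' [wn /exit_after H].
by split; [rewrite -ww'|apply/exit_after => i ilt; rewrite -ww' ?H].
Qed.

Lemma pn0 x y : (`|x.2| < h)%N -> pn 0 x y = (x == y)%:R.
Proof.
move=> xh; rewrite /pn; have [<-|xy] := eqVneq x y.
  rewrite -(pr_setT R s0 st x); apply: pr_as => // w w0; split => // _.
  by split => //; apply/exit_after => i; rewrite leqn0 => /eqP->; rewrite w0.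
rewrite mulr0n -[RHS](prb0 (walk_law R s0 st x)); apply: pr_as => // w w0; split => // -[w0' _].
by move: xy; rewrite -w0 w0' eqxx.
Qed.

Lemma pn_step n x y : (`|x.2| < h)%N -> pn n.+1 x y = avg (fun z => pn n z y) x.
Proof.
move=> xh; rewrite /pn (pr_cons countE)//; congr (_ * _); apply: eq_bigr => s _; congr (pr _ _).
apply/seteqP; split => w [wn /exit_after H]; split => //; apply/exit_after.
  by move=> i ilt; exact: (H i.+1).
by case=> [|i]//= ilt; exact: H.
Qed.

Lemma alive0 x : alive 0 x = 1.
Proof. by rewrite -(pr_setT R s0 st x); congr (pr _ _); apply/seteqP; split. Qed.

Lemma alive_step n x : (`|x.2| < h)%N -> alive n.+1 x = avg (alive n) x.
Proof.
move=> xh; rewrite /alive (pr_cons countE)//; congr (_ * _); apply: eq_bigr => s _; congr (pr _ _).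
apply/seteqP; split => w H; first by move=> i ilt; exact: (H i.+1).
by case=> [|i]//= ilt; exact: H.
Qed.

Lemma alive_out n x : ~~ (`|x.2| < h)%N -> alive n.+1 x = 0.
Proof.
move=> xh; rewrite -(prb0 (walk_law R s0 st x)); apply: pr_as => // w w0; split => // H.
by move: xh; rewrite -w0 H.
Qed.

Lemma alive_ge0 n x : 0 <= alive n x. Proof. exact: prb_ge0. Qed.

Lemma alive_decr n x : alive n.+1 x <= alive n x.
Proof. by apply: le_prb => // w H i ilt; apply: H; exact: ltnW. Qed.

Lemma avg_height (f : int -> R) (x : E) :
  2 * D * avg (fun z => f z.2) x = 2 * d%:R * f x.2 + (f (x.2 + 1) + f (x.2 - 1)).
Proof.
by case: x => t z; rewrite avg_cylE/= sumr_const card_ord -[X in X + _]mulr_natl; ring.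
Qed.

Lemma sum_alive M x : (`|x.2| <= h)%N ->
  \sum_(n < M) alive n.+1 x <= D * (h%:R ^+ 2 - (x.2%:~R) ^+ 2).
Proof.
elim: M x => [|M IH] x xh.
  rewrite big_ord0 mulr_ge0// subr_ge0 -[leLHS]real_normK ?num_real// -intr_norm lerXn2r ?nnegrE//.
  by rewrite -[_%:R]/(h%:Z%:~R) ler_int; move: x.2 xh => z; lia.
have [xU|xU] := boolP (`|x.2| < h)%N; last first.
  rewrite big1 => [|n _]; last by rewrite alive_out.
  apply: le_trans (IH x xh); apply: sumr_ge0 => n _; exact: alive_ge0.
have D0 : 0 < 2 * D by rewrite mulr_gt0.
rewrite (eq_bigr (fun n : 'I_M.+1 => avg (alive n) x)) => [|n _]; last by rewrite alive_step.
rewrite -avg_sum -(ler_pM2l D0).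
have H : avg (fun z => \sum_(i < M.+1) alive i z) x <= avg (fun z => 1 + D * (h%:R ^+ 2 - (z.2%:~R) ^+ 2)) x.
  apply: (le_avg s0) => s; rewrite big_ord_recl alive0 lerD2l; apply: IH.
  by move: (x + st s) (step_height_le x s) => w; move: w.2 x.2 xU => a b; lia.
apply: le_trans (ler_wpM2l (ltW D0) H) _.
rewrite (avg_height (fun z => 1 + D * (h%:R ^+ 2 - z%:~R ^+ 2))) !intrD.
rewrite le_eqVlt; apply/orP; left; apply/eqP; rewrite -natr1; ring.
Qed.

Lemma alive_le M x : (0 < M)%N -> (`|x.2| <= h)%N -> alive M x <= D * h%:R ^+ 2 / M%:R.
Proof.
move=> M0 xh; rewrite ler_pdivlMr ?ltr0n//.
apply: (@le_trans _ _ (\sum_(n < M) alive n.+1 x)).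
  have -> : alive M x * M%:R = \sum_(n < M) alive M x by rewrite sumr_const card_ord mulr_natr.
  apply: ler_sum => n _.
  have : forall m k, (m <= k)%N -> alive k x <= alive m x.
    by move=> m; elim=> [|k IHk]; [rewrite leqn0 => /eqP->|rewrite leq_eqVlt => /predU1P[->//|/IHk]; apply: le_trans; exact: alive_decr].
  exact.
apply: le_trans (sum_alive M xh) _; rewrite ler_wpM2l// gerBl; exact: sqr_ge0.
Qed.

Section one_set.
Variable K : {fset E}.
Hypothesis K_in : forall x, x \in K -> (`|x.2| < N)%N.

Let K_h x : x \in K -> (`|x.2| < h)%N.
Proof. by move=> /K_in/ltn_trans; exact. Qed.

Lemma hitK_ge0 x : 0 <= hitK K x. Proof. exact: hp_ge0. Qed.
Lemma hitK_le1 x : hitK K x <= 1. Proof. exact: (hp_le1 countE). Qed.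

Lemma hitK_out x : ~~ (`|x.2| < h)%N -> hitK K x = 0.
Proof.
move=> xh; rewrite /Submission.hitK (hp_in countE) ?asboolF//; first by move=> /K_h; apply/negP.
by right; exact/negP.
Qed.

Lemma eqm_ge0 x : 0 <= eqm K x.
Proof. by apply: avg_ge0 => s; rewrite subr_ge0 hitK_le1. Qed.

Lemma hitK_last_exit M x : (`|x.2| <= h)%N ->
  hitK K x <= \sum_(n < M) \sum_(y <- K) pn n x y * eqm K y + alive M x.
Proof.
elim: M x => [|M IH] x xh; first by rewrite big_ord0 add0r alive0 hitK_le1.
have [xU|xU] := boolP (`|x.2| < h)%N; last first.
  rewrite hitK_out// addr_ge0 ?alive_ge0// sumr_ge0// => n _; apply: sumr_ge0 => y _.
  by rewrite mulr_ge0 ?eqm_ge0// prb_ge0.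
have -> : hitK K x = avg (hitK K) x + (x \in K)%:R * eqm K x.
  have [xK|xK] := boolP (x \in K).
    by rewrite mul1r /Submission.eqm avgB (avg_cst s0) subrKC hitK_in.
  by rewrite mul0r addr0 {1}/Submission.hitK (hp_step countE)// => -[|]; [exact/negP|].
rewrite big_ord_recl alive_step// addrAC -addrA [leLHS]addrC; apply: lerD.
  rewrite (eq_bigr (fun y => (x == y)%:R * eqm K y)) => [|y _]; last by rewrite pn0.
  have [xK|xK] := boolP (x \in K); last by rewrite mul0r sumr_ge0// => y _; rewrite mulr_ge0// eqm_ge0.
  by rewrite (big_rem x)//= eqxx lerDl sumr_ge0// => y _; rewrite mulr_ge0// eqm_ge0.
rewrite (eq_bigr (fun i : 'I_M => avg (fun z => \sum_(y <- K) pn i z y * eqm K y) x)) => [|i _]; last first.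
  rewrite avg_sum; apply: eq_bigr => y _; rewrite pn_step// mulrC -avgZ.
  by apply: eq_avg => s; rewrite mulrC.
rewrite -avg_sum addrC -avgD; apply: (le_avg s0) => s; apply: IH.
by move: (x + st s) (step_height_le x s) => w; move: w.2 x.2 xU => a b; lia.
Qed.

Lemma hitK_green x : (`|x.2| <= h)%N ->
  ((hitK K x)%:E <= \sum_(y <- K) killed_green R U x y * (eqm K y)%:E)%E.
Proof.
move=> xh; apply/lee_addgt0Pr => e e0.
pose M := (Num.truncn (D * h%:R ^+ 2 / e)).+1.
have aM : alive M x <= e.
  apply: le_trans (alive_le _ xh) _ => //; rewrite ler_pdivrMr ?ltr0n// [leRHS]mulrC -ler_pdivrMr//.
  have c0 : 0 <= D * h%:R ^+ 2 / e by rewrite divr_ge0 ?(ltW e0)// mulr_ge0// exprn_ge0.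
  by have /andP[_ /ltW] := truncn_itv c0.
apply: (@le_trans _ _ ((\sum_(n < M) \sum_(y <- K) pn n x y * eqm K y + e)%:E)).
  by rewrite lee_fin; apply: le_trans (hitK_last_exit M xh) _; rewrite lerD2l.
rewrite EFinD leeD2r// exchange_big/= -sumEFin; apply: lee_sum => y _.
rewrite -mulr_suml EFinM lee_wpmul2r ?lee_fin ?eqm_ge0// -sumEFin.
pose F n := srw R x [set w | w n = y /\ time_lt (Some n) (exit U w)].
rewrite (eq_bigr (fun n : 'I_M => F n)) => [|n _]; last by rewrite /F /pn -prbE.
rewrite -(big_mkord xpredT F); exact: nneseries_lim_ge.
Qed.

Lemma killed_equilibriumE x : x \in K -> killed_equilibrium R U K x = (eqm K x)%:E.
Proof.
move=> xK; rewrite /killed_equilibrium xK; have xU := K_h xK.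
pose G : set traj := [set w | time_lt (exit U w) (hit_pos [set` K] w)].
have GP w : G w <-> exists n, [/\ ~ U (w n), forall i, (i < n)%N -> U (w i) &
    forall i, (1 <= i <= n)%N -> w i \notin K].
  rewrite /G/=; split.
    have := first_timeP [set n | ~ U (w n)]; rewrite -/(exit U _).
    have := first_timeP [set n | (1 <= n)%N /\ [set` K] (w n)]; rewrite -/(hit_pos _ _).
    case: (exit U w) => [m|]; last by case: (hit_pos _ _).
    move=> HK [wm mU] H; exists m; split => //; first by move=> i /mU/contrapT.
    move=> i /andP[i1 im]; apply/negP => wiK.
    case: (hit_pos _ _) HK H => [p [_ pmin] /= mp|/(_ i) + _]; last by apply.
    by apply: (pmin i) => //; exact: leq_ltn_trans mp.
  move=> [n [wn wU wK]].
  have -> : exit U w = Some n by apply/(hit_hitat (~` U)); split => // i ilt; apply; exact: wU.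
  have := first_timeP [set n | (1 <= n)%N /\ [set` K] (w n)]; rewrite -/(hit_pos _ _).
  case: (hit_pos _ _) => //= p [[p1 pK] _]; rewrite ltnNge; apply/negP => pn'.
  by have := wK p; rewrite p1 pn' => /(_ isT)/negP.
have mG : measurable G.
  have -> : G = \bigcup_n [set w | [/\ ~ U (w n), forall i, (i < n)%N -> U (w i) &
      forall i, (1 <= i <= n)%N -> w i \notin K]].
    by apply/seteqP; split => w; [move=> /GP[n]; exists n|move=> [n _ H]; apply/GP; exists n].
  apply: bigcupT_measurable => n; apply: (@fdep_measurable _ countE n).
  move=> w w' ww' [wn wU wK]; split.
  - by rewrite -ww'.
  - by move=> i ilt; rewrite -ww' ?(ltnW ilt)//; exact: wU.
  - by move=> i /andP[i1 ilt]; rewrite -ww'//; apply: wK; rewrite i1.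
have GE w : G (consw x w) <-> hev (Kc K) (@exitAll d N h) w.
  split=> [/GP[[|n] [wn wU wK]]|[n [[Zn nZ] Sn]]]; first by case: wn.
    exists n; split => //; split; first by right.
    move=> i ilt [iK|]; first by have := wK i.+1; rewrite /= ltnW// iK => /(_ isT).
    by apply; exact: (wU i.+1).
  apply/GP; exists n.+1; split => //.
    by case=> [_|i ilt]; [exact: xU|apply: contrapT => nU; apply: (nZ i) => //; right].
  case=> [//|i] /=; rewrite ltnS leq_eqVlt => /predU1P[->|ilt].
    by apply/negP => /K_h.
  by apply/negP => iK; apply: (nZ i) => //; left.
rewrite -/G -[LHS]/(srw R x G) (prbE _ mG) -/(pr x G) (pr_cons countE)//.
congr (_%:E); congr (_ * _); apply: eq_bigr => s _.
rewrite (_ : _ @^-1` G = hev (Kc K) (@exitAll d N h)); last by apply/seteqP; split => w /GE.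
rewrite -[LHS]/(hp (Kc K) (@exitAll d N h) (x + st s)); apply/eqP; rewrite eq_sym subr_eq; apply/eqP.
rewrite /Submission.hitK -(hpU countE) => [|z zh /K_h//].
set y := x + st s; have [yD|yD] := boolP (y \in [seq z <- tB d N h | z \notin K]).
  have bS z : z \in bdry [seq z <- tB d N h | z \notin K] -> (@exitAll d N h `|` [set` K]) z.
    by move=> /bdry_notin zD; have [zK|zh] : Kc K z; [exact/KcP|right|left].
  have ZD z : Kc K z <-> z \notin [seq z <- tB d N h | z \notin K] by exact: KcP.
  by rewrite (@hp_total R A d countE _ (Kc K) _ ZD bS y yD).
rewrite (hp_in countE); last exact/KcP.
by rewrite asboolT//; have [yK|yh] : Kc K y; [exact/KcP|right|left].
Qed.

Hypothesis rho_small : rho <= 2^-1.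
Hypothesis capture_small : forall x, `|x.2|%N = N -> hitK K x <= rho.

Definition capacity : R := \sum_(y <- K) eqm K y.

Definition hit_mean (s : bool) : R := smean (hitK K) (sgn s N).

Lemma hitK_sum x : hitK K x = \sum_(y <- K) hp (Kc K) [set y] x.
Proof.
by rewrite /Submission.hitK -(hp_seq countE) ?fset_uniq//; congr (hp _ _ _); apply/seteqP; split.
Qed.

Lemma hit_mean_bounds s : (1 - 3 * rho) * (capacity * invKN) <= hit_mean s <= (1 + 4 * rho) * (capacity * invKN).
Proof.
have -> : hit_mean s = \sum_(y <- K) smean (hp (Kc K) [set y]) (sgn s N).
  rewrite /hit_mean /slice_mean; under eq_bigr do rewrite hitK_sum.
  by rewrite exchange_big/= mulr_sumr.
rewrite /capacity mulr_suml !mulr_sumr big_seq [X in _ <= X <= _]big_seq [X in _ <= _ <= X]big_seq.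
by apply/andP; split; apply: ler_sum => y yK; have /andP[] := entrance_bounds N_gt1 d_gt0 Nh K_in rho_small capture_small s yK.
Qed.

Lemma hitK_harm t z : (N%:Z <= z) -> (z < h%:Z) -> hitK K (t, z) = avg (hitK K) (t, z).
Proof.
move=> Nz zh; apply: (hp_step countE) => -[/K_in|] /=; first by move: Nz; clear; lia.
by apply; move: Nz zh; clear; lia.
Qed.

Lemma hit_mean_interp (L : nat) : (N <= L <= h)%N ->
  (h - N)%N%:R * smean (hitK K) L%:Z = (h - L)%N%:R * hit_mean true.
Proof.
move=> /andP[NL Lh].
have harm t k : (0 < k < h - N)%N -> hitK K (t, N%:Z + k%:Z) = avg (hitK K) (t, N%:Z + k%:Z).
  by move=> kn; apply: hitK_harm; move: kn; clear; lia.
have kn : (L - N <= h - N)%N by exact: leq_sub2r.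
have := slice_mean_interp harm kn.
have -> : N%:Z + (h - N)%N%:Z = h%:Z by move: Nh; clear; lia.
have -> : N%:Z + (L - N)%N%:Z = L%:Z by move: NL; clear; lia.
have -> : smean (hitK K) h%:Z = 0.
  by rewrite /slice_mean big1 ?mulr0// => t _; rewrite hitK_out//= ltnn.
by rewrite mulr0 addr0 (_ : h - N - (L - N) = h - L)%N//; move: NL Lh; clear; lia.
Qed.

Lemma hitK_lb (L : nat) x : (2 * N <= L)%N -> (2 * L <= h)%N -> lam ^+ (L - N) <= (16 * NT)^-1 ->
  (`|x.2| <= N)%N -> hit_mean true / 16 <= hitK K x.
Proof.
move=> NL Lh mixL xN.
have NT0 := NT_gt0 R d N_gt1; have N0 : (0 < N)%N by exact: ltnW.
have L0 : (0 < L)%N by move: NL N0; clear; lia.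
pose u (z : E) := \sum_t hp (out (- L%:Z) (2 * L)) [set (t, L%:Z)] z * hitK K (t, L%:Z).
have lu : hit_mean true / 16 <= u x.
  have lb t : NT^-1 / 8 <= hp (out (- L%:Z) (2 * L)) [set (t, L%:Z)] x.
    pose k := `|(x.2 + L%:Z)%R|%N; have kn : (k <= 2 * L)%N by rewrite /k; move: x.2 xN NL => z; clear; lia.
    have xE : x = (x.1, - L%:Z + k%:Z).
      by rewrite /k; case: (x) xN => t0 z /= zN; congr (_, _); move: zN NL; clear; lia.
    have := slab_exit R N_gt1 d_gt0 (- L%:Z) x.1 t true kn; rewrite -xE.
    rewrite (_ : - L%:Z + (2 * L)%N%:Z = L%:Z); last by clear; lia.
    have k4 : 4^-1 <= k%:R / (2 * L)%N%:R :> R.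
      have L0' : 0 < (2 * L)%N%:R :> R by rewrite ltr0n muln_gt0.
      rewrite ler_pdivlMr// mulrC ler_pdivrMr// -natrM ler_nat /k.
      by move: x.2 xN NL => z; clear; lia.
    have mono i : (L - N <= i)%N -> lam ^+ i <= (16 * NT)^-1.
      move=> Li; apply: le_trans mixL; rewrite -(subnK Li) exprD ler_piMl ?exprn_ge0//.
        exact/ltW/decay_gt0.
      by rewrite exprn_ile1 ?(ltW (decay_gt0 _ _ _))// ltW// decay_lt1.
    have m1 : lam ^+ k <= (16 * NT)^-1 by apply: mono; rewrite /k; move: x.2 xN NL => z; clear; lia.
    have m2 : lam ^+ (2 * L - k) <= (16 * NT)^-1 by apply: mono; rewrite /k; move: x.2 xN NL => z; clear; lia.
    have c0 : 0 < NT^-1 by rewrite invr_gt0.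
    have := ler_wpM2l (ltW c0) k4; move: m1 m2; rewrite invfM; lra.
  apply: (@le_trans _ _ (8^-1 * smean (hitK K) L%:Z)); last first.
    rewrite /slice_mean mulrA mulr_sumr; apply: ler_sum => t _.
    by rewrite ler_wpM2r ?hitK_ge0// mulrC.
  have I : (N <= L <= h)%N by move: NL Lh; clear; lia.
  have := hit_mean_interp I; have hm0 : 0 <= hit_mean true.
    by rewrite mulr_ge0 ?invr_ge0 ?(ltW NT0)// sumr_ge0// => t _; exact: hitK_ge0.
  have a0 : 0 < (h - N)%N%:R :> R by rewrite ltr0n subn_gt0.
  have a1 : (h - N)%N%:R / 2 <= (h - L)%N%:R :> R.
    by rewrite ler_pdivrMr// -natrM ler_nat; move: Lh; clear; lia.
  have := ler_wpM2r hm0 a1; move=> H1 H2.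
  rewrite -(ler_pM2l a0); move: H1; rewrite -H2; lra.
apply: le_trans lu _.
pose Dm := [seq z <- @slab d N (- L%:Z) (2 * L)%N | z \notin K].
have LE : (- L%:Z + (2 * L)%N%:Z = L%:Z) by clear; lia.
have mS (z : E) : (z \in @slab d N (- L%:Z) (2 * L)%N) = (- L%:Z < z.2 < L%:Z).
  by rewrite mem_slab; move: z.2 => a; clear; lia.
have u1 z : u z <= 1.
  apply: (@le_trans _ _ (\sum_t hp (out (- L%:Z) (2 * L)) [set (t, L%:Z)] z)); last exact: sum_hp_slice_le1.
  by apply: ler_sum => t _; rewrite ler_piMr ?hp_ge0// hitK_le1.
have uedge z : ~ (- L%:Z < z.2 < L%:Z) -> u z <= hitK K z.
  move=> zL; case: z zL => t0 z /= zL; rewrite /u.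
  have oz : out (- L%:Z) (2 * L) (t0, z) by rewrite /out/= LE.
  have [zE|zE] := eqVneq z L%:Z; last first.
    rewrite big1 ?hitK_ge0// => t _; rewrite (hp_in countE)// asboolF ?mul0r//.
    by move=> [_ zL']; move: zE; rewrite zL' eqxx.
  subst z; rewrite (bigD1 t0)//= big1 ?addr0 => [|t tt0].
    by rewrite ler_piMl ?hitK_ge0// (hp_le1 countE).
  rewrite (hp_in countE); last exact: oz.
  by rewrite asboolF ?mul0r// => -[te]; move: tt0; rewrite te eqxx.
have hb z : z \in K -> u z <= hitK K z by move=> zK; rewrite hitK_in//.
have [xD|] := boolP (x \in Dm).
  apply: (@max_principle_le R A d Dm u (hitK K)) xD => z.
    rewrite mem_filter mS => /andP[zK zL].
    have -> : u z = avg u z.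
      rewrite /u avg_sum; apply: eq_bigr => t _; rewrite (hp_step countE).
        by rewrite mulrC -avgZ; apply: eq_avg => s; rewrite mulrC.
      by rewrite /out/= LE; apply.
    rewrite -(hp_step countE) ?subrr// => -[|]; first exact/negP.
    by apply; move: z.2 zL Lh L0 => a; clear; lia.
  move=> /bdry_height[+ _]; rewrite mem_filter mS negb_and negbK => /orP[|/negP]; first exact: hb.
  exact: uedge.
rewrite mem_filter mS negb_and negbK => /orP[|/negP]; [exact: hb|exact: uedge].
Qed.

Lemma hit_mean_lb : K != fset0 -> (2 * N <= h)%N -> (3 * NT)^-1 <= hit_mean true.
Proof.
move=> /fset0Pn[p0 pK0] Nh2; pose p : E := p0; have pK : p \in K := pK0.
clearbody p; clear p0 pK0; have NT0 := NT_gt0 R d N_gt1.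
have pN := K_in pK; set n := `|(h%:Z - p.2)%R|%N.
have nE : p.2 + n%:Z = h%:Z by rewrite /n; move: p.2 pN Nh => z; clear; lia.
pose k := `|(N%:Z - p.2)%R|%N.
have kE : p.2 + k%:Z = N%:Z by rewrite /k; move: p.2 pN Nh => z; clear; lia.
have kn : (k <= n)%N by move: nE kE Nh; clear; lia.
pose u := hp (out p.2 n) [set p].
have harm t j : (0 < j < n)%N -> u (t, p.2 + j%:Z) = avg u (t, p.2 + j%:Z).
  by move=> jn; apply: (hp_step countE) => nj; apply: nj => /=; move: jn; clear; lia.
have := slice_mean_interp harm kn; rewrite nE kE.
have -> : smean u h%:Z = 0.
  rewrite /slice_mean big1 ?mulr0// => t _; rewrite /u (hp_in countE) ?asboolF//.
    by move=> pE; move: pN; rewrite -pE /= => hN'; move: Nh; rewrite ltnNge (ltnW hN').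
  by rewrite /out/= nE; clear; lia.
have -> : smean u p.2 = NT^-1.
  rewrite /slice_mean (eq_bigr (fun t => `[<t = p.1>]%:R)) ?sum_indic ?mulr1// => t _.
  rewrite /u (hp_in countE); last by rewrite /out/=; clear; lia.
  by congr ((nat_of_bool _)%:R); apply: asbool_equiv_eq; case: (p) => a b /=; split => [[]|->].
rewrite mulr0 addr0 => I.
have uh x : u x <= hitK K x.
  pose Dm := [seq z <- @slab d N p.2 n | z \notin K].
  have mS (z : E) : (z \in @slab d N p.2 n) = (p.2 < z.2 < h%:Z) by rewrite -nE mem_slab.
  have bdz z : z \in K \/ ~ (p.2 < z.2 < h%:Z) -> u z <= hitK K z.
    case=> [zK|zo]; first by rewrite hitK_in// /u (hp_le1 countE).
    rewrite /u (hp_in countE); last by rewrite /out/= nE.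
    by case: asboolP => [->|_]; rewrite ?hitK_ge0// hitK_in.
  have [xD|] := boolP (x \in Dm).
    apply: (@max_principle_le R A d Dm u (hitK K)) xD => z.
      rewrite mem_filter mS => /andP[zK zL].
      rewrite -!(hp_step countE) ?subrr//; last by rewrite /out/= nE; apply.
      by move=> [|]; [exact/negP|apply; move: z.2 p.2 zL pN Nh => a b; clear; lia].
    move=> /bdry_height[+ _]; rewrite mem_filter mS negb_and negbK => zD.
    by apply: bdz; case/orP: zD => [|/negP]; [left|right].
  rewrite mem_filter mS negb_and negbK => zD.
  by apply: bdz; case/orP: zD => [|/negP]; [left|right].
apply: (@le_trans _ _ (smean u N%:Z)); last first.
  by rewrite /hit_mean /slice_mean ler_wpM2l ?invr_ge0 ?(ltW NT0)//; apply: ler_sum.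
have n0 : 0 < n%:R :> R by rewrite ltr0n /n; move: p.2 pN Nh => z; clear; lia.
rewrite -(ler_pM2l n0) I invfM mulrA ler_pM2r ?invr_gt0// ler_pdivrMr// -natrM ler_nat.
 rewrite /n /k; move: p.2 pN Nh Nh2 => z; clear; lia.
Qed.

End one_set.

Lemma energy_ge (K K' : {fset E}) : (forall x, x \in K -> (`|x.2| < N)%N) ->
  (forall x, x \in K' -> (`|x.2| < N)%N) ->
  ((\sum_(x <- K) eqm K x * hitK K' x)%:E <= mutual_energy R U K K')%E.
Proof.
move=> Kin K'in; rewrite /mutual_energy -sumEFin big_seq [leRHS]big_seq; apply: lee_sum => x xK.
rewrite killed_equilibriumE// EFinM.
apply: le_trans (lee_wpmul2l _ (hitK_green K'in _)) _.
- by rewrite lee_fin eqm_ge0.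
- by rewrite ltnW// (ltn_trans (Kin x xK)).
have g0 y : (0 <= killed_green R U x y)%E by exact: nneseries_ge0.
rewrite ge0_sume_distrr => [|y _]; last by rewrite mule_ge0// lee_fin eqm_ge0.
rewrite big_seq [leRHS]big_seq; apply: lee_sum => y yK.
by rewrite killed_equilibriumE// muleA.
Qed.

End cylinder_energy.

(** * Excursions *)

Section times.
Variable E : zmodType.
Implicit Types (w : nat -> E).

Lemma shift_shift n m w : Defs.shift n (Defs.shift m w) = Defs.shift (m + n) w.
Proof. by apply/funext => i; rewrite /Defs.shift addnA. Qed.

Lemma shift0 w : Defs.shift 0 w = w. Proof. by []. Qed.

Lemma afterP t (T : (nat -> E) -> option nat) w n :
  after t T w = Some n <-> exists j k, [/\ t = Some j, T (Defs.shift j w) = Some k & n = (j + k)%N].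
Proof.
rewrite /after; case: t => [j|] /=; last by split => // -[j [k []]].
case E1 : (T _) => [k|] /=; split => //.
- by move=> [<-]; exists j, k.
- by move=> [j' [k' [[<-]]]]; rewrite E1 => -[<-] ->.
by move=> [j' [k' [[<-]]]]; rewrite E1.
Qed.

Lemma departureS (B B' : set E) m w :
  departure B B' m.+1 w = after (departure1 B B' w) (departure B B' m) w.
Proof.
elim: m w => [|m IH] w.
  by rewrite /= /after /= shift0; case: departure1 => [n|] //=; rewrite addn0.
rewrite [LHS]/= -/(departure B B' m.+1 w) IH /= /after.
case: (departure1 B B' w) => //= n; case: (departure B B' m (Defs.shift n w)) => //= k.
by rewrite shift_shift; case: departure1 => //= j; rewrite addnA.
Qed.

Definition timely (T : (nat -> E) -> option nat) := forall n, fdep n [set w | T w = Some n].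

Lemma timely_after (T1 T2 : (nat -> E) -> option nat) : timely T1 -> timely T2 ->
  timely (fun w => after (T1 w) T2 w).
Proof.
move=> t1 t2 n w w' ww' /afterP[j [k [e1 e2 e3]]]; apply/afterP; exists j, k; split => //.
  by apply: (t1 j w w') e1 => i ij; apply: ww'; rewrite e3 (leq_trans ij)// leq_addr.
by apply: (t2 k _ _ _ e2) => i ik; apply: ww'; rewrite e3 leq_add2l.
Qed.

Lemma timely_hit (U : set E) : timely (hit U).
Proof.
move=> n w w' ww' /hit_hitat H; apply/hit_hitat.
by have [fU _] := hitat_stopping U; exact: fU H.
Qed.

Lemma timely_departure B B' m : timely (departure B B' m).
Proof.
elim: m => [|m IH]; first by move=> n w w' ww'.
apply: timely_after => //; apply: timely_after; first exact: timely_hit.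
have H := @timely_hit (~` B'); exact: H.
Qed.

Lemma timely_departure1 B B' : timely (departure1 B B').
Proof.
apply: timely_after; first exact: timely_hit.
have H := @timely_hit (~` B'); exact: H.
Qed.

End times.

Section excursions.
Variables (R : realType) (d N h : nat).
Hypotheses (N_gt1 : (1 < N)%N) (d_gt0 : (0 < d)%N) (Nh : (N < h)%N).
Local Notation A := 'Z_N.
Local Notation T := 'rV[A]_d.
Local Notation E := (lattice A d).
Local Notation st := (@step A d).
Local Notation s0 := ((None, false) : direction d).
Local Notation avg := (@avg R _ _ st).
Local Notation hp := (@hp R _ _ s0 st).
Local Notation pr := (@pr R _ _ s0 st).
Local Notation NT := (N%:R ^+ d : R).
Local Notation smean := (@slice_mean R d N).
Local Notation countE := (countable_cyl d N).
Local Notation traj := (trajectory E).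
Local Notation I := ([set x | (`|x.2| <= N)%N] : set E).
Local Notation O := ([set x | (`|x.2| < h)%N] : set E).
Variables (PT : finType) (f : PT -> E).
Hypothesis f_in : forall p, (`|(f p).2| < N)%N.

Let IO x : I x -> O x. Proof. by move=> /leq_ltn_trans; exact. Qed.
Let fI p : I (f p). Proof. exact: ltnW. Qed.

Definition Wtr m (w : nat -> E) : {set PT} :=
  [set p | `[< visited (departure I O m w) w (f p) >]].

Definition vis p (w : nat -> E) := exists n, w n = f p /\ forall i, (i <= n)%N -> O (w i).

Definition Vtr (w : nat -> E) : {set PT} := [set p | `[< vis p w >]].

Lemma visitedP m w p : visited (departure I O m w) w (f p) <->
  exists n, w n = f p /\ ~ exists2 j, (j < n)%N & departure I O m w = Some j.
Proof.
split=> [[n /= nt wn]|[n [wn nj]]]; exists n => //=.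
  by split => // -[j jn dj]; move: nt; rewrite dj /= jn.
by case E1: (departure _ _ _ _) => [j|] //=; apply/negP => jn; apply: nj; exists j.
Qed.

Lemma finset_measurable (V : (nat -> E) -> {set PT}) (Q : {set PT} -> Prop) :
  (forall p, measurable ([set w | p \in V w] : set traj)) ->
  measurable ([set w | Q (V w)] : set traj).
Proof.
move=> mp; have mA (B : {set PT}) : measurable ([set w | V w = B] : set traj).
  rewrite (_ : [set w | _] = \bigcap_(p in [set: PT])
      (if p \in B then [set w | p \in V w] else ~` [set w | p \in V w])).
    apply: fin_bigcap_measurable => [|p _]; first exact: finite_finset.
    by case: ifP => _; [exact: mp|apply: measurableC; exact: mp].
  apply/seteqP; split => w.
    by move=> /= <- p _; case: ifP => //= /negbT/negP.
  move=> Hw; apply/setP => p; have := Hw p Logic.I.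
  by case: ifP => // _ /= /negP/negbTE.
rewrite (_ : [set w | _] = \bigcup_(B in [set B | Q B]) [set w | V w = B]).
  by apply: fin_bigcup_measurable => [|B _]; [exact: finite_finset|exact: mA].
by apply/seteqP; split => [w Qw|w [B /= QB ->]//]; exists (V w).
Qed.

Lemma measurable_Wtr m (Q : {set PT} -> Prop) : measurable ([set w | Q (Wtr m w)] : set traj).
Proof.
apply: finset_measurable => p.
rewrite (_ : [set w | _] = \bigcup_n [set w | w n = f p /\
    ~ exists2 j, (j < n)%N & departure I O m w = Some j]).
  apply: bigcupT_measurable => n; apply: (@fdep_measurable _ countE n).
  move=> w w' ww' [wn nj]; split; first by rewrite -ww'.
  move=> [j jn dj]; apply: nj; exists j => //.
  by apply: (@timely_departure E I O m j w' w _ dj) => i ij; rewrite ww'// (leq_trans ij)// ltnW.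
apply/seteqP; split => w /=; rewrite inE.
  by move=> /asboolP/visitedP[n H]; exists n.
by move=> [n _ H]; apply/asboolP/visitedP; exists n.
Qed.

Lemma measurable_Vtr (Q : {set PT} -> Prop) : measurable ([set w | Q (Vtr w)] : set traj).
Proof.
apply: finset_measurable => p.
rewrite (_ : [set w | _] = \bigcup_n [set w | w n = f p /\ forall i, (i <= n)%N -> O (w i)]).
  apply: bigcupT_measurable => n; apply: (@fdep_measurable _ countE n).
  by move=> w w' ww' [wn wO]; split => [|i ij]; rewrite -ww'//; exact: wO.
apply/seteqP; split => w /=; rewrite inE; first by move=> /asboolP[n H]; exists n.
by move=> [n _ H]; apply/asboolP; exists n.
Qed.

Lemma departure1P w n : departure1 I O w = Some n <-> exists r k,
  [/\ hitat I r w, hitat (~` O) k (Defs.shift r w) & n = (r + k)%N].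
Proof.
rewrite /departure1 afterP; split => -[r [k [H1 H2 H3]]]; exists r, k; split => //.
- exact/hit_hitat.
- exact/(hit_hitat (~` O)).
- exact/hit_hitat.
- exact/(hit_hitat (~` O)).
Qed.

Lemma Wtr0 w : ~ I (w 0%N) -> Wtr 0 w = finset.set0.
Proof.
move=> w0; apply/setP => p; rewrite !inE; apply/asboolP => /visitedP[n [wn nj]].
case: n wn nj => [wn _|n _ nj]; first by apply: w0; rewrite wn.
by apply: nj; exists 0%N.
Qed.

Lemma Wtr1 r w n : departure1 I O w = Some n -> hitat I r w -> Wtr 1 w = Vtr (Defs.shift r w).
Proof.
move=> dn [Ir rI]; have := dn; move=> /departure1P[r' [k [Hr Hk nE]]].
have rr : r' = r by have [_ uI] := hitat_stopping I; exact: uI Hr (conj Ir rI).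
subst r'; have d1 : departure I O 1 w = Some n by rewrite departureS dn /after/= addn0.
case: Hk => kO kmin; apply/setP => p; rewrite !inE; apply: asbool_equiv_eq.
rewrite visitedP d1; split.
  move=> [j [wj nj]]; have jn : (j <= n)%N by rewrite leqNgt; apply/negP => nj'; apply: nj; exists n.
  have rj : (r <= j)%N by rewrite leqNgt; apply/negP => /rI; rewrite wj; apply.
  have jk : (j - r < k)%N.
    rewrite ltn_neqAle -(leq_add2l r) subnKC// -nE jn andbT; apply/eqP => jk.
    by apply: kO; rewrite -jk /Defs.shift subnKC// wj; exact/IO/fI.
  exists (j - r)%N; rewrite /Defs.shift subnKC//; split => // i ij.
  by apply: contrapT => /kmin; apply; exact: leq_ltn_trans jk.
move=> [j [wj jO]]; exists (r + j)%N; split => // -[_ /[swap] -[<-]].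
have jk : (j < k)%N by rewrite ltnNge; apply/negP => /jO.
by rewrite nE ltn_add2l ltnNge ltnW.
Qed.

Lemma WtrS m w n : departure1 I O w = Some n ->
  Wtr m.+1 w = Wtr 1 w :|: Wtr m (Defs.shift n w).
Proof.
move=> dn; apply/setP => p; rewrite !inE.
have d1 : departure I O 1 w = Some n by rewrite departureS dn /after/= addn0.
have dS j : departure I O m.+1 w = Some j <-> exists2 k, departure I O m (Defs.shift n w) = Some k & j = (n + k)%N.
  rewrite departureS afterP dn; split; first by move=> [a [k [[<-] dk ->]]]; exists k.
  by move=> [k dk ->]; exists n, k.
apply/asboolP/orP => [/visitedP[j [wj nj]]|[/asboolP/visitedP|/asboolP/visitedP] [j [wj nj]]].
- have [jn|nj'] := leqP j n.
    left; apply/asboolP/visitedP; exists j; split => // -[a aj]; rewrite d1 => -[na].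
    by move: jn; rewrite na leqNgt aj.
  right; apply/asboolP/visitedP; exists (j - n)%N; rewrite /Defs.shift subnKC ?(ltnW nj')//; split => //.
  move=> [a aj da]; apply: nj; exists (n + a)%N; last by apply/dS; exists a.
  by rewrite -(subnKC (ltnW nj')) ltn_add2l.
- apply/visitedP; exists j; split => // -[a aj /dS[k _ ak]]; apply: nj; exists n => //.
  by apply: leq_ltn_trans aj; rewrite ak leq_addr.
- apply/visitedP; exists (n + j)%N; split => // -[a aj /dS[k dk ak]]; apply: nj; exists k => //.
  by rewrite -(ltn_add2l n) -ak.
Qed.

Definition edge (y : bool * T) : E := (y.2, sgn y.1 h).
Definition rim (y : bool * T) : E := (y.2, sgn y.1 N).

Let H1 (i : {set PT} * (bool * T)) : set traj :=
  [set w | exists n, (departure1 I O w = Some n /\ Wtr 1 w = i.1) /\ w n = edge i.2].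

Definition kap (x : E) (v : {set PT}) (y : bool * T) : R := pr x (H1 (v, y)).

Lemma kap_ge0 x v y : 0 <= kap x v y. Proof. exact: prb_ge0. Qed.

Let tau (v : {set PT}) n := [set w : nat -> E | departure1 I O w = Some n /\ Wtr 1 w = v].

Let tau_stopping v : stopping (tau v).
Proof.
split=> [n w w' ww' [dn Wv]|n m w [dn _] [dm _]]; last by move: dn; rewrite dm => -[].
have dn' : departure1 I O w' = Some n by exact: (timely_departure1 ww' dn).
split => //; rewrite -Wv; apply/setP => p; rewrite !inE; apply: asbool_equiv_eq.
have d1 w1 : departure1 I O w1 = Some n -> visited (departure I O 1 w1) w1 (f p) <->
    exists2 j, (j <= n)%N & w1 j = f p.
  move=> e; rewrite visitedP departureS e /after/= addn0; split.
    by move=> [j [wj nj]]; exists j => //; rewrite leqNgt; apply/negP => jn; apply: nj; exists n.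
  by move=> [j jn wj]; exists j; split => // -[a aj [na]]; move: jn; rewrite na leqNgt aj.
rewrite !d1//; split => -[j jn wj]; exists j => //; first by rewrite ww'.
by rewrite -ww'.
Qed.

Let mH1 i : measurable (H1 i).
Proof. exact: (stopping_measurable countE [set edge i.2] (tau_stopping i.1)). Qed.

Lemma edge_inj : injective edge.
Proof.
have hp0 : (0 < h)%N by exact: leq_ltn_trans Nh.
move=> [s t] [s' t'] [-> e]; congr (_, _); move: e hp0; clear; rewrite /sgn; case: s; case: s' => //=; lia.
Qed.

Let dH1 i j w : H1 i w -> H1 j w -> i = j.
Proof.
case: i j => [v y] [v' y'] [n [[/= dn wv] /= wn]] [m [[/= dm wv'] /= wm]].
move: dm; rewrite dn => -[nm]; subst m.
by congr (_, _); [rewrite -wv -wv'|apply: edge_inj; rewrite -wn -wm].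
Qed.

Lemma hp_I_side (s : bool) (x : E) : (N%:Z <= sgn s 1 * x.2) -> hp I [set z | z.2 = sgn s N] x = 1.
Proof.
move=> xs; apply/eqP; rewrite eq_le (hp_le1 countE)//=; apply/ler_addgt0Pr => e e0.
pose k := `|(sgn s 1 * x.2 - N%:Z)%R|%N.
pose n := (k + (Num.truncn (k%:R / e)).+1)%N.
have n0 : 0 < n%:R :> R by rewrite ltr0n /n addnS.
pose g (z : E) : R := (N%:R + n%:R - (sgn s 1 * z.2)%:~R) / n%:R.
have gx : 1 <= g x + e.
  have -> : g x = 1 - k%:R / n%:R.
    rewrite /g; have -> : sgn s 1 * x.2 = N%:Z + k%:Z by rewrite /k; move: (sgn s 1 * x.2) xs => z; clear; lia.
    by rewrite intrD -![(Posz _)%:~R]/(_%:R); field; rewrite gt_eqF.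
  rewrite -addrA lerDl addrC subr_ge0 ler_pdivrMr// mulrC -ler_pdivrMr//.
  apply: ltW; apply: (@lt_le_trans _ _ (Num.truncn (k%:R / e)).+1%:R).
    by have /andP[] := truncn_itv (divr_ge0 (ler0n R k) (ltW e0)).
  by rewrite ler_nat /n leq_addl.
apply: le_trans gx _; rewrite lerD2r.
have sgnE (b : bool) z : sgn b z = sgn b 1 * z%:Z by rewrite /sgn; case: b; rewrite ?mul1r ?mulN1r.
have s2 (z : int) : sgn s 1 * (sgn s 1 * z) = z by rewrite /sgn; case: (s); rewrite ?mul1r ?mulN1r ?opprK.
pose u z := hp I [set z | z.2 = sgn s N] z.
pose Dm := [seq z <- @slab d N (- (N + n)%N%:Z) (2 * (N + n))%N | (N%:Z < sgn s 1 * z.2)].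
have mD z : (z \in Dm) = (N%:Z < sgn s 1 * z.2 < (N + n)%N%:Z).
  by rewrite mem_filter mem_slab /sgn; case: (s); rewrite ?mul1r ?mulN1r; move: z.2 => a; clear; lia.
have gavg z : avg g z = g z.
  have D0 : 2 * d.+1%:R != 0 :> R by rewrite mulf_neq0 ?pnatr_eq0.
  apply: (mulfI D0); case: z => t z; rewrite avg_cylE /g /= !mulrDr !intrD.
  by rewrite sumr_const card_ord mulrN intrN -[X in X + _]mulr_natl -natr1; field; rewrite gt_eqF.
have bd (z : E) : (sgn s 1 * z.2 = N%:Z) \/ ((N + n)%N%:Z <= sgn s 1 * z.2) -> g z <= u z.
  case=> [zN|zn].
    rewrite /u (hp_in countE); last by move=> /=; move: zN; rewrite /sgn; case: (s); rewrite ?mul1r ?mulN1r; move: z.2 => a; clear; lia.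
    rewrite asboolT; last by rewrite /= -(s2 z.2) zN -sgnE.
    by rewrite /g zN addrAC subrr add0r mulfV ?gt_eqF.
  apply: (@le_trans _ _ 0); last exact: hp_ge0.
  by rewrite ler_pdivrMr// mul0r subr_le0 -natrD -[_%:R]/((N + n)%N%:Z%:~R) ler_int.
have [xD|xD] := boolP (x \in Dm); last first.
  by apply: bd; move: xD xs; rewrite mD; move: (sgn s 1 * x.2) => a; clear; lia.
apply: (@max_principle_le R A d Dm g u) xD => z.
  rewrite mD => /andP[zN _]; rewrite gavg -(hp_step countE) ?subrr//.
  by move=> /= zI; move: zI zN; rewrite /sgn; case: (s); rewrite ?mul1r ?mulN1r; move: z.2 => a; clear; lia.
move=> /bdry_height[+ [z']]; rewrite !mD => zD z'D zz'; apply: bd.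
move: zD z'D zz'; rewrite /sgn; case: (s); rewrite ?mul1r ?mulN1r; move: z.2 z'.2 => a b; clear; lia.
Qed.

Let reach (x : E) := I x \/ `|x.2|%N = h.

Lemma hit_I x : reach x -> hp I setT x = 1.
Proof.
case=> [xI|xh]; first by rewrite (hp_in countE)// asboolT.
apply/eqP; rewrite eq_le (hp_le1 countE)/=.
have [s xs] : exists s, N%:Z <= sgn s 1 * x.2.
  have [x0|x0] := leP 0 x.2; [exists true|exists false]; rewrite /sgn ?mul1r ?mulN1r;
    move: x.2 x0 xh Nh => a; clear; lia.
by rewrite -(hp_I_side xs); exact: (le_hp countE).
Qed.

Lemma hit_out x : (`|x.2| < h)%N -> hp (~` O) [set z | exists y, z = edge y] x = 1.
Proof.
move=> xh; apply: (@hp_total R A d countE (tB d N h)) => [z|z|]; last by rewrite mem_tB.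
  by rewrite mem_tB; split => /negP.
move=> /bdry_height[+ [z']]; rewrite !mem_tB => zh z'h zz'.
have [zs|zs] : z.2 = sgn true h \/ z.2 = sgn false h.
  by rewrite /sgn; move: z.2 z'.2 zh z'h zz' => a b; clear; lia.
  by exists (true, z.1); rewrite /edge -zs; case: (z).
by exists (false, z.1); rewrite /edge -zs; case: (z).
Qed.

Lemma kap_cover x : reach x -> pr x (\bigcup_i H1 i) = 1.
Proof.
move=> xr; have mU : measurable (\bigcup_i H1 i).
  by apply: fin_bigcup_measurable => [|i _]; [exact: finite_finset|exact: mH1].
pose G := hev (~` O) [set z | exists y, z = edge y] : set traj.
have mG : measurable G by exact: (measurable_hev countE).
have [_ E1] := @strong_markov R _ _ s0 st countE (hitat I) I G 1 x (hitat_stopping I) mG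
  (fun y Iy => hit_out (IO Iy)).
apply/eqP; rewrite eq_le prb_le1//= -[leLHS](_ : pr x [set w | exists n, [/\ hitat I n w, I (w n) & G (Defs.shift n w)]] = 1).
  apply: le_prb => //.
    by have [] := @strong_markov R _ _ s0 st countE (hitat I) I G 1 x (hitat_stopping I) mG
      (fun y Iy => hit_out (IO Iy)).
  move=> w [r [Hr _ [k [Hk [y wy]]]]]; exists (Wtr 1 w, y) => //; exists (r + k)%N.
  by split => //; split => //; apply/departure1P; exists r, k.
rewrite E1 mulr1 -(hit_I xr); congr (pr _ _); apply/seteqP; split => w [n [Hn Sn]]; exists n; split => //.
by case: Hn.
Qed.

Lemma kap_sum x : reach x -> \sum_v \sum_y kap x v y = 1.
Proof.
move=> xr; have mU : measurable (\bigcup_i H1 i).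
  by apply: fin_bigcup_measurable => [|i _]; [exact: finite_finset|exact: mH1].
rewrite -(kap_cover xr) [RHS]/Submission.pr (prb_partition _ mU mH1 dH1) setDv prb0 addr0 pair_big.
by apply: eq_bigr => -[v y] _; congr (prb _ _); apply/seteqP; split => [w Hw|w []//]; split => //; exists (v, y).
Qed.

Lemma Wtr_rec m x (B : {set PT}) : reach x ->
  pr x [set w | Wtr m.+1 w = B] = \sum_v \sum_y kap x v y * pr (edge y) [set w | v :|: Wtr m w = B].
Proof.
move=> xr; have mW : measurable ([set w | Wtr m.+1 w = B] : set traj).
  exact: (measurable_Wtr m.+1 (fun V => V = B)).
have mU : measurable (\bigcup_i H1 i).
  by apply: fin_bigcup_measurable => [|i _]; [exact: finite_finset|exact: mH1].
have e0 : prb (walk_law R s0 st x) ([set w | Wtr m.+1 w = B] `\` \bigcup_i H1 i) = 0.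
  apply/eqP; rewrite eq_le prb_ge0 andbT.
  apply: (@le_trans _ _ (pr x (~` \bigcup_i H1 i))).
    by apply: le_prb; [exact: measurableD|exact: measurableC|move=> w []].
  by rewrite /Submission.pr prbC// -/(Submission.pr _ _ _ _ _) kap_cover// subrr.
rewrite {1}/Submission.pr (prb_partition _ mW mH1 dH1) e0 addr0 pair_big; apply: eq_bigr => -[v y] _ /=.
have mG : measurable ([set w | v :|: Wtr m w = B] : set traj).
  exact: (measurable_Wtr m (fun V => v :|: V = B)).
have [_ <-] := @strong_markov R _ _ s0 st countE _ [set edge y] _
  (pr (edge y) [set w | v :|: Wtr m w = B]) x (tau_stopping v) mG
  (fun z (zx : z = edge y) => congr1 (fun z => pr z _) zx).
congr (prb _ _); apply/seteqP; split => w.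
  move=> [/= WB [n [[dn Wv] wn]]]; exists n; split => //.
  by rewrite /= -WB (WtrS m dn) Wv.
move=> [n [[dn Wv] wn /= GB]]; split; last by exists n.
by rewrite /= (WtrS m dn) Wv.
Qed.

Definition nu x v : R := \sum_y kap x v y.

Let nu_ev v : set traj := [set w | exists n, [/\ hitat I n w, I (w n) & Vtr (Defs.shift n w) = v]].

Let m_nu_ev v : measurable (nu_ev v).
Proof.
rewrite (_ : nu_ev v = \bigcup_n [set w | hitat I n w /\ Vtr (Defs.shift n w) = v]).
  apply: bigcupT_measurable => n; apply: (measurable_shiftI n (A := hitat I n) (G := [set w | Vtr w = v])).
    by apply: (@fdep_measurable _ countE n); case: (hitat_stopping I).
  exact: (measurable_Vtr (fun V => V = v)).
by apply/seteqP; split => w; [move=> [n [? ? ?]]; exists n|move=> [n _ [Hn ?]]; exists n; split => //; case: Hn].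
Qed.

Lemma nuE x v : reach x -> nu x v = pr x (nu_ev v).
Proof.
move=> xr; have le1 v' : nu x v' <= pr x (nu_ev v').
  have -> : nu x v' = pr x (\bigcup_y H1 (v', y)).
    have mU : measurable (\bigcup_y H1 (v', y)).
      by apply: fin_bigcup_measurable => [|i _]; [exact: finite_finset|exact: mH1].
    rewrite [RHS]/Submission.pr (prb_partition _ mU (fun y => mH1 (v', y))) => [|y y' w Hy Hy'].
      rewrite setDv prb0 addr0; apply: eq_bigr => y _; congr (prb _ _).
      by apply/seteqP; split => [w Hw|w []//]; split => //; exists y.
    by have [] := dH1 Hy Hy'.
  apply: le_prb => [||w [y _ [n [[/= dn Wv] _]]]]; last 1 first.
  - have := dn => /departure1P[r [k [Hr _ _]]]; exists r; split => //; first by case: Hr.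
    by rewrite -(Wtr1 dn Hr).
  - by apply: fin_bigcup_measurable => [|i _]; [exact: finite_finset|exact: mH1].
  - exact: m_nu_ev.
have tot : \sum_v' pr x (nu_ev v') <= 1.
  have dn i j w : nu_ev i w -> nu_ev j w -> i = j.
    move=> [n [Hn _ <-]] [m [Hm _ <-]]; have [_ uI] := hitat_stopping I.
    by have nm := uI _ _ _ Hn Hm; subst m.
  rewrite -(pr_setT R s0 st x) /Submission.pr (prb_partition _ measurableT m_nu_ev dn) -[leLHS]addr0 lerD ?prb_ge0//.
  by apply: ler_sum => i _; rewrite setTI.
have tot1 : \sum_v' nu x v' = 1 by exact: kap_sum.
apply/eqP; rewrite eq_le le1/= leNgt; apply/negP => lt.
suff : \sum_v' nu x v' < \sum_v' pr x (nu_ev v') by rewrite tot1 ltNge tot.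
by rewrite (bigD1 v)//= [ltRHS](bigD1 v)//= ltr_leD// ler_sum.
Qed.

Lemma nu_inner x v : I x -> nu x v = pr x [set w | Vtr w = v].
Proof.
move=> xI; rewrite nuE; last by left.
apply: pr_as => [||w w0]; [exact: m_nu_ev|exact: (measurable_Vtr (fun V => V = v))|].
split=> [[[|n] [[Hn nI] _ VE]]|VE]; first by rewrite -VE shift0.
  by case: (nI 0%N isT); rewrite w0.
by exists 0%N; split; [split; rewrite ?w0|rewrite w0|rewrite shift0].
Qed.

Lemma nu_edge (s : bool) t v :
  nu (edge (s, t)) v = \sum_t' hp I [set rim (s, t')] (edge (s, t)) * pr (rim (s, t')) [set w | Vtr w = v].
Proof.
set x := edge (s, t); have xr : reach x by right; rewrite /x /edge/= /sgn; case: (s); clear; lia.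
have xs : N%:Z <= sgn s 1 * x.2.
  by rewrite /x /edge /= /sgn; case: (s); rewrite ?mul1r ?mulN1r ?opprK; move: Nh; clear; lia.
rewrite nuE//; have mV : measurable ([set w | Vtr w = v] : set traj).
  exact: (measurable_Vtr (fun V => V = v)).
pose HH t' := hev I [set rim (s, t')] : set traj.
have mHH t' : measurable (HH t') by exact: (measurable_hev countE).
have dHH t1 t2 w : HH t1 w -> HH t2 w -> t1 = t2.
  move=> [n [Hn /= wn]] [m [Hm /= wm]]; have [_ uI] := hitat_stopping I.
  by have nm := uI _ _ _ Hn Hm; subst m; move: wm; rewrite wn => -[].
have U1 : pr x (\bigcup_t' HH t') = 1.
  rewrite -(hp_I_side xs); congr (pr _ _); apply/seteqP; split => w.
    by move=> [t' _ [n [Hn /= wn]]]; exists n; split => //=; rewrite wn.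
  by move=> [n [Hn /= wn]]; exists (w n).1 => //; exists n; split => //=; rewrite /rim -wn; case: (w n).
have mU : measurable (\bigcup_t' HH t').
  by apply: fin_bigcup_measurable => [|i _]; [exact: finite_finset|exact: mHH].
have e0 : prb (walk_law R s0 st x) (nu_ev v `\` \bigcup_t' HH t') = 0.
  apply/eqP; rewrite eq_le prb_ge0 andbT.
  apply: (@le_trans _ _ (pr x (~` \bigcup_t' HH t'))).
    by apply: le_prb; [apply: measurableD => //; exact: m_nu_ev|exact: measurableC|move=> w []].
  by rewrite /Submission.pr prbC// -/(Submission.pr _ _ _ _ _) U1 subrr.
rewrite {1}/Submission.pr (prb_partition _ (m_nu_ev v) mHH dHH) e0 addr0; apply: eq_bigr => t' _.
have [_ <-] := @strong_markov R _ _ s0 st countE _ [set rim (s, t')] _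
  (pr (rim (s, t')) [set w | Vtr w = v]) x (hitat_stopping I) mV
  (fun z (zx : z = rim (s, t')) => congr1 (fun z => pr z _) zx).
congr (prb _ _); apply/seteqP; split => w.
  move=> [[n [Hn _ Vn]] [m [Hm wm]]]; exists m; split => //.
  by have [_ uI] := hitat_stopping I; have nm := uI _ _ _ Hn Hm; subst m.
move=> [n [Hn wn Vn]]; split; last by exists n.
by exists n; split => //; case: Hn.
Qed.

End excursions.

(** * Traces of excursions on several blocks *)

Section projection.
Variables (d N : nat).
Hypothesis N_gt1 : (1 < N)%N.
Local Notation Z := (lattice int d).
Local Notation E := (lattice 'Z_N d).

Lemma intr_Zp_eq0 (m : int) : ((m%:~R : 'Z_N) == 0) = (N %| `|m|)%N.
Proof.
have nE (n : nat) : ((n%:R : 'Z_N) == 0) = (N %| n)%N.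
  by rewrite -val_eqE /= (val_Zp_nat N_gt1) /dvdn.
by case: m => n; rewrite ?NegzE ?intrN ?oppr_eq0 nE ?abszN.
Qed.

Lemma projectD (x y : Z) : project N (x + y) = project N x + project N y.
Proof.
congr (_, _); apply/matrixP => i j; rewrite !mxE; exact: intrD.
Qed.

Lemma project_step (s : direction d) : project N (@step int d s) = @step 'Z_N d s.
Proof.
by case: s => -[j|] []; rewrite /step /project /=; congr (_, _); apply/matrixP => a b;
  rewrite !mxE ?intrN ?oppr0 //; case: eqP; case: eqP.
Qed.

Lemma project_eq (x y : Z) : project N x = project N y <-> equiv N x y.
Proof.
split=> [[e1 e2]|[k ->]]; last first.
  rewrite projectD -[RHS]addr0; congr (_ + _); congr (_, _); apply/matrixP => i j.
  by rewrite !mxE; apply/eqP; rewrite intr_Zp_eq0 abszM dvdn_mulr.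
have H j : (N%:Z %| (x.1 0%R j - y.1 0%R j)%R)%Z.
  apply: etrans (esym (intr_Zp_eq0 _)) _; rewrite intrB subr_eq0; apply/eqP.
  by move/matrixP : e1 => /(_ 0 j); rewrite !mxE.
exists (\row_j (((x.1 0%R j - y.1 0%R j)%R %/ N%:Z)%Z), 0).
rewrite /period /= [RHS]surjective_pairing /= addr0 -e2 [LHS]surjective_pairing; congr (_, _).
apply/matrixP => i j; rewrite ord1 !mxE mulrC divzK ?H//.
by rewrite addrCA subrr addr0.
Qed.

Lemma project_rep (x : E) : exists2 w : Z, project N w = x & forall j, (`|w.1 0%R j| <= N)%N.
Proof.
exists (\row_j (val (x.1 0 j))%:Z, x.2) => [|j].
  case: x => t z; congr (_, _); apply/matrixP => i j; rewrite ord1 !mxE /=.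
  exact: natr_Zp.
have := ltn_ord (x.1 0 j); rewrite [X in (_ < X)%N](Zp_cast N_gt1) /= mxE => H.
by apply: ltnW; exact: H.
Qed.

End projection.

Section block.
Variables (R : realType) (d N h : nat).
Hypotheses (N_gt1 : (1 < N)%N) (d_gt0 : (0 < d)%N) (Nh : (N < h)%N).
Local Notation Z := (lattice int d).
Local Notation E := (lattice 'Z_N d).
Local Notation st := (@step 'Z_N d).
Local Notation s0 := ((None, false) : direction d).
Local Notation hp := (@hp R _ _ s0 st).
Local Notation pr := (@pr R _ _ s0 st).
Local Notation prZ := (@Submission.pr R _ _ s0 (@step int d)).
Local Notation smean := (@slice_mean R d N).
Local Notation countE := (countable_cyl d N).
Local Notation hitK := (@hitK R d N h).
Local Notation eqm := (@eqm R d N h).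
Local Notation Kc := (@Kc d N h).
Local Notation NT := (N%:R ^+ d : R).
Local Notation invKN := (d.+1%:R * (h - N)%N%:R / NT : R).
Local Notation rho := (N%:R / h%:R : R).
Local Notation traj := (trajectory E).
Local Notation O := ([set x | (`|x.2| < h)%N] : set E).
Variables (S : {fset Z}) (x : E).
Local Notation K := (translate S x).
Local Notation dead := (@dead_cyl d h x.2).
Local Notation T := (@T_cyl d S N).

Definition place (y : S) : E := project N (val y) + x.

Let pj (w : Z) : E := project N w + x.

Let pjD w s : pj (w + @step int d s) = pj w + st s.
Proof. by rewrite /pj projectD project_step addrAC. Qed.

Lemma mem_translate z : z \in K <-> exists y : S, z = place y.
Proof.
split=> [/imfsetP[y /= yS ->]|[y ->]]; first by exists [` yS]%fset.
by apply/imfsetP; exists (val y) => //; exact: valP.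
Qed.

Let pj_mem w : pj w \in K <-> exists y, T y w.
Proof.
rewrite mem_translate; split=> -[y]; first by move/addIr/(project_eq N_gt1) => H; exists y.
by move/(project_eq N_gt1) => H; exists y; rewrite /pj H.
Qed.

Let pj_dead w : (`|(pj w).2| < h)%N <-> ~ dead w.
Proof. by rewrite /dead_cyl /pj /=; split; [move=> H /=; rewrite leqNgt => /negP|move=> /negP; rewrite -ltnNge]. Qed.

Let pj_Kc w : Kc K (pj w) <-> trZ dead T w.
Proof.
rewrite /Kc /trZ /=; split=> -[H|H]; [by left; apply/pj_mem| |by left; apply/pj_mem|].
  by right; apply: contrapT => /pj_dead.
by right=> /pj_dead; apply.
Qed.

Lemma hitK_capture w : hitK K (project N w + x) = capture R dead T w.
Proof.
rewrite /Submission.hitK -/(pj w) (@hp_lift R _ _ _ s0 (@step int d) st pj pjD).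
apply: eq_hp => y; first exact: pj_Kc.
by move=> _; exact: pj_mem.
Qed.

Lemma eqm_escape y : eqm K (place y) = escape R dead T y.
Proof.
by rewrite /Submission.eqm /escape /avg; congr (_ * _); apply: eq_bigr => s _; rewrite -hitK_capture projectD project_step addrAC.
Qed.

Lemma pr_Vtr y (B : {set S}) :
  pr (place y) [set w | Vtr h place w = B] = prZ (val y) (ev dead T finset.set0 B).
Proof.
rewrite (@pr_lift R _ _ _ s0 (@step int d) st pj pjD); congr (Submission.pr _ _ _ _ _).
rewrite /ev; apply/seteqP; split => w /=; rewrite finset.set0U => <-; apply/setP => y';
  rewrite !inE; apply: asbool_equiv_eq; split=> -[n [wn H]]; exists n; split;
  try (by move=> j /H/pj_dead);
  by [congr (_ + x); apply/(project_eq N_gt1)|move/addIr/(project_eq N_gt1) : wn].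
Qed.

Hypothesis place_inj : injective place.

Lemma sum_translate (F : E -> R) : \sum_(z <- K) F z = \sum_y F (place y).
Proof.
rewrite -(big_map place predT); apply: perm_big; apply: uniq_perm; rewrite ?fset_uniq//.
  by rewrite map_inj_uniq ?index_enum_uniq.
move=> z; apply/idP/mapP => [/mem_translate[y ->]|[y _ ->]]; first by exists y; rewrite ?mem_index_enum.
by apply/mem_translate; exists y.
Qed.

Hypothesis K_in : forall y, (`|(place y).2| < N)%N.

Lemma K_height z : z \in K -> (`|z.2| < N)%N.
Proof. by move=> /mem_translate[y ->]. Qed.

Let HH (y : S) : set traj := hev (Kc K) [set place y].

Let mHH y : measurable (HH y). Proof. exact: (measurable_hev countE). Qed.

Let dHH y y' w : HH y w -> HH y' w -> y = y'.
Proof.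
move=> [n [Hn /= wn]] [m [Hm /= wm]]; have [_ uI] := hitat_stopping (Kc K).
by have nm := uI _ _ _ Hn Hm; subst m; apply: place_inj; rewrite -wn -wm.
Qed.

(* Strong Markov property at the entrance in [K]: [G] forces a visit to [K] and only depends on the
   walk from then on, through [G']. *)
Lemma pr_entrance (G G' : set traj) z : measurable G -> measurable G' ->
  (forall w, G w -> exists y, HH y w) ->
  (forall y w n, hitat (Kc K) n w -> w n = place y -> G w <-> G' (Defs.shift n w)) ->
  pr z G = \sum_y hp (Kc K) [set place y] z * pr (place y) G'.
Proof.
move=> mG mG' GH GS; rewrite {1}/Submission.pr (prb_partition _ mG mHH dHH).
rewrite (_ : G `\` _ = set0) ?prb0 ?addr0; last first.
  by apply/seteqP; split => // w [/GH[y Hy] []]; exists y.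
apply: eq_bigr => y _.
have [_ <-] := @strong_markov R _ _ s0 st countE _ [set place y] _
  (pr (place y) G') z (hitat_stopping (Kc K)) mG'
  (fun a (ax : a = place y) => congr1 (fun a => pr a _) ax).
congr (prb _ _); apply/seteqP; split => w.
  by move=> [Gw [n [Hn wn]]]; exists n; split => //; apply/(GS _ _ _ Hn wn).
by move=> [n [Hn wn Gn]]; split; [apply/(GS _ _ _ Hn wn)|exists n].
Qed.

Lemma visit_entrance y w : vis h place y w -> exists y', HH y' w.
Proof.
move=> [n [wn Ow]].
have : exists i, `[< Kc K (w i) >] by exists n; apply/asboolP; left; rewrite wn; apply/mem_translate; exists y.
case/ex_minnP => i /asboolP Ki imin.
have ni : (i <= n)%N by apply: imin; apply/asboolP; left; rewrite wn; apply/mem_translate; exists y.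
have : w i \in K by case: Ki => // /(_ (Ow i ni)).
move=> /mem_translate[y' wy']; exists y', i; split => //; split => // j ji Kj.
by have := imin j (asboolT Kj); rewrite leqNgt ji.
Qed.

Lemma vis_shift y n w : hitat (Kc K) n w -> (`|(w n).2| < h)%N ->
  vis h place y w <-> vis h place y (Defs.shift n w).
Proof.
move=> [Kn nK] On; have Oi i : (i <= n)%N -> O (w i).
  rewrite leq_eqVlt => /predU1P[->//|/nK H]; apply: contrapT => Hi; apply: H; by right.
split=> -[m [wm Om]].
  have nm : (n <= m)%N.
    rewrite leqNgt; apply/negP => /nK; apply; left; rewrite wm; apply/mem_translate; by exists y.
  exists (m - n)%N; rewrite /Defs.shift subnKC//; split => // i im.
  by apply: Om; rewrite -leq_subRL.
exists (n + m)%N; split => // i inm; have [/Oi//|ni] := leqP i n.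
by rewrite -(subnKC (ltnW ni)); apply: Om; rewrite leq_subLR.
Qed.

Lemma entrance_Vtr (B : {set S}) s : B != finset.set0 ->
  smean (fun z => pr z [set w | Vtr h place w = B]) (sgn s N) =
  \sum_y smean (hp (Kc K) [set place y]) (sgn s N) * prZ (val y) (ev dead T finset.set0 B).
Proof.
move=> /set0Pn[y0 y0B]; have mV : measurable ([set w | Vtr h place w = B] : set traj).
  exact: (measurable_Vtr _ _ (fun V => V = B)).
under eq_bigr do rewrite -pr_Vtr /slice_mean mulrAC -mulrA.
rewrite -mulr_sumr; congr (_ * _).
under [RHS]eq_bigr do rewrite mulr_sumr.
rewrite exchange_big; apply: eq_bigr => t _ /=; under [RHS]eq_bigr do rewrite mulrC.
apply: pr_entrance => // [w /= VB|y w n Hn wn].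
  by move: y0B; rewrite -VB inE => /asboolP; exact: visit_entrance.
have On : (`|(w n).2| < h)%N by rewrite wn (ltn_trans (K_in y)).
have VE : Vtr h place w = Vtr h place (Defs.shift n w).
  by apply/setP => y'; rewrite !inE; apply: asbool_equiv_eq; exact: vis_shift.
by rewrite /= VE.
Qed.

Hypothesis rho_small : rho <= 2^-1.
Hypothesis capture_small : forall w : Z, (forall j, (`|w.1 0%R j| <= N)%N) ->
  (N < 4 * `|w.2|)%N -> ~ dead w -> capture R dead T w <= rho.
Hypothesis x_height : (`|x.2|%N.*2 <= N)%N.

Lemma hitK_far z : `|z.2|%N = N -> hitK K z <= rho.
Proof.
move=> zN; have [w wz wN] := project_rep N_gt1 (z - x).
have zE : z = project N w + x by rewrite wz subrK.
have w2 : w.2 = z.2 - x.2 by move: (congr1 snd wz).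
rewrite zE hitK_capture; apply: capture_small => //.
  by rewrite w2; move: z.2 x.2 zN x_height N_gt1 => a b; clear; lia.
by rewrite /dead_cyl /= w2 subrK zN; move: Nh; clear; lia.
Qed.

Let bounds s y := entrance_bounds N_gt1 d_gt0 Nh K_height rho_small hitK_far s (y := y).

Lemma block_bounds (B : {set S}) s : B != finset.set0 ->
  (1 - 3 * rho) * (invKN * trace_weight R dead T B) <=
  smean (fun z => pr z [set w | Vtr h place w = B]) (sgn s N) <=
  (1 + 4 * rho) * (invKN * trace_weight R dead T B).
Proof.
move=> B0; rewrite entrance_Vtr// /trace_weight !mulr_sumr.
have aux (a c e q X : R) : a * (c * (e * q)) = a * (e * c) * q by ring.
apply/andP; split; apply: ler_sum => y _; rewrite -eqm_escape (aux _ _ _ _ 0) ler_wpM2r ?prb_ge0//;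
  by have /andP[] := bounds s (proj2 (mem_translate (place y)) (ex_intro _ y erefl)).
Qed.

Definition visit_both (K' : {fset E}) : set traj :=
  [set w | exists n, [/\ hitat (Kc K) n w, w n \in K & hev (Kc K') [set` K'] (Defs.shift n w)]].

Lemma pr_visit_both (K' : {fset E}) z :
  pr z (visit_both K') = \sum_y hp (Kc K) [set place y] z * hitK K' (place y) /\
  measurable (visit_both K').
Proof.
have mG : measurable (hev (Kc K') [set` K'] : set traj) by exact: (measurable_hev countE).
have mV : measurable (visit_both K').
  rewrite (_ : visit_both K' = \bigcup_n [set w | (hitat (Kc K) n w /\ w n \in K) /\
      hev (Kc K') [set` K'] (Defs.shift n w)]).
    apply: bigcupT_measurable => n.
    apply: (measurable_shiftI n (A := [set w | hitat (Kc K) n w /\ w n \in K])) => //.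
    apply: (@fdep_measurable _ countE n); apply: fdepI; first by case: (hitat_stopping (Kc K)).
    exact: (@fdep_at E n (fun z => z \in K)).
  by apply/seteqP; split => w; [move=> [n [? ? ?]]; exists n|move=> [n _ [[? ?] ?]]; exists n].
split => //; apply: pr_entrance => // [w [n [Hn /mem_translate[y wn] _]]|y w n Hn wn].
  by exists y, n.
split=> [[m [Hm wm Gm]]|Gn].
  by have [_ uI] := hitat_stopping (Kc K); have nm := uI _ _ _ Hn Hm; subst m.
by exists n; split => //; rewrite wn; apply/mem_translate; exists y.
Qed.

Lemma visit_both_bound (K' : {fset E}) s :
  smean (fun z => pr z (visit_both K')) (sgn s N) <=
  (1 + 4 * rho) * (invKN * \sum_(z <- K) eqm K z * hitK K' z).
Proof.
have -> : smean (fun z => pr z (visit_both K')) (sgn s N) =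
    \sum_y smean (hp (Kc K) [set place y]) (sgn s N) * hitK K' (place y).
  rewrite /slice_mean; under [RHS]eq_bigr do rewrite mulrAC -mulrA.
  rewrite -mulr_sumr; congr (_ * _); under [RHS]eq_bigr do rewrite mulr_sumr.
  rewrite exchange_big; apply: eq_bigr => t _ /=; have [-> _] := pr_visit_both K' (t, sgn s N).
  by apply: eq_bigr => y _; rewrite mulrC.
rewrite sum_translate !mulr_sumr; apply: ler_sum => y _.
rewrite (_ : _ * (_ * (_ * _)) = (1 + 4 * rho) * (eqm K (place y) * invKN) * hitK K' (place y)); last by ring.
rewrite ler_wpM2r ?prb_ge0//.
by have /andP[] := bounds s (proj2 (mem_translate (place y)) (ex_intro _ y erefl)).
Qed.

End block.

Lemma approx_absorb (R : realType) (X p g lo up a : R) : 0 <= X -> 0 <= p -> 0 <= g -> 0 <= a ->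
  lo - g <= p + a -> p + a <= up + g -> lo - (a + g + X) <= p <= up + (a + g + X).
Proof. by lra. Qed.

Section blocks.
Variables (R : realType) (k : nat) (F : 'I_k -> finType).
Local Notation PT := {i : 'I_k & F i}.
Implicit Types (v : {set PT}).

Definition res i v : {set F i} := [set y | Tagged F y \in v].
Definition emb i (B : {set F i}) : {set PT} := [set Tagged F y | y in B].
Arguments emb : clear implicits.

Lemma resK i (B : {set F i}) : res i (emb i B) = B.
Proof.
apply/setP => y; rewrite !inE; apply/imsetP/idP => [[y' y'B e]|yB]; last by exists y.
by rewrite (eq_from_Tagged e).
Qed.

Definition block_set i v := (v == emb i (res i v)) && (res i v != finset.set0).

Lemma sum_block i (G : {set PT} -> R) :
  \sum_(v | block_set i v) G v = \sum_(B : {set F i} | B != finset.set0) G (emb i B).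
Proof.
rewrite (reindex_onto (emb i) (res i)) => [|v /andP[/eqP <- _]//].
by apply: eq_bigl => B; rewrite /block_set resK !eqxx andbT.
Qed.

Lemma res_nonempty v : v != finset.set0 -> exists i, res i v != finset.set0.
Proof.
move=> /set0Pn[[i y] yv]; exists i; apply/set0Pn; exists y; by rewrite inE.
Qed.

Lemma emb_res i v : (forall j, j != i -> res j v = finset.set0) -> v = emb i (res i v).
Proof.
move=> H; apply/setP => -[j y]; apply/idP/imsetP => [yv|[y' + ->]]; last by rewrite inE.
have ji : j = i.
  apply/eqP; apply/negPn/negP => /H/setP/(_ y); rewrite !inE.
  by rewrite -/(Tagged F y) in yv; rewrite yv.
by subst j; exists y; rewrite ?inE.
Qed.

Variables (P : {set PT} -> R) (sg g : forall i, {set F i} -> R) (l u : R) (w : 'I_k -> 'I_k -> R).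
Arguments sg : clear implicits.
Arguments g : clear implicits.
Hypothesis P_ge0 : forall v, 0 <= P v.
Hypothesis g_ge0 : forall i B, 0 <= g i B.

Definition block_weight v : R := \sum_(i | block_set i v) sg i (res i v).

Definition both i j v := (res i v != finset.set0) && (res j v != finset.set0).

Hypothesis P_res : forall i B, B != finset.set0 ->
  l * sg i B - g i B <= \sum_(v | res i v == B) P v <= u * sg i B + g i B.
Hypothesis P_both : forall i j, i != j -> \sum_(v | both i j v) P v <= w i j.

Definition block_err v : R :=
  \sum_(i | block_set i v) (\sum_(v' | (res i v' == res i v) && (v' != v)) P v' + g i (res i v)) +
  (if [exists i, exists j, (i != j) && both i j v] then P v else 0).

Lemma block_set_uniq i j v : block_set i v -> block_set j v -> i = j.
Proof.
move=> /andP[/eqP vi /set0Pn[y yi]] /andP[/eqP vj _].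
have : Tagged F y \in emb j (res j v) by rewrite -vj; move: yi; rewrite inE.
by case/imsetP => y' _ /(congr1 (@tag _ _)).
Qed.

Lemma block_err_ge0 v : 0 <= block_err v.
Proof.
rewrite addr_ge0//; last by case: ifP.
by apply: sumr_ge0 => i _; rewrite addr_ge0// sumr_ge0.
Qed.

Lemma block_approx v : v != finset.set0 ->
  l * block_weight v - block_err v <= P v <= u * block_weight v + block_err v.
Proof.
move=> v0; have [/existsP[i si]|/existsPn ns] := boolP [exists i, block_set i v].
  have u1 (G : 'I_k -> R) : \sum_(j | block_set j v) G j = G i.
    by apply: (big_pred1 i) => j /=; apply/idP/eqP => [sj|->//]; exact: block_set_uniq sj si.
  rewrite /block_err /block_weight !u1; have /andP[_ r0] := si.
  have /andP[] := P_res r0; rewrite (bigD1 v)//=.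
  set a := \sum_(_ | _) _; have a0 : 0 <= a by apply: sumr_ge0.
  have : 0 <= (if [exists i, exists j, (i != j) && both i j v] then P v else 0) by case: ifP.
  by move=> X0 h1 h2; exact: approx_absorb.
have -> : block_weight v = 0 by apply: big_pred0 => i; exact/negbTE/ns.
rewrite !mulr0 sub0r add0r /block_err ifT.
  rewrite [X in X + _]big_pred0 ?add0r; last by move=> i; exact/negbTE/ns.
  by rewrite lexx andbT -subr_ge0 opprK addr_ge0.
have [i ri] := res_nonempty v0; apply/existsP; exists i.
apply/existsP; apply: contrapT => nj; have := ns i; rewrite /block_set ri andbT => /eqP; apply.
apply: emb_res => j ji; apply/eqP/negPn/negP => rj; apply: nj; exists j.
by rewrite eq_sym ji /both ri.
Qed.

Lemma block_err_sum : \sum_v block_err v <=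
  2 * (\sum_i \sum_(j | j != i) w i j) + \sum_i \sum_B g i B.
Proof.
rewrite /block_err big_split /=.
have A1 : \sum_v \sum_(i | block_set i v) (\sum_(v' | (res i v' == res i v) && (v' != v)) P v' + g i (res i v)) <=
    \sum_i (\sum_(j | j != i) w i j + \sum_B g i B).
  under eq_bigr do rewrite big_mkcond; rewrite exchange_big; apply: ler_sum => i _.
  rewrite -big_mkcond sum_block big_split /=; apply: lerD; last first.
    rewrite [leRHS](bigID (fun B => B != finset.set0))/= -[leLHS]addr0 lerD ?sumr_ge0//.
    by apply: ler_sum => B _; rewrite resK.
  apply: (@le_trans _ _ (\sum_(j | j != i) \sum_(v | both i j v) P v)); last first.
    by apply: ler_sum => j ji; apply: P_both; rewrite eq_sym.
  under eq_bigr do rewrite big_mkcond; under [leRHS]eq_bigr do rewrite big_mkcond.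
  rewrite exchange_big [leRHS]exchange_big; apply: ler_sum => v _ /=.
  rewrite -big_mkcondr -big_mkcondr /=; set r := res i v.
  have [r0|r0] := eqVneq r finset.set0.
    rewrite big1 ?sumr_ge0// => B /andP[B0 /andP[/eqP rB _]].
    by move: B0; rewrite resK in rB; rewrite -rB -/r r0 eqxx.
  have [vE|vE] := eqVneq v (emb i r).
    by rewrite big1 ?sumr_ge0// => B /andP[_ /andP[/eqP]]; rewrite resK -/r => <-; rewrite -vE eqxx.
  have [j ji rj] : exists2 j, j != i & res j v != finset.set0.
    apply: contrapT => nj; move/eqP : vE; apply; apply: emb_res => j ji.
    by apply/eqP/negPn/negP => rj; apply: nj; exists j.
  apply: (@le_trans _ _ (P v)).
    rewrite (bigD1 r)/= ?r0 ?resK ?eqxx ?vE// big1 ?addr0// => B /andP[/andP[_ /andP[/eqP]]].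
    by rewrite resK -/r => ->; rewrite eqxx.
  by rewrite (bigD1 j)/= ?ji/= /both -/r ?r0// lerDl sumr_ge0.
have A2 : \sum_v (if [exists i, exists j, (i != j) && both i j v] then P v else 0) <=
    \sum_i \sum_(j | j != i) w i j.
  apply: (@le_trans _ _ (\sum_i \sum_(j | j != i) \sum_(v | both i j v) P v)); last first.
    by apply: ler_sum => i _; apply: ler_sum => j ji; apply: P_both; rewrite eq_sym.
  under [leRHS]eq_bigr do under eq_bigr do rewrite big_mkcond.
  under [leRHS]eq_bigr do rewrite exchange_big; rewrite [leRHS]exchange_big /=.
  have b0 i v : 0 <= \sum_(j | j != i) (if both i j v then P v else 0) by apply: sumr_ge0 => j _; case: ifP.
  apply: ler_sum => v _; case: existsP => [[i /existsP[j /andP[ij bij]]]|_]; last by apply: sumr_ge0.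
  rewrite (bigD1 i)//= (bigD1 j)/= 1?eq_sym// bij -addrA lerDl addr_ge0// sumr_ge0// => a _.
  by case: ifP.
rewrite mulr2n mulrDl mul1r addrAC; apply: lerD => //.
by apply: le_trans A1 _; rewrite big_split.
Qed.

Hypothesis sg_ge0 : forall i B, 0 <= sg i B.

Lemma block_weight_ge0 v : 0 <= block_weight v.
Proof. exact: sumr_ge0. Qed.

Lemma block_weight_sum (Q : pred {set PT}) :
  \sum_(v | Q v) block_weight v = \sum_i \sum_(B | (B != finset.set0) && Q (emb i B)) sg i B.
Proof.
under eq_bigr do rewrite /block_weight big_mkcond; rewrite exchange_big; apply: eq_bigr => i _ /=.
rewrite big_mkcond /= [RHS]big_mkcondr /=.
rewrite [RHS](eq_bigr (fun B => if Q (emb i B) then sg i (res i (emb i B)) else 0)) => [|B _]; last by rewrite resK.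
rewrite -(sum_block i (fun v => if Q v then sg i (res i v) else 0)) [RHS]big_mkcond /=.
by apply: eq_bigr => v _; case: ifP; case: ifP.
Qed.

End blocks.

Lemma slab_arith (R : realFieldType) (a b c e : R) : b <= c -> e <= c -> a - 3 * c <= a - b - (c + e).
Proof. by lra. Qed.

Lemma interp_arith (R : realFieldType) (p q a b : R) : `|a| <= q -> b <= q / 2 -> p - a <= p + 3 * q - 4 * b.
Proof. by rewrite ler_norml => /andP[]; lra. Qed.

Section excursion_law.
Variables (R : realType) (d N h : nat).
Hypotheses (N_gt1 : (1 < N)%N) (d_gt0 : (0 < d)%N) (Nh : (N < h)%N).
Local Notation Z := (lattice int d).
Local Notation T := 'rV['Z_N]_d.
Local Notation E := (lattice 'Z_N d).
Local Notation st := (@step 'Z_N d).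
Local Notation s0 := ((None, false) : direction d).
Local Notation hp := (@hp R _ _ s0 st).
Local Notation pr := (@pr R _ _ s0 st).
Local Notation avg := (@avg R _ _ st).
Local Notation smean := (@slice_mean R d N).
Local Notation countE := (countable_cyl d N).
Local Notation hitK := (@hitK R d N h).
Local Notation eqm := (@eqm R d N h).
Local Notation NT := (N%:R ^+ d : R).
Local Notation invKN := (d.+1%:R * (h - N)%N%:R / NT : R).
Local Notation rho := (N%:R / h%:R : R).
Local Notation lam := (decay R d N).
Local Notation traj := (trajectory E).
Local Notation I := ([set x | (`|x.2| <= N)%N] : set E).
Local Notation O := ([set x | (`|x.2| < h)%N] : set E).

Let NT0 : 0 < NT. Proof. exact: NT_gt0. Qed.

Section points.
Variables (PT : finType) (f : PT -> E).
Hypothesis f_in : forall p, (`|(f p).2| < N)%N.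

Definition rim_law s (v : {set PT}) : R := smean (fun z => pr z [set w | Vtr h f w = v]) (sgn s N).

Lemma rim_law_ge0 s v : 0 <= rim_law s v.
Proof.
rewrite /rim_law /slice_mean mulr_ge0 ?invr_ge0 ?(ltW NT0)// sumr_ge0// => t _; exact: prb_ge0.
Qed.

Let mV (Q : {set PT} -> Prop) : measurable ([set w | Q (Vtr h f w)] : set traj).
Proof. exact: measurable_Vtr. Qed.

Lemma pr_Vtr_sum (Q : pred {set PT}) z :
  pr z [set w | Q (Vtr h f w)] = \sum_(v | Q v) pr z [set w | Vtr h f w = v].
Proof.
rewrite {1}/Submission.pr (@prb_fin _ _ traj _ _ (Vtr h f) _ (mV Q)) => [|v]; last exact: (mV (fun V => V = v)).
rewrite [RHS]big_mkcond; apply: eq_bigr => v _ /=; case: ifP => Qv.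
  by congr (prb _ _); apply/seteqP; split => w /=; [case|move=> ->].
rewrite -(prb0 (walk_law R s0 st z)); congr (prb _ _); apply/seteqP; split => w //= -[+ e].
by rewrite e Qv.
Qed.

Lemma rim_law_sum (Q : pred {set PT}) s :
  \sum_(v | Q v) rim_law s v = smean (fun z => pr z [set w | Q (Vtr h f w)]) (sgn s N).
Proof.
rewrite /rim_law /slice_mean -mulr_sumr exchange_big; congr (_ * _).
by apply: eq_bigr => t _; rewrite pr_Vtr_sum.
Qed.

Hypothesis mix : 3 * NT ^+ 2 * lam ^+ (h - N) <= rho.

Let lam0 : 0 < lam. Proof. exact: decay_gt0. Qed.

Lemma edge_hit_lb s t t' : NT^-1 - 3 * lam ^+ (h - N) <= hp I [set rim (s, t')] (edge h (s, t)).
Proof.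
set j := (h - N)%N; have lj : 0 < lam ^+ j by rewrite exprn_gt0.
pose q := Num.truncn (j%:R / lam ^+ j : R).
pose n := (j + j + q.+1)%N.
have n0 : 0 < n%:R :> R by rewrite ltr0n /n addnS.
have jn : (j <= n)%N by rewrite /n -addnA leq_addr.
have jq : NT^-1 * (j%:R / n%:R) <= lam ^+ j.
  apply: (@le_trans _ _ (j%:R / n%:R)).
    rewrite ler_piMl// ?divr_ge0// invf_le1// -natrX ler1n expn_gt0.
    by rewrite ltnW.
  rewrite ler_pdivrMr// mulrC -ler_pdivrMr//; apply: ltW; apply: (@lt_le_trans _ _ q.+1%:R).
    by have /andP[] := truncn_itv (divr_ge0 (ler0n R j) (ltW lj)).
  by rewrite ler_nat /n leq_addl.
have e1 : (n - j)%N%:R / n%:R = 1 - j%:R / n%:R :> R.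
  by rewrite natrB// mulrBl mulfV ?gt_eqF.
have l1 : lam ^+ (n - j) <= lam ^+ j.
  rewrite ler_wiXn2l ?ltW//; first by rewrite decay_lt1.
  by rewrite leq_subRL// /n leq_addr.
have sub a (x : E) b : (forall z : E, I z -> out a n z) -> I b ->
    hp (out a n) [set b] x <= hp I [set b] x.
  by move=> Io Ib; apply: hp_mono => // z ->.
case: s.
  have := slab_exit R N_gt1 d_gt0 N%:Z t t' false jn.
  have -> : N%:Z + j%:Z = sgn true h by rewrite /sgn /j; move: Nh; clear; lia.
  rewrite addr0 e1 mulrBr mulr1 => H; apply: le_trans (le_trans _ H) (sub _ _ _ _ _).
  - exact: slab_arith jq l1.
  - by move=> z /= zI /andP[z1 _]; move: zI z1; move: z.2 => a; clear; lia.
  - by rewrite /=; clear; lia.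
have := slab_exit R N_gt1 d_gt0 (- (N + n)%N%:Z) t t' true (leq_subr j n).
have -> : - (N + n)%N%:Z + (n - j)%N%:Z = sgn false h by rewrite /sgn; move: jn Nh; rewrite /j; clear; lia.
have -> : - (N + n)%N%:Z + n%:Z = sgn false N by rewrite /sgn; clear; lia.
rewrite e1 mulrBr mulr1 (subKn jn) => H; apply: le_trans (le_trans _ H) (sub _ _ _ _ _).
- by rewrite [lam ^+ (n - j) + _]addrC; exact: slab_arith jq l1.
- by move=> z /= zI /andP[_ z1]; move: zI z1; move: z.2 => a; clear; lia.
- by rewrite /=; clear; lia.
Qed.

Lemma edge_hit_bounds s t t' :
  NT^-1 * (1 - rho) <= hp I [set rim (s, t')] (edge h (s, t)) <= NT^-1 * (1 + rho).
Proof.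
have NT1 : 1 <= NT by rewrite -natrX ler1n expn_gt0 ltnW.
set e := 3 * NT * lam ^+ (h - N).
have e0 : 0 <= e by rewrite !mulr_ge0 ?(ltW NT0)// exprn_ge0// ltW.
have lb t1 : NT^-1 * (1 - e) <= hp I [set rim (s, t1)] (edge h (s, t)).
  apply: le_trans _ (edge_hit_lb s t t1).
  by rewrite mulrBr mulr1 /e -mulrA mulrCA mulKf// gt_eqF.
have er : NT * e <= rho by apply: le_trans mix; rewrite /e expr2 !mulrA [NT * 3]mulrC.
apply/andP; split.
  apply: le_trans (lb t'); rewrite ler_pM2l ?invr_gt0// lerB//.
  by apply: le_trans er; rewrite ler_peMl.
apply: le_trans (slice_hit_ub N_gt1 e0 lb t') _.
by rewrite ler_pM2l ?invr_gt0// lerD2l.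
Qed.

Lemma nu_rim s t v : (1 - rho) * rim_law s v <= nu R h f (edge h (s, t)) v <= (1 + rho) * rim_law s v.
Proof.
rewrite (nu_edge R Nh f_in) /rim_law /slice_mean !mulrA mulr_sumr [X in _ <= _ <= X]mulr_sumr.
apply/andP; split; apply: ler_sum => t' _; rewrite ler_wpM2r ?prb_ge0// mulrC;
  by have /andP[] := edge_hit_bounds s t t'.
Qed.

(* A walk started uniformly at height [N] that visits the slice [z] before   *)
(* leaving [O] does so at a uniform point, so that the excursion from the    *)
(* uniform law on this slice is a part of one started at height [N].         *)
Section first_excursion.
Variables (z : int).
Hypothesis zN : (`|z| <= N)%N.
Hypothesis hN2 : (2 * N <= h)%N.

Let Zz : set E := [set x | x.2 = z \/ ~ (`|x.2| < h)%N].

Let zh : (`|z| < h)%N. Proof. exact: leq_ltn_trans Nh. Qed.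

Let hits t' v : set traj := [set w | exists n, [/\ hitat Zz n w, w n = (t', z) & Vtr h f (Defs.shift n w) = v]].

Let pz : R := smean (hp Zz [set x | x.2 = z]) N%:Z.

Let mhits t' v : measurable (hits t' v) /\
  forall x, pr x (hits t' v) = hp Zz [set (t', z)] x * pr (t', z) [set w | Vtr h f w = v].
Proof.
have H x := @strong_markov R _ _ s0 st countE _ [set (t', z)] _
  (pr (t', z) [set w | Vtr h f w = v]) x (hitat_stopping Zz) (mV (fun V => V = v))
  (fun a (ax : a = (t', z)) => congr1 (fun a => pr a _) ax).
by split=> [|x]; [have [] := H 0|have [] := H x].
Qed.

Lemma hp_slice_translate t' t a : hp Zz [set (t', z)] (t, a) = hp Zz [set (0, z)] (t - t', a).
Proof.
pose g (x : E) : E := x + (t', 0).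
have gst x s : g (x + st s) = g x + st s by rewrite /g addrAC.
have -> : (t, a) = g (t - t', a) by rewrite /g; congr (_, _) => /=; rewrite ?subrK ?addr0.
rewrite (hp_lift R s0 gst); apply: eq_hp => y; first by rewrite /Zz /g /= addr0.
move=> _; rewrite /g /=; split=> [[e1 e2]|->]; last by congr (_, _); rewrite ?add0r ?addr0.
by move: e1 e2; case: y => y1 y2 /= /eqP; rewrite -subr_eq0 addrK => /eqP -> ; rewrite addr0 => ->.
Qed.

Let hp_slice_sum x : hp Zz [set x | x.2 = z] x = \sum_t' hp Zz [set (t', z)] x.
Proof.
have -> : \sum_t' hp Zz [set (t', z)] x = hp Zz [set` [seq ((t', z) : E) | t' <- enum {: T}]] x.
  by rewrite (hp_seq countE) ?big_map ?big_enum// map_inj_uniq ?enum_uniq// => t1 t2 [].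
apply: eq_hp => // y _ /=; split=> [yz|/mapP[t _ ->]//].
by apply/mapP; exists y.1; rewrite ?mem_enum// -yz; case: (y).
Qed.

Let smean_slice t' : smean (hp Zz [set (t', z)]) N%:Z = NT^-1 * pz.
Proof.
have E1 t1 : smean (hp Zz [set (t1, z)]) N%:Z = smean (hp Zz [set (0, z)]) N%:Z.
  rewrite /slice_mean; congr (_ * _); under eq_bigr do rewrite hp_slice_translate.
  by rewrite [RHS](reindex_inj (addIr (- t1))).
have -> : pz = \sum_t1 smean (hp Zz [set (t1, z)]) N%:Z.
  rewrite /pz /slice_mean -mulr_sumr exchange_big; congr (_ * _); apply: eq_bigr => t _.
  exact: hp_slice_sum.
rewrite (eq_bigr _ (fun t1 _ => E1 t1)) sumr_const -[X in _ * X]mulr_natl (card_torus R d N_gt1) E1.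
by rewrite mulKf// gt_eqF.
Qed.

Let pzE : (h%:R - z%:~R) * pz = (h - N)%N%:R.
Proof.
set n := `|(h%:Z - z)%R|%N; set j := `|(N%:Z - z)%R|%N; set u := hp Zz [set x | x.2 = z].
have nE : z + n%:Z = h%:Z by rewrite /n; move: zh; clear; lia.
have jE : z + j%:Z = N%:Z by rewrite /j; move: zN; clear; lia.
have harm t i : (0 < i < n)%N -> u (t, z + i%:Z) = avg u (t, z + i%:Z).
  move=> ii; apply: (hp_step countE) => -[] /=; first by move: ii; clear; lia.
  by apply; move: ii nE zN Nh; clear; lia.
have jn : (j <= n)%N by move: jE nE Nh; clear; lia.
have := slice_mean_interp harm jn; rewrite nE jE -/pz.
have -> : smean u z = 1.
  rewrite /slice_mean (eq_bigr (fun=> 1)) => [|t _].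
    by rewrite sumr_const (card_torus R d N_gt1) mulVf// gt_eqF.
  by rewrite /u (hp_in countE) ?asboolT//; left.
have -> : smean u h%:Z = 0.
  rewrite /slice_mean big1 ?mulr0// => t _; rewrite /u (hp_in countE) ?asboolF//=.
    by move=> hz; move: zh; rewrite -hz; clear; lia.
  by right; rewrite /= ltnn.
rewrite mulr0 addr0 mulr1 (_ : (n - j = h - N)%N); last by move: jE nE Nh; clear; lia.
move=> <-; congr (_ * _).
by rewrite -[n%:R]/(n%:Z%:~R) -[h%:R]/(h%:Z%:~R) -intrB -nE addrAC subrr add0r.
Qed.

Let pz_gt0 : 0 < pz.
Proof.
have hz0 : 0 < h%:R - z%:~R :> R.
  by rewrite subr_gt0 -[h%:R]/(h%:Z%:~R) ltr_int; move: zh; clear; lia.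
by rewrite -(pmulr_rgt0 _ hz0) pzE ltr0n subn_gt0.
Qed.

Let pz_inv : pz^-1 <= 1 + 4 * rho.
Proof.
have zR : `|z%:~R : R| <= N%:R.
  by rewrite -intr_norm -[N%:R]/(N%:Z%:~R) ler_int; move: zN; clear; lia.
have h0 : 0 < h%:R :> R by rewrite ltr0n (leq_ltn_trans _ Nh).
have h2 : 2 * N%:R <= h%:R :> R by rewrite -natrM ler_nat.
have := pzE; rewrite natrB ?(ltnW Nh)// => e.
rewrite -[leLHS]mul1r ler_pdivrMr// -(ler_pM2r h0).
have hz : h%:R - z%:~R <= (1 + 4 * rho) * (h%:R - N%:R).
  have -> : (1 + 4 * rho) * (h%:R - N%:R) = h%:R + 3 * N%:R - 4 * (N%:R * rho).
    by field; rewrite gt_eqF.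
  have : N%:R * rho <= N%:R / 2.
    by rewrite ler_wpM2l// ler_pdivrMr// mulrC ler_pdivlMr// mulrC.
  exact: interp_arith zR.
have hz0 : 0 < h%:R - z%:~R :> R.
  by rewrite subr_gt0 -[h%:R]/(h%:Z%:~R) ltr_int; move: zh; clear; lia.
rewrite -(ler_pM2l hz0) [in leRHS]mulrA [_ * ((1 + 4 * rho) * pz)]mulrCA e mul1r [leLHS]mulrC [leRHS]mulrC.
by rewrite ler_pM2l.
Qed.

Definition first_pair (v v' : {set PT}) : R :=
  pz^-1 * \sum_t' smean (fun x => pr x (hits t' v `&` [set w | Vtr h f w = v'])) N%:Z.

Lemma first_pair_ge0 v v' : 0 <= first_pair v v'.
Proof.
rewrite mulr_ge0 ?invr_ge0 ?(ltW pz_gt0)// sumr_ge0// => t' _.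
by rewrite /slice_mean mulr_ge0 ?invr_ge0 ?(ltW NT0)// sumr_ge0// => t _; exact: prb_ge0.
Qed.

Lemma first_pair_row v : \sum_v' first_pair v v' = smean (fun x => nu R h f x v) z.
Proof.
rewrite -mulr_sumr exchange_big /=.
have E1 t' : \sum_v' smean (fun x => pr x (hits t' v `&` [set w | Vtr h f w = v'])) N%:Z =
    NT^-1 * pz * pr (t', z) [set w | Vtr h f w = v].
  rewrite -(smean_slice t') /slice_mean -mulr_sumr exchange_big -mulrA mulr_suml; congr (_ * _).
  apply: eq_bigr => t _; have [mh <-] := mhits t' v.
  by rewrite {2}/Submission.pr (@prb_fin _ _ traj _ _ (Vtr h f) _ mh) => [//|v']; exact: (mV (fun V => V = v')).
rewrite (eq_bigr _ (fun t' _ => E1 t')) -mulr_sumr.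
rewrite [_ * pz]mulrC -mulrA mulKf ?gt_eqF//.
rewrite /slice_mean; congr (_ * _); apply: eq_bigr => t' _.
by rewrite (nu_inner R Nh f_in).
Qed.

Lemma first_pair_col v' : \sum_v first_pair v v' <= (1 + 4 * rho) * rim_law true v'.
Proof.
rewrite -mulr_sumr ler_pM ?invr_ge0 ?(ltW pz_gt0)//.
  apply: sumr_ge0 => v _; apply: sumr_ge0 => t' _.
  by rewrite /slice_mean mulr_ge0 ?invr_ge0 ?(ltW NT0)// sumr_ge0// => t _; exact: prb_ge0.
rewrite /rim_law /slice_mean /=; under eq_bigr do rewrite -mulr_sumr exchange_big.
rewrite -mulr_sumr ler_pM2l ?invr_gt0// exchange_big; apply: ler_sum => t _ /=.
rewrite pair_big /=; set x : E := (t, N%:Z).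
pose H (i : {set PT} * T) := hits i.2 i.1.
have dH i j w : H i w -> H j w -> i = j.
  move=> [n [Hn wn Vn]] [m [Hm wm Vm]]; have [_ uI] := hitat_stopping Zz.
  have nm := uI _ _ _ Hn Hm; subst m; case: i wn Vn => [a b] /= wn Vn; case: j wm Vm => [a' b'] /= wm Vm.
  by congr (_, _); [rewrite -Vn -Vm|move: wm; rewrite wn => -[]].
rewrite [leRHS]/Submission.pr (@prb_partition _ _ _ _ _ H _ (mV (fun V => V = v'))) => [|i|//]; last by have [] := mhits i.2 i.1.
rewrite -[leLHS]addr0 lerD ?prb_ge0// le_eqVlt; apply/orP; left; apply/eqP.
by apply: eq_bigr => i _; rewrite setIC.
Qed.

Lemma first_pair_sub v v' : first_pair v v' != 0 -> v \subset v'.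
Proof.
apply: contraNT => /fintype.subsetPn[p pv pv']; rewrite /first_pair big1 ?mulr0// => t' _.
rewrite /slice_mean big1 ?mulr0// => t _; rewrite (_ : _ `&` _ = set0) ?/Submission.pr ?prb0//.
apply/seteqP; split => // w [[n [[_ nZ] wn Vn]] /= V'].
have [m [wm Om]] : vis h f p (Defs.shift n w) by apply/asboolP; move: pv; rewrite -Vn inE.
suff : p \in v' by rewrite (negbTE pv').
rewrite -V' inE; apply/asboolP.
exists (n + m)%N; split => // i inm.
have [ni|ni] := leqP n i; first by rewrite -(subnKC ni); apply: Om; rewrite leq_subLR.
by apply: contrapT => Oi; apply: (nZ i ni); right.
Qed.

End first_excursion.

End points.

End excursion_law.

Lemma cap_arith (R : realFieldType) (r a p : R) : 0 <= a -> (1 - 3 * r) * a <= p -> 0 <= r -> r <= 8^-1 ->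
  (1 + r) * a <= 2 * p.
Proof.
move=> a0 ap r0 r1; have : r * a <= 8^-1 * a by exact: ler_wpM2r.
lra.
Qed.

Lemma err_arith (R : realFieldType) (r a b : R) : 0 <= a -> 0 <= b -> r <= 8^-1 ->
  2 * (2 * ((1 + 4 * r) * (2 * a)) + 3 * b) <= 24 * (a + b).
Proof.
move=> a0 b0 r1; have : r * a <= 8^-1 * a by exact: ler_wpM2r.
lra.
Qed.

Lemma lower_weight (R : realFieldType) (r a t g f X : R) : 0 <= r -> r <= 8^-1 -> 0 <= a -> 0 <= t ->
  0 <= f -> 0 <= g -> f <= (1 + r) * t + g -> (1 - 3 * r) * (a * t) <= X ->
  (1 - 4 * r) * (a * f) - 3 * (a * g) <= X.
Proof.
move=> r0 r1 a0 t0 f0 g0 ft tX; apply: le_trans tX.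
apply: (@le_trans _ _ (a * ((1 - 4 * r) * ((1 + r) * t + g) - 3 * g))).
  rewrite mulrBr [a * (3 * g)]mulrCA lerB// mulrCA ler_wpM2l// ler_wpM2l//; lra.
rewrite mulrCA ler_wpM2l//.
have : 0 <= r * g by exact: mulr_ge0.
have : 0 <= r * r * t by rewrite !mulr_ge0.
lra.
Qed.

Lemma upper_weight (R : realFieldType) (r a t g f X : R) : 0 <= r -> r <= 8^-1 -> 0 <= a -> 0 <= f ->
  0 <= g -> t <= (1 + r) * f + g -> X <= (1 + 4 * r) * (a * t) ->
  X <= (1 + 7 * r) * (a * f) + 3 * (a * g).
Proof.
move=> r0 r1 a0 f0 g0 tf Xt; apply: le_trans Xt _.
apply: (@le_trans _ _ (a * ((1 + 4 * r) * ((1 + r) * f + g)))).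
  by rewrite mulrCA ler_wpM2l// ler_wpM2l//; lra.
have -> : (1 + 7 * r) * (a * f) + 3 * (a * g) = a * ((1 + 7 * r) * f + 3 * g) by ring.
rewrite ler_wpM2l//.
have : r * g <= 8^-1 * g by exact: ler_wpM2r.
have : r * (r * f) <= 8^-1 * (r * f) by apply: ler_wpM2r => //; exact: mulr_ge0.
have : 0 <= r * f by exact: mulr_ge0.
lra.
Qed.

Lemma lower_nu (R : realFieldType) (r s b p X : R) : 0 <= r -> r <= 8^-1 -> 0 <= s -> 0 <= p -> 0 <= b ->
  (1 - 4 * r) * s - b <= p -> (1 - r) * p <= X -> (1 - 12 * r) * s - 2 * b <= X.
Proof.
move=> r0 r1 s0 p0 b0 sp pX; apply: le_trans pX.
have : 0 <= (1 - r) * (p - ((1 - 4 * r) * s - b)) by rewrite mulr_ge0 ?subr_ge0//; lra.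
have : 0 <= r * s by exact: mulr_ge0.
have : 0 <= r * b by exact: mulr_ge0.
have : 0 <= r * r * s by rewrite !mulr_ge0.
lra.
Qed.

Lemma upper_nu (R : realFieldType) (r s b p X : R) : 0 <= r -> r <= 8^-1 -> 0 <= s -> 0 <= b ->
  p <= (1 + 7 * r) * s + b -> X <= (1 + 4 * r) * p -> X <= (1 + 16 * r) * s + 2 * b.
Proof.
move=> r0 r1 s0 b0 sp pX; apply: le_trans pX _.
have : 0 <= (1 + 4 * r) * ((1 + 7 * r) * s + b - p) by rewrite mulr_ge0 ?subr_ge0//; lra.
have : r * b <= 8^-1 * b by exact: ler_wpM2r.
have : r * (r * s) <= 8^-1 * (r * s) by apply: ler_wpM2r => //; exact: mulr_ge0.
have : 0 <= r * s by exact: mulr_ge0.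
lra.
Qed.

Section several_blocks.
Variables (R : realType) (d N h : nat).
Hypotheses (N_gt1 : (1 < N)%N) (d_gt0 : (0 < d)%N) (Nh : (N < h)%N).
Local Notation Z := (lattice int d).
Local Notation T := 'rV['Z_N]_d.
Local Notation E := (lattice 'Z_N d).
Local Notation st := (@step 'Z_N d).
Local Notation s0 := ((None, false) : direction d).
Local Notation hp := (@hp R _ _ s0 st).
Local Notation pr := (@pr R _ _ s0 st).
Local Notation smean := (@slice_mean R d N).
Local Notation hitK := (@hitK R d N h).
Local Notation eqm := (@eqm R d N h).
Local Notation NT := (N%:R ^+ d : R).
Local Notation invKN := (d.+1%:R * (h - N)%N%:R / NT : R).
Local Notation rho := (N%:R / h%:R : R).
Local Notation lam := (decay R d N).
Local Notation traj := (trajectory E).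
Variables (k : nat) (S : 'I_k -> {fset Z}) (x : 'I_k -> E).
Local Notation K i := (translate (S i) (x i)).
Local Notation F := (fun i => S i : finType).
Local Notation PT := {i : 'I_k & S i}.

Definition point (p : PT) : E := place (x (tag p)) (tagged p).

Hypothesis point_inj : injective point.
Hypothesis point_height : forall p, (`|(point p).2| < N)%N.
Hypothesis rho_small : rho <= 8^-1.
Hypothesis capture_small : forall i (w : Z), (forall j, (`|w.1 0%R j| <= N)%N) ->
  (N < 4 * `|w.2|)%N -> ~ dead_cyl h (x i).2 w -> capture R (dead_cyl h (x i).2) (@T_cyl d (S i) N) w <= rho.
Hypothesis x_height : forall i, (`|(x i).2|%N.*2 <= N)%N.
Variable g : forall i, {set S i} -> R.
Arguments g : clear implicits.
Local Notation tau i B := (trace_weight R set0 (@T_full d (S i)) B).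
Hypothesis g_bounds : forall i (B : {set S i}),
  [/\ 0 <= g i B,
      trace_weight R (dead_cyl h (x i).2) (@T_cyl d (S i) N) B <= (1 + rho) * tau i B + g i B &
      tau i B <= (1 + rho) * trace_weight R (dead_cyl h (x i).2) (@T_cyl d (S i) N) B + g i B].
Hypothesis mix : 3 * NT ^+ 2 * lam ^+ (h - N) <= rho.

Let NT0 : 0 < NT. Proof. exact: NT_gt0. Qed.
Let inv0 : 0 <= invKN.
Proof. by rewrite divr_ge0 ?(ltW NT0)// mulr_ge0. Qed.
Let rho0 : 0 <= rho. Proof. exact: divr_ge0. Qed.
Let rho_half : rho <= 2^-1. Proof. by move: rho_small; lra. Qed.

Lemma place_block_inj i : injective (place (x i) : S i -> E).
Proof.
move=> y y' e; have := @point_inj (Tagged F y) (Tagged F y') e.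
exact: eq_from_Tagged.
Qed.

Lemma place_block_height i (y : S i) : (`|(place (x i) y).2| < N)%N.
Proof. exact: (point_height (Tagged F y)). Qed.

Lemma trace_weight_ge0 dead i (TT : S i -> set Z) (B : {set S i}) : 0 <= trace_weight R dead TT B.
Proof. by apply: sumr_ge0 => y _; rewrite mulr_ge0 ?escape_ge0 ?prb_ge0. Qed.

Definition weight i (B : {set S i}) : R := invKN * tau i B.
Arguments weight : clear implicits.

Lemma weight_ge0 i B : 0 <= weight i B.
Proof. by rewrite mulr_ge0// trace_weight_ge0. Qed.

Definition pair_energy : R := \sum_i \sum_(j | j != i) \sum_(z <- K i) eqm (K i) z * hitK (K j) z.

Definition error_mass : R := invKN * (pair_energy + \sum_i \sum_B g i B).

Let w i j : R := (1 + 4 * rho) * (invKN * (\sum_(z <- K i) eqm (K i) z * hitK (K j) z +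
  \sum_(z <- K j) eqm (K j) z * hitK (K i) z)).

Let res_Vtr i w' : res i (Vtr h point w') = Vtr h (place (x i)) w'.
Proof. by apply/setP => y; rewrite !inE. Qed.

Lemma rim_res s i (B : {set S i}) : B != finset.set0 ->
  (1 - 4 * rho) * weight i B - 3 * (invKN * g i B) <= \sum_(v | res i v == B) rim_law R h point s v <=
  (1 + 7 * rho) * weight i B + 3 * (invKN * g i B).
Proof.
move=> B0; rewrite (@rim_law_sum R d N h PT point (fun v => res i v == B)).
rewrite (_ : smean _ _ = smean (fun z => pr z [set w | Vtr h (place (x i)) w = B]) (sgn s N)); last first.
  rewrite /slice_mean; congr (_ * _); apply: eq_bigr => t _; congr (pr _ _).
  by apply/seteqP; split => w' /=; rewrite res_Vtr => /eqP.
have [g0 gu gl] := g_bounds B.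
have /andP[lb ub] := block_bounds N_gt1 d_gt0 Nh (@place_block_inj i) (@place_block_height i)
  rho_half (@capture_small i) (x_height i) s B0.
rewrite (lower_weight _ _ _ _ _ _ gl lb) ?trace_weight_ge0//=.
by rewrite (upper_weight _ _ _ _ _ gu ub) ?trace_weight_ge0.
Qed.

Lemma rim_both s i j : i != j -> \sum_(v | both i j v) rim_law R h point s v <= w i j.
Proof.
move=> ij; rewrite (@rim_law_sum R d N h PT point (both i j)).
have B a b := visit_both_bound N_gt1 d_gt0 Nh (@place_block_inj a) (@place_block_height a)
  rho_half (@capture_small a) (x_height a) (K b) s.
rewrite /w mulrDr mulrDr; apply: le_trans (lerD (B i j) (B j i)).
rewrite /slice_mean -mulrDr ler_pM2l ?invr_gt0// -big_split; apply: ler_sum => t _ /=.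
have mb a b : measurable (visit_both h (S a) (x a) (K b)).
  by have [] := pr_visit_both R h (@place_block_inj a) (K b) 0.
apply: le_trans (prbU_le _ (mb i j) (mb j i)).
apply: le_prb; [exact: (measurable_Vtr _ _ (fun V => both i j V))|exact: measurableU|].
move=> w'; rewrite /both /= !res_Vtr => /andP[/set0Pn[y yi] /set0Pn[y' yj]].
have v1 : vis h (place (x i)) y w' by apply/asboolP; move: yi; rewrite inE.
have v2 : vis h (place (x j)) y' w' by apply/asboolP; move: yj; rewrite inE.
have [y1 [n1 [H1 /= e1]]] := visit_entrance v1; have [y2 [n2 [H2 /= e2]]] := visit_entrance v2.
have sh a b (ya : S a) (yb : S b) n m : hitat (@Kc d N h (K a)) n w' -> w' n = place (x a) ya ->
    hitat (@Kc d N h (K b)) m w' -> w' m = place (x b) yb -> (n <= m)%N -> visit_both h (S a) (x a) (K b) w'.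
  move=> Ha ea [Hb1 Hb2] eb nm; exists n; split => //; first by rewrite ea; apply/mem_translate; exists ya.
  exists (m - n)%N; rewrite /Defs.shift subnKC//; split; last by rewrite eb; apply/mem_translate; exists yb.
  split; first by rewrite /= subnKC.
  by move=> i' im; apply: Hb2; rewrite -ltn_subRL.
have [n12|n21] := leqP n1 n2; first by left; exact: sh H1 e1 H2 e2 n12.
by right; exact: sh H2 e2 H1 e1 (ltnW n21).
Qed.

Definition rim_err s (v : {set PT}) : R :=
  2 * block_err (F := F) (rim_law R h point s) (fun i B => 3 * (invKN * g i B)) v.

Let g'0 i B : 0 <= 3 * (invKN * g i B).
Proof. by have [g0 _ _] := g_bounds B; rewrite mulr_ge0// mulr_ge0. Qed.

Lemma rim_err_ge0 s v : 0 <= rim_err s v.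
Proof. by rewrite mulr_ge0// block_err_ge0// => v'; exact: rim_law_ge0. Qed.

Lemma rim_err_sum s : \sum_v rim_err s v <= 24 * error_mass.
Proof.
have H := block_err_sum (F := F) (fun v => rim_law_ge0 R h N_gt1 point s v) g'0 (@rim_both s).
rewrite -mulr_sumr; apply: le_trans (ler_wpM2l _ H) _ => //.
have -> : \sum_i \sum_B 3 * (invKN * g i B) = 3 * (invKN * \sum_i \sum_B g i B).
  by rewrite !mulr_sumr; apply: eq_bigr => i _; rewrite !mulr_sumr.
have -> : \sum_i \sum_(j | j != i) w i j = (1 + 4 * rho) * (invKN * (2 * pair_energy)).
  under eq_bigr do rewrite -mulr_sumr -mulr_sumr big_split /=.
  have aux (c e : R) (a b : 'I_k -> R) : \sum_i a i = pair_energy -> \sum_i b i = pair_energy ->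
      \sum_i c * (e * (a i + b i)) = c * (e * (2 * pair_energy)).
    by move=> ea eb; rewrite -2!mulr_sumr big_split /= ea eb mulr2n mulrDl mul1r.
  apply: aux => //.
  rewrite /pair_energy; under eq_bigr do rewrite big_mkcond.
  rewrite exchange_big /=; apply: eq_bigr => i _; rewrite [RHS]big_mkcond /=.
  by apply: eq_bigr => j _; rewrite eq_sym.
have e0 : 0 <= invKN * pair_energy.
  rewrite mulr_ge0//; apply: sumr_ge0 => i _; apply: sumr_ge0 => j _; apply: sumr_ge0 => z _.
  by rewrite mulr_ge0 ?hitK_ge0// eqm_ge0.
have g0 : 0 <= invKN * \sum_i \sum_B g i B.
  by rewrite mulr_ge0// sumr_ge0// => i _; apply: sumr_ge0 => B _; have [] := g_bounds B.
rewrite /error_mass [X in _ <= 24 * X]mulrDr; move: e0 g0 rho_small; rewrite [invKN * (2 * _)]mulrCA.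
set a := invKN * pair_energy; set b := invKN * _ => a0 b0 rs.
exact: err_arith.
Qed.

Lemma edge_approx s t v : v != finset.set0 ->
  (1 - 12 * rho) * block_weight weight v - rim_err s v <= nu R h point (edge h (s, t)) v <=
  (1 + 16 * rho) * block_weight weight v + rim_err s v.
Proof.
move=> v0; have /andP[l1 u1] := block_approx (F := F) (fun v => rim_law_ge0 R h N_gt1 point s v) g'0 (@rim_res s) v0.
have /andP[l2 u2] := nu_rim N_gt1 d_gt0 Nh point_height mix s t v.
have b0 := block_err_ge0 (F := F) (fun v => rim_law_ge0 R h N_gt1 point s v) g'0 v.
have w0 := block_weight_ge0 weight_ge0 v.
have p0 := rim_law_ge0 R h N_gt1 point s v.
rewrite (lower_nu _ _ _ _ _ l1 l2)//= (upper_nu _ _ _ _ u1)//; apply: le_trans u2 _.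
by rewrite ler_wpM2r// lerD2l ler_peMl// ler1n.
Qed.

Lemma first_approx v : v != finset.set0 ->
  (1 + 4 * rho) * rim_law R h point true v <= (1 + 16 * rho) * block_weight weight v + rim_err true v.
Proof.
move=> v0; have /andP[_ u1] := block_approx (F := F) (fun v => rim_law_ge0 R h N_gt1 point true v) g'0 (@rim_res true) v0.
have b0 := block_err_ge0 (F := F) (fun v => rim_law_ge0 R h N_gt1 point true v) g'0 v.
have w0 := block_weight_ge0 weight_ge0 v.
exact: (upper_nu _ _ _ _ u1).
Qed.

Section energy.
Variable L : nat.
Hypotheses (NL : (2 * N <= L)%N) (Lh : (2 * L <= h)%N) (mixL : lam ^+ (L - N) <= (16 * NT)^-1).
Hypothesis S_neq0 : forall i, S i != fset0.
Hypothesis esc : forall i (y : S i), escape R set0 (@T_full d (S i)) y <=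
  (1 + rho) * escape R (dead_cyl h (x i).2) (@T_cyl d (S i) N) y.

Local Notation pi i := (hit_mean R h (K i) true).

Let K_in i z : z \in K i -> (`|z.2| < N)%N.
Proof. by move=> zK; apply: K_height zK; exact: place_block_height. Qed.

Let far i z : `|z.2|%N = N -> hitK (K i) z <= rho.
Proof. by apply: hitK_far => //; exact: capture_small. Qed.

Let pi_le i : pi i <= rho.
Proof.
rewrite /hit_mean /slice_mean ler_pdivrMl//.
apply: (@le_trans _ _ (\sum_(t : T) rho)); first by apply: ler_sum => t _; apply: far; rewrite /=.
by rewrite sumr_const -[leLHS]mulr_natl (card_torus R d N_gt1).
Qed.

Let pi_bounds i := hit_mean_bounds N_gt1 d_gt0 Nh (@K_in i) rho_half (@far i) true.

Let pi_gt0 i : (3 * NT)^-1 <= pi i.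
Proof.
apply: (hit_mean_lb R N_gt1 Nh (@K_in i)) => //; last first.
  by apply: leq_trans Lh; apply: leq_trans NL _; rewrite leq_pmull.
have /fset0Pn[y yS] := S_neq0 i; apply/fset0Pn; exists (place (x i) [` yS]%fset).
by apply/mem_translate; exists [` yS]%fset.
Qed.

Let pi0 i : 0 <= pi i.
Proof. by apply: le_trans (pi_gt0 i); rewrite invr_ge0 mulr_ge0 ?(ltW NT0). Qed.

Lemma weight_sum i : \sum_(B | B != finset.set0) weight i B <= 2 * pi i.
Proof.
rewrite /weight -mulr_sumr.
have c0 : 0 <= capacity R h (K i).
  by apply: sumr_ge0 => z _; exact: eqm_ge0.
have tc : \sum_(B | B != finset.set0) tau i B <= (1 + rho) * capacity R h (K i).
  apply: (@le_trans _ _ (\sum_(y : S i) escape R set0 (@T_full d (S i)) y)).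
    rewrite /trace_weight exchange_big; apply: ler_sum => y _ /=.
    rewrite -mulr_sumr ler_piMr ?escape_ge0//.
    have := pr_setT R s0 (@step int d) (val y); rewrite /Submission.pr => <-.
    have mE B : measurable (ev set0 (@T_full d (S i)) finset.set0 B).
      exact: (measurable_trset _ _ (fun V => finset.set0 :|: V = B)).
    rewrite (@prb_partition _ _ _ _ _ (fun B => ev set0 (@T_full d (S i)) finset.set0 B) _ measurableT mE); last first.
      by move=> B B' w' /= <- <-.
    rewrite [X in _ <= X + _](bigID (fun B => B != finset.set0)) /= -addrA.
    rewrite (eq_bigr (fun B => prb (walk_law R s0 (@step int d) (val y)) (setT `&` ev set0 (@T_full d (S i)) finset.set0 B))) => [|B _]; last by rewrite setTI.
    by rewrite lerDl addr_ge0 ?prb_ge0// sumr_ge0// => B _; exact: prb_ge0.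
  rewrite /capacity (sum_translate (@place_block_inj i)) mulr_sumr; apply: ler_sum => y _.
  by rewrite (eqm_escape R h N_gt1); exact: esc.
have /andP[lb _] := pi_bounds i.
apply: le_trans (ler_wpM2l inv0 tc) _.
have H : 0 <= capacity R h (K i) * invKN by exact: mulr_ge0.
by rewrite mulrCA [invKN * _]mulrC; exact: cap_arith H lb rho0 rho_small.
Qed.

Lemma block_energy i j : pi i * pi j <= 24 * (invKN * \sum_(z <- K i) eqm (K i) z * hitK (K j) z).
Proof.
have /andP[_ ub] := pi_bounds i.
have lb : capacity R h (K i) * (pi j / 16) <= \sum_(z <- K i) eqm (K i) z * hitK (K j) z.
  rewrite /capacity mulr_suml big_seq [leRHS]big_seq; apply: ler_sum => z zK.
  rewrite ler_wpM2l ?eqm_ge0//; apply: (hitK_lb N_gt1 d_gt0 Nh (@K_in j) NL Lh mixL).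
  exact/ltnW/(K_in zK).
apply: le_trans (ler_wpM2l _ (ler_wpM2l inv0 lb)) => //.
have c0 : 0 <= capacity R h (K i) * invKN.
  by rewrite mulr_ge0// sumr_ge0// => z _; exact: eqm_ge0.
have aux (a c p : R) : 24 * (a * (c * (p / 16))) = 3 / 2 * (c * a) * p by field.
rewrite aux.
rewrite ler_wpM2r//; apply: le_trans ub _; rewrite ler_wpM2r//.
by move: rho_small; lra.
Qed.

Lemma pair_energy_ge : \sum_i \sum_(j | j != i) pi i * pi j <= 24 * (invKN * pair_energy).
Proof.
rewrite /pair_energy 2!mulr_sumr; apply: ler_sum => i _; rewrite 2!mulr_sumr; apply: ler_sum => j _.
exact: block_energy.
Qed.

Lemma pair_energy_ge0 : 0 <= pair_energy.
Proof.
apply: sumr_ge0 => i _; apply: sumr_ge0 => j _; apply: sumr_ge0 => z _.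
by rewrite mulr_ge0 ?hitK_ge0// eqm_ge0.
Qed.

Lemma pair_energy_lb : (1 < k)%N -> k%:R <= 216 * NT ^+ 2 * (invKN * pair_energy).
Proof.
move=> k1; have c0 : 0 <= (3 * NT)^-1 by rewrite invr_ge0 mulr_ge0 ?(ltW NT0).
have H : k%:R * ((3 * NT)^-1 * (3 * NT)^-1) <= 24 * (invKN * pair_energy).
  apply: le_trans pair_energy_ge; rewrite mulr_natl -[X in _ *+ X](card_ord k) -sumr_const.
  apply: ler_sum => i _.
  have [j ji] : exists j, j != i.
    have [i0|i0] := eqVneq i (Ordinal (ltnW k1)); last by exists (Ordinal (ltnW k1)); rewrite eq_sym.
    by exists (Ordinal k1); rewrite i0 -val_eqE.
  rewrite (bigD1 j)//= -[leLHS]addr0 lerD//; first by apply: ler_pM.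
  by apply: sumr_ge0 => a _; rewrite mulr_ge0.
have -> : 216 * NT ^+ 2 * (invKN * pair_energy) = (3 * NT) ^+ 2 * (24 * (invKN * pair_energy)) by ring.
have e0 : 0 < 3 * NT by rewrite mulr_gt0.
apply: le_trans (ler_wpM2l _ H); last by rewrite exprn_ge0// ltW.
by rewrite mulrCA -invfM -expr2 mulfV ?mulr1// expf_neq0// gt_eqF.
Qed.

Lemma dense_energy : rho <= 16^-1 ->
  4^-1 < \sum_(v | v != finset.set0) block_weight weight v -> 1 <= 3072 * (invKN * pair_energy).
Proof.
move=> r16; rewrite block_weight_sum => W.
set P := \sum_i pi i.
have P8 : 8^-1 < P.
  rewrite -(ltr_pM2l (ltr0n _ 2)) mulr_sumr (_ : 2%:R * 8^-1 = 4^-1 :> R); last by field.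
  apply: lt_le_trans W _; apply: ler_sum => i _; apply: le_trans (weight_sum i).
  rewrite [leRHS](bigID (fun B : {set S i} => emb (F := F) B != finset.set0))/= -[leLHS]addr0 lerD ?sumr_ge0// => B _.
  exact: weight_ge0.
have : P * (P - rho) <= 24 * (invKN * pair_energy).
  apply: le_trans pair_energy_ge; rewrite /P mulr_suml; apply: ler_sum => i _.
  rewrite -mulr_sumr ler_wpM2l// -/P [X in X - _](bigD1 i)//= lerBlDr addrC lerD2l//.
have : 8^-1 * 16^-1 <= P * (P - rho) by apply: ler_pM => //; lra.
lra.
Qed.

End energy.

End several_blocks.

(** * Couplings of laws on finite sets *)

Section coupling.
Variable R : realType.
Implicit Types (A B C : finType).

Definition coupled A B (mu : A -> R) (nu : B -> R) (rel : A -> B -> bool) (e : R) : Prop :=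
  exists g : A -> B -> R, [/\ forall a b, 0 <= g a b, forall a, \sum_b g a b = mu a,
    forall b, \sum_a g a b = nu b & \sum_a \sum_(b | ~~ rel a b) g a b <= e].

Definition push A B (f : A -> B) (mu : A -> R) (b : B) : R := \sum_(a | f a == b) mu a.

Lemma sum_push A B (f : A -> B) (mu : A -> R) (P : pred B) :
  \sum_(b | P b) push f mu b = \sum_(a | P (f a)) mu a.
Proof.
rewrite /push (exchange_big_dep (fun a => P (f a)))/= => [|b a Pb /eqP->//].
apply: eq_bigr => a Pa; rewrite (big_pred1 (f a)) => [//|b /=].
by rewrite eq_sym; case: eqP => [->|]; rewrite ?andbT ?andbF.
Qed.

Lemma coupled_le A B (mu : A -> R) (nu : B -> R) rel e e' : e <= e' ->
  coupled mu nu rel e -> coupled mu nu rel e'.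
Proof. by move=> ee [g [? ? ? ge]]; exists g; split => //; apply: le_trans ee. Qed.

Lemma coupled_complete A B (mu : A -> R) (nu : B -> R) (rel : A -> B -> bool) (g : A -> B -> R)
    (A' : pred A) (B' : pred B) :
  \sum_a mu a = \sum_b nu b ->
  (forall a b, 0 <= g a b) -> (forall a, \sum_b g a b <= mu a) -> (forall b, \sum_a g a b <= nu b) ->
  (forall a b, ~~ A' a -> ~~ B' b -> rel a b) ->
  coupled mu nu rel (\sum_a \sum_(b | ~~ rel a b) g a b +
    (\sum_(a | A' a) (mu a - \sum_b g a b) + \sum_(b | B' b) (nu b - \sum_a g a b))).
Proof.
move=> mn g0 gr gc AB.
pose r a := mu a - \sum_b g a b; pose s b := nu b - \sum_a g a b.
have r0 a : 0 <= r a by rewrite subr_ge0.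
have s0 b : 0 <= s b by rewrite subr_ge0.
set t := \sum_a r a; have tE : \sum_b s b = t.
  by rewrite /t /r /s !sumrB mn exchange_big.
have t0 : 0 <= t by exact: sumr_ge0.
have rt a : r a * (t / t) = r a.
  have [tz|tz] := eqVneq t 0; last by rewrite mulfV ?mulr1.
  suff -> : r a = 0 by rewrite mul0r.
  by apply: (psumr_eq0P (fun a _ => r0 a) tz).
have st b : s b * (t / t) = s b.
  have [tz|tz] := eqVneq t 0; last by rewrite mulfV ?mulr1.
  suff -> : s b = 0 by rewrite mul0r.
  by move: tz; rewrite -tE => tz; apply: (psumr_eq0P (fun b _ => s0 b) tz).
exists (fun a b => g a b + r a * (s b / t)); split => [a b|a|b|].
- by rewrite addr_ge0// mulr_ge0// divr_ge0.
- by rewrite big_split/= -mulr_sumr -mulr_suml tE rt addrC subrK.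
- rewrite big_split/= -mulr_suml -/t mulrCA st addrC subrK//.
under eq_bigr do rewrite big_split; rewrite big_split/= lerD2l.
apply: (@le_trans _ _ (\sum_a \sum_b ((A' a)%:R * (r a * (s b / t)) + (B' b)%:R * (r a * (s b / t))))).
  apply: ler_sum => a _; rewrite big_mkcond; apply: ler_sum => b _ /=.
  have x0 : 0 <= r a * (s b / t) by rewrite mulr_ge0// divr_ge0.
  case: ifPn => [nr|_]; last by rewrite addr_ge0// mulr_ge0.
  case Aa : (A' a); first by rewrite mul1r lerDl mulr_ge0.
  case Bb : (B' b); first by rewrite mul0r mul1r add0r.
  by move: nr; rewrite AB ?Aa ?Bb.
rewrite (eq_bigr (fun a => \sum_b (A' a)%:R * (r a * (s b / t)) + \sum_b (B' b)%:R * (r a * (s b / t)))) => [|a _]; last exact: big_split.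
rewrite big_split /=; apply: lerD.
  rewrite [leRHS]big_mkcond; apply: ler_sum => a _.
  by rewrite -2!mulr_sumr -mulr_suml tE rt; case: (A' a); rewrite ?mul1r ?mul0r.
rewrite exchange_big [leRHS]big_mkcond; apply: ler_sum => b _ /=.
by rewrite -mulr_sumr -mulr_suml -/t [t * _]mulrCA st; case: (B' b); rewrite ?mul1r ?mul0r.
Qed.

Lemma coupled_trivial A B (mu : A -> R) (nu : B -> R) rel : (forall a, 0 <= mu a) ->
  (forall b, 0 <= nu b) -> \sum_a mu a = 1 -> \sum_b nu b = 1 -> coupled mu nu rel 1.
Proof.
move=> mu0 nu0 mu1 nu1.
have H := @coupled_complete A B mu nu rel (fun _ _ => 0) predT pred0.
apply: coupled_le (H _ _ _ _ _) => //; [|by rewrite mu1 nu1|by move=> a; rewrite big1|by move=> b; rewrite big1].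
rewrite [X in X + _]big1 => [|a _]; last exact: big1.
rewrite add0r [X in _ + X]big_pred0// addr0 -mu1.
by under eq_bigr do rewrite big1// subr0.
Qed.

Lemma coupled_map A B A2 B2 (mu : A -> R) (nu : B -> R) (rel : A -> B -> bool) (rel2 : A2 -> B2 -> bool) e
    (f : A -> A2) (h : B -> B2) : coupled mu nu rel e ->
  (forall a b, rel a b -> rel2 (f a) (h b)) -> coupled (push f mu) (push h nu) rel2 e.
Proof.
move=> [g [g0 gr gc ge]] fh.
exists (fun a2 b2 => \sum_(a | f a == a2) \sum_(b | h b == b2) g a b); split => [a2 b2|a2|b2|].
- by apply: sumr_ge0 => a _; exact: sumr_ge0.
- rewrite exchange_big; apply: eq_bigr => a _.
  by rewrite (sum_push h (g a) predT).
- rewrite (sum_push f (fun a => \sum_(b | h b == b2) g a b) predT).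
  by rewrite exchange_big; apply: eq_bigr => b _.
apply: le_trans ge.
rewrite (eq_bigr (fun a2 => push f (fun a => \sum_(b2 | ~~ rel2 (f a) b2) \sum_(b | h b == b2) g a b) a2)) => [|a2 _].
  rewrite (sum_push f _ predT); apply: ler_sum => a _.
  rewrite (sum_push h (g a) (fun b2 => ~~ rel2 (f a) b2)) big_mkcond [leRHS]big_mkcond.
  apply: ler_sum => b _; case: ifPn => [nr|_]; last by case: ifP.
  by case: ifPn => // /negPn /fh; rewrite (negbTE nr).
rewrite exchange_big; apply: eq_bigr => a /eqP <-.
by [].
Qed.

Lemma coupled_mix (I : finType) A B (c : I -> R) (mu : I -> A -> R) (nu : I -> B -> R) rel e :
  (forall i, 0 <= c i) -> (forall i, coupled (mu i) (nu i) rel (e i)) ->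
  coupled (fun a => \sum_i c i * mu i a) (fun b => \sum_i c i * nu i b) rel (\sum_i c i * e i).
Proof.
move=> c0 /choice[g gP]; exists (fun a b => \sum_i c i * g i a b); split => [a b|a|b|].
- by apply: sumr_ge0 => i _; have [g0 _ _ _] := gP i; rewrite mulr_ge0.
- by rewrite exchange_big; apply: eq_bigr => i _; have [_ <- _ _] := gP i; rewrite mulr_sumr.
- by rewrite exchange_big; apply: eq_bigr => i _; have [_ _ <- _] := gP i; rewrite mulr_sumr.
under eq_bigr do rewrite exchange_big; rewrite exchange_big; apply: ler_sum => i _ /=.
have [_ _ _ ge] := gP i; apply: le_trans (ler_wpM2l (c0 i) ge).
by rewrite mulr_sumr; apply: ler_sum => a _; rewrite mulr_sumr.
Qed.

Lemma coupled_trans A B C (mu : A -> R) (nu : B -> R) (la : C -> R) r1 r2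
    (r3 : A -> C -> bool) e1 e2 :
  coupled mu nu r1 e1 -> coupled nu la r2 e2 ->
  (forall a b c, r1 a b -> r2 b c -> r3 a c) -> coupled mu la r3 (e1 + e2).
Proof.
move=> [g [g0 gr gc ge]] [f [f0 fr fc fe]] r123.
have g_nu a b : g a b / nu b * nu b = g a b.
  have [nz|nz] := eqVneq (nu b) 0; last by rewrite divfK.
  rewrite nz mulr0; apply/esym; move: nz; rewrite -gc => nz.
  by apply: (psumr_eq0P (fun a _ => g0 a b) nz).
have f_nu b c : f b c / nu b * nu b = f b c.
  have [nz|nz] := eqVneq (nu b) 0; last by rewrite divfK.
  rewrite nz mulr0; apply/esym; move: nz; rewrite -fr => nz.
  by apply: (psumr_eq0P (fun c _ => f0 b c) nz).
have nu_f b c : nu b / nu b * f b c = f b c by rewrite -mulrA mulrC [_^-1 * _]mulrC f_nu.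
have nu0 b : 0 <= nu b by rewrite -gc sumr_ge0.
have t0 a b c : 0 <= g a b / nu b * f b c by rewrite mulr_ge0// divr_ge0.
exists (fun a c => \sum_b g a b / nu b * f b c); split => [a c|a|c|].
- exact: sumr_ge0.
- by rewrite exchange_big -gr; apply: eq_bigr => b _ /=; rewrite -mulr_sumr fr g_nu.
- rewrite exchange_big -fc; apply: eq_bigr => b _ /=.
  by rewrite -mulr_suml -mulr_suml gc nu_f.
apply: (@le_trans _ _ (\sum_a \sum_c \sum_b (g a b / nu b * f b c * ((~~ r1 a b)%:R + (~~ r2 b c)%:R)))).
  apply: ler_sum => a _; rewrite big_mkcond; apply: ler_sum => c _ /=; case: ifPn => [nr|_]; last first.
    by apply: sumr_ge0 => b _; rewrite mulr_ge0// addr_ge0.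
  apply: ler_sum => b _; case r1ab : (r1 a b); case r2bc : (r2 b c); rewrite /=.
  - by move: nr; rewrite (r123 _ _ _ r1ab r2bc).
  - by rewrite add0r mulr1.
  - by rewrite addr0 mulr1.
  - by rewrite ler_peMr//; lra.
under eq_bigr do under eq_bigr do under eq_bigr do rewrite mulrDr.
under eq_bigr do under eq_bigr do rewrite big_split; under eq_bigr do rewrite big_split.
rewrite big_split /=; apply: lerD.
  apply: le_trans ge; apply: ler_sum => a _; rewrite exchange_big [leRHS]big_mkcond.
  apply: ler_sum => b _ /=; rewrite -mulr_suml -mulr_sumr fr g_nu.
  by case: (r1 a b); rewrite /= ?mulr0 ?mulr1.
apply: le_trans fe; rewrite exchange_big /=; under eq_bigr do rewrite exchange_big.
rewrite exchange_big; apply: ler_sum => b _ /=; rewrite [leRHS]big_mkcond; apply: ler_sum => c _ /=.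
rewrite -mulr_suml -mulr_suml -mulr_suml gc nu_f.
by case: (r2 b c); rewrite /= ?mulr0 ?mulr1.
Qed.

End coupling.

Section slots.
Variables (R : realType) (PT : finType).
Local Notation V := {set PT}.
Local Notation Q := ({set PT} * {set PT})%type.
Implicit Types (q : Q) (v : V) (s z : Q -> R).

Definition union2 q q' : Q := (q.1 :|: q'.1, q.2 :|: q'.2).
Definition none : Q := (finset.set0, finset.set0).
Definition delta q0 q : R := (q == q0)%:R.
Definition conv s z q : R := \sum_q1 s q1 * push (union2 q1) z q.
Definition convs (l : seq (Q -> R)) : Q -> R := foldr conv (delta none) l.
Definition below q0 q := (q.1 \subset q0.1) && (q.2 \subset q0.2).
Definition down_sum z q0 : R := \sum_(q | below q0 q) z q.

Lemma sum_delta (P : pred Q) q0 : \sum_(q | P q) delta q0 q = (P q0)%:R.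
Proof.
rewrite big_mkcond (bigD1 q0)//= big1 ?addr0 => [|q /negbTE qq]; first by rewrite /delta eqxx; case: (P q0).
by rewrite /delta qq; case: ifP.
Qed.

Lemma down_sum_conv s z q0 : down_sum (conv s z) q0 = down_sum s q0 * down_sum z q0.
Proof.
rewrite /down_sum /conv exchange_big mulr_suml [RHS]big_mkcond; apply: eq_bigr => q1 _ /=.
rewrite -mulr_sumr (sum_push (union2 q1) z (below q0)).
case: ifPn => [b1|nb1].
  congr (_ * _); apply: eq_bigl => q2; rewrite /below /union2 /= !finset.subUset.
  by move: b1; rewrite /below => /andP[-> ->].
rewrite big_pred0 ?mulr0// => q2; apply/negbTE; apply: contra nb1.
by rewrite /below /union2 /= !finset.subUset => /andP[/andP[-> _] /andP[-> _]].
Qed.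

Lemma below_refl q : below q q. Proof. by rewrite /below !subxx. Qed.

Lemma below_lt q0 q : below q0 q -> q != q0 -> (#|q.1| + #|q.2| < #|q0.1| + #|q0.2|)%N.
Proof.
move=> /andP[b1 b2] qq; rewrite ltn_neqAle leq_add ?subset_leq_card// andbT.
apply: contra qq => /eqP e; have c1 := subset_leq_card b1; have c2 := subset_leq_card b2.
have e1 : #|q.1| = #|q0.1| by move: e c1 c2; clear; lia.
have e2 : #|q.2| = #|q0.2| by move: e c1 c2; clear; lia.
have /eqP f1 : q.1 == q0.1 by rewrite eqEcard b1 e1 leqnn.
have /eqP f2 : q.2 == q0.2 by rewrite eqEcard b2 e2 leqnn.
by rewrite [q]surjective_pairing f1 f2 -surjective_pairing.
Qed.

Lemma down_ind (P : Q -> Prop) : (forall q0, (forall q, below q0 q -> q != q0 -> P q) -> P q0) ->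
  forall q, P q.
Proof.
move=> H q; have [n] := ubnP (#|q.1| + #|q.2|); elim: n q => // n IH q qn.
apply: H => q' b qq; apply: IH; exact: leq_trans (below_lt b qq) qn.
Qed.

Lemma down_sumE z q0 : z q0 = down_sum z q0 - \sum_(q | below q0 q && (q != q0)) z q.
Proof. by rewrite /down_sum (bigD1 q0)/= ?below_refl// addrK. Qed.

Lemma down_sum_inj s z : down_sum s =1 down_sum z -> s =1 z.
Proof.
move=> sz; apply: down_ind => q0 IH; rewrite down_sumE [RHS]down_sumE sz; congr (_ - _).
by apply: eq_bigr => q /andP[b qq]; exact: IH.
Qed.

Lemma down_sum_none q0 : down_sum (delta none) q0 = 1.
Proof. by rewrite /down_sum sum_delta /below /= !finset.sub0set. Qed.

Lemma conv_ge0 s z : (forall q, 0 <= s q) -> (forall q, 0 <= z q) -> forall q, 0 <= conv s z q.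
Proof. by move=> s0 z0 q; apply: sumr_ge0 => q1 _; rewrite mulr_ge0// sumr_ge0. Qed.

Lemma sum_conv s z : \sum_q conv s z q = (\sum_q s q) * (\sum_q z q).
Proof.
rewrite /conv exchange_big mulr_suml; apply: eq_bigr => q1 _.
by rewrite -mulr_sumr (sum_push _ _ predT).
Qed.

Definition sandwich v q := (q.1 \subset v) && (v \subset q.2).

Lemma sandwichU v v' q q' : sandwich v q -> sandwich v' q' -> sandwich (v :|: v') (union2 q q').
Proof. by move=> /andP[a b] /andP[a' b']; rewrite /sandwich /= !finset.setUSS. Qed.

Definition is_law (A : finType) (mu : A -> R) := (forall a, 0 <= mu a) /\ \sum_a mu a = 1.

Lemma law_push (A B : finType) (f : A -> B) (mu : A -> R) : is_law mu -> is_law (push f mu).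
Proof. by move=> [m0 m1]; split=> [b|]; [exact: sumr_ge0|rewrite (sum_push f mu predT)]. Qed.

Lemma law_conv s z : is_law s -> is_law z -> is_law (conv s z).
Proof. by move=> [s0 s1] [z0 z1]; split; [exact: conv_ge0|rewrite sum_conv s1 z1 mulr1]. Qed.

Lemma law_none : is_law (delta none).
Proof. by split=> [q|]; [rewrite /delta|rewrite (sum_delta predT)]. Qed.

Lemma sum3 (A B C : finType) (G : A * (B * C) -> R) :
  \sum_i G i = \sum_a \sum_b \sum_c G (a, (b, c)).
Proof.
under [RHS]eq_bigr do rewrite pair_bigA; rewrite pair_bigA.
by apply: eq_bigr => -[a [b c]].
Qed.

(* A step of a chain with increment [v] and next state [y], coupled with an  *)
(* independent slot.                                                          *)
Lemma coupled_step (Y : finType) (kap : V -> Y -> R) (mu : Y -> V -> R) s z (e1 e2 : R) :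
  (forall v y, 0 <= kap v y) -> \sum_v \sum_y kap v y = 1 -> 0 <= e2 ->
  is_law z -> (forall y, is_law (mu y)) ->
  coupled (fun v => \sum_y kap v y) s sandwich e1 ->
  (forall y, coupled (mu y) z sandwich e2) ->
  coupled (fun B => \sum_v \sum_y kap v y * push (finset.setU v) (mu y) B) (conv s z) sandwich (e1 + e2).
Proof.
move=> k0 k1 e20 lz lmu [g [g0 gr gc ge]] H.
pose nu v := \sum_y kap v y.
have nu0 v : 0 <= nu v by exact: sumr_ge0.
pose c (i : V * (Q * Y)) := g i.1 i.2.1 * (kap i.1 i.2.2 / nu i.1).
have c0 i : 0 <= c i by rewrite mulr_ge0// divr_ge0.
have gn v q : g v q * (nu v / nu v) = g v q.
  have [nz|nz] := eqVneq (nu v) 0; last by rewrite mulfV ?mulr1.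
  suff -> : g v q = 0 by rewrite mul0r.
  by move: nz; rewrite /nu -gr => nz; apply: (psumr_eq0P (fun q _ => g0 v q) nz).
have kn v y : nu v * (kap v y / nu v) = kap v y.
  have [nz|nz] := eqVneq (nu v) 0; last by rewrite mulrCA mulfV ?mulr1.
  rewrite nz mul0r; apply/esym.
  by apply: (psumr_eq0P (fun y _ => k0 v y) nz).
pose e (i : V * (Q * Y)) := e2 + (~~ sandwich i.1 i.2.1)%:R.
have cpl i : coupled (push (finset.setU i.1) (mu i.2.2)) (push (union2 i.2.1) z) sandwich (e i).
  case: i => v [q y]; rewrite /e /=; have [vq|nvq] := boolP (sandwich v q).
    rewrite addr0; apply: coupled_map (H y) _ => B q2; exact: sandwichU.
  have [p0 p1] := law_push (finset.setU v) (lmu y); have [q0 q1] := law_push (union2 q) lz.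
  by apply: coupled_le (coupled_trivial sandwich p0 q0 p1 q1); rewrite lerDr.
have := coupled_mix c0 cpl.
have -> : (fun a => \sum_i c i * push (finset.setU i.1) (mu i.2.2) a) =
    (fun B => \sum_v \sum_y kap v y * push (finset.setU v) (mu y) B).
  apply/funext => B; rewrite sum3; apply: eq_bigr => v _; rewrite exchange_big; apply: eq_bigr => y _ /=.
  by rewrite -mulr_suml; congr (_ * _); rewrite /c /= -mulr_suml gr kn.
have -> : (fun b => \sum_i c i * push (union2 i.2.1) z b) = conv s z.
  apply/funext => q; rewrite sum3 exchange_big; apply: eq_bigr => q1 _ /=.
  under eq_bigr do rewrite -mulr_suml; rewrite -mulr_suml; congr (_ * _).
  by rewrite -gc; apply: eq_bigr => v _; rewrite /c /= -mulr_sumr -mulr_suml gn.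
apply: coupled_le; rewrite /e; under eq_bigr do rewrite mulrDr; rewrite big_split/= addrC; apply: lerD.
  rewrite sum3; apply: le_trans ge; apply: ler_sum => v _; rewrite [leRHS]big_mkcond; apply: ler_sum => q _.
  by rewrite /c /= -mulr_suml -mulr_sumr -mulr_suml gn; case: sandwich; rewrite /= ?mulr0 ?mulr1.
rewrite -mulr_suml ler_piMl// sum3 -k1; apply: ler_sum => v _.
by under eq_bigr do rewrite /c /= -mulr_sumr -mulr_suml gn; rewrite gr.
Qed.

Lemma coupled_extra (mu : V -> R) s z e : (forall q, 0 <= s q) -> \sum_q s q = 1 ->
  (forall q, q.1 != finset.set0 -> s q = 0) -> 0 <= e ->
  is_law mu -> is_law z -> coupled mu z sandwich e -> coupled mu (conv s z) sandwich e.
Proof.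
move=> s0 s1 sE e0 [m0 m1] lz H.
pose ee q := e + (q.1 != finset.set0)%:R.
have cpl q : coupled mu (push (union2 q) z) sandwich (ee q).
  rewrite /ee; have [q10|q10] := eqVneq q.1 finset.set0.
    have -> : mu = push id mu by apply/funext => v; rewrite /push big_pred1_eq.
    rewrite addr0; apply: coupled_map H _ => v q2 /andP[a b]; rewrite /sandwich /= q10 finset.set0U a.
    exact: fintype.subset_trans b (finset.subsetUr _ _).
  have [p0 p1] := law_push (union2 q) lz.
  by apply: coupled_le (coupled_trivial sandwich m0 p0 m1 p1); rewrite lerDr.
have := coupled_mix s0 cpl.
have -> : (fun a => \sum_i s i * mu a) = mu by apply/funext => a; rewrite -mulr_suml s1 mul1r.
apply: coupled_le; rewrite /ee; under eq_bigr do rewrite mulrDr; rewrite big_split /= -mulr_suml s1 mul1r.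
rewrite -[leRHS]addr0 lerD// big1// => q _; have [|q1] := eqVneq q.1 finset.set0; first by rewrite mulr0.
by rewrite sE ?mul0r.
Qed.

Variable sg : V -> R.
Hypothesis sg_ge0 : forall v, 0 <= sg v.

Definition slot (am ap : R) q : R :=
  (1 - ap * \sum_(v | v != finset.set0) sg v) * delta none q +
  \sum_(v | v != finset.set0) (am * sg v * delta (v, v) q + (ap - am) * sg v * delta (finset.set0, v) q).

Lemma sum_slot (P : pred Q) am ap : \sum_(q | P q) slot am ap q =
  (1 - ap * \sum_(v | v != finset.set0) sg v) * (P none)%:R +
  \sum_(v | v != finset.set0) (am * sg v * (P (v, v))%:R + (ap - am) * sg v * (P (finset.set0, v))%:R).
Proof.
rewrite /slot big_split /= -mulr_sumr sum_delta; congr (_ + _).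
rewrite exchange_big; apply: eq_bigr => v _ /=.
by rewrite big_split /= -!mulr_sumr !sum_delta.
Qed.

Section slot_law.
Variables (am ap : R).
Hypotheses (am0 : 0 <= am) (amp : am <= ap) (ap1 : ap * \sum_(v | v != finset.set0) sg v <= 1).

Lemma slot_law : is_law (slot am ap).
Proof.
split=> [q|]; last first.
  rewrite (sum_slot predT) /= mulr1; set P := \sum_(v | _) sg v.
  rewrite (_ : \sum_(v | _) _ = ap * P) ?subrK// mulr_sumr; apply: eq_bigr => v _.
  by rewrite !mulr1 -mulrDl addrC subrK.
rewrite addr_ge0//; first by rewrite mulr_ge0 ?subr_ge0.
by apply: sumr_ge0 => v _; rewrite addr_ge0// mulr_ge0// mulr_ge0// subr_ge0.
Qed.

Lemma down_sum_slot q0 : down_sum (slot am ap) q0 =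
  1 - am * (\sum_(v : V | ~~ (v \subset q0.1 :&: q0.2)) sg v)
    - (ap - am) * (\sum_(v : V | ~~ (v \subset q0.2)) sg v).
Proof.
rewrite /down_sum sum_slot /below /= !finset.sub0set /= mulr1.
have nb (A : V) : \sum_(v : V | ~~ (v \subset A)) sg v =
    \sum_(v | v != finset.set0) sg v - \sum_(v | v != finset.set0) sg v * (v \subset A)%:R.
  rewrite -sumrB big_mkcond [RHS]big_mkcond; apply: eq_bigr => v _.
  have [->|v0] := eqVneq v finset.set0; first by rewrite finset.sub0set.
  by case: (v \subset A); rewrite /= ?mulr1 ?mulr0 ?subrr ?subr0.
rewrite !nb big_split /=.
have -> : \sum_(v | v != finset.set0) am * sg v * ((v \subset q0.1) && (v \subset q0.2))%:R =
    am * \sum_(v | v != finset.set0) sg v * (v \subset q0.1 :&: q0.2)%:R.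
  by rewrite mulr_sumr; apply: eq_bigr => v _; rewrite finset.subsetI mulrA.
have -> : \sum_(v | v != finset.set0) (ap - am) * sg v * (v \subset q0.2)%:R =
    (ap - am) * \sum_(v | v != finset.set0) sg v * (v \subset q0.2)%:R.
  by rewrite mulr_sumr; apply: eq_bigr => v _; rewrite mulrA.
by ring.
Qed.

(* [V] takes the value [v] of the slot with the largest possible probability.*)
Lemma slot_coupled (nu b : V -> R) : is_law nu -> (forall v, 0 <= b v) ->
  (forall v, v != finset.set0 -> am * sg v - b v <= nu v <= ap * sg v + b v) ->
  coupled nu (slot am ap) sandwich (2 * \sum_v b v).
Proof.
move=> [nu0 nu1] b0 nub; have [sl0 sl1] := slot_law.
pose p1 v := Num.min (nu v) (am * sg v).
pose p2 v := Num.min (nu v - p1 v) ((ap - am) * sg v).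
have p10 v : 0 <= p1 v by rewrite le_min nu0 mulr_ge0.
have p1n v : p1 v <= nu v by rewrite ge_min lexx.
have p20 v : 0 <= p2 v by rewrite le_min subr_ge0 p1n mulr_ge0 ?subr_ge0.
pose g v q := (v != finset.set0)%:R * (p1 v * delta (v, v) q + p2 v * delta (finset.set0, v) q).
have d0 q1 q : 0 <= delta q1 q by [].
have g0 v q : 0 <= g v q by rewrite mulr_ge0// addr_ge0// mulr_ge0.
have row v : \sum_q g v q = (v != finset.set0)%:R * (p1 v + p2 v).
  by rewrite -mulr_sumr big_split/= -!mulr_sumr !(sum_delta predT) !mulr1.
have col q : \sum_v g v q = \sum_(v | v != finset.set0) (p1 v * delta (v, v) q + p2 v * delta (finset.set0, v) q).
  by rewrite [RHS]big_mkcond; apply: eq_bigr => v _; rewrite /g; case: eqP; rewrite ?mul1r ?mul0r.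
have p2n v : p1 v + p2 v <= nu v by rewrite -lerBrDl ge_min lexx.
have g_row v : \sum_q g v q <= nu v.
  by rewrite row; case: eqP => _; rewrite ?mul1r ?mul0r.
have g_col q : \sum_v g v q <= slot am ap q.
  rewrite col /slot -[leLHS]add0r lerD//; first by rewrite mulr_ge0 ?subr_ge0.
  by apply: ler_sum => v _; rewrite lerD// ler_wpM2r// ge_min lexx orbT.
have := @coupled_complete R _ _ nu (slot am ap) sandwich g (fun v => v != finset.set0)
  (fun q => q.1 != finset.set0) (etrans nu1 (esym sl1)) g0 g_row g_col.
case=> [v q /negPn/eqP -> /negPn/eqP q1|f H].
  by rewrite /sandwich q1 subxx finset.sub0set.
apply: coupled_le (ex_intro _ f H).
rewrite [X in X + _]big1 ?add0r; last first.
  move=> v _; apply: big1 => q; rewrite /g /delta /sandwich => nr.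
  have [e|_] := eqVneq q (v, v); first by move: nr; rewrite e /= !subxx.
  have [e|_] := eqVneq q (finset.set0, v); first by move: nr; rewrite e /= finset.sub0set subxx.
  by rewrite !mulr0 addr0 mulr0.
rewrite mulr2n mulrDl mul1r; apply: lerD.
  rewrite big_mkcond; apply: ler_sum => v _; case: ifPn => // v0; rewrite row v0 mul1r.
  have /andP[nl nuu] := nub v v0; rewrite lerBlDr -lerBlDl /p2.
  case: (leP (nu v - p1 v) _) => _; first by rewrite [leRHS]addrC subrK lerBlDr lerDl.
  rewrite /p1; case: (leP (nu v) _) => h; last by move: nuu; lra.
  have : 0 <= (ap - am) * sg v by rewrite mulr_ge0 ?subr_ge0.
  by move: (b0 v); lra.
under eq_bigr do rewrite col /slot.
rewrite sumrB big_split /= -mulr_sumr sum_delta eqxx mulr0 add0r.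
rewrite exchange_big /= [X in _ - X]exchange_big /= -sumrB big_mkcond; apply: ler_sum => v _.
case: ifPn => // v0; rewrite !big_split /= -!mulr_sumr !sum_delta /= v0 eqxx !mulr0 !mulr1 !addr0.
have /andP[nl _] := nub v v0; rewrite /p1; case: (leP (nu v) _) => h; last by rewrite subrr.
by rewrite lerBlDr -lerBlDl.
Qed.

End slot_law.

End slots.

Section poisson.
Variable R : realType.

Definition pois (a : R) (j : nat) : R := expR (- a) * (a ^+ j / j`!%:R).

Lemma pois_ge0 a j : 0 <= a -> 0 <= pois a j.
Proof. by move=> a0; rewrite mulr_ge0 ?expR_ge0// divr_ge0// exprn_ge0. Qed.

Lemma pois_cvg a x : (fun M : nat => \sum_(j < M) pois a j * x ^+ j) @ \oo --> expR (a * (x - 1)).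
Proof.
have -> : (fun M : nat => \sum_(j < M) pois a j * x ^+ j) =
    (fun M : nat => expR (- a) * series (exp_coeff (a * x)) M).
  apply/funext => M; rewrite /series /= big_mkord mulr_sumr; apply: eq_bigr => j _.
  by rewrite /pois /exp_coeff /= exprMn; ring.
have -> : expR (a * (x - 1)) = expR (- a) * expR (a * x) by rewrite -expRD; congr expR; ring.
by apply: cvgM; [exact: cvg_cst|exact: is_cvg_series_exp_coeff].
Qed.

Lemma pois_sum_le a x M : 0 <= a -> 0 <= x -> \sum_(j < M) pois a j * x ^+ j <= expR (a * (x - 1)).
Proof.
move=> a0 x0; have H := @pois_cvg a x; rewrite -(cvg_lim _ H)//.
apply: (nondecreasing_cvgn_le (u_ := fun M : nat => \sum_(j < M) pois a j * x ^+ j)).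
  apply/nondecreasing_seqP => n; rewrite big_ord_recr /= lerDl mulr_ge0 ?pois_ge0//.
  exact: exprn_ge0.
by apply/cvg_ex; exists (expR (a * (x - 1))).
Qed.

Lemma pois_mass_le a M : 0 <= a -> \sum_(j < M) pois a j <= 1.
Proof.
move=> a0; have := pois_sum_le M a0 ler01; rewrite subrr mulr0 expR0.
by under eq_bigr do rewrite expr1n mulr1.
Qed.

End poisson.

Section mixture.
Variables (R : realType) (PT : finType).
Local Notation V := {set PT}.
Local Notation Q := ({set PT} * {set PT})%type.
Local Notation none := (none PT).
Variables (s t : Q -> R).
Hypotheses (s_law : is_law s) (t_law : is_law t).

Lemma convs_law (l : seq bool) : is_law (convs [seq if b then s else t | b <- l]).
Proof.
elim: l => [|b l IH] /=; first exact: law_none.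
by apply: law_conv => //; case: b.
Qed.

Lemma down_sum_convs (l : seq bool) q0 : down_sum (convs [seq if b then s else t | b <- l]) q0 =
  down_sum s q0 ^+ count id l * down_sum t q0 ^+ count negb l.
Proof.
elim: l => [|b l IH] /=; first by rewrite down_sum_none !expr0 mulr1.
by rewrite down_sum_conv IH; case: b; rewrite /= add0n add1n exprS ?mulrA//; ring.
Qed.

Definition slots_law (j j' : nat) : Q -> R := convs [seq if b then s else t | b <- nseq j true ++ nseq j' false].

Lemma slots_lawE (l : seq bool) : convs [seq if b then s else t | b <- l] = slots_law (count id l) (count negb l).
Proof.
apply/funext/down_sum_inj => q0; rewrite !down_sum_convs; congr (_ ^+ _ * _ ^+ _);
  by rewrite count_cat !count_nseq /= ?mul0n ?mul1n ?addn0 ?add0n.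
Qed.

Lemma down_sum_slots j j' q0 : down_sum (slots_law j j') q0 = down_sum s q0 ^+ j * down_sum t q0 ^+ j'.
Proof.
by rewrite down_sum_convs !count_cat !count_nseq /= !mul0n !mul1n addn0 add0n.
Qed.

Variables (a a' : R).
Hypotheses (a0 : 0 <= a) (a'0 : 0 <= a').

Definition mixture (M : nat) q : R := \sum_(j < M) \sum_(j' < M) pois a j * pois a' j' * slots_law j j' q.

Let slots_ge0 j j' q : 0 <= slots_law j j' q.
Proof. by have [H _] := convs_law (nseq j true ++ nseq j' false); exact: H. Qed.

Let c0 (j j' : nat) : 0 <= pois a j * pois a' j'.
Proof. by rewrite mulr_ge0 ?pois_ge0. Qed.

Lemma mixture_nondecreasing q : nondecreasing_seq (mixture ^~ q).
Proof.
apply/nondecreasing_seqP => M; rewrite /mixture [leRHS]big_ord_recr /=.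
rewrite -[leLHS]addr0 lerD//; last by apply: sumr_ge0 => j _; rewrite mulr_ge0.
by apply: ler_sum => j _; rewrite big_ord_recr /= lerDl mulr_ge0.
Qed.

Lemma down_sum_mixture M q0 : down_sum (mixture M) q0 =
  (\sum_(j < M) pois a j * down_sum s q0 ^+ j) * (\sum_(j' < M) pois a' j' * down_sum t q0 ^+ j').
Proof.
rewrite /down_sum exchange_big mulr_suml; apply: eq_bigr => j _ /=.
rewrite exchange_big mulr_sumr; apply: eq_bigr => j' _ /=.
by rewrite -mulr_sumr -/(down_sum _ _) down_sum_slots; ring.
Qed.

Variable z : Q -> R.
Hypothesis z_law : is_law z.
Hypothesis z_down : forall q0, down_sum z q0 =
  expR (a * (down_sum s q0 - 1)) * expR (a' * (down_sum t q0 - 1)).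

Lemma mixture_cvg q : mixture ^~ q @ \oo --> z q.
Proof.
elim/(@down_ind PT) : q => q0 IH.
have -> : mixture ^~ q0 = (fun M => down_sum (mixture M) q0 - \sum_(q | below q0 q && (q != q0)) mixture M q).
  by apply/funext => M; exact: down_sumE.
rewrite down_sumE z_down; apply: cvgB.
  under eq_fun do rewrite down_sum_mixture.
  by apply: cvgM; exact: pois_cvg.
by apply: cvg_big => [|q /andP[b qq]]; [exact: add_continuous|exact: IH].
Qed.

Lemma mixture_le M q : mixture M q <= z q.
Proof.
have H := @mixture_cvg q; rewrite -(cvg_lim _ H)//.
apply: (nondecreasing_cvgn_le (u_ := mixture ^~ q)); first exact: mixture_nondecreasing.
by apply/cvg_ex; exists (z q).
Qed.

Lemma coupled_mixture (mu : V -> R) (m : nat) (e x y e' : R) : is_law mu -> 0 <= e -> 1 <= x ->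
  0 < y -> y <= 1 -> 0 < e' ->
  (forall j j', (j < m)%N -> (m <= j + j')%N -> coupled mu (slots_law j j') (@sandwich PT) e) ->
  coupled mu z (@sandwich PT)
    (e + (expR (a * (x - 1)) / x ^+ m + expR ((a + a') * (y - 1)) / y ^+ m + e')).
Proof.
move=> lmu e0 x1 y0 y1 e'0 cpl; have [mu0 mu1] := lmu; have [z0 z1] := z_law.
have x0 : 0 < x by exact: lt_le_trans x1.
have [M Me] : exists M : nat, 1 - e' <= (\sum_(j < M) pois a j) * (\sum_(j' < M) pois a' j').
  have one b : (fun M : nat => \sum_(j < M) pois b j) @ \oo --> (1 : R).
    have := @pois_cvg R b 1; rewrite subrr mulr0 expR0; apply: cvg_trans; apply: near_eq_cvg.
    by apply: nearW => M; apply: eq_bigr => j _; rewrite expr1n mulr1.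
  have H := cvgM (one a) (one a') _; rewrite mulr1 in H.
  have lt1 : 1 - e' < 1 by rewrite ltrBlDr ltrDl.
  by have [M _ HM] := cvgr_ge 1 (H _) _ lt1; exists M; apply: HM => /=.
pose good (i : 'I_M * 'I_M) := (i.1 < m)%N && (m <= i.1 + i.2)%N.
pose w (i : 'I_M * 'I_M) := pois a i.1 * pois a' i.2.
pose c i := if good i then w i else 0.
have w0 i : 0 <= w i by exact: c0.
have cc0 i : 0 <= c i by rewrite /c; case: ifP.
have cpl' (i : 'I_M * 'I_M) : coupled mu (slots_law i.1 i.2) (@sandwich PT) (if good i then e else 1).
  case: ifP => [/andP[? ?]|_]; first exact: cpl.
  have [? ?] := convs_law (nseq i.1 true ++ nseq i.2 false).
  exact: coupled_trivial.
have [g [g0 gr gc ge]] := coupled_mix cc0 cpl'.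
have C1 : \sum_i c i <= 1.
  apply: (@le_trans _ _ (\sum_i w i)); first by apply: ler_sum => i _; rewrite /c; case: ifP.
  have -> : \sum_i w i = (\sum_(j < M) pois a j) * (\sum_(j < M) pois a' j).
    rewrite mulr_suml; under [RHS]eq_bigr do rewrite mulr_sumr.
    by rewrite pair_bigA.
  rewrite -[leRHS]mulr1; apply: ler_pM; rewrite ?pois_mass_le//; apply: sumr_ge0 => j _; exact: pois_ge0.
have row v : \sum_q g v q <= mu v by rewrite gr -mulr_suml ler_piMl.
have col q : \sum_v g v q <= z q.
  rewrite gc; apply: le_trans (mixture_le M q); rewrite /mixture pair_bigA /=.
  by apply: ler_sum => i _; rewrite /c; case: ifP => _; rewrite ?mul0r// mulr_ge0.
apply: coupled_le (coupled_complete (A' := predT) (B' := pred0) (etrans mu1 (esym z1)) g0 row col _) => //.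
rewrite [X in _ + (_ + X)]big_pred0// addr0; apply: lerD.
  apply: le_trans ge _; apply: (@le_trans _ _ (\sum_i c i * e)).
    by apply: ler_sum => i _; rewrite /c; case: ifP => _; rewrite ?mul0r.
  by rewrite -mulr_suml ler_piMl.
rewrite sumrB mu1; under eq_bigr do rewrite gr -mulr_suml; rewrite -mulr_sumr mu1 mulr1.
rewrite lerBlDl; apply: (@le_trans _ _ (e' + \sum_i w i)).
  rewrite -lerBlDl; apply: le_trans Me _; rewrite mulr_suml; under eq_bigr do rewrite mulr_sumr.
  by rewrite pair_bigA.
rewrite addrC -addrA [X in _ <= _ + X]addrA addrA lerD2r.
have wx : \sum_i w i * (x ^+ i.1 / x ^+ m) <= expR (a * (x - 1)) / x ^+ m.
  have -> : \sum_i w i * (x ^+ i.1 / x ^+ m) = (\sum_(j < M) pois a j * x ^+ j) * (\sum_(j < M) pois a' j) / x ^+ m.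
    rewrite !mulr_suml; under [RHS]eq_bigr do rewrite mulr_sumr mulr_suml.
    by rewrite pair_bigA; apply: eq_bigr => i _; rewrite /w /=; ring.
  rewrite ler_pM2r ?invr_gt0 ?exprn_gt0// -[leRHS]mulr1 ler_pM ?pois_mass_le ?pois_sum_le ?(ltW x0)//.
    by apply: sumr_ge0 => j _; rewrite mulr_ge0 ?pois_ge0// exprn_ge0// ltW.
  by apply: sumr_ge0 => j _; rewrite pois_ge0.
have wy : \sum_i w i * (y ^+ (i.1 + i.2) / y ^+ m) <= expR ((a + a') * (y - 1)) / y ^+ m.
  have -> : \sum_i w i * (y ^+ (i.1 + i.2) / y ^+ m) =
      (\sum_(j < M) pois a j * y ^+ j) * (\sum_(j < M) pois a' j * y ^+ j) / y ^+ m.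
    rewrite !mulr_suml; under [RHS]eq_bigr do rewrite mulr_sumr mulr_suml.
    by rewrite pair_bigA; apply: eq_bigr => i _; rewrite /w /= exprD; ring.
  rewrite ler_pM2r ?invr_gt0 ?exprn_gt0// mulrDl expRD ler_pM ?pois_sum_le ?(ltW y0)//;
    by apply: sumr_ge0 => j _; rewrite mulr_ge0 ?pois_ge0// exprn_ge0// ltW.
apply: le_trans (lerD (lexx _) (lerD wx wy)).
rewrite -!big_split /=; apply: ler_sum => i _; rewrite /c.
case: ifPn => [_|]; first by rewrite lerDl addr_ge0// mulr_ge0// divr_ge0// exprn_ge0// ltW.
rewrite add0r negb_and -leqNgt -ltnNge -mulrDr => mi; rewrite ler_peMr//.
have xx n : 0 <= x ^+ n by rewrite exprn_ge0// ltW.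
have yy n : 0 <= y ^+ n by rewrite exprn_ge0// ltW.
case/orP : mi => H.
  rewrite -[leLHS]addr0 lerD ?divr_ge0// ler_pdivlMr ?exprn_gt0// mul1r.
  exact: ler_weXn2l.
rewrite -[leLHS]add0r lerD ?divr_ge0// ler_pdivlMr ?exprn_gt0// mul1r.
by apply: ler_wiXn2l; [exact: ltW|exact: y1|exact: ltnW].
Qed.

End mixture.

(** * Coupling the chain of excursions *)

Lemma coupled_support (R : realType) (A B : finType) (mu : A -> R) (nu : B -> R) rel (P : pred B) e :
  coupled mu nu rel e -> (forall b, ~~ P b -> nu b = 0) ->
  coupled mu nu (fun a b => rel a b && P b) e.
Proof.
move=> [g [g0 gr gc ge]] nP; exists g; split => //; apply: le_trans ge; apply: ler_sum => a _.
rewrite big_mkcond [leRHS]big_mkcond; apply: ler_sum => b _; rewrite negb_and.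
case: (rel a b) => //=; case: ifPn => // /nP; rewrite -gc => n0.
by rewrite (psumr_eq0P (fun a _ => g0 a b) n0).
Qed.

Section chain.
Variables (R : realType) (PT Y : finType).
Local Notation V := {set PT}.
Local Notation Q := ({set PT} * {set PT})%type.
Local Notation sandwich := (@sandwich PT).
Variables (kap : Y -> V -> Y -> R) (law : nat -> Y -> V -> R) (s t : Q -> R) (e : R).
Hypotheses (kap_ge0 : forall y v y', 0 <= kap y v y') (kap_sum1 : forall y, \sum_v \sum_y' kap y v y' = 1).
Hypothesis law0 : forall y v, law 0 y v = (v == finset.set0)%:R.
Hypothesis lawS : forall m y B, law m.+1 y B = \sum_v \sum_y' kap y v y' * push (finset.setU v) (law m y') B.
Hypotheses (s_law : is_law s) (t_law : is_law t) (e_ge0 : 0 <= e).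
Hypotheses (cs : forall y, coupled (fun v => \sum_y' kap y v y') s sandwich e)
  (ct : forall y, coupled (fun v => \sum_y' kap y v y') t sandwich e).

Lemma chain_law (kp : V -> Y -> R) (mu : Y -> V -> R) : (forall v y, 0 <= kp v y) ->
  \sum_v \sum_y kp v y = 1 -> (forall y, is_law (mu y)) ->
  is_law (fun B => \sum_v \sum_y kp v y * push (finset.setU v) (mu y) B).
Proof.
move=> k0 k1 lm; split=> [B|].
  apply: sumr_ge0 => v _; apply: sumr_ge0 => y _; rewrite mulr_ge0// sumr_ge0// => B' _.
  by have [] := lm y.
rewrite exchange_big -k1; apply: eq_bigr => v _ /=; rewrite exchange_big; apply: eq_bigr => y _ /=.
by rewrite -mulr_sumr; have [_ ->] := law_push (finset.setU v) (lm y); rewrite mulr1.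
Qed.

Lemma law_law m y : is_law (law m y).
Proof.
elim: m y => [|m IH] y.
  split=> [v|]; first by rewrite law0.
  rewrite (bigD1 finset.set0)//= big1 => [|v /negbTE v0]; first by rewrite law0 eqxx addr0.
  by rewrite law0 v0.
have [H1 H2] := chain_law (kap_ge0 y) (kap_sum1 y) IH.
by split=> [v|]; [rewrite lawS; exact: H1|rewrite -H2; apply: eq_bigr => v _; rewrite lawS].
Qed.

Lemma coupled_chain (l : seq bool) y :
  coupled (law (size l) y) (convs [seq if b then s else t | b <- l]) sandwich ((size l)%:R * e).
Proof.
elim: l y => [|b l IH] y /=.
  rewrite mul0r; apply: coupled_le (coupled_complete (g := fun v q => (v == finset.set0)%:R * delta R (none PT) q)
    (A' := fun v => v != finset.set0) (B' := fun q => q != none PT) _ _ _ _ _).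
  - rewrite [X in _ + (X + _)]big1 ?[X in _ + (_ + X)]big1 ?addr0 ?big1//.
    + move=> v _; apply: big1 => q nr; rewrite /delta; have [v0|] := eqVneq v finset.set0; last by rewrite mul0r.
      have [q0|] := eqVneq q (none PT); last by rewrite mulr0.
      by move: nr; rewrite v0 q0 /Submission.sandwich /= subxx.
    + by move=> q /negbTE qn; rewrite /delta qn big1 ?subrr// => v _; rewrite mulr0.
    + by move=> v /negbTE v0; rewrite law0 v0 big1 ?subrr// => q _; rewrite mul0r.
  - by have [_ ->] := law_law 0 y; have [_ ->] := law_none R PT.
  - by move=> v q; rewrite mulr_ge0.
  - by move=> v; rewrite -mulr_sumr (sum_delta R predT) mulr1 law0.
  - move=> q; rewrite -mulr_suml (bigD1 finset.set0)//= big1 ?eqxx ?addr0 ?mul1r// => v /negbTE ->.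
    by [].
  - by move=> v q /negPn/eqP -> /negPn/eqP ->; rewrite /Submission.sandwich /= subxx.
have cb : coupled (fun v => \sum_y' kap y v y') (if b then s else t) sandwich e by case: b.
have -> : law (size l).+1 y = (fun B => \sum_v \sum_y' kap y v y' * push (finset.setU v) (law (size l) y') B).
  by apply/funext => B; exact: lawS.
have H0 : 0 <= (size l)%:R * e by rewrite mulr_ge0.
rewrite -[X in X * e]natr1 mulrDl mul1r addrC.
by apply: (coupled_step (kap_ge0 y) (kap_sum1 y) H0 (convs_law s_law t_law l) (law_law _) cb IH).
Qed.

Variables (kap0 : V -> Y -> R) (start : nat -> V -> R).
Hypotheses (kap0_ge0 : forall v y, 0 <= kap0 v y) (kap0_sum1 : \sum_v \sum_y kap0 v y = 1).
Hypothesis startS : forall m B, start m.+1 B = \sum_v \sum_y kap0 v y * push (finset.setU v) (law m y) B.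
Hypothesis c0 : coupled (fun v => \sum_y kap0 v y) t sandwich e.
Hypothesis t_lower : forall q, q.1 != finset.set0 -> t q = 0.

Lemma start_law m : is_law (start m.+1).
Proof.
have [H1 H2] := chain_law kap0_ge0 kap0_sum1 (law_law m).
by split=> [v|]; [rewrite startS; exact: H1|rewrite -H2; apply: eq_bigr => v _; rewrite startS].
Qed.

Lemma coupled_start m j j' : (j < m.+1)%N -> (m.+1 <= j + j')%N ->
  coupled (start m.+1) (slots_law s t j j') sandwich (m.+1%:R * e).
Proof.
move=> jm mj; pose l := nseq j true ++ nseq (m - j) false.
have sl : size l = m by rewrite size_cat !size_nseq subnKC.
pose n := (j + j' - m.+1)%N.
have -> : slots_law s t j j' = convs [seq if b then s else t | b <- nseq n false ++ false :: l].
  rewrite (slots_lawE s t); congr slots_law; rewrite !(count_cat, count_nseq) /= !(count_cat, count_nseq) /= ?mul0n ?mul1n ?addn0 ?add0n//.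
  by rewrite /n; move: jm mj; clear; lia.
elim: n => [|n IH] /=.
  have -> : start m.+1 = (fun B => \sum_v \sum_y kap0 v y * push (finset.setU v) (law (size l) y) B).
    by apply/funext => B; rewrite startS sl.
  have H0 : 0 <= (size l)%:R * e by rewrite mulr_ge0.
  have -> : m.+1%:R * e = e + (size l)%:R * e by rewrite sl -natr1 mulrDl mul1r addrC.
  exact: (coupled_step kap0_ge0 kap0_sum1 H0 (convs_law s_law t_law l) (law_law _) c0 (coupled_chain l)).
have [t0 t1] := t_law.
by apply: (coupled_extra t0 t1 t_lower _ (start_law m) (convs_law s_law t_law _) IH); rewrite mulr_ge0.
Qed.

End chain.

Section walk_coupling.
Variables (R : realType) (d N h : nat).
Hypotheses (N_gt1 : (1 < N)%N) (d_gt0 : (0 < d)%N) (Nh : (N < h)%N).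
Local Notation T := 'rV['Z_N]_d.
Local Notation E := (lattice 'Z_N d).
Local Notation st := (@step 'Z_N d).
Local Notation s0 := ((None, false) : direction d).
Local Notation pr := (@pr R _ _ s0 st).
Local Notation smean := (@slice_mean R d N).
Local Notation NT := (N%:R ^+ d : R).
Local Notation rho := (N%:R / h%:R : R).
Variables (PT : finType) (f : PT -> E).
Hypothesis f_in : forall p, (`|(f p).2| < N)%N.
Local Notation V := {set PT}.
Local Notation Q := ({set PT} * {set PT})%type.
Local Notation sandwich := (@sandwich PT).
Variables (sg : V -> R) (b : bool -> V -> R) (am ap beta : R).
Hypotheses (sg_ge0 : forall v, 0 <= sg v) (b_ge0 : forall s v, 0 <= b s v).
Hypothesis b_sum : forall s, \sum_v b s v <= beta.
Hypotheses (am0 : 0 <= am) (amp : am <= ap) (ap1 : ap * \sum_(v | v != finset.set0) sg v <= 1).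
Hypothesis edge_ok : forall s t v, v != finset.set0 ->
  am * sg v - b s v <= nu R h f (edge h (s, t)) v <= ap * sg v + b s v.
Hypothesis first_ok : forall v, v != finset.set0 ->
  (1 + 4 * rho) * rim_law R h f true v <= ap * sg v + b true v.
Variable z : int.
Hypotheses (zN : (`|z| <= N)%N) (hN2 : (2 * N <= h)%N).

Let reach_edge (y : bool * T) : (`|(edge h y).2| <= N)%N \/ `|(edge h y).2|%N = h.
Proof. by right; rewrite /edge /sgn /=; case: y.1; clear; lia. Qed.

Let ap0 : 0 <= ap. Proof. exact: le_trans am0 amp. Qed.

Definition start_trace m (B : V) : R := smean (fun x => pr x [set w | Wtr h f m w = B]) z.

Let NT0 : 0 < NT. Proof. exact: NT_gt0. Qed.

Let pr_WtrU m x (v B : V) : pr x [set w | v :|: Wtr h f m w = B] =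
  push (finset.setU v) (fun B' => pr x [set w | Wtr h f m w = B']) B.
Proof.
have mW (P : {set PT} -> Prop) : measurable ([set w | P (Wtr h f m w)] : set (trajectory E)) by exact: measurable_Wtr.
rewrite {1}/Submission.pr (@prb_fin _ _ (trajectory E) _ _ (Wtr h f m) _ (mW (fun W => v :|: W = B))) => [|B']; last exact: (mW (fun W => W = B')).
rewrite /push [RHS]big_mkcond; apply: eq_bigr => B' _ /=; case: eqP => vB.
  by congr (prb _ _); apply/seteqP; split => w /=; [case|move=> ->].
rewrite -(prb0 (walk_law R s0 st x)); congr (prb _ _); apply/seteqP; split => w //= -[+ e].
by rewrite e => /vB.
Qed.

Let kap_law (x : E) : (`|x.2| <= N)%N \/ `|x.2|%N = h -> is_law (nu R h f x).
Proof.
by move=> xr; split; [move=> v; apply: sumr_ge0 => y _; exact: kap_ge0|exact: (kap_sum R Nh f)].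
Qed.

Lemma first_coupled : coupled (fun v => smean (fun x => nu R h f x v) z) (slot sg 0 ap) sandwich (2 * beta).
Proof.
pose mu' v' := \sum_v first_pair R h f z v v'.
have fp0 := first_pair_ge0 R N_gt1 Nh f zN.
have row v := first_pair_row R N_gt1 Nh f_in zN v.
have mu'1 : is_law mu'.
  split=> [v'|]; first by apply: sumr_ge0 => v _; exact: fp0.
  rewrite exchange_big (eq_bigr _ (fun v _ => row v)) /slice_mean -mulr_sumr exchange_big /=.
  rewrite (eq_bigr (fun=> 1)) => [|t _]; last by have [_ ->] := @kap_law (t, z) (or_introl zN).
  by rewrite sumr_const (card_torus R d N_gt1) mulVf// gt_eqF.
have c1 : coupled (fun v => smean (fun x => nu R h f x v) z) mu' (fun v v' => v \subset v') 0.
  exists (first_pair R h f z); split => //.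
  rewrite big1// => v _; apply: big1 => v' nv; apply/eqP; apply: contraNT nv.
  exact: first_pair_sub.
have c2 : coupled mu' (slot sg 0 ap) sandwich (2 * beta).
  have [H0 _] := mu'1.
  apply: coupled_le (slot_coupled sg_ge0 (lexx 0) ap0 ap1 mu'1 (b_ge0 true) _).
    by rewrite ler_wpM2l.
  move=> v v0; apply/andP; split; first by apply: (@le_trans _ _ 0); rewrite ?mul0r ?sub0r ?oppr_le0.
  apply: le_trans (first_ok v0); exact: (first_pair_col R N_gt1 Nh f zN hN2).
have c3 := coupled_support (P := fun q => q.1 == finset.set0) c2 _.
rewrite -[2 * beta]add0r; apply: coupled_trans c1 (c3 _) _.
  move=> q q1; rewrite /slot /delta; have [qn|_] := eqVneq q (none PT); first by move: q1; rewrite qn eqxx.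
  rewrite mulr0 add0r big1// => v _; rewrite mul0r mul0r add0r.
  by have [qn|_] := eqVneq q (finset.set0, v); [move: q1; rewrite qn eqxx|rewrite mulr0].
move=> v v' q vv' /andP[/andP[_ vq] /eqP q1]; rewrite /Submission.sandwich q1 finset.sub0set.
exact: fintype.subset_trans vv' vq.
Qed.

Variables (a a' : R) (zeta : Q -> R).
Hypotheses (a0 : 0 <= a) (a'0 : 0 <= a') (zeta_law : is_law zeta).
Hypothesis zeta_down : forall q0, down_sum zeta q0 =
  expR (a * (down_sum (slot sg am ap) q0 - 1)) * expR (a' * (down_sum (slot sg 0 ap) q0 - 1)).

Theorem walk_coupled m (x y e' : R) : 1 <= x -> 0 < y -> y <= 1 -> 0 < e' ->
  is_law (start_trace m.+1) /\
  coupled (start_trace m.+1) zeta sandwich (m.+1%:R * (2 * beta) +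
    (expR (a * (x - 1)) / x ^+ m.+1 + expR ((a + a') * (y - 1)) / y ^+ m.+1 + e')).
Proof.
move=> x1 y0 y1 e'0.
pose kp (y : bool * T) v y' := kap R h f (edge h y) v y'.
pose law m (y : bool * T) (B : V) := pr (edge h y) [set w | Wtr h f m w = B].
pose kap0 v y := smean (fun x => kap R h f x v y) z.
have s_law := slot_law sg_ge0 am0 amp ap1.
have t_law := slot_law sg_ge0 (lexx 0) ap0 ap1.
have kp0 yy v y' : 0 <= kp yy v y' by exact: kap_ge0.
have kp1 yy : \sum_v \sum_y' kp yy v y' = 1 := kap_sum R Nh f (reach_edge yy).
have beta0 : 0 <= 2 * beta.
  by rewrite mulr_ge0//; apply: le_trans (b_sum true); exact: sumr_ge0.
have law0 yy v : law 0 yy v = (v == finset.set0)%:R.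
  have nI : ~ (`|(edge h yy).2| <= N)%N by move: Nh; rewrite /edge /sgn /=; case: yy.1; clear; lia.
  have W0 (w : nat -> E) : w 0%N = edge h yy -> Wtr h f 0 w = finset.set0.
    by move=> w0; apply: Wtr0 => //; rewrite w0.
  rewrite /law; have [->|v0] := eqVneq v finset.set0.
    rewrite -(pr_setT R s0 st (edge h yy)); apply: pr_as => //; first exact: (measurable_Wtr _ _ 0 (fun W => W = finset.set0)).
    by move=> w w0; split => // _; exact: W0.
  rewrite mulr0n -[RHS](prb0 (walk_law R s0 st (edge h yy))); apply: pr_as => //; first exact: (measurable_Wtr _ _ 0 (fun W => W = v)).
  by move=> w w0; split => // /= e; move: v0; rewrite -e W0 ?eqxx.
have rec m' (x' : E) B : (`|x'.2| <= N)%N \/ `|x'.2|%N = h -> pr x' [set w | Wtr h f m'.+1 w = B] =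
    \sum_v \sum_y' kap R h f x' v y' * push (finset.setU v) (law m' y') B.
  move=> xr; rewrite (Wtr_rec R Nh f m' B xr); apply: eq_bigr => v _; apply: eq_bigr => y' _.
  by rewrite pr_WtrU.
have lawS m' yy B : law m'.+1 yy B = \sum_v \sum_y' kp yy v y' * push (finset.setU v) (law m' y') B.
  exact: rec.
have cs yy : coupled (fun v => \sum_y' kp yy v y') (slot sg am ap) sandwich (2 * beta).
  case: yy => s t; apply: coupled_le (slot_coupled sg_ge0 am0 amp ap1 (kap_law (reach_edge (s, t))) (b_ge0 s) (edge_ok s t)).
  by rewrite ler_wpM2l.
have ct yy : coupled (fun v => \sum_y' kp yy v y') (slot sg 0 ap) sandwich (2 * beta).
  case: yy => s t; have lw := kap_law (reach_edge (s, t)).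
  apply: coupled_le (slot_coupled sg_ge0 (lexx 0) ap0 ap1 lw (b_ge0 s) _); first by rewrite ler_wpM2l.
  move=> v v0; have /andP[_ ->] := edge_ok s t v0; rewrite andbT.
  by have [H _] := lw; apply: (@le_trans _ _ 0); rewrite ?mul0r ?sub0r ?oppr_le0.
have kap00 v yy : 0 <= kap0 v yy.
  by rewrite /kap0 /slice_mean mulr_ge0 ?invr_ge0 ?(ltW NT0)// sumr_ge0// => t _; exact: kap_ge0.
have sw (F : E -> V -> (bool * T) -> R) (G : V -> (bool * T) -> R) :
    smean (fun x => \sum_v \sum_y F x v y * G v y) z = \sum_v \sum_y smean (fun x => F x v y) z * G v y.
  rewrite /slice_mean; under [RHS]eq_bigr do under eq_bigr do rewrite -mulrA mulr_suml.
  under [RHS]eq_bigr do rewrite -mulr_sumr exchange_big.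
  by rewrite -mulr_sumr exchange_big.
have kap01 : \sum_v \sum_yy kap0 v yy = 1.
  have := sw (fun x v y => kap R h f x v y) (fun _ _ => 1).
  under [X in _ = X -> _]eq_bigr do under eq_bigr do rewrite mulr1; move=> <-.
  rewrite /slice_mean (eq_bigr (fun=> 1)) => [|t _].
    by rewrite sumr_const (card_torus R d N_gt1) mulVf// gt_eqF.
  under eq_bigr do under eq_bigr do rewrite mulr1.
  by have [_ <-] := @kap_law (t, z) (or_introl zN).
have startS m' B : start_trace m'.+1 B = \sum_v \sum_yy kap0 v yy * push (finset.setU v) (law m' yy) B.
  rewrite -(sw (fun x v y => kap R h f x v y)) /start_trace /slice_mean; congr (_ * _); apply: eq_bigr => t _.
  by apply: rec; left.
have c0 : coupled (fun v => \sum_yy kap0 v yy) (slot sg 0 ap) sandwich (2 * beta).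
  have -> : (fun v => \sum_yy kap0 v yy) = (fun v => smean (fun x => nu R h f x v) z).
    by apply/funext => v; rewrite /kap0 /slice_mean -mulr_sumr exchange_big.
  exact: first_coupled.
have t_lower q : q.1 != finset.set0 -> slot sg 0 ap q = 0.
  move=> q1; rewrite /slot /delta; have [qn|_] := eqVneq q (none PT); first by move: q1; rewrite qn eqxx.
  rewrite mulr0 add0r big1// => v _; rewrite mul0r mul0r add0r.
  by have [qn|_] := eqVneq q (finset.set0, v); [move: q1; rewrite qn eqxx|rewrite mulr0].
have lm := start_law kp0 kp1 law0 lawS kap00 kap01 startS m.
split => //; apply: (coupled_mixture s_law t_law a0 a'0 zeta_law zeta_down lm _ x1 y0 y1 e'0).
  by rewrite mulr_ge0.
by move=> j j'; exact: (coupled_start kp0 kp1 law0 lawS s_law t_law beta0 cs ct kap00 kap01 startS c0 t_lower).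
Qed.

End walk_coupling.

(** * Interlacements *)

Section void_probability.
Variables (R : realType) (d : nat).
Local Notation Z := (lattice int d).
Local Notation st := (@step int d).
Local Notation s0 := ((None, false) : direction d).
Local Notation pr := (@pr R _ _ s0 st).
Local Notation countE := (countable_latticeZ d).
Variable S : {fset Z}.
Local Notation T := (@T_full d S).
Local Notation tau B := (trace_weight R set0 T B).

Lemma equilibriumE (y : S) : equilibrium R S (val y) = (escape R set0 T y)%:E.
Proof.
have yS := valP y; rewrite /equilibrium yS.
set K : set Z := [set` S].
have K_T z : trZ set0 T z <-> K z.
  split=> [[[y' ->]|//]|zK]; first exact: valP.
  by left; exists [` zK]%fset.
have GP w : hit_pos K w = None <-> forall n, (1 <= n)%N -> ~ K (w n).
  have := first_timeP [set n | (1 <= n)%N /\ K (w n)]; rewrite -/(hit_pos _ _).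
  case: (hit_pos K w) => [n [[n1 nK] _]|H]; first by split => // /(_ n n1).
  by split=> // _ n n1 nK; apply: (H n).
have mG : measurable ([set w | hit_pos K w = None] : set (trajectory Z)).
  rewrite (_ : [set w | _] = \bigcap_n [set w : trajectory Z | (1 <= n)%N -> ~ K (w n)]); last first.
    by apply/seteqP; split => w; [move=> /GP H n _; exact: H|move=> H; apply/GP => n; exact: H].
  apply: bigcapT_measurable => n; apply: (@fdep_measurable _ countE n) => w w' ww' H n1.
  by rewrite -ww'//; exact: H.
have -> : srw R (val y) [set w | hit_pos K w = None] = (pr (val y) [set w | hit_pos K w = None])%:E.
  exact: prbE.
rewrite (pr_cons countE)//; congr (_%:E); congr (_ * _); apply: eq_bigr => s _.
rewrite /capture -(eq_hp (Z := K) (S := K)) => [|z|z zK]; last first.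
- by split=> [zK'|[y' ->]]; [exists [` zK']%fset|exact: valP].
- by rewrite K_T.
rewrite /Submission.hp /Submission.pr -prbC; last exact: (measurable_hev countE).
congr (prb _ _); apply/seteqP; split => w.
  by move=> /GP H [n [[nK _] _]]; exact: (H n.+1).
move=> H; apply/GP => -[//|n] _ /= nK.
have : exists i, `[< K (w i) >] by exists n; apply/asboolP.
case/ex_minnP => i /asboolP iK imin; apply: H; exists i; split => //; split => // j ji jK.
by have := imin j (asboolT jK); rewrite leqNgt ji.
Qed.

Definition subset_event (B : {set S}) : set (configuration Z) :=
  [set C | forall y : S, C (val y) -> y \in B].

Lemma measurable_point (z : Z) : measurable ([set C | C z] : set (configuration Z)).
Proof. by apply: sub_sigma_algebra; exists z. Qed.

Lemma measurable_subset_event B : measurable (subset_event B).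
Proof.
rewrite (_ : subset_event B = \bigcap_(y in [set: S]) [set C | C (val y) -> y \in B]).
  apply: fin_bigcap_measurable => [|y _]; first exact: finite_finset.
  have [yB|yB] := boolP (y \in B).
    by rewrite (_ : [set C | _] = setT)//; apply/seteqP.
  rewrite (_ : [set C | _] = ~` [set C | C (val y)]).
    by apply: measurableC; exact: measurable_point.
  by apply/seteqP; split => C /= H; [move=> /H|move=> /H].
by apply/seteqP; split => C H; [move=> y _; exact: H|move=> y; exact: H].
Qed.

Definition weight_out (B : {set S}) : R := \sum_(B' : {set S} | ~~ (B' \subset B)) tau B'.

Let outside (B : {set S}) : set (trajectory Z) := [set w | ~~ (trset set0 T w \subset B)].

Let measurable_outside B : measurable (outside B).
Proof. exact: (measurable_trset _ _ (fun V => ~~ (V \subset B))). Qed.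

Lemma intensity_outside (u : R) B : interlacement_intensity u S (outside B) = (u * weight_out B)%:E.
Proof.
rewrite /interlacement_intensity EFinM; congr (_ * _)%E.
rewrite big_seq_fsetE /= (eq_bigr (fun y => (escape R set0 T y * pr (val y) (outside B))%:E)) => [|y _].
  rewrite sumEFin; congr (_%:E); rewrite /weight_out /trace_weight exchange_big; apply: eq_bigr => y _ /=.
  rewrite -mulr_sumr; congr (_ * _).
  have mE B' : measurable ([set w | trset set0 T w = B'] : set (trajectory Z)).
    exact: (measurable_trset _ _ (fun V => V = B')).
  rewrite {1}/Submission.pr (@prb_fin _ _ (trajectory Z) _ {set S} (trset set0 T) _ (measurable_outside B) mE).
  rewrite [RHS]big_mkcond; apply: eq_bigr => B' _ /=; case: ifPn => B'B.
    congr (prb _ _); apply/seteqP; split => w /=; first by move=> [_ <-]; rewrite /ev /= finset.set0U.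
    by rewrite /ev /= finset.set0U => e; split => //; rewrite /outside /= e.
  rewrite -(prb0 (walk_law R s0 st (val y))); congr (prb _ _); apply/seteqP; split => w //= -[+ e].
  by rewrite /outside /= e (negbTE B'B).
rewrite [RHS]EFinM -equilibriumE; congr (_ * _)%E.
exact: (prbE (srw R (val y)) (measurable_outside B)).
Qed.

Lemma weight_out_ge0 B : 0 <= weight_out B.
Proof.
by apply: sumr_ge0 => B' _; apply: sumr_ge0 => y _; rewrite mulr_ge0 ?escape_ge0 ?prb_ge0.
Qed.

Lemma poisson_prob_zero (r : R) : 0 <= r -> poisson_prob r 0%N [set 0%N] = (expR (- r))%:E.
Proof.
move=> r0; rewrite /poisson_prob; case: ifPn => [rp|].
  by rewrite esum_set1 ?lee_fin ?poisson_pmf_ge0 ?ltW// /poisson_pmf rp expr0 fact0 invr1 !mul1r.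
rewrite -leNgt => rn; have -> : r = 0 by apply/eqP; rewrite eq_le rn r0.
by rewrite oppr0 expR0 diracE mem_set.
Qed.

Variables (d0 : measure_display) (Omega0 : measurableType d0) (Q0 : probability Omega0 R).
Variable I : R -> Omega0 -> configuration Z.
Hypothesis HI : is_interlacement Q0 I.

Lemma void_probability u B : 0 <= u ->
  Q0 [set w | subset_event B (I u w)] = (expR (- (u * weight_out B)))%:E.
Proof.
move=> u0; have [d' [T' [P [M [Y [PP SL]]]]]] := interlacement_local HI S u0.
have trE (C : configuration Z) : subset_event B (Defs.trace C S) <-> subset_event B C.
  by split=> H y; [move=> Cy; apply: H; split => //; exact: valP|move=> [Cy _]; exact: H].
have := SL _ (measurable_subset_event B).
have -> : (fun w => Defs.trace (I u w) S) @^-1` subset_event B = [set w | subset_event B (I u w)].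
  by apply/seteqP; split => w /trE.
have tI : trivIset setT (fun _ : 'I_1 => outside B) by move=> i j _ _ _; rewrite !ord1.
move=> ->; have [_ /(_ ord0 [set 0%N])] := PP 1%N (fun=> outside B) (fun=> measurable_outside B) tI.
rewrite intensity_outside /= poisson_prob_zero ?mulr_ge0 ?weight_out_ge0// => <-.
congr (P _); apply/seteqP; split => w /=.
  move=> /trE H; rewrite /nb_points; apply: big1 => i _; apply/eqP; rewrite eqb0; apply/negP => /set_mem.
  move=> /fintype.subsetPn[y]; rewrite inE => /asboolP[n [yn _]] /negP; apply; apply: H.
  by exists i, n; split.
move=> nb0; apply/trE => y [i [n [iM yn]]].
have : (Y i w \in outside B) = false.
  by move/eqP : nb0; rewrite /nb_points sum_nat_eq0 => /forallP/(_ (Ordinal iM)); rewrite eqb0 => /negbTE.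
move=> /negP Yi; apply: contrapT => /negP yB; apply: Yi; apply/mem_set.
apply/fintype.subsetPn; exists y => //; rewrite inE; apply/asboolP; exists n; split; first exact: yn.
by move=> j _ [].
Qed.

Lemma pair_void_probability u v (B B' : {set S}) : 0 <= u -> u <= v ->
  Q0 [set w | subset_event B (I u w) /\ subset_event B' (I v w)] =
  (expR (- (u * weight_out (B :&: B'))) * expR (- ((v - u) * weight_out B')))%:E.
Proof.
move=> u0 uv; have vu0 : 0 <= v - u by rewrite subr_ge0.
have mG := measurableX (measurable_subset_event B) (measurable_subset_event B').
have mI a (X : {set S}) : 0 <= a -> measurable [set w | subset_event X (I a w)].
  move=> a0; rewrite -[X in measurable X]setTI.
  exact: (interlacement_measurable HI a0 measurableT (measurable_subset_event X)).
have := interlacement_joint HI u0 uv mG.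
have -> : (fun w => (I u w, I v w)) @^-1` (subset_event B `*` subset_event B') =
  [set w | subset_event B (I u w) /\ subset_event B' (I v w)] by [].
move=> ->; rewrite EFinM -!void_probability// -(product_measure1E _ _ (mI _ _ u0) (mI _ _ vu0)).
congr (_ _); apply/seteqP; split => w /=.
  move=> [H1 H2]; split=> y Iy; last by apply: H2; right.
  by rewrite finset.inE (H1 y Iy) H2//; left.
move=> [H1 H2]; split=> y; first by move=> /H1; rewrite finset.inE => /andP[].
by move=> [/H1|/H2//]; rewrite finset.inE => /andP[].
Qed.

End void_probability.

Section interlacement_pairs.
Variables (R : realType) (d k : nat).
Local Notation Z := (lattice int d).
Variable S : 'I_k -> {fset Z}.
Local Notation F := (fun i => S i : finType).
Local Notation PT := {i : 'I_k & S i}.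
Local Notation V := {set PT}.
Local Notation Q := ({set PT} * {set PT})%type.
Variables (d0 : measure_display) (Omega0 : measurableType d0) (Q0 : probability Omega0 R).
Variable I : R -> Omega0 -> configuration Z.
Hypothesis HI : is_interlacement Q0 I.
Variables (ua ub : R).
Hypotheses (ua0 : 0 <= ua) (uab : ua <= ub).

Definition config_set i (C : configuration Z) : {set S i} := [set y | `[< C (val y) >]].

Definition block_pair i w : Q :=
  (emb (F := F) (config_set i (I ua w)), emb (F := F) (config_set i (I ub w))).

Lemma measurable_config_set i (B : {set S i}) : measurable [set C | config_set i C = B].
Proof.
rewrite (_ : [set C | _] = \bigcap_(y in [set: S i]) [set C | (y \in B) = `[< C (val y) >] ]).
  apply: fin_bigcap_measurable => [|y _]; first exact: finite_finset.
  have mp := measurable_point (val y : Z).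
  case: (y \in B).
    by rewrite (_ : [set C | _] = [set C | C (val y)])//; apply/seteqP; split => C /=; [move=> /esym/asboolW|move=> /asboolT].
  rewrite (_ : [set C | _] = ~` [set C | C (val y)]); first exact: measurableC.
  by apply/seteqP; split => C /=; [move=> /esym/asboolPn|move=> /asboolF].
apply/seteqP; split => C /=; first by move=> <- y _ /=; rewrite inE.
by move=> H; apply/setP => y; rewrite inE H.
Qed.

Let mI a i (B : {set S i}) : 0 <= a -> measurable [set w | config_set i (I a w) = B].
Proof.
move=> a0; rewrite -[X in measurable X]setTI.
exact: (interlacement_measurable HI a0 measurableT (measurable_config_set B)).
Qed.

Let ub0 : 0 <= ub. Proof. exact: le_trans ua0 uab. Qed.

Let mX i q : measurable [set w | block_pair i w = q].
Proof.
rewrite (_ : [set w | _] = \bigcup_(b in [set b : {set S i} * {set S i} | (emb (F := F) b.1, emb (F := F) b.2) = q])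
   ([set w | config_set i (I ua w) = b.1] `&` [set w | config_set i (I ub w) = b.2])).
  apply: fin_bigcup_measurable => [|b _]; first exact: finite_finset.
  by apply: measurableI; exact: mI.
apply/seteqP; split => w; last by move=> [b /= <- [e1 e2]]; rewrite /block_pair e1 e2.
by move=> /= wq; exists (config_set i (I ua w), config_set i (I ub w)).
Qed.

Definition pair_law i q : R := prb Q0 [set w | block_pair i w = q].

Lemma sum_pair_law i (P : pred Q) : \sum_(q | P q) pair_law i q = prb Q0 [set w | P (block_pair i w)] /\
  measurable [set w | P (block_pair i w)].
Proof.
have mP : measurable [set w | P (block_pair i w)].
  rewrite (_ : [set w | _] = \bigcup_(q in [set q | P q]) [set w | block_pair i w = q]).
    by apply: fin_bigcup_measurable => [|q _]; [exact: finite_finset|exact: mX].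
  by apply/seteqP; split => w; [move=> Pw; exists (block_pair i w)|move=> [q Pq /= ->]].
split=> //; rewrite (@prb_fin _ _ _ _ _ (block_pair i) _ mP (mX i)) big_mkcond; apply: eq_bigr => q _ /=.
case: ifPn => Pq; first by congr (prb _ _); apply/seteqP; split => w /=; [move=> e; split => //; rewrite e|case].
rewrite -(prb0 Q0); congr (prb _ _); apply/seteqP; split => w //= -[+ e].
by rewrite e (negbTE Pq).
Qed.

Definition part i q : Q := (emb (F := F) (res i q.1), emb (F := F) (res i q.2)).

Definition join (f : {ffun 'I_k -> Q}) : Q :=
  (\bigcup_i (f i).1, \bigcup_i (f i).2)%SET.

Definition zeta : Q -> R := push join (fun f => \prod_i pair_law i (f i)).

Lemma pair_law_ge0 i q : 0 <= pair_law i q. Proof. exact: prb_ge0. Qed.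

Lemma pair_law_part i q : pair_law i q != 0 -> q = part i q.
Proof.
apply: contraNeq => qi; rewrite /pair_law (_ : [set w | _] = set0) ?prb0//.
by apply/seteqP; split => // w /= e; move: qi; rewrite -e /part /block_pair /= !resK eqxx.
Qed.

Lemma res_bigcup i (v : 'I_k -> V) : (forall j, v j = emb (F := F) (res j (v j))) ->
  res i (\bigcup_j v j)%SET = res i (v i).
Proof.
move=> vE; apply/setP => y; rewrite !inE; apply/finset.bigcupP/idP => [[j _]|yv]; last by exists i.
by rewrite {1}vE => /imsetP[y' + e]; have ji : j = i by [case: e]; subst j; rewrite (eq_from_Tagged e) inE.
Qed.

Lemma zeta_product (P : 'I_k -> pred Q) :
  \sum_(q | [forall i, P i (part i q)]) zeta q = \prod_i \sum_(q | P i q) pair_law i q.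
Proof.
rewrite (sum_push join _ (fun q => [forall i, P i (part i q)])) bigA_distr_big_dep.
rewrite [LHS]big_mkcond [RHS]big_mkcond; apply: eq_bigr => f _ /=.
have [[i]|nz] := pselect (exists i, pair_law i (f i) = 0).
  by move=> fi; rewrite (bigD1 i)//= fi mul0r; do 2 case: ifP.
have fE i : f i = part i (f i).
  by apply: pair_law_part; apply/eqP => fi; apply: nz; exists i.
have pf i : part i (join f) = f i.
  have r1 : res i (join f).1 = res i (f i).1 by apply: res_bigcup => j; rewrite {1}fE.
  have r2 : res i (join f).2 = res i (f i).2 by apply: res_bigcup => j; rewrite {1}fE.
  by rewrite [RHS]fE /part r1 r2.
congr (if _ then _ else _); apply/forallP/familyP => H i; have := H i; rewrite pf//.
Qed.

Lemma zeta_law : is_law zeta.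
Proof.
split=> [q|]; first by apply: sumr_ge0 => f _; apply: prodr_ge0 => i _; exact: pair_law_ge0.
have := zeta_product (fun _ => predT).
rewrite [RHS]big1 => [<-|i _]; first by apply: eq_bigl => q; apply/esym/forallP.
have [-> _] := sum_pair_law i predT.
by rewrite (_ : [set w | _] = setT) ?prbT//; apply/seteqP.
Qed.

Lemma below_part (q0 q : Q) : below q0 q = [forall i, below q0 (part i q)].
Proof.
have sub (A v : V) : (v \subset A) = [forall i, emb (F := F) (res i v) \subset A].
  apply/idP/forallP => [vA i|H].
    by apply/fintype.subsetP => p /imsetP[y + ->]; rewrite inE => /(fintype.subsetP vA).
  apply/fintype.subsetP => -[i y] yv; apply: (fintype.subsetP (H i)); apply/imsetP; exists y => //.
  by rewrite inE.
rewrite /below !sub; apply/andP/forallP => [[/forallP H1 /forallP H2] i|H]; first by rewrite H1 H2.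
by split; apply/forallP => i; have /andP[] := H i.
Qed.

Let out i (B : {set S i}) : R := weight_out R B.

Lemma zeta_down (q0 : Q) : down_sum zeta q0 =
  expR (- (ua * \sum_i out (res i (q0.1 :&: q0.2)))) * expR (- ((ub - ua) * \sum_i out (res i q0.2))).
Proof.
rewrite /down_sum; under eq_bigl do rewrite below_part.
rewrite (zeta_product (fun _ => below q0)) !mulr_sumr -!sumrN !expR_sum -big_split /=.
apply: eq_bigr => i _; have [-> _] := sum_pair_law i (below q0).
rewrite -[RHS]/(fine (_)%:E) /prb.
rewrite (_ : res i (q0.1 :&: q0.2) = res i q0.1 :&: res i q0.2); last by apply/setP => y; rewrite !inE.
rewrite -(pair_void_probability HI _ _ ua0 uab); congr (fine (Q0 _)).
have sub a (A : V) w : (emb (F := F) (config_set i (I a w)) \subset A) <-> subset_event (res i A) (I a w).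
  split=> [/fintype.subsetP H y Iy|H].
    by rewrite inE; apply: H; apply/imsetP; exists y => //; rewrite inE; exact: asboolT.
  by apply/fintype.subsetP => p /imsetP[y + ->]; rewrite inE => /asboolW/H; rewrite inE.
apply/seteqP; split => w; first by move=> /andP[/sub H1 /sub H2].
by move=> [/sub H1 /sub H2]; apply/andP.
Qed.

End interlacement_pairs.

(** * Construction of the probability space *)

Lemma finite_mixture (R : realType) (d : measure_display) (T : measurableType d) (K : finType)
    (m : K -> {measure set T -> \bar R}) : (\sum_k m k setT = 1)%E ->
  exists P : probability T R, forall A, P A = (\sum_k m k A)%E.
Proof.
move=> m1; have [k0 _|K0] := pickP K; last by move: m1; rewrite big_pred0// => /esym/eqP; rewrite onee_eq0.
pose M : {measure set T -> \bar R} := msum (fun i => m (nth k0 (enum K) i)) #|K|.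
have ME A : M A = (\sum_k m k A)%E.
  by rewrite /M /= /msum -(big_mkord predT (fun i => m (nth k0 (enum K) i) A)) cardE -(big_nth k0 predT (fun k => m k A)) big_enum.
have M1 : M setT = 1%E by rewrite ME.
pose P : probability T R := HB.pack (Measure.sort M) (Measure_isProbability.Build _ _ _ M M1).
by exists P => A; rewrite -ME.
Qed.

Section glue.
Variables (R : realType) (d : measure_display) (T : measurableType d) (J V Q : finType).
Variables (P : J -> probability T R) (p : J -> R) (W : T -> V).
Hypotheses (p0 : forall j, 0 <= p j) (p1 : \sum_j p j = 1).
Hypothesis mW : forall v, measurable [set w | W w = v].

Let mu v := \sum_j p j * prb (P j) [set w | W w = v].

Definition code (q : Q) : nat := index q (enum Q).
Definition decode (q0 : Q) (n : nat) : Q := nth q0 (enum Q) n.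

Lemma codeK q0 : cancel code (decode q0).
Proof. by move=> q; rewrite /decode nth_index// mem_enum. Qed.

Let with_code q (w : T) : T * nat := (w, code q).

Let measurable_with_code q : measurable_fun setT (with_code q).
Proof. exact: measurable_fun_pair. Qed.

(* On [T * nat] the second coordinate carries the outcome in [Q], given the  *)
(* value of [W] on the first one.                                             *)
Lemma glue (nu : Q -> R) (rel : V -> Q -> bool) (e : R) (q0 : Q) : coupled mu nu rel e ->
  exists P1 : probability (T * nat)%type R,
  [/\ forall G, measurable G -> P1 [set w | G w.1] = (\sum_j p j * prb (P j) G)%:E,
      forall X : pred Q, P1 [set w | X (decode q0 w.2)] = (\sum_(q | X q) nu q)%:E &
      (P1 [set w | ~~ rel (W w.1) (decode q0 w.2)] <= e%:E)%E].
Proof.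
move=> [g [g0 gr gc ge]].
pose c v q := g v q / mu v.
have mu0 v : 0 <= mu v by rewrite -gr sumr_ge0.
have c0 v q : 0 <= c v q by rewrite divr_ge0.
have cmu v q : c v q * mu v = g v q.
  have [mz|mz] := eqVneq (mu v) 0; last by rewrite divfK.
  rewrite mz mulr0; move: mz; rewrite -gr => mz.
  by rewrite (psumr_eq0P (fun q _ => g0 v q) mz).
pose K := ((V * Q) * J)%type.
have w0 (x : K) : 0 <= c x.1.1 x.1.2 * p x.2 by rewrite mulr_ge0.
have mW' v : measurable [set y : T * nat | W y.1 = v].
  rewrite -[X in measurable X]setTI.
  exact: (@measurable_fst _ _ T nat measurableT [set w | W w = v] (mW v)).
pose tagf q : {mfun T >-> (T * nat)%type} := @mfun_Sub _ _ T (T * nat)%type (with_code q) (mem_set (measurable_with_code q)).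
pose m (x : K) : {measure set (T * nat) -> \bar R} :=
  mscale (NngNum (w0 x)) (mrestr (distribution (P x.2) (tagf x.1.2)) (mW' x.1.1)).
have mE x G : m x G = ((c x.1.1 x.1.2 * p x.2)%:E * P x.2 [set w | G (w, code x.1.2) /\ W w = x.1.1])%E by [].
have sumK (F : V -> Q -> J -> R) : \sum_(x : K) F x.1.1 x.1.2 x.2 = \sum_v \sum_q \sum_j F v q j.
  by rewrite pair_bigA pair_bigA; apply: eq_bigr => -[[v q] j].
have evE (X : V -> pred Q) : (\sum_x m x [set w | X (W w.1) (decode q0 w.2)])%E = (\sum_v \sum_(q | X v q) g v q)%:E.
  rewrite (eq_bigr (fun x : K => ((X x.1.1 x.1.2)%:R * (c x.1.1 x.1.2 * (p x.2 * prb (P x.2) [set w | W w = x.1.1])))%:E)) => [|x _].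
    rewrite sumEFin (sumK (fun v q j => (X v q)%:R * (c v q * (p j * prb (P j) [set w | W w = v])))).
    congr (_%:E); apply: eq_bigr => v _; rewrite [RHS]big_mkcond; apply: eq_bigr => q _ /=.
    by rewrite -2!mulr_sumr cmu; case: (X v q); rewrite ?mul1r ?mul0r.
  rewrite mE; case Xx : (X x.1.1 x.1.2).
    rewrite mul1r mulrA [RHS]EFinM -prbE//; congr (_ * P _ _)%E; apply/seteqP; split => w /=; first by case.
    by move=> e1; split => //; rewrite codeK e1 Xx.
  rewrite mul0r (_ : [set w | _] = set0) ?measure0 ?mule0//.
  by apply/seteqP; split => // w /= [+ e1]; rewrite codeK e1 Xx.
have mu1 : \sum_v mu v = 1.
  rewrite exchange_big -p1; apply: eq_bigr => j _; rewrite -mulr_sumr.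
  have -> : \sum_v prb (P j) [set w | W w = v] = 1.
    rewrite -(prbT (P j)) (@prb_fin _ _ _ _ _ W _ measurableT mW).
    by apply: eq_bigr => v _; rewrite setTI.
  by rewrite mulr1.
have m1 : (\sum_x m x setT = 1)%E.
  have := evE (fun _ _ => true); rewrite (_ : [set w | _] = setT); last exact/seteqP.
  by move=> ->; under eq_bigr do rewrite gr; rewrite mu1.
have [P1 P1E] := finite_mixture m1; exists P1; split => [G mG|X|].
- rewrite P1E (eq_bigr (fun x : K => (c x.1.1 x.1.2 * (p x.2 * prb (P x.2) (G `&` [set w | W w = x.1.1])))%:E)) => [|x _].
    rewrite sumEFin (sumK (fun v q j => c v q * (p j * prb (P j) (G `&` [set w | W w = v])))).
    congr (_%:E).
    have E1 v : \sum_q \sum_j c v q * (p j * prb (P j) (G `&` [set w | W w = v])) = \sum_j p j * prb (P j) (G `&` [set w | W w = v]).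
      rewrite exchange_big; apply: eq_bigr => j _ /=; rewrite -mulr_suml -mulr_suml gr.
      have [mz|mz] := eqVneq (mu v) 0; last by rewrite mulfV ?mul1r.
      rewrite mz mul0r mul0r.
      have pz : p j * prb (P j) [set w | W w = v] = 0.
        by apply: (psumr_eq0P (fun j _ => mulr_ge0 (p0 j) (prb_ge0 (P j) [set w | W w = v])) mz).
      apply/eqP; rewrite eq_le mulr_ge0 ?prb_ge0//= -pz ler_wpM2l// le_prb//; first exact: measurableI.
    rewrite (eq_bigr _ (fun v _ => E1 v)) exchange_big; apply: eq_bigr => j _ /=.
    by rewrite -mulr_sumr; congr (_ * _); rewrite [RHS](@prb_fin _ _ _ _ _ W _ mG mW).
  rewrite mE mulrA [RHS]EFinM; congr (_ * _)%E.
  exact: (prbE (P x.2) (measurableI _ _ mG (mW x.1.1))).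
- rewrite P1E (evE (fun _ => X)) exchange_big; congr (_%:E); apply: eq_bigr => q _.
  exact: gc.
by rewrite P1E (evE (fun v q => ~~ rel v q)) lee_fin.
Qed.

End glue.

Section construction.
Variables (R : realType) (d N : nat).
Hypotheses (N_gt1 : (1 < N)%N).
Local Notation Z := (lattice int d).
Local Notation T := 'rV['Z_N]_d.
Local Notation E := (lattice 'Z_N d).
Local Notation NT := (N%:R ^+ d : R).
Local Notation h := (hN R N).
Variables (k : nat) (S : 'I_k -> {fset Z}) (x : 'I_k -> E).
Local Notation F := (fun i => S i : finType).
Local Notation PT := {i : 'I_k & S i}.
Local Notation V := {set PT}.
Local Notation Q := ({set PT} * {set PT})%type.
Variables (d0 : measure_display) (Omega0 : measurableType d0) (Q0 : probability Omega0 R).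
Variable I : R -> Omega0 -> configuration Z.
Hypothesis HI : is_interlacement Q0 I.
Variables (ua ub : R).
Hypotheses (ua0 : 0 <= ua) (uab : ua <= ub).
Local Notation f := (point x : PT -> E).

Definition block_config i (A : V) : configuration Z := [set y | exists2 y0 : S i, val y0 = y & y0 \in res i A].

Let traces i (q : Q) : configuration Z * configuration Z :=
  (Defs.trace (block_config i q.1) (S i), Defs.trace (block_config i q.2) (S i)).

Let traces_part i q : traces i (part i q) = traces i q.
Proof. by rewrite /traces /block_config /part /= !resK. Qed.

Let traces_pair i w : traces i (block_pair S I ua ub i w) =
  (Defs.trace (I ua w) (S i), Defs.trace (I ub w) (S i)).
Proof.
rewrite /traces /block_config /block_pair /= !resK; congr (_, _); apply/seteqP; split => y /=.
- by move=> [[y0 <-]]; rewrite inE => /asboolW.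
- by move=> [Iy yS]; split => //; exists [` yS]%fset => //; rewrite inE; exact: asboolT.
- by move=> [[y0 <-]]; rewrite inE => /asboolW.
- by move=> [Iy yS]; split => //; exists [` yS]%fset => //; rewrite inE; exact: asboolT.
Qed.

Lemma zeta_marginal (J : pred 'I_k) (P : 'I_k -> pred Q) :
  (forall i q, P i (part i q) = P i q) ->
  \sum_(q | [forall i, J i ==> P i q]) zeta Q0 I ua ub q =
  \prod_(i | J i) \sum_(q | P i q) pair_law Q0 I ua ub i q.
Proof.
move=> Pp; have := @zeta_product R d k S _ _ Q0 I ua ub (fun i q => J i ==> P i q).
rewrite (eq_bigl (fun q => [forall i, J i ==> P i q])) => [->|q]; last by apply: eq_forallb => i; rewrite Pp.
rewrite [RHS]big_mkcond; apply: eq_bigr => i _; case: (J i) => //=.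
have [H _] := sum_pair_law (S := S) HI ua0 uab i predT; apply: etrans H _.
by rewrite (_ : [set w | _] = setT) ?prbT//; apply/seteqP.
Qed.

Theorem construction z m (e : R) :
  coupled (start_trace R h f z m) (zeta (S := S) Q0 I ua ub) (@sandwich PT) e ->
  exists (d1 : measure_display) (Omega1 : measurableType d1)
    (Q1 : probability Omega1 R)
    (X : {mfun Omega1 >-> trajectory E})
    (Iminus Iplus : 'I_k -> {mfun Omega1 >-> configuration Z}),
  [/\ forall G, measurable G -> Q1 (X @^-1` G) = qz_walk R z G,
      independent_family Q1
        (fun i w => (Defs.trace (Iminus i w) (S i), Defs.trace (Iplus i w) (S i))),
      forall i,
        same_law
          Q1 (fun w => (Defs.trace (Iminus i w) (S i), Defs.trace (Iplus i w) (S i)))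
          Q0 (fun w => (Defs.trace (I ua w) (S i), Defs.trace (I ub w) (S i))) &
      let walk_trace i w : set (lattice int d) :=
        [set y | y \in S i /\ visited_departure R m (X w) (project N y + x i)] in
      let F := [set w | forall i,
        (Defs.trace (Iminus i w) (S i) : set _) `<=` walk_trace i w /\
        walk_trace i w `<=` Defs.trace (Iplus i w) (S i)] in
      (Q1 (~` F) <= e%:E)%E].
Proof.
move=> cpl; have NT0 : 0 < NT := NT_gt0 R d N_gt1.
pose P (t : T) : probability (trajectory E) R := srw R ((t, z) : E).
pose p (t : T) : R := NT^-1.
have p0 t : 0 <= p t by rewrite invr_ge0 ltW.
have p1 : \sum_t p t = 1 by rewrite sumr_const -[LHS]mulr_natl (card_torus R d N_gt1) mulfV// gt_eqF.
have mW v : measurable ([set w | Wtr h f m w = v] : set (trajectory E)).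
  exact: (measurable_Wtr _ _ m (fun W => W = v)).
have muE : start_trace R h f z m = (fun v => \sum_t p t * prb (P t) [set w | Wtr h f m w = v]).
  by apply/funext => v; rewrite /start_trace /slice_mean mulr_sumr.
rewrite muE in cpl.
have [Q1 [Q1X Q1q Q1e]] := glue p0 p1 mW (none PT) cpl.
have mcfg i (A : nat -> V) : measurable_fun setT (fun w : trajectory E * nat => block_config i (A w.2)).
  have H : measurable_fun setT (fun n : nat => block_config i (A n)) by move=> _ Y _.
  exact: (measurableT_comp H measurable_snd).
pose Im i : {mfun (trajectory E * nat)%type >-> configuration Z} :=
  @mfun_Sub _ _ (trajectory E * nat)%type (configuration Z) _ (mem_set (mcfg i (fun n => (decode (none PT) n).1))).
pose Ip i : {mfun (trajectory E * nat)%type >-> configuration Z} :=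
  @mfun_Sub _ _ (trajectory E * nat)%type (configuration Z) _ (mem_set (mcfg i (fun n => (decode (none PT) n).2))).
pose X : {mfun (trajectory E * nat)%type >-> trajectory E} :=
  @mfun_Sub _ _ (trajectory E * nat)%type (trajectory E) fst (mem_set measurable_fst).
exists _, _, Q1, X, Im, Ip.
have lawE (G : set (configuration Z * configuration Z)) i :
    Q1 [set w | G (traces i (decode (none PT) w.2))] = (\sum_(q | `[< G (traces i q) >]) pair_law Q0 I ua ub i q)%:E.
  rewrite (_ : [set w | _] = [set w | [forall j, pred1 i j ==> `[< G (traces j (decode (none PT) w.2)) >] ] ]).
    rewrite (Q1q (fun q => [forall j, pred1 i j ==> `[< G (traces j q) >] ])).
    rewrite (zeta_marginal (pred1 i) (P := fun j q => `[< G (traces j q) >])) => [|j q]; last by rewrite traces_part.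
    by rewrite big_pred1_eq.
  apply/seteqP; split => w /=.
    by move=> Gw; apply/forallP => j; apply/implyP => /eqP ->; exact: asboolT.
  by move=> /forallP/(_ i)/implyP/(_ (eqxx _)) /asboolW.
split.
- move=> G mG; rewrite (Q1X G mG) /qz_walk -sumEFin; apply: eq_bigr => t _.
  by rewrite EFinM; congr (_ * _)%E; apply/esym/prbE.
- move=> J G mG.
  rewrite (eq_bigr (fun i => (\sum_(q | `[< G i (traces i q) >]) pair_law Q0 I ua ub i q)%:E)) => [|i _]; last exact: lawE.
  rewrite prodEFin -(zeta_marginal (mem J) (P := fun i q => `[< G i (traces i q) >])) => [|j q]; last by rewrite traces_part.
  rewrite -(Q1q (fun q => [forall i, mem J i ==> `[< G i (traces i q) >] ])); congr (Q1 _); apply/seteqP; split => w /=.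
    by move=> H; apply/forallP => i; apply/implyP => iJ; apply: asboolT; exact: H.
  by move=> /forallP H i iJ; have /implyP/(_ iJ)/asboolW := H i.
- move=> i G mG; apply: etrans (lawE G i) _.
  have [E1 mE] := sum_pair_law HI ua0 uab i (fun q => `[< G (traces i q) >]).
  rewrite E1 -(prbE _ mE); congr (Q0 _); apply/seteqP; split => w /=.
    by move=> /asboolW; rewrite traces_pair.
  by move=> Gw; apply: asboolT; rewrite traces_pair.
move=> walk_trace FF; apply: le_trans Q1e; rewrite le_eqVlt; apply/orP; left; apply/eqP.
congr (Q1 _); rewrite -[RHS]setCK; congr (~` _); apply/seteqP.
have Wv w i (y : S i) : (Tagged F y \in Wtr h f m w) <-> visited_departure R m w (project N (val y) + x i).
  by rewrite inE; split => [/asboolW|/asboolT].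
split=> -[w n] /=; set q := decode (none PT) n.
  move=> H /negP; apply; apply/andP; split; apply/fintype.subsetP => -[i y] yq.
    have [H1 _] := H i; have [|_ /Wv//] := H1 (val y); split; last exact: valP.
    by exists y => //; rewrite inE.
  have [_ H2] := H i; have [[y0 /val_inj <- +] _] := H2 (val y) (conj (valP y) ((Wv w i y).1 yq)).
  by rewrite inE.
move=> /negP/negPn/andP[/fintype.subsetP s1 /fintype.subsetP s2] i; split=> y.
  move=> [[y0 <-] + yS]; rewrite inE => /s1/Wv vy; split => //.
move=> [yS vy]; split => //; exists [` yS]%fset => //; rewrite inE; apply: s2; exact/Wv.
Qed.

End construction.

(** * Choice of the parameters *)

Section rates.
Variables (R : realType) (L delta rho : R).
Hypotheses (L1 : 1 <= L) (rho0 : 0 <= rho) (rd : 64 * rho <= delta) (d1 : delta <= 1).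
Local Notation am := (1 - 12 * rho).
Local Notation ap := (1 + 16 * rho).

Definition rate_lower : R := (1 - delta) * L / am.
Definition rate_extra : R := (1 + delta) * L / ap - rate_lower.
Local Notation a := rate_lower.
Local Notation a' := rate_extra.

Let am0 : 0 < am. Proof. by move: rd d1; lra. Qed.
Let ap0 : 0 < ap. Proof. by move: rho0; lra. Qed.
Let L0 : 0 < L. Proof. exact: lt_le_trans L1. Qed.
Let del0 : 0 <= delta. Proof. by move: rd rho0; lra. Qed.

Lemma rate_lower_ge0 : 0 <= a.
Proof. by rewrite divr_ge0 ?(ltW am0)// mulr_ge0 ?subr_ge0 ?(ltW L0). Qed.

Lemma rate_lower_le : a <= (1 - delta / 2) * L.
Proof.
rewrite ler_pdivrMr// mulrAC ler_wpM2r ?(ltW L0)//.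
have : 0 <= (1 - delta / 2) * (delta / 4 - 12 * rho) by rewrite mulr_ge0//; move: rd d1 rho0; lra.
have : 0 <= delta * delta by rewrite mulr_ge0.
move: del0; lra.
Qed.

Lemma rate_total_ge : (1 + delta / 2) * L <= a + a'.
Proof.
rewrite /rate_extra subrKC ler_pdivlMr// mulrAC ler_wpM2r ?(ltW L0)//.
have : 0 <= (1 + delta / 2) * (delta / 4 - 16 * rho) by rewrite mulr_ge0//; move: rd d1 rho0; lra.
have : 0 <= delta * (1 - delta) by rewrite mulr_ge0 ?subr_ge0.
move: del0; lra.
Qed.

Lemma rate_extra_ge0 : 0 <= a'.
Proof.
have := rate_total_ge; have := rate_lower_le.
have : 0 <= delta * L by rewrite mulr_ge0 ?(ltW L0).
lra.
Qed.

Local Notation theta := (delta / 8).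

Lemma expR_quadratic : expR theta <= 1 + theta + 2 * theta ^+ 2.
Proof.
have t0 : 0 <= theta by rewrite divr_ge0.
have t8 : theta <= 8^-1 by rewrite ler_pdivrMr// mulVf.
have := expR_ge1Dx (- theta); rewrite expRN => H.
have e0 := expR_gt0 theta.
have : expR theta * (1 - theta) <= 1 by rewrite mulrC -ler_pdivlMr// mul1r.
have : 0 <= expR theta * theta ^+ 2 * (1 - 2 * theta).
  by rewrite mulr_ge0//; [rewrite mulr_ge0 ?(ltW e0)// exprn_ge0|lra].
have : 0 <= (1 + theta + 2 * theta ^+ 2) * (1 - expR theta * (1 - theta)).
  rewrite mulr_ge0//; first by have : 0 <= theta ^+ 2; [exact: exprn_ge0|lra].
  by rewrite subr_ge0 mulrC -ler_pdivlMr// mul1r.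
have -> : (1 + theta + 2 * theta ^+ 2) * (1 - expR theta * (1 - theta)) =
  (1 + theta + 2 * theta ^+ 2) - expR theta - expR theta * theta ^+ 2 * (1 - 2 * theta) by ring.
lra.
Qed.

Lemma expRN_quadratic : expR (- theta) <= 1 - theta + theta ^+ 2.
Proof.
have t0 : 0 <= theta by rewrite divr_ge0.
have := expR_ge1Dx theta => H; have e0 := expR_gt0 theta.
rewrite expRN -[leLHS]mul1r ler_pdivrMr//.
have q0 : 0 <= 1 - theta + theta ^+ 2.
  have : 0 <= theta ^+ 2 by exact: exprn_ge0.
  by move: d1; lra.
apply: le_trans (ler_wpM2l q0 H).
have -> : (1 - theta + theta ^+ 2) * (1 + theta) = 1 + theta ^+ 3 by ring.
by rewrite lerDl exprn_ge0.
Qed.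

Lemma upper_tail m : L - 1 <= m%:R ->
  expR (a * (expR theta - 1)) / expR theta ^+ m <= expR (1 - L * delta ^+ 2 / 32).
Proof.
move=> mL; rewrite -expRM_natl -expRN -expRD ler_expR.
have t0 : 0 <= theta by rewrite divr_ge0.
have H1 : a * (expR theta - 1) <= (1 - delta / 2) * L * (theta + 2 * theta ^+ 2).
  rewrite ler_pM ?rate_lower_ge0 ?rate_lower_le//; first by have := expR_ge1Dx theta; lra.
  by have := expR_quadratic; lra.
have H2 : (L - 1) * theta <= m%:R * theta by rewrite ler_wpM2r.
have H3 : theta <= 1 by move: d1; lra.
have H4 : 0 <= L * delta * theta ^+ 2 by rewrite !mulr_ge0 ?exprn_ge0 ?(ltW L0).
have -> : L * delta ^+ 2 / 32 = 2 * (L * theta ^+ 2) by field.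
have E1 : (1 - delta / 2) * L * (theta + 2 * theta ^+ 2) - (L - 1) * theta =
  theta - 2 * (L * theta ^+ 2) - L * delta * theta ^+ 2 by field.
by move: H1 H2 H3 H4 E1; lra.
Qed.

Lemma lower_tail m : m%:R <= L ->
  expR ((a + a') * (expR (- theta) - 1)) / expR (- theta) ^+ m <= expR (1 - L * delta ^+ 2 / 32).
Proof.
move=> mL; rewrite -expRM_natl -expRN -expRD ler_expR.
have t0 : 0 <= theta by rewrite divr_ge0.
have t8 : theta <= 8^-1 by rewrite ler_pdivrMr// mulVf.
have q0 : 0 <= theta - theta ^+ 2.
  by rewrite expr2 -{1}[theta]mulr1 -mulrBr mulr_ge0// subr_ge0; lra.
have H1 : (1 + delta / 2) * L * (theta - theta ^+ 2) <= (a + a') * (1 - expR (- theta)).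
  rewrite ler_pM ?rate_total_ge//; first by rewrite mulr_ge0 ?(ltW L0)//; move: del0; lra.
  by have := expRN_quadratic; lra.
have H2 : m%:R * theta <= L * theta by rewrite ler_wpM2r.
have H4 : L * delta * theta ^+ 2 <= L * theta ^+ 2.
  by rewrite ler_wpM2r ?exprn_ge0// ler_piMr// ltW.
have -> : L * delta ^+ 2 / 32 = 2 * (L * theta ^+ 2) by field.
have E1 : (1 + delta / 2) * L * (theta - theta ^+ 2) =
  L * theta + 3 * (L * theta ^+ 2) - L * delta * theta ^+ 2 / 2 by field.
have H5 : 0 <= L * theta ^+ 2 by rewrite mulr_ge0 ?exprn_ge0 ?(ltW L0).
have -> : (a + a') * (expR (- theta) - 1) = - ((a + a') * (1 - expR (- theta))) by ring.
rewrite mulrN opprK.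
by move: H1 H2 H4 E1 H5; lra.
Qed.

End rates.

Section fixed_scale.
Variables (R : realType) (d N h : nat).
Hypotheses (N_gt1 : (1 < N)%N) (d_gt0 : (0 < d)%N) (Nh : (N < h)%N).
Local Notation Z := (lattice int d).
Local Notation E := (lattice 'Z_N d).
Local Notation NT := (N%:R ^+ d : R).
Local Notation invKN := (d.+1%:R * (h - N)%N%:R / NT : R).
Local Notation rho := (N%:R / h%:R : R).
Local Notation lam := (decay R d N).
Variables (k : nat) (S : 'I_k -> {fset Z}) (x : 'I_k -> E).
Local Notation F := (fun i => S i : finType).
Local Notation PT := {i : 'I_k & S i}.
Local Notation V := {set PT}.
Local Notation f := (point x : PT -> E).
Hypothesis point_inj : injective f.
Hypothesis point_height : forall p, (`|(f p).2| < N)%N.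
Hypothesis rho16 : rho <= 16^-1.
Hypothesis capture_small : forall i (w : Z), (forall j, (`|w.1 0%R j| <= N)%N) ->
  (N < 4 * `|w.2|)%N -> ~ dead_cyl h (x i).2 w -> capture R (dead_cyl h (x i).2) (@T_cyl d (S i) N) w <= rho.
Hypothesis x_height : forall i, (`|(x i).2|%N.*2 <= N)%N.
Variable g : forall i, {set S i} -> R.
Arguments g : clear implicits.
Local Notation tau i B := (trace_weight R set0 (@T_full d (S i)) B).
Hypothesis g_bounds : forall i (B : {set S i}),
  [/\ 0 <= g i B,
      trace_weight R (dead_cyl h (x i).2) (@T_cyl d (S i) N) B <= (1 + rho) * tau i B + g i B &
      tau i B <= (1 + rho) * trace_weight R (dead_cyl h (x i).2) (@T_cyl d (S i) N) B + g i B].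
Hypothesis mix : 3 * NT ^+ 2 * lam ^+ (h - N) <= rho.
Variable L : nat.
Hypotheses (NL : (2 * N <= L)%N) (Lh : (2 * L <= h)%N) (mixL : lam ^+ (L - N) <= (16 * NT)^-1).
Hypothesis S_neq0 : forall i, S i != fset0.
Hypothesis esc : forall i (y : S i), escape R set0 (@T_full d (S i)) y <=
  (1 + rho) * escape R (dead_cyl h (x i).2) (@T_cyl d (S i) N) y.
Variables (d0 : measure_display) (Omega0 : measurableType d0) (Q0 : probability Omega0 R).
Variable I : R -> Omega0 -> configuration Z.
Hypothesis HI : is_interlacement Q0 I.
Variables (u delta : R) (z : int).
Hypothesis u1 : 1 <= u / invKN.
Hypotheses (rd : 64 * rho <= delta) (d1 : delta <= 1).
Hypothesis zN : (`|z| <= N)%N.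
Local Notation ell := (u / invKN).
Local Notation sg := (block_weight (weight R N h (S := S))).

Let NT0 : 0 < NT. Proof. exact: NT_gt0. Qed.
Let inv0 : 0 < invKN.
Proof. by rewrite divr_gt0// mulr_gt0 ?ltr0n ?subn_gt0. Qed.
Let rho0 : 0 <= rho. Proof. exact: divr_ge0. Qed.
Let rho8 : rho <= 8^-1. Proof. by move: rho16; lra. Qed.
Let del0 : 0 <= delta. Proof. by move: rd rho0; lra. Qed.
Let uE : u = ell * invKN. Proof. by rewrite divfK// gt_eqF. Qed.
Let u0 : 0 <= u. Proof. by rewrite uE mulr_ge0 ?(ltW inv0)// (le_trans _ u1). Qed.

Lemma start_trace_law m : is_law (start_trace R h f z m).
Proof.
have pr0 y B : 0 <= Submission.pr R ((None, false) : direction d) (@step 'Z_N d) y [set w | Wtr h f m w = B].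
  exact: prb_ge0.
split=> [B|].
  by rewrite /start_trace /slice_mean mulr_ge0 ?invr_ge0 ?(ltW NT0)// sumr_ge0.
rewrite /start_trace /slice_mean -mulr_sumr exchange_big /=.
rewrite (eq_bigr (fun=> 1)) => [|t _].
  by rewrite sumr_const (card_torus R d N_gt1) mulVf// gt_eqF.
have mW B : measurable ([set w | Wtr h f m w = B] : set (trajectory E)) by exact: (measurable_Wtr _ _ m (fun W => W = B)).
rewrite -(pr_setT R (None, false) (@step 'Z_N d) (t, z)) {2}/Submission.pr.
rewrite (@prb_fin _ _ (trajectory E) _ V (Wtr h f m) _ measurableT mW).
by apply: eq_bigr => B _; rewrite setTI.
Qed.

Let sum_out (A : V) : \sum_(v : V | ~~ (v \subset A)) sg v = invKN * \sum_i weight_out R (res i A).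
Proof.
rewrite block_weight_sum mulr_sumr; apply: eq_bigr => i _.
rewrite /weight_out /weight mulr_sumr; apply: eq_bigl => B.
have -> : (emb (F := F) B \subset A) = (B \subset res i A).
  apply/fintype.subsetP/fintype.subsetP => H.
    by move=> y yB; rewrite inE; apply: H; apply/imsetP; exists y.
  by move=> p /imsetP[y /H + ->]; rewrite inE.
by have [->|] := eqVneq B finset.set0; rewrite //= finset.sub0set.
Qed.

Theorem fixed_scale m : ell - 1 <= m.+1%:R -> m.+1%:R <= ell ->
  coupled (start_trace R h f z m.+1) (zeta (S := S) Q0 I (u * (1 - delta)) (u * (1 + delta))) (@sandwich PT)
    (48 * u * (pair_energy R h S x + \sum_i \sum_B g i B) + 3 * expR (1 - ell * delta ^+ 2 / 32))
  \/ 1 <= 3072 * (invKN * pair_energy R h S x).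
Proof.
move=> m1 m2.
have [dense|sparse] := ltP 4^-1 (\sum_(v | v != finset.set0) sg v).
  right; exact: (dense_energy N_gt1 d_gt0 Nh point_inj point_height rho8 capture_small x_height NL Lh mixL S_neq0 esc).
left; have ua0 : 0 <= u * (1 - delta) by rewrite mulr_ge0 ?subr_ge0.
have uab : u * (1 - delta) <= u * (1 + delta) by rewrite ler_wpM2l//; move: del0; lra.
have am0 : 0 <= 1 - 12 * rho by move: rho16; lra.
have amp : 1 - 12 * rho <= 1 + 16 * rho by move: rho0; lra.
have sg0 v : 0 <= sg v by apply: block_weight_ge0 => i B; exact: weight_ge0.
have ap1 : (1 + 16 * rho) * (\sum_(v | v != finset.set0) sg v) <= 1.
  have s0 : 0 <= \sum_(v | v != finset.set0) sg v by exact: sumr_ge0.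
  apply: (@le_trans _ _ (2 * 4^-1)); last by lra.
  by apply: ler_pM => //; move: rho0 rho16; lra.
have th0 : 0 <= delta / 8 by rewrite divr_ge0.
have x1 : 1 <= expR (delta / 8) by apply: le_trans (expR_ge1Dx _); rewrite lerDl.
have y1 : expR (- (delta / 8)) <= 1 by rewrite expRN invf_le1// expR_gt0.
have zd q0 : down_sum (zeta (S := S) Q0 I (u * (1 - delta)) (u * (1 + delta))) q0 =
    expR (rate_lower ell delta rho * (down_sum (slot sg (1 - 12 * rho) (1 + 16 * rho)) q0 - 1)) *
    expR (rate_extra ell delta rho * (down_sum (slot sg 0 (1 + 16 * rho)) q0 - 1)).
  rewrite (zeta_down HI ua0 uab) !down_sum_slot !sum_out -!expRD; congr expR.
  set X := \sum_i _; set Y := \sum_i _; set W1 := invKN * _; set W2 := invKN * _.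
  have e1 : rate_lower ell delta rho * (1 - 12 * rho) = (1 - delta) * ell.
    by rewrite /rate_lower divfK// gt_eqF//; move: rho16; lra.
  have e2 : (rate_lower ell delta rho + rate_extra ell delta rho) * (1 + 16 * rho) = (1 + delta) * ell.
    by rewrite /rate_extra subrKC divfK// gt_eqF//; move: rho0; lra.
  have w1 : ell * W1 = u * X by rewrite {2}uE /W1 mulrA.
  have w2 : ell * W2 = u * Y by rewrite {2}uE /W2 mulrA.
  have -> : - (u * (1 - delta) * X) - (u * (1 + delta) - u * (1 - delta)) * Y =
    - ((1 - delta) * (ell * W1)) - 2 * delta * (ell * W2) by rewrite w1 w2; ring.
  set r1 := rate_lower _ _ _ in e1 e2 *; set r2 := rate_extra _ _ _ in e2 *.
  have -> : r1 * (1 - (1 - 12 * rho) * W1 - (1 + 16 * rho - (1 - 12 * rho)) * W2 - 1) +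
      r2 * (1 - 0 * W1 - (1 + 16 * rho - 0) * W2 - 1) =
    - (r1 * (1 - 12 * rho)) * W1 - ((r1 + r2) * (1 + 16 * rho) - r1 * (1 - 12 * rho)) * W2 by ring.
  by rewrite e1 e2; ring.
have [_ cpl] := walk_coupled N_gt1 Nh point_height sg0 (rim_err_ge0 N_gt1 g_bounds)
  (rim_err_sum N_gt1 d_gt0 Nh point_inj point_height rho8 capture_small x_height g_bounds)
  am0 amp ap1
  (edge_approx N_gt1 d_gt0 Nh point_inj point_height rho8 capture_small x_height g_bounds mix)
  (first_approx N_gt1 d_gt0 Nh point_inj point_height rho8 capture_small x_height g_bounds)
  zN (leq_trans NL (leq_trans (leq_pmull L (isT : (0 < 2)%N)) Lh))
  (rate_lower_ge0 u1 rd d1) (rate_extra_ge0 u1 rho0 rd d1) (zeta_law S HI ua0 uab) zd m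
  x1 (expR_gt0 _) y1 (expR_gt0 (1 - ell * delta ^+ 2 / 32)).
apply: coupled_le cpl; apply: lerD; last first.
  have t1 := upper_tail u1 rho0 rd d1 m1; have t2 := lower_tail u1 rho0 rd d1 m2.
  by move: t1 t2; set t := expR (1 - _); lra.
have pe0 : 0 <= pair_energy R h S x + \sum_i \sum_B g i B.
  rewrite addr_ge0//.
    exact: (pair_energy_ge0 R h S x).
  by apply: sumr_ge0 => i _; apply: sumr_ge0 => B _; have [] := g_bounds B.
rewrite /error_mass; set p := pair_energy _ _ _ _ + _ in pe0 *.
have -> : m.+1%:R * (2 * (24 * (invKN * p))) = 48 * (m.+1%:R * invKN * p) by ring.
rewrite -[48 * u * p]mulrA ler_wpM2l// ler_wpM2r// [leRHS]uE ler_wpM2r// ltW.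
Qed.

End fixed_scale.

Section asymptotics.
Variable R : realType.

Lemma near_ln (C : R) : \forall N \near \oo, C <= ln N%:R.
Proof.
have : \forall N \near \oo, expR C <= N%:R :> R by exact: nbhs_infty_ger.
apply: filterS => N CN; rewrite -(expRK C) ler_ln ?posrE ?expR_gt0//.
exact: lt_le_trans (expR_gt0 _) CN.
Qed.

Lemma expR_ln_nat (N P : nat) : (0 < N)%N -> expR (- (P%:R * ln N%:R)) = (N%:R ^+ P)^-1 :> R.
Proof. by move=> N0; rewrite expRN expRM_natl lnK// posrE ltr0n. Qed.

Lemma decay_powR (d N P n : nat) : (0 < d)%N -> (1 < N)%N ->
  (8 * d * P)%:R <= ln N%:R :> R -> N%:R * ln N%:R ^+ 2 / 4 <= n%:R :> R ->
  decay R d N ^+ n <= (N%:R ^+ P)^-1.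
Proof.
move=> d0 N1 lP ln4; have N0 : (0 < N)%N by exact: ltnW.
have dR : 1 <= d%:R :> R by rewrite ler1n.
have NR : 1 <= N%:R :> R by rewrite ler1n.
have dN0 : 0 < d%:R * N%:R :> R by rewrite mulr_gt0//; lra.
have dN1 : 1 <= d%:R * N%:R :> R by rewrite -natrM ler1n muln_gt0 d0.
set l := ln N%:R in lP ln4 *.
have l0 : 0 <= l by apply: le_trans lP.
have le1 : decay R d N <= expR (- (2 * (d%:R * N%:R))^-1).
  apply: le_trans (expR_ge1Dx _).
  have -> : decay R d N = 1 - (d%:R * N%:R + 1)^-1.
    rewrite /decay natrM; set q := d%:R * N%:R in dN0 *.
    have q1 : q + 1 != 0 by rewrite gt_eqF// addr_gt0.
    rewrite (_ : 1 + q^-1 = (q + 1) / q); last by rewrite mulrDl mulfV ?gt_eqF// mul1r.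
    by rewrite invf_div -{1}(addrK 1 q) mulrBl mulfV// mul1r.
  by rewrite lerD2l lerN2 lef_pV2 ?posrE//; lra.
apply: le_trans (lerXn2r n _ _ le1) _; rewrite ?nnegrE ?expR_ge0//.
  exact/ltW/decay_gt0.
rewrite -expRM_natl -expR_ln_nat// ler_expR mulrN lerN2 -/l ler_pdivlMr; last by rewrite mulr_gt0.
apply: le_trans ln4; rewrite -(ler_pM2r (ltr0n R 4)) divfK//.
have H : (8 * d * P)%:R * l <= l * l by rewrite ler_wpM2r.
have := ler_wpM2r (ler0n R N) H; rewrite !natrM expr2.
by move: (N%:R : R) (d%:R : R) (P%:R : R) => a b c; lra.
Qed.

Lemma tail_small (N P : nat) (l delta r : R) : (3 <= N)%N -> (P + 1)%:R <= ln N%:R :> R -> 1 <= ln N%:R :> R ->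
  ln N%:R ^+ 6 <= l -> (2 * ln N%:R ^+ 2)^-1 <= r -> 64 * r <= delta ->
  3 * expR (1 - l * delta ^+ 2 / 32) <= (N%:R ^+ P)^-1.
Proof.
move=> N3 lP l1 l6 rl rd; set q := ln N%:R in lP l1 l6 rl *.
have q0 : 0 < q by exact: lt_le_trans l1.
have N0 : (0 < N)%N by exact: leq_trans N3.
have d32 : 32 / q ^+ 2 <= delta.
  apply: le_trans rd; apply: le_trans (ler_wpM2l _ rl) => //.
  by rewrite invfM mulrA; lra.
have key : 32 * q ^+ 2 <= l * delta ^+ 2 / 32.
  rewrite ler_pdivlMr//.
  have -> : 32 * q ^+ 2 * 32 = q ^+ 6 * (32 / q ^+ 2) ^+ 2 by field; rewrite gt_eqF.
  have p0 : 0 <= 32 / q ^+ 2 by rewrite divr_ge0// exprn_ge0// ltW.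
  by apply: ler_pM => //; [exact/exprn_ge0/ltW|exact: exprn_ge0|rewrite lerXn2r ?nnegrE// (le_trans p0)].
have e1 : expR (1 - l * delta ^+ 2 / 32) <= (N%:R ^+ (P + 1))^-1.
  rewrite -expR_ln_nat// ler_expR -/q.
  have : (P + 1)%:R * q <= q * q by rewrite ler_wpM2r// ltW.
  have : 1 <= q * q by rewrite -expr2 exprn_ege1.
  by move: key; rewrite expr2; lra.
apply: le_trans (ler_wpM2l _ e1) _ => //.
have NP : 0 < N%:R ^+ P :> R by rewrite exprn_gt0// ltr0n.
rewrite exprD expr1 invfM mulrCA ler_piMr ?invr_ge0 ?(ltW NP)//.
by rewrite ler_pdivrMr ?ltr0n// mul1r ler_nat.
Qed.

End asymptotics.

Section scale_conditions.
Variables (R : realType) (d : nat) (eps : R).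
Hypotheses (d_ge2 : (2 <= d)%N) (eps0 : 0 < eps) (eps1 : eps < 1).

Record good_scale (N : nat) : Prop := GoodScale {
  gs_large : (216 * d.+1 <= N)%N ;
  gs_ln : (8 * d * (4 * d + 3))%:R <= ln N%:R :> R ;
  gs_ln_le : 2 + ln N%:R ^+ 2 <= N%:R :> R ;
  gs_ball : ((Num.truncn (N%:R `^ (1 - eps) : R)).+1 + (Num.truncn (N%:R `^ (1 - eps) : R)).+1 <= N)%N ;
  gs_trace : forall (S : {fset lattice int d}) (zh : int),
    (forall y, y \in S -> linf_ball (N%:R `^ (1 - eps)) y) -> (`|zh|%N.*2 <= N)%N ->
    let h := hN R N in let eta := N%:R / h%:R : R in
    let dead := dead_cyl h zh in let T := @T_cyl d S N in
    ((forall y, escape R dead T y <= (1 + eta) * escape R set0 (@T_full d S) y) /\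
     (forall y, escape R set0 (@T_full d S) y <= (1 + eta) * escape R dead T y)) /\
    (forall x : lattice int d, (forall j, (`|x.1 0%R j| <= N)%N) -> (N < 4 * `|x.2|)%N -> ~ dead x ->
      capture R dead T x <= eta) /\
    exists2 g : {set S} -> R,
      (forall B, [/\ 0 <= g B,
        trace_weight R dead T B <= (1 + eta) * trace_weight R set0 (@T_full d S) B + g B &
        trace_weight R set0 (@T_full d S) B <= (1 + eta) * trace_weight R dead T B + g B]) &
      \sum_B g B <= (N%:R ^+ (3 * d + 1))^-1
}.

Lemma near_good_scale : \forall N \near \oo, good_scale N.
Proof.
near=> N; have N4 : (4 <= N)%N by near: N; exact: nbhs_infty_ge.
split.
- by near: N; exact: nbhs_infty_ge.
- by near: N; exact: near_ln.
- by near: N; have := @near_ln_sqr R 1 ltr01; apply: filterS => N; rewrite powRr1.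
- have N0 : 0 < N%:R :> R by rewrite ltr0n (leq_trans _ N4).
  have p4 : 4 <= N%:R `^ eps by near: N; exact: near_powR.
  have pq : N%:R `^ (1 - eps) * N%:R `^ eps = N%:R :> R.
    by rewrite -powRD ?subrK ?powRr1 ?(ltW N0)// (gt_eqF N0) implybT.
  have p0 : 0 <= N%:R `^ (1 - eps) :> R by exact: powR_ge0.
  have /andP[t1 _] := truncn_itv p0; set t := Num.truncn _ in t1 *.
  have : t%:R * 4 <= N%:R :> R by rewrite -pq ler_pM.
  by rewrite -natrM ler_nat; move: N4; clear; lia.
- by near: N; exact: local_trace.
Unshelve. all: by end_near. Qed.

Variable N : nat.
Hypothesis gN : good_scale N.
Local Notation h := (hN R N).
Local Notation NT := (N%:R ^+ d : R).
Local Notation rho := (N%:R / h%:R : R).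
Local Notation l := (ln N%:R : R).

Lemma gs_d_gt0 : (0 < d)%N. Proof. exact: leq_trans d_ge2. Qed.

Lemma gs_N_ge : (648 <= N)%N.
Proof. by have := gs_large gN; move: d_ge2; clear; lia. Qed.

Lemma gs_N_gt1 : (1 < N)%N. Proof. exact: leq_trans gs_N_ge. Qed.

Lemma gs_ln_ge : 176 <= l.
Proof.
apply: le_trans (gs_ln gN); rewrite (ler_nat R 176); move: d_ge2; clear => d2.
by have := leq_mul (leq_mul (leqnn 8) d2) (leq_add (leq_mul (leqnn 4) d2) (leqnn 3)).
Qed.

Let Nr : 648 <= N%:R :> R. Proof. by rewrite (ler_nat R 648) gs_N_ge. Qed.

Let l2 : 16 <= l ^+ 2.
Proof.
have g := gs_ln_ge; have : 176 * l <= l * l by rewrite ler_wpM2r//; lra.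
by rewrite expr2; lra.
Qed.

Lemma gs_h_bounds : N%:R * (1 + l ^+ 2) <= h%:R :> R /\ h%:R <= N%:R * N%:R :> R.
Proof.
have [lb [ub _]] := hN_bounds R N; split.
  have -> : N%:R * (1 + l ^+ 2) = N%:R * (2 + l ^+ 2) - N%:R by ring.
  by apply: le_trans (ltW lb); rewrite lerD2l lerN2; move: Nr; lra.
apply: le_trans ub _; rewrite ler_wpM2l//; exact: gs_ln_le gN.
Qed.

Lemma gs_h16 : (16 * N <= h)%N.
Proof.
rewrite -(ler_nat R) natrM mulrC; have [lb _] := gs_h_bounds; apply: le_trans lb.
by rewrite ler_wpM2l//; move: l2; lra.
Qed.

Lemma gs_Nh : (N < h)%N.
Proof. by have := gs_h16; have := gs_N_ge; clear; lia. Qed.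

Let h0 : 0 < h%:R :> R. Proof. by rewrite ltr0n (leq_ltn_trans _ gs_Nh). Qed.

Lemma gs_rho : rho <= 16^-1.
Proof.
by rewrite ler_pdivrMr// mulrC ler_pdivlMr// mulrC -natrM ler_nat gs_h16.
Qed.

Lemma gs_rho_ge : N%:R^-1 <= rho /\ (2 * l ^+ 2)^-1 <= rho.
Proof.
have N0 : 0 < N%:R :> R by move: Nr; lra.
split; rewrite -[leLHS]mul1r.
  by rewrite ler_pdivrMr// mulrAC ler_pdivlMr// mul1r; have [_] := gs_h_bounds.
rewrite ler_pdivrMr; last by rewrite mulr_gt0// (lt_le_trans _ l2).
rewrite mulrAC ler_pdivlMr// mul1r; have [_ [ub _]] := hN_bounds R N; apply: le_trans ub _.
by rewrite ler_wpM2l//; move: l2; lra.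
Qed.

Lemma gs_decay P n : (P <= 4 * d + 3)%N -> N%:R * l ^+ 2 / 4 <= n%:R :> R ->
  decay R d N ^+ n <= (N%:R ^+ P)^-1.
Proof.
move=> PP; apply: decay_powR; [exact: gs_d_gt0|exact: gs_N_gt1|].
by apply: le_trans (gs_ln gN); rewrite ler_nat leq_mul.
Qed.

Lemma gs_mix : 3 * NT ^+ 2 * decay R d N ^+ (h - N) <= rho.
Proof.
have N0 : 0 < N%:R :> R by move: Nr; lra.
have [lb _] := gs_h_bounds.
have H : decay R d N ^+ (h - N) <= (N%:R ^+ (2 * d + 2))^-1.
  apply: gs_decay; first by clear; lia.
  rewrite natrB ?(ltnW gs_Nh)//.
  have q0 : 0 <= N%:R * l ^+ 2 by rewrite mulr_ge0// (le_trans _ l2).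
  by move: lb; rewrite mulrDr mulr1; lra.
have [r1 _] := gs_rho_ge; apply: le_trans r1.
apply: le_trans (ler_wpM2l _ H) _; first by rewrite mulr_ge0// exprn_ge0// exprn_ge0.
have -> : (N%:R ^+ (2 * d + 2))^-1 = (NT ^+ 2)^-1 * (N%:R^-1 * N%:R^-1) :> R.
  by rewrite exprD -exprM [(d * 2)%N]mulnC expr2 invfM invfM.
have a0 : NT ^+ 2 != 0 by rewrite !expf_neq0// gt_eqF.
have aux (b n : R) : b != 0 -> 3 * b * (b^-1 * (n^-1 * n^-1)) = 3 / n * n^-1.
  move=> b0; have -> : 3 * b * (b^-1 * (n^-1 * n^-1)) = b / b * (3 / n * n^-1) by ring.
  by rewrite mulfV// mul1r.
rewrite aux// -[leRHS]mul1r ler_wpM2r ?invr_ge0// ler_pdivrMr// mul1r.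
by rewrite (ler_nat R 3) (leq_trans _ gs_N_ge).
Qed.

Lemma gs_mid : [/\ (2 * N <= h./2)%N, (2 * h./2 <= h)%N & decay R d N ^+ (h./2 - N) <= (16 * NT)^-1].
Proof.
have h2 : (2 * h./2 <= h)%N by rewrite mul2n -[leqRHS]odd_double_half leq_addl.
have N2 : (2 * N <= h./2)%N by have := gs_h16; have := odd_double_half h; have := gs_N_ge; case: odd; clear; lia.
split => //; have N0 : 0 < N%:R :> R by move: Nr; lra.
have H : decay R d N ^+ (h./2 - N) <= (N%:R ^+ (d + 1))^-1.
  apply: gs_decay; first by clear; lia.
  rewrite natrB; last by apply: leq_trans N2; rewrite leq_pmull.
  have hh : h%:R <= 2 * h./2%:R + 1 :> R.
    by rewrite -natrM natr1 ler_nat -[leqLHS]odd_double_half mul2n; case: odd; rewrite /= ?add1n ?add0n ?leqnSn.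
  have [lb _] := gs_h_bounds; have q0 : N%:R * 16 <= N%:R * l ^+ 2 by rewrite ler_wpM2l.
  by move: lb hh Nr; rewrite mulrDr mulr1; lra.
apply: le_trans H _; rewrite exprD expr1 lef_pV2 ?posrE ?mulr_gt0 ?exprn_gt0//.
by rewrite [leRHS]mulrC ler_wpM2r ?exprn_ge0//; move: Nr; lra.
Qed.

End scale_conditions.

Section assembly.
Variables (R : realType) (d : nat) (eps : R).
Hypotheses (d_ge2 : (2 <= d)%N) (eps0 : 0 < eps) (eps1 : eps < 1).
Variable N : nat.
Hypothesis gN : good_scale d eps N.
Local Notation h := (hN R N).
Local Notation Z := (lattice int d).
Local Notation E := (lattice 'Z_N d).
Local Notation NT := (N%:R ^+ d : R).
Local Notation rho := (N%:R / h%:R : R).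
Local Notation invKN := (d.+1%:R * (h - N)%N%:R / NT : R).
Variables (k : nat) (z : int) (delta u : R) (x : 'I_k -> E) (S : 'I_k -> {fset Z}).
Local Notation PT := {i : 'I_k & S i}.
Hypotheses (k1 : (1 <= k)%N) (zN : (`|z| <= N)%N).
Hypotheses (rd : 64 * rho <= delta) (d1 : delta <= 1) (uK : ln N%:R ^+ 6 <= u * KN R d N).
Hypothesis x_half : forall i, `|(x i).2|%:~R <= N%:R / 2 :> R.
Hypothesis S_neq0 : forall i, S i != fset0.
Hypothesis S_ball : forall i y, y \in S i -> linf_ball (N%:R `^ (1 - eps)) y.
Hypothesis S_disj : forall i j, i != j -> [disjoint translate (S i) (x i) & translate (S j) (x j)]%fset.
Variables (d0 : measure_display) (Omega0 : measurableType d0) (Q0 : probability Omega0 R).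
Variable I : R -> Omega0 -> configuration Z.
Hypothesis HI : is_interlacement Q0 I.

Let N_gt1 := gs_N_gt1 d_ge2 gN.
Let d_gt0 := gs_d_gt0 d_ge2.
Let Nh := gs_Nh d_ge2 gN.
Let N0 : 0 < N%:R :> R. Proof. by rewrite ltr0n ltnW. Qed.
Let NT0 : 0 < NT. Proof. exact: NT_gt0. Qed.

Local Notation v := (Num.truncn (N%:R `^ (1 - eps) : R)).

Let S_nrm i (y : S i) : (nrm (val y : Z) <= v)%N.
Proof. by apply: in_linf_ball => //; exact: S_ball (valP y). Qed.

Let x_height i : (`|(x i).2|%N.*2 <= N)%N.
Proof.
have := x_half i; rewrite ler_pdivlMr// -muln2 -(ler_nat R) natrM.
by rewrite -[(`|(x i).2|%N)%:R]/((`|(x i).2|%N : int)%:~R).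
Qed.

Let point_height (p : PT) : (`|(point x p).2| < N)%N.
Proof.
case: p => i y; have := x_height i; have := nrm_coord (val y : Z) None; have := S_nrm y.
have := gs_ball gN; rewrite /point /place /project /coord /=.
by move: (val y).2 (x i).2 (nrm _) v => a b m w; clear; lia.
Qed.

Let point_inj : injective (point x : PT -> E).
Proof.
move=> [i y] [j y'] e; have pK a (w : S a) : point x (Tagged (fun a => S a : finType) w) \in translate (S a) (x a).
  by apply/mem_translate; exists w.
have ij : i = j.
  apply/eqP; apply: contraT => ij; have /fdisjointP/(_ _ (pK i y)) := S_disj ij.
  by rewrite -[point x _]/(point x (Tagged _ y)) in e *; move: (pK j y'); rewrite -e => ->.
subst j; congr (Tagged _ _); apply: val_inj.
have /addIr/(project_eq N_gt1) := e.
exact: (equiv_in_box (gs_ball gN) (S_nrm y) (S_nrm y')).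
Qed.

Let tr i := gs_trace gN (@S_ball i) (x_height i).

Let g i : {set S i} -> R := sval (cid2 (proj2 (proj2 (tr i)))).
Arguments g : clear implicits.

Let g_bounds i (B : {set S i}) :
  [/\ 0 <= g i B,
      trace_weight R (dead_cyl h (x i).2) (@T_cyl d (S i) N) B <=
        (1 + rho) * trace_weight R set0 (@T_full d (S i)) B + g i B &
      trace_weight R set0 (@T_full d (S i)) B <=
        (1 + rho) * trace_weight R (dead_cyl h (x i).2) (@T_cyl d (S i) N) B + g i B].
Proof. exact: (s2valP (cid2 (proj2 (proj2 (tr i)))) B). Qed.

Let g_sum : \sum_i \sum_B g i B <= k%:R * (N%:R ^+ (3 * d + 1))^-1.
Proof.
apply: (@le_trans _ _ (\sum_(i < k) (N%:R ^+ (3 * d + 1))^-1)).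
  by apply: ler_sum => i _; exact: (s2valP' (cid2 (proj2 (proj2 (tr i))))).
by rewrite sumr_const card_ord mulr_natl.
Qed.

Let capture_small i (w : Z) : (forall j, (`|w.1 0%R j| <= N)%N) ->
  (N < 4 * `|w.2|)%N -> ~ dead_cyl h (x i).2 w -> capture R (dead_cyl h (x i).2) (@T_cyl d (S i) N) w <= rho.
Proof. by have [_ [+ _]] := tr i; apply. Qed.

Let esc i (y : S i) : escape R set0 (@T_full d (S i)) y <=
  (1 + rho) * escape R (dead_cyl h (x i).2) (@T_cyl d (S i) N) y.
Proof. by have [[_ +] _] := tr i; apply. Qed.

Let invE : KN R d N = invKN^-1.
Proof. by rewrite /KN invf_div natrB// ltnW. Qed.

Let inv0 : 0 < invKN.
Proof. by rewrite divr_gt0// mulr_gt0 ?ltr0n ?subn_gt0. Qed.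

Local Notation ell := (u / invKN).

Let l1 : 1 <= ln N%:R :> R.
Proof. by apply: le_trans (gs_ln_ge d_ge2 gN); rewrite (ler_nat R 1 176). Qed.

Let u1 : 1 <= ell.
Proof. by rewrite -invE; apply: le_trans uK; rewrite exprn_ege1. Qed.

Let u_inv : invKN <= u.
Proof. by rewrite -[leLHS]mul1r -ler_pdivlMr. Qed.

Let inv_ge : NT^-1 <= invKN.
Proof.
rewrite -[leLHS]mul1r ler_wpM2r ?invr_ge0 ?(ltW NT0)// -natrM ler1n muln_gt0 /= subn_gt0.
exact: Nh.
Qed.

Let u0 : 0 <= u. Proof. exact: le_trans (ltW inv0) u_inv. Qed.

Let rho0 : 0 <= rho. Proof. exact: divr_ge0. Qed.
Let del0 : 0 <= delta. Proof. by apply: le_trans rd; rewrite mulr_ge0. Qed.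

Local Notation energy := (pair_energy R h S x).

Let energy0 : 0 <= energy. Proof. exact: pair_energy_ge0. Qed.

Let tail : 3 * expR (1 - ell * delta ^+ 2 / 32) <= (N%:R ^+ (4 * d + 1))^-1.
Proof.
apply: (@tail_small R N (4 * d + 1) ell delta rho) => //.
- by apply: leq_trans (gs_N_ge d_ge2 gN).
- by apply: le_trans (gs_ln gN); rewrite ler_nat; move: d_gt0; clear; nia.
- by rewrite -invE.
- by have [] := gs_rho_ge d_ge2 gN.
Qed.

Let energy_lb : (1 < k)%N -> (k%:R * (N%:R ^+ (3 * d + 1))^-1 <= energy) /\
  ((N%:R ^+ (4 * d + 1))^-1 <= u * energy).
Proof.
move=> k2; have [NL Lh mixL] := gs_mid d_ge2 gN.
have rho8 : rho <= 8^-1 by apply: le_trans (gs_rho d_ge2 gN) _; rewrite lef_pV2 ?posrE// (ler_nat R 8 16).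
have := pair_energy_lb N_gt1 d_gt0 Nh point_height rho8 capture_small x_height NL Lh mixL S_neq0 k2.
move=> H; have NP n : 0 < N%:R ^+ n :> R by rewrite exprn_gt0.
split.
  rewrite ler_pdivrMr//; apply: le_trans H _.
  have -> : 216 * NT ^+ 2 * (invKN * energy) = 216 * (NT * (d.+1%:R * (h - N)%N%:R)) * energy.
    by field; rewrite gt_eqF.
  rewrite mulrC ler_wpM2l//.
  have hN2 : (h - N)%N%:R <= N%:R * N%:R :> R.
    have [_ hh] := gs_h_bounds d_ge2 gN; apply: le_trans hh; rewrite ler_nat; exact: leq_subr.
  have dN : 216 * d.+1%:R <= N%:R :> R by rewrite -natrM ler_nat; exact: gs_large gN.
  have -> : 216 * (NT * (d.+1%:R * (h - N)%N%:R)) = NT * (216 * d.+1%:R * (h - N)%N%:R) by ring.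
  apply: (@le_trans _ _ (NT * (N%:R * (N%:R * N%:R)))).
    apply: ler_wpM2l; first exact: ltW NT0.
    by apply: ler_pM; [rewrite mulr_ge0 ?ler0n|exact: ler0n|exact: dN|exact: hN2].
  have -> : NT * (N%:R * (N%:R * N%:R)) = N%:R ^+ (d + 3) :> R by rewrite exprD; ring.
  by rewrite ler_weXn2l ?ler1n ?(ltnW N_gt1)//; move: d_ge2; clear; lia.
apply: (@le_trans _ _ (invKN * energy)); last by rewrite ler_wpM2r.
rewrite -[leLHS]mul1r ler_pdivrMr//; apply: (@le_trans _ _ k%:R); first by rewrite ler1n.
apply: le_trans H _; rewrite mulrC ler_wpM2l ?mulr_ge0 ?(ltW inv0)//.
have -> : N%:R ^+ (4 * d + 1) = NT ^+ 2 * (N%:R * NT ^+ 2) :> R.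
  by rewrite -!exprM -exprS -exprD; congr (_ ^+ _); clear; lia.
rewrite mulrC ler_wpM2l ?exprn_ge0 ?(ltW NT0)//.
apply: (@le_trans _ _ N%:R); first by rewrite (ler_nat R 216) (leq_trans _ (gs_N_ge d_ge2 gN)).
by rewrite ler_peMr// -exprM exprn_ege1// ler1n ltnW.
Qed.

Let energy_le : (energy%:E <= \sum_(i < k) \sum_(j < k | j != i)
  mutual_energy R (outer_box R (d := d) (N := N)) (translate (S i) (x i)) (translate (S j) (x j)))%E.
Proof.
have K_in i a : a \in translate (S i) (x i) -> (`|a.2| < N)%N.
  by apply: K_height => y; exact: (point_height (Tagged (fun i => S i : finType) y)).
rewrite /pair_energy -sumEFin; apply: lee_sum => i _; rewrite -sumEFin; apply: lee_sum => j _.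
exact: (energy_ge R N_gt1 d_gt0 Nh (@K_in i) (@K_in j)).
Qed.

Variable cst : R.
Hypothesis cst_ge : 3072 <= cst.

Lemma assembled : exists2 e : R,
  coupled (start_trace R h (point x : PT -> E) z (Num.truncn (u * KN R d N)))
    (zeta (S := S) Q0 I (u * (1 - delta)) (u * (1 + delta))) (@sandwich PT) e &
  (e%:E <= if k == 1%N then (cst * u * (N%:R ^+ (3 * d + 1))^-1)%:E
       else (cst * u)%:E *
            \sum_(i < k) \sum_(j < k | j != i)
              mutual_energy R (outer_box R (d := d) (N := N))
                (translate (S i) (x i)) (translate (S j) (x j)))%E.
Proof.
have ell0 : 0 <= ell by exact: le_trans u1.
have /andP[m1 m2] := truncn_itv ell0; rewrite invE.
case: (Num.truncn ell) m1 m2 => [|m] m1 m2; first by move: m2; rewrite ltNge u1.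
have m3 : ell - 1 <= m.+1%:R by rewrite lerBlDr natr1 ltW.
have [NL Lh mixL] := gs_mid d_ge2 gN.
have uab : u * (1 - delta) <= u * (1 + delta) by rewrite ler_wpM2l// lerD2l (ge0_cp del0).2.
have ua0 : 0 <= u * (1 - delta) by rewrite mulr_ge0 ?subr_ge0.
have energy1 : k = 1%N -> energy = 0.
  move=> k1'; rewrite /pair_energy big1// => i _; rewrite big1// => j.
  have one n : n = 1%N -> forall a b : 'I_n, a = b by move=> -> a b; rewrite !ord1.
  by rewrite (one _ k1' j i) eqxx.
have cst0 : 0 <= cst by apply: le_trans cst_ge; exact: ler0n.
have NP n : 0 < N%:R ^+ n :> R by rewrite exprn_gt0.
have rhs e : (1 < k)%N -> e <= cst * u * energy ->
    (e%:E <= (cst * u)%:E * \sum_(i < k) \sum_(j < k | j != i)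
              mutual_energy R (outer_box R (d := d) (N := N))
                (translate (S i) (x i)) (translate (S j) (x j)))%E.
  move=> k2 ee; apply: (@le_trans _ _ ((cst * u)%:E * energy%:E)%E); first by rewrite -EFinM lee_fin.
  by apply: lee_wpmul2l => //; rewrite lee_fin mulr_ge0.
have [cpl|dense] := fixed_scale N_gt1 d_gt0 Nh point_inj point_height (gs_rho d_ge2 gN) capture_small x_height
  g_bounds (gs_mix d_ge2 gN) NL Lh mixL S_neq0 esc HI u1 rd d1 zN m3 m1.
  eexists; first exact: cpl.
  case: eqP => [k1'|k1']; last first.
    have k2 : (1 < k)%N by move: k1 k1'; clear; lia.
    have [gk tk] := energy_lb k2; apply: rhs => //.
    have G : 48 * u * (energy + \sum_i \sum_B g i B) <= 48 * u * (2 * energy).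
      by rewrite ler_wpM2l ?mulr_ge0// mulr2n mulrDl mul1r lerD2l (le_trans g_sum).
    have T := le_trans tail tk; have P0 : 0 <= u * energy by rewrite mulr_ge0.
    apply: le_trans (lerD G T) _.
    have -> : 48 * u * (2 * energy) + u * energy = 97 * (u * energy) by ring.
    by rewrite -mulrA ler_wpM2r// (le_trans _ cst_ge)// (ler_nat R 97 3072).
  rewrite lee_fin energy1// add0r.
  have kR : k%:R = 1 :> R by rewrite k1'.
  have gs := g_sum; rewrite kR mul1r in gs.
  have T : (N%:R ^+ (4 * d + 1))^-1 <= u * (N%:R ^+ (3 * d + 1))^-1.
    have -> : N%:R ^+ (4 * d + 1) = NT * N%:R ^+ (3 * d + 1) :> R.
      by rewrite -exprD; congr (_ ^+ _); clear; lia.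
    by rewrite invfM ler_wpM2r ?invr_ge0 ?(ltW (NP _))// (le_trans inv_ge).
  have G : 48 * u * (\sum_i \sum_B g i B) <= 48 * u * (N%:R ^+ (3 * d + 1))^-1.
    by rewrite ler_wpM2l// mulr_ge0.
  apply: le_trans (lerD G (le_trans tail T)) _.
  set q := (N%:R ^+ _)^-1; have q0 : 0 <= u * q by rewrite mulr_ge0// invr_ge0 ltW.
  have -> : 48 * u * q + u * q = 49 * (u * q) by ring.
  by rewrite -mulrA ler_wpM2r// (le_trans _ cst_ge)// (ler_nat R 49 3072).
have k2 : (1 < k)%N.
  rewrite ltn_neqAle k1 andbT eq_sym; apply/eqP => k1'; move: dense; rewrite energy1// mulr0 mulr0.
  by rewrite ler10.
exists 1; last first.
  rewrite gtn_eqF//; apply: rhs => //; apply: le_trans dense _.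
  have P0 : 0 <= u * energy by rewrite mulr_ge0.
  rewrite -[leRHS]mulrA; apply: ler_pM; rewrite ?ler0n ?(mulr_ge0 (ltW inv0) energy0)//.
  by rewrite ler_wpM2r.
have [a1 a2] := start_trace_law R h N_gt1 S x z m.+1; have [b1 b2] := zeta_law S HI ua0 uab.
exact: coupled_trivial.
Qed.

End assembly.

Theorem theorem4p1 (R : realType) (d : nat) (d_ge2 : (2 <= d)%N) :
  exists c c2 : R, 0 < c /\ 0 < c2 /\
  forall eps : R, 0 < eps -> eps < 1 ->
  exists ceps : R, 0 < ceps /\
  forall (k N : nat) (z : int) (delta u : R)
    (x : 'I_k -> lattice 'Z_N d) (S : 'I_k -> {fset lattice int d})
    (d0 : measure_display) (Omega0 : measurableType d0)
    (Q0 : probability Omega0 R)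
    (I : R -> Omega0 -> configuration (lattice int d)),
  (1 <= k)%N ->
  ceps <= N%:R ->
  (`|z| <= N)%N ->
  c2 * (N%:R / (hN R N)%:R) <= delta -> delta <= 1 ->
  ln N%:R ^+ 6 <= u * KN R d N ->
  (forall i, `|(x i).2|%:~R <= N%:R / 2 :> R) ->
  (forall i, S i != fset0) ->
  (forall i y, y \in S i -> linf_ball (N%:R `^ (1 - eps)) y) ->
  (forall i j, i != j ->
     [disjoint translate (S i) (x i) & translate (S j) (x j)]%fset) ->
  is_interlacement Q0 I ->
  exists (d1 : measure_display) (Omega1 : measurableType d1)
    (Q1 : probability Omega1 R)
    (X : {mfun Omega1 >-> trajectory (lattice 'Z_N d)})
    (Iminus Iplus : 'I_k -> {mfun Omega1 >-> configuration (lattice int d)}),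
  [/\ forall G, measurable G -> Q1 (X @^-1` G) = qz_walk R z G,
      independent_family Q1
        (fun i w => (trace (Iminus i w) (S i), trace (Iplus i w) (S i))),
      forall i,
        same_law
          Q1 (fun w => (trace (Iminus i w) (S i), trace (Iplus i w) (S i)))
          Q0 (fun w => (trace (I (u * (1 - delta)) w) (S i),
                        trace (I (u * (1 + delta)) w) (S i))) &
      let walk_trace i w : set (lattice int d) :=
        [set y | y \in S i /\
          visited_departure R (Num.truncn (u * KN R d N)) (X w)
            (project N y + x i)] in
      let F := [set w | forall i,
        (trace (Iminus i w) (S i) : set _) `<=` walk_trace i w /\
        walk_trace i w `<=` trace (Iplus i w) (S i)] in
      (Q1 (~` F) <=
       if k == 1%N then (c * u * (N%:R ^+ (3 * d + 1))^-1)%:E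
       else (c * u)%:E *
            \sum_(i < k) \sum_(j < k | j != i)
              mutual_energy R (outer_box R (d := d) (N := N))
                (translate (S i) (x i)) (translate (S j) (x j)))%E].
Proof.
have [c cst_ge] : exists c : R, 3072 <= c by exists 3072.
exists c, 64; split; first by apply: lt_le_trans cst_ge; rewrite ltr0n.
split; first by rewrite ltr0n.
move=> eps eps0 eps1.
have [M _ good] := near_good_scale d_ge2 eps0 eps1.
exists M.+1%:R; split => // k N z delta u x S d0 Omega0 Q0 I k1 MN zN rd d1 uK xN S0 Sb Sd HI.
have gN : good_scale d eps N by apply: good => /=; rewrite -(ler_nat R) (le_trans _ MN)// ler_nat.
have [e cpl ee] := assembled d_ge2 eps0 eps1 gN k1 zN rd d1 uK xN S0 Sb Sd HI cst_ge.
have rho0 : 0 <= N%:R / (hN R N)%:R :> R by exact: divr_ge0.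
have del0 : 0 <= delta by apply: le_trans rd; rewrite mulr_ge0.
have u0 : 0 <= u.
  have N1 := gs_N_gt1 d_ge2 gN; have Nh := gs_Nh d_ge2 gN.
  have K0 : 0 < KN R d N.
    rewrite /KN divr_gt0 ?exprn_gt0 ?ltr0n ?(ltnW N1)//.
    by rewrite mulr_gt0// subr_gt0 ltr_nat.
  rewrite -(pmulr_lge0 _ K0); apply: le_trans uK; exact: exprn_even_ge0.
have ua0 : 0 <= u * (1 - delta) by rewrite mulr_ge0 ?subr_ge0.
have uab : u * (1 - delta) <= u * (1 + delta) by rewrite ler_wpM2l// lerD2l (ge0_cp del0).2.
have [d1' [T1 [Q1 [X [a [b [law_X indep law_I bound]]]]]]] :=
  construction (gs_N_gt1 d_ge2 gN) HI ua0 uab cpl.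
exists d1', T1, Q1, X, a, b; split => //.
exact: le_trans bound ee.
Qed.
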